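(* Let $1<p<\infty$. Consider the normed linear function space $\mathcal V_p^0$ with norm $\|C(\nabla u)\|_{L_p(\mathbf R^n)}$. Then for every $u\in\mathcal V_p^0$ the trace $\gamma u$ is well defined almost everywhere on $\mathbf R^n$ in the sense of convergence of Whitney averages, i.e. the limit $$(\gamma u)(x):=\lim_{t\to0^+}|W(t,x)|^{-1}\iint_{W(t,x)}u(s,y)\,ds\,dy$$ exists for almost every $x\in\mathbf R^n$. The trace map $\gamma:\mathcal V_p^0\to L_p(\mathbf R^n)$ is well defined, and there exists $c_p<\infty$ such that $$\|\gamma u\|_{L_p(\mathbf R^n)}\le c_p\|C(\nabla u)\|_{L_p(\mathbf R^n)}\qquad\text{for all }u\in\mathcal V_p^0.$$ Moreover, $\gamma$ is surjective: given any $g\in L_p(\mathbf R^n)$ there exists an extension $u\in\mathcal V_p^0$ such that $\gamma u=g$, with the estimate $$\|C(\nabla u)\|_{L_p(\mathbf R^n)}\le c_p\|g\|_{L_p(\mathbf R^n)}.$$ In fact, this extension may be chosen so that $u\in\tilde{\mathcal V}_p^N$, with the additional estimate $\|Nu\|_{L_p(\mathbf R^n)}\le c_p\|g\|_{L_p(\mathbf R^n)}$, and such that the pointwise non-tangential limits $$\lim_{(t,y)\to(0,x),\ |y-x|<\alpha t}u(t,y)=g(x)$$ exist at each Lebesgue point $x$ of $g$, for any fixed $\alpha<\infty$.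
   Context: $\mathbf R^{1+n}_+=\{(t,x): t>0,\ x\in\mathbf R^n\}$. $\mathrm{BV}_{\mathrm{loc}}(\mathbf R^{1+n}_+)$ is the space of real functions of locally bounded variation on $\mathbf R^{1+n}_+$; for such $u$, $\nabla u$ (full gradient in $(t,x)$) is a locally finite vector-valued measure and $|\nabla u|$ its total variation measure. Cubes $Q\subset\mathbf R^n$ are open, with side length $\ell(Q)$, and $\widehat Q:=(0,\ell(Q))\times Q$. For a locally finite measure $\mu$ on $\mathbf R^{1+n}_+$ the Carleson functional is $$C\mu(x):=\sup_{Q\ni x}\frac1{|Q|}\iint_{\widehat Q}d|\mu|(t,y),\qquad x\in\mathbf R^n,$$ the supremum being over all cubes $Q\subset\mathbf R^n$ containing $x$. The non-tangential maximal function is $Nu(x):=\operatorname{ess\,sup}_{|y-x|<t}|u(t,y)|$. The Whitney regions are $W(t,x):=\{(s,y): c_0^{-1}<s/t<c_0,\ |y-x|<c_1t\}$ with fixed parameters $c_0>1$, $c_1>0$, and $\langle|u|\rangle_{W(t,x)}:=|W(t,x)|^{-1}\iint_{W(t,x)}|u(s,y)|\,ds\,dy$. The function spaces are $$\mathcal V_p^0:=\{u\in \mathrm{BV}_{\mathrm{loc}}(\mathbf R^{1+n}_+): C(\nabla u)\in L_p(\mathbf R^n),\ \langle|u|\rangle_{W(t,x)}\to0\text{ as }t\to\infty\text{ for all }x\in\mathbf R^n\},$$ $$\tilde{\mathcal V}_p^N:=\{u\in C^1(\mathbf R^{1+n}_+): C(\nabla u)\in L_p(\mathbf R^n),\ Nu\in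 L_p(\mathbf R^n)\}.$$ The extension $g\mapsto u$ is not claimed to be linear. The constant $c_p$ may also depend on $n$ and the fixed Whitney parameters. *)

(* Defs.v *)
From HB Require Import structures.
From mathcomp Require Import all_boot all_order all_algebra.
From mathcomp Require Import all_classical all_reals all_analysis.
From mathcomp Require Import measurable_realfun ess_sup_inf.

Set Implicit Arguments.
Unset Strict Implicit.
Unset Printing Implicit Defensive.

Import Order.TTheory GRing.Theory Num.Theory.
Import numFieldNormedType.Exports.

Local Open Scope classical_set_scope.
Local Open Scope ring_scope.

(* Lebesgue measure on R^m = 'rV[R]_m.  The sigma-algebra is the one generated
   by the coordinates, as for n.-tuple; it is the Borel sigma-algebra. *)

Definition rV_display : measure_display. Proof. exact. Qed.

Section rV_measurable.
Context {R : realType} (m : nat).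

Definition rV_coord (i : 'I_m) (x : 'rV[R]_m) : R := x ord0 i.

Let rV_set0 : g_sigma_preimage rV_coord set0.
Proof. exact: sigma_algebra0. Qed.

Let rV_setC A : g_sigma_preimage rV_coord A -> g_sigma_preimage rV_coord (~` A).
Proof. exact: sigma_algebraC. Qed.

Let rV_bigcup (F : (set 'rV[R]_m)^nat) :
  (forall i, g_sigma_preimage rV_coord (F i)) ->
  g_sigma_preimage rV_coord (\bigcup_i (F i)).
Proof. exact: sigma_algebra_bigcup. Qed.

HB.instance Definition _ := @isMeasurable.Build rV_display
  'rV[R]_m (g_sigma_preimage rV_coord) rV_set0 rV_setC rV_bigcup.

Lemma measurable_rV_coord (i : 'I_m) : measurable_fun setT (rV_coord i).
Proof.
move=> _ Y mY; rewrite setTI; apply: sub_sigma_algebra => /=.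
rewrite -bigcup_seq/=; exists i => /=; first by rewrite mem_index_enum.
by exists Y => //; rewrite setTI.
Qed.

Lemma measurable_fun_rV d (T : measurableType d) (f : T -> 'rV[R]_m) :
  (forall i, measurable_fun setT (rV_coord i \o f)) -> measurable_fun setT f.
Proof.
move=> mf _ A mA.
have : preimage_set_system setT f (g_sigma_preimage rV_coord)
    `<=` measurable.
  rewrite /g_sigma_preimage -g_sigma_preimageE.
  apply: smallest_sub; first exact: sigma_algebra_measurable.
  move=> _ [B + <-]; rewrite -bigcup_seq => -[i _ [C mC <-]].
  by rewrite setTI; exact: mf.
by apply; exists A.
Qed.

End rV_measurable.

Section lebesgue_rV.
Context {R : realType}.

Definition rV_cons m (p : measurableTypeR R * 'rV[R]_m) : 'rV[R]_(1 + m) :=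
  row_mx (p.1)%:M p.2.

Lemma measurable_rV_cons m : measurable_fun setT (@rV_cons m).
Proof.
apply: measurable_fun_rV => i.
have [j ->|j ->] := split_ordP i.
  rewrite (_ : _ \o _ = fst); first exact: measurable_fst.
  by apply/funext => p /=; rewrite /rV_coord /rV_cons row_mxEl (ord1 j) mxE.
rewrite (_ : _ \o _ = rV_coord j \o snd).
  by apply: measurableT_comp; [exact: measurable_rV_coord|exact: measurable_snd].
by apply/funext => p /=; rewrite /rV_coord /rV_cons row_mxEr.
Qed.

Definition rV_uncons m (x : 'rV[R]_(1 + m)) : measurableTypeR R * 'rV[R]_m :=
  (x ord0 (lshift m ord0), rsubmx x).

Lemma measurable_rV_uncons m : measurable_fun setT (@rV_uncons m).
Proof.
apply/measurable_fun_pair => /=; first exact: (measurable_rV_coord (lshift m ord0)).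
apply: measurable_fun_rV => i.
rewrite (_ : _ \o _ = rV_coord (rshift 1 i)); first exact: measurable_rV_coord.
by apply/funext => x /=; rewrite /rV_coord mxE.
Qed.

Lemma rV_consK m : cancel (@rV_cons m) (@rV_uncons m).
Proof.
move=> [t x]; rewrite /rV_uncons /rV_cons row_mxKr; congr pair.
by rewrite row_mxEl mxE.
Qed.

Section cons_measure.
Variables (m : nat) (mu : {sigma_finite_measure set 'rV[R]_m -> \bar R}).

Definition rV_cons_measure : set 'rV[R]_(1 + m) -> \bar R :=
  pushforward (lebesgue_measure \x mu)%E (@rV_cons m).

Let cons_measure0 : rV_cons_measure set0 = 0%E.
Proof. by rewrite /rV_cons_measure /pushforward preimage_set0 measure0. Qed.

Let cons_measure_ge0 A : (0 <= rV_cons_measure A)%E.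
Proof. by rewrite /rV_cons_measure /pushforward; exact: measure_ge0. Qed.

Let cons_measure_sigma_additive : semi_sigma_additive rV_cons_measure.
Proof.
move=> F mF tF mUF; rewrite /rV_cons_measure /pushforward preimage_bigcup.
have mcons A : measurable A -> measurable (@rV_cons m @^-1` A).
  by move=> mA; rewrite -[X in measurable X]setTI; exact: measurable_rV_cons.
apply: measure_semi_sigma_additive.
- by move=> n; exact: mcons.
- apply/trivIsetP => /= i j _ _ ij; rewrite -preimage_setI.
  by move/trivIsetP : tF => /(_ _ _ _ _ ij) ->//; rewrite preimage_set0.
- by rewrite -preimage_bigcup; exact: mcons.
Qed.

HB.instance Definition _ := isMeasure.Build _ _ _ rV_cons_measure
  cons_measure0 cons_measure_ge0 cons_measure_sigma_additive.

Let cons_measure_sigma_finite : sigma_finite setT rV_cons_measure.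
Proof.
have /sigma_finiteP[F [FT ndF Foo]] :=
  sigma_finiteT (@lebesgue_measure R : {sigma_finite_measure set _ -> \bar R}).
have /sigma_finiteP[G [GT ndG Goo]] := sigma_finiteT mu.
exists (fun k => @rV_uncons m @^-1` (F k `*` G k)).
  rewrite -preimage_bigcup; apply/seteqP; split => // x _ /=.
  have [k _ Fk] : (\bigcup_i F i) (rV_uncons x).1 by rewrite -FT.
  have [l _ Gl] : (\bigcup_i G i) (rV_uncons x).2 by rewrite -GT.
  exists (maxn k l) => //; split.
  - by move: Fk; exact/subsetPset/ndF/leq_maxl.
  - by move: Gl; exact/subsetPset/ndG/leq_maxr.
move=> k; have [mF muF] := Foo k; have [mG muG] := Goo k; split.
  rewrite -[X in measurable X]setTI; apply: measurable_rV_uncons => //.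
  exact: measurableX.
rewrite /rV_cons_measure /pushforward -comp_preimage.
rewrite (_ : _ \o _ = id); last by apply/funext; exact: rV_consK.
by rewrite preimage_id product_measure1E// lte_mul_pinfty// ge0_fin_numE.
Qed.

HB.instance Definition _ := @Measure_isSigmaFinite.Build _ _ _
  rV_cons_measure cons_measure_sigma_finite.

End cons_measure.

Fixpoint lebesgue_rV m : {sigma_finite_measure set 'rV[R]_m -> \bar R} :=
  match m with
  | 0 => \d_(0 : 'rV[R]_0)
  | k.+1 => rV_cons_measure (lebesgue_rV k)
  end.

Lemma lebesgue_rV_box m (a b : 'rV[R]_m) : (forall i, a ord0 i <= b ord0 i) ->
  lebesgue_rV m [set x | forall i, a ord0 i < x ord0 i < b ord0 i] =
    (\prod_i (b ord0 i - a ord0 i))%:E.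
Proof.
elim: m a b => [|m IHm] a b ab.
  by rewrite big_ord0 /= diracE mem_set//= => -[].
have cons0 (p : measurableTypeR R * 'rV[R]_m) :
    (rV_cons p : 'rV[R]_m.+1) ord0 ord0 = p.1.
  transitivity (rV_cons p ord0 (lshift m ord0)).
    by congr (fun_of_matrix _ _ _); exact/val_inj.
  by rewrite row_mxEl mxE.
have consS (p : measurableTypeR R * 'rV[R]_m) j :
    (rV_cons p : 'rV[R]_m.+1) ord0 (lift ord0 j) = p.2 ord0 j.
  transitivity (rV_cons p ord0 (rshift 1 j)); last by rewrite row_mxEr.
  by congr (fun_of_matrix _ _ _); exact/val_inj.
pose a' := \row_i a ord0 (lift ord0 i); pose b' := \row_i b ord0 (lift ord0 i).
pose B := [set x : 'rV[R]_m | forall i, a' ord0 i < x ord0 i < b' ord0 i].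
have mB : measurable B.
  rewrite (_ : B = \big[setI/setT]_i
      (rV_coord i @^-1` `](a' ord0 i), (b' ord0 i)[)).
    apply: bigsetI_measurable => i _; rewrite -[X in measurable X]setTI.
    by apply: measurable_rV_coord => //; exact: measurable_itv.
  rewrite -bigcap_seq; apply/seteqP; split => x /= + i.
    by move=> /(_ i) xi _; rewrite /= in_itv.
  by move=> /(_ i); rewrite /= in_itv/=; apply; rewrite mem_index_enum.
rewrite /= /rV_cons_measure /pushforward.
rewrite (_ : _ @^-1` _ = `](a ord0 ord0), (b ord0 ord0)[%classic `*` B);
    last first.
  apply/seteqP; split => -[t x] /=.
    move=> h; rewrite in_itv/=; split; first by have := h ord0; rewrite cons0.
    by move=> i; have := h (lift ord0 i); rewrite consS !mxE.
  rewrite in_itv/= => -[tab h] i.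
  have [j ->|->] := unliftP ord0 i; last by rewrite cons0.
  by rewrite consS; have := h j; rewrite !mxE.
rewrite product_measure1E// (IHm a' b'); last by move=> i; rewrite !mxE.
transitivity (lebesgue_measure `](a ord0 ord0), (b ord0 ord0)[%classic *
    (\prod_i (b' ord0 i - a' ord0 i))%:E)%E; first by [].
rewrite lebesgue_measure_itv /= lte_fin big_ord_recl.
rewrite (eq_bigr (fun i => b ord0 (lift ord0 i) - a ord0 (lift ord0 i)));
  last by move=> i _; rewrite !mxE.
have := ab ord0; rewrite le_eqVlt => /orP[/eqP ->|ab0].
  by rewrite ltxx subrr mul0r mul0e.
by rewrite ab0 -EFinD -EFinM.
Qed.

End lebesgue_rV.

(* A point (t, x) of R^{1+n} is a row vector of length 1 + n whose first
   coordinate is t; the topology of 'rV is that of the sup norm, so Euclidean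
   lengths are spelled out. *)

Section halfspace.
Context {R : realType} (n : nat).
Implicit Types (z : 'rV[R]_(1 + n)) (x y : 'rV[R]_n) (t : R).

Definition enorm m (v : 'rV[R]_m) : R := Num.sqrt (\sum_i v ord0 i ^+ 2).

Definition tcoord z : R := z ord0 (lshift n ord0).
Definition xcoord z : 'rV[R]_n := rsubmx z.

Definition hspace : set 'rV[R]_(1 + n) := [set z | 0 < tcoord z].

Definition compactly_in (A : set 'rV[R]_(1 + n)) : Prop :=
  exists K, [/\ compact K, K `<=` hspace & A `<=` K].

(* C^1 on an open set D *)
Definition C1_on (D : set 'rV[R]_(1 + n)) (f : 'rV[R]_(1 + n) -> R) : Prop :=
  forall z, D z -> differentiable f z /\
    forall v, {for z, continuous (fun w => 'D_v f w)}.

Definition test_function (phi : 'rV[R]_(1 + n) -> R) : Prop :=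
  C1_on setT phi /\ compactly_in [set z | phi z != 0].

(* Vector-valued measures.  A locally finite R^{1+n}-valued measure on the half
   space is a set function on the Borel sets that are relatively compact in it;
   each of its coordinates is a difference of two positive measures that are
   finite on compact subsets of the half space (what these measures are outside
   the half space is irrelevant). *)

Definition locally_finite (mu : {measure set 'rV[R]_(1 + n) -> \bar R}) : Prop :=
  forall K, compact K -> K `<=` hspace -> (mu K < +oo)%E.

Definition vector_measure : Type := 'I_(1 + n) ->
  {measure set 'rV[R]_(1 + n) -> \bar R} *
  {measure set 'rV[R]_(1 + n) -> \bar R}.

Implicit Type nu : vector_measure.

Definition vm_locally_finite nu : Prop :=
  forall i, locally_finite (nu i).1 /\ locally_finite (nu i).2.

Definition vm_val nu (A : set 'rV[R]_(1 + n)) : 'rV[R]_(1 + n) :=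
  \row_i (fine ((nu i).1 A) - fine ((nu i).2 A)).

Definition vm_integral nu (i : 'I_(1 + n)) (phi : 'rV[R]_(1 + n) -> R) : R :=
  \int[(nu i).1]_(z in hspace) phi z - \int[(nu i).2]_(z in hspace) phi z.

Definition vm_total_variation nu (A : set 'rV[R]_(1 + n)) : \bar R :=
  ereal_sup [set r | exists F : (set 'rV[R]_(1 + n))^nat,
    [/\ forall j, measurable (F j) /\ compactly_in (F j),
        trivIset setT F,
        \bigcup_j F j = A
      & r = (\sum_(j <oo) (enorm (vm_val nu (F j)))%:E)%E]].

Implicit Type u : 'rV[R]_(1 + n) -> R.

Definition L1loc u : Prop :=
  measurable_fun hspace u /\
  forall K, compact K -> K `<=` hspace ->
    (lebesgue_rV (1 + n)).-integrable K (EFin \o u).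

Definition is_gradient u nu : Prop :=
  vm_locally_finite nu /\
  forall (i : 'I_(1 + n)) (phi : 'rV[R]_(1 + n) -> R), test_function phi ->
    \int[lebesgue_rV (1 + n)]_(z in hspace) (u z * 'D_(delta_mx ord0 i) phi z) =
    - vm_integral nu i phi.

Definition BVloc u : Prop := L1loc u /\ exists nu, is_gradient u nu.

(* [is_gradient u] determines nu on relatively compact Borel sets, so the choice
   below is harmless; the last branch is only reached if u is not in BVloc. *)
Definition grad u : vector_measure :=
  if pselect (exists nu, is_gradient u nu) is left h then projT1 (cid h)
  else fun=> ([the measure _ _ of mzero], [the measure _ _ of mzero]).

Definition cube (a : 'rV[R]_n) (l : R) : set 'rV[R]_n :=
  [set y | forall i, a ord0 i < y ord0 i < a ord0 i + l].

Definition carleson_box (a : 'rV[R]_n) (l : R) : set 'rV[R]_(1 + n) :=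
  [set z | 0 < tcoord z < l /\ cube a l (xcoord z)].

(* m plays the role of |mu| *)
Definition carleson (m : set 'rV[R]_(1 + n) -> \bar R) x : \bar R :=
  ereal_sup [set r | exists a l, [/\ 0 < l, cube a l x &
    r = (m (carleson_box a l) / lebesgue_rV n (cube a l))%E]].

Definition Cgrad u : 'rV[R]_n -> \bar R := carleson (vm_total_variation (grad u)).

Definition cone (alpha : R) x : set 'rV[R]_(1 + n) :=
  [set z | 0 < tcoord z /\ enorm (xcoord z - x) < alpha * tcoord z].

(* Restricting |u| by 0 outside the cone does not change its essential sup. *)
Definition ntmax u x : \bar R :=
  ess_sup (lebesgue_rV (1 + n)) ((fun z => `|u z|%:E) \_ (cone 1 x)).

Definition whitney (c0 c1 t : R) x : set 'rV[R]_(1 + n) :=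
  [set z | c0^-1 < tcoord z / t < c0 /\ enorm (xcoord z - x) < c1 * t].

Definition whitney_avg (c0 c1 : R) u (t : R) x : R :=
  (fine (lebesgue_rV (1 + n) (whitney c0 c1 t x)))^-1 *
  \int[lebesgue_rV (1 + n)]_(z in whitney c0 c1 t x) u z.

Definition whitney_trace (c0 c1 : R) u x : R :=
  lim (whitney_avg c0 c1 u t x @[t --> 0^'+]).

(* C(nabla u) and Nu take values in \bar R, so Lp is stated for such functions. *)
Definition Lp (p : R) (f : 'rV[R]_n -> \bar R) : Prop :=
  measurable_fun setT f /\ ('N[lebesgue_rV n]_p%:E[f] < +oo)%E.

Definition V0 (c0 c1 p : R) u : Prop :=
  [/\ BVloc u, Lp p (Cgrad u) &
      forall x, whitney_avg c0 c1 (fun z => `|u z|) t x @[t --> +oo] --> 0].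

Definition VN (p : R) u : Prop :=
  [/\ C1_on hspace u, Lp p (Cgrad u) & Lp p (ntmax u)].

(* Functions on the half space are identified when they agree a.e. there. *)
Definition normed_linear_space (V : ('rV[R]_(1 + n) -> R) -> Prop)
    (N : ('rV[R]_(1 + n) -> R) -> \bar R) : Prop :=
  [/\ V (fun=> 0) /\
        (forall a u v, V u -> V v -> V (fun z => a * u z + v z)),
      forall u, V u -> (0 <= N u < +oo)%E,
      forall a u, V u -> N (fun z => a * u z) = (`|a|%:E * N u)%E,
      forall u v, V u -> V v -> (N (fun z => (u z + v z)%R) <= N u + N v)%E &
      forall u, V u -> N u = 0%E <->
        {ae lebesgue_rV (1 + n), forall z, hspace z -> u z = 0}].

Definition eball x (r : R) : set 'rV[R]_n := [set y | enorm (y - x) < r].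

Definition lebesgue_point (g : 'rV[R]_n -> R) x : Prop :=
  ((\int[lebesgue_rV n]_(y in eball x r) `|g y - g x|%:E)
     / lebesgue_rV n (eball x r))%E @[r --> 0^'+] --> 0%E.

End halfspace.

(* Main.v *)
Require Import Defs.
From HB Require Import structures.
From mathcomp Require Import all_boot all_order all_algebra.
From mathcomp Require Import all_classical all_reals all_analysis.
From mathcomp Require Import measurable_realfun ess_sup_inf.
From mathcomp Require Import ring lra.
Import Order.TTheory GRing.Theory Num.Theory.
Import numFieldNormedType.Exports.
Local Open Scope classical_set_scope.
Local Open Scope ring_scope.
Set Implicit Arguments.
Unset Strict Implicit.
Unset Printing Implicit Defensive.
Local Notation compactly_in := Defs.compactly_in.
Local Notation measT := (measurable_fun setT).

(** Two mechanisms carry the theorem.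

    Trace.  By the Poincare inequality ([poincare_box]) the Whitney averages
    of u over x at two heights of size s differ by at most a constant times
    s^(-n) times the total variation of the gradient on a box of size s at
    height s above x ([whitney_osc]).  Summing over the dyadic scales
    s = 2^j bounds both the oscillation of t |-> <u>_(W(t,x)) and, since the
    averages vanish at infinity, its size by a dyadic potential S(x)
    ([chain_cvg], [chain_lim]).  Because the boxes at different scales have
    bounded overlap, Tonelli shows that over a dyadic cell the integral of the
    part of S coming from scales below the cell is at most a constant times
    the integral of C(grad u) ([potential]).  An inequality of Garsia type for
    sums adapted to a nested family of partitions ([garsia]) turns this
    conditional bound into the L^p bound of S by C(grad u)
    ([dyadic_square]); hence S is finite almost everywhere and the trace
    exists and is bounded ([trace_bound]).

    Extension.  As in Gagliardo's proof for p = 1, let g_k = P_(s_k) g be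
    smoothings of g at scales s_k decreasing so fast that g_k - g is at most
    4^(-k-1) |g| in L^p ([scales_exist]), and let u interpolate between
    g_(k-1) and g_k on heights t_k / 2 < t < t_k with t_k = 4^(-k) s_k.  The
    t-derivative costs |g_k - g_(k-1)|, with geometrically small norm, however
    thin the transition layer is; the x-derivatives are at most Mg / s_k on
    a layer of thickness t_k, and so cost 4^(-k) Mg.  Thus the integral of
    |grad u| along a vertical line is controlled in L^p by g, and C(grad u)
    is controlled by the Hardy-Littlewood maximal function of that line integral
    ([ext_BVloc_Cgrad], [Cgrad_ext_pw]).  As t_k <= s_k, on a cone u is a
    convex combination of averages at scales larger than the height, so that Nu is
    at most a constant times Mg ([ntmax_ext_le]) and the boundary limits of u
    are those of g_k on balls of radius proportional to t_k, small compared with s_k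
    ([ext_limit]).

    The L^p maximal theorem ([maximal_bound]) is obtained from the same
    Garsia argument, applied to dyadic grids shifted by thirds.  That the
    functional is definite on the space rests on Poincare again: if it
    vanishes, all averages of u agree with its Whitney averages at infinity
    ([zero_of_tv_zero]).  The total variation is compatible with all this since
    it is a measure ([tv_measure]) and the gradient measure is unique
    ([gradient_unique]). *)

(** * Lebesgue measure on row vectors *)

Section boxes.
Context {R : realType} (m : nat).
Implicit Types (a b x y h : 'rV[R]_m).

Definition obox a b : set 'rV[R]_m :=
  [set x | forall i, a ord0 i < x ord0 i < b ord0 i].

Lemma ball_rVP x (r : R) y : 0 < r ->
  ball x r y <-> forall i, `|x ord0 i - y ord0 i| < r.
Proof.
move=> r0; split=> [[_ h] i|h]; first exact: h.
by split => // i j; rewrite (ord1 i); exact: h.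
Qed.

Lemma ball_obox x (r : R) : 0 < r ->
  ball x r = obox (x - const_mx r) (x + const_mx r).
Proof.
move=> r0; apply/seteqP; split => y.
  by move=> /(ball_rVP _ _ r0) h i; have := h i; rewrite !mxE ltr_distlC.
by move=> h; apply/ball_rVP => // i; have := h i; rewrite !mxE ltr_distlC.
Qed.

Lemma measurable_obox a b : measurable (obox a b).
Proof.
rewrite (_ : obox a b = \big[setI/setT]_i
    (rV_coord i @^-1` `](a ord0 i), (b ord0 i)[)).
  apply: bigsetI_measurable => i _; rewrite -[X in measurable X]setTI.
  by apply: measurable_rV_coord => //; exact: measurable_itv.
rewrite -bigcap_seq; apply/seteqP; split => x /= + i.
  by move=> /(_ i) xi _; rewrite /= in_itv.
by move=> /(_ i); rewrite /= in_itv/=; apply; rewrite mem_index_enum.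
Qed.

Definition ratpt (q : 'rV[rat]_m) : 'rV[R]_m := map_mx ratr q.

Lemma coord_le_norm x i : `|x ord0 i| <= `|x|.
Proof.
rewrite [leRHS]/Num.norm /= mx_normrE; apply/bigmax_geP; right => /=.
by exists (ord0, i).
Qed.

(** Rational balls form a base of the topology; the factor N leaves room for a
    concentric larger ball. *)
Lemma rat_ball (U : set 'rV[R]_m) x (N : R) : 0 <= N -> open U -> U x ->
  exists (q : 'rV[rat]_m) (k : nat),
    ball (ratpt q) k.+1%:R^-1 x /\ forall y, (forall i, `|ratpt q ord0 i - y ord0 i| < N * k.+1%:R^-1) -> U y.
Proof.
move=> N0 oU Ux; have /nbhs_ballP[e /= e0 eU] : nbhs x U by exact: open_nbhs_nbhs.
pose k := Num.truncn ((N + 1) / e).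
have k0 : 0 < k.+1%:R^-1 :> R by rewrite invr_gt0.
have N1 : 0 < (N + 1) / e by rewrite divr_gt0// ltr_wpDl.
have k3 : (N + 1) * k.+1%:R^-1 < e.
  rewrite ltr_pdivrMr// mulrC -ltr_pdivrMr//.
  by have /andP[] := truncn_itv (ltW N1).
have [q qP] : exists q : 'rV[rat]_m, forall i, `|x ord0 i - ratr (q ord0 i)| < k.+1%:R^-1 :> R.
  have ex i : exists q : rat, `|x ord0 i - ratr q| < k.+1%:R^-1 :> R.
    have : x ord0 i < x ord0 i + k.+1%:R^-1 by rewrite ltrDl.
    by move=> /rat_in_itvoo[q]; rewrite in_itv/= => /andP[h1 h2]; exists q; rewrite ltr_distl; move: k0 h1 h2; move: (_^-1) (ratr q) (x _ _) => X Y Z *; apply/andP; split; lra.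
  exists (\row_i projT1 (cid (ex i))) => i; rewrite mxE.
  by case: cid.
exists q, k; split; first by apply/ball_rVP => // i; rewrite mxE distrC.
move=> y h; apply: eU; apply/ball_rVP => // i; have := h i; have := qP i; rewrite mxE => h1 h2.
move: k3 h1 h2; set X := _^-1; set Q := ratr _.
have -> : x ord0 i - y ord0 i = (x ord0 i - Q) + (Q - y ord0 i) by ring.
by have := ler_normD (x ord0 i - Q) (Q - y ord0 i); lra.
Qed.

Lemma open_measurable_rV (U : set 'rV[R]_m) : open U -> measurable U.
Proof.
move=> oU.
pose B (p : 'rV[rat]_m * nat) : set 'rV[R]_m :=
  ball (ratpt p.1) (p.2.+1%:R^-1).
rewrite (_ : U = \bigcup_p (if `[< B p `<=` U >] then B p else set0)).
  apply: countable_bigcupT_measurable => // p.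
  by case: ifPn => // _; rewrite /B ball_obox//; exact: measurable_obox.
apply/seteqP; split => x.
  move=> /(rat_ball (@ler01 R) oU)[q [k [h1 h2]]]; exists (q, k) => //=.
  rewrite asboolT// => y /ball_rVP; rewrite invr_gt0 ltr0Sn => /(_ isT) hy.
  by apply: h2 => i; rewrite mul1r; exact: hy.
by move=> [p _]; case: ifPn => //= /asboolP h /h.
Qed.

Lemma closed_measurable_rV (U : set 'rV[R]_m) : closed U -> measurable U.
Proof.
by move=> cU; rewrite -[U]setCK; apply: measurableC; apply: open_measurable_rV; exact: closed_openC.
Qed.

Lemma compact_measurable_rV (K : set 'rV[R]_m) : compact K -> measurable K.
Proof.
by move=> cK; apply: closed_measurable_rV; apply: compact_closed => //; exact: norm_hausdorff.
Qed.

Definition oboxes : set (set 'rV[R]_m) := [set B | exists a b, B = obox a b].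

Lemma oboxesI : setI_closed oboxes.
Proof.
move=> _ _ [a [b ->]] [a' [b' ->]].
exists (\row_i Num.max (a ord0 i) (a' ord0 i)), (\row_i Num.min (b ord0 i) (b' ord0 i)).
apply/seteqP; split => x.
  by move=> [h1 h2] i; rewrite !mxE gt_max lt_min; have /andP[-> ->] := h1 i; have /andP[-> ->] := h2 i.
by move=> h; split => i; have := h i; rewrite !mxE gt_max lt_min => /andP[/andP[? ?] /andP[? ?]]; apply/andP.
Qed.

Lemma bigcup_obox : \bigcup_k obox (const_mx (- k%:R)) (const_mx k%:R) = setT.
Proof.
apply/seteqP; split => // x _; exists (Num.truncn `|x|).+1 => // i; rewrite !mxE.
have := truncnS_gt `|x|.
by move=> h2; rewrite -ltr_norml (le_lt_trans (coord_le_norm _ _)).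
Qed.

Lemma measurable_rV_oboxes : @measurable _ 'rV[R]_m = <<s oboxes >>.
Proof.
apply/seteqP; split; last first.
  apply: smallest_sub; first exact: sigma_algebra_measurable.
  by move=> _ [a [b ->]]; exact: measurable_obox.
apply: smallest_sub; first exact: smallest_sigma_algebra.
move=> A; rewrite -bigcup_seq => -[i _ [Y mY <-]].
pose f : g_sigma_algebraType oboxes -> R := fun x => x ord0 i.
have mf : measT f.
  apply: (measurability (@RGenOInfty.G R)); first exact: RGenOInfty.measurableE.
  move=> _ [_ [t ->] <-]; rewrite setTI.
  rewrite (_ : _ @^-1` _ = \bigcup_k (obox (\row_j if j == i then t else - k%:R) (const_mx k%:R))).
    apply: bigcup_measurable => k _; apply: sub_sigma_algebra; by do 2 eexists.
  apply/seteqP; split => x /=.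
    rewrite in_itv/= andbT => tx.
    have [k _ hk] : (\bigcup_k obox (const_mx (- k%:R)) (const_mx k%:R)) x by rewrite bigcup_obox.
    exists k => // j; have := hk j; rewrite !mxE; case: eqP => // ->.
    by rewrite -/(f x) tx => /andP[].
  by move=> [k _ /(_ i)]; rewrite !mxE eqxx in_itv/= andbT => /andP[].
by have := mf measurableT Y mY; rewrite setTI.
Qed.

(** Open boxes form a generating pi-system, so a measure on row vectors is
    determined by its values on them. *)
Lemma measure_eq_oboxes (m1 m2 : {measure set 'rV[R]_m -> \bar R}) A :
  (forall a b, m1 (obox a b) = m2 (obox a b)) ->
  (forall k : nat, (m1 (obox (const_mx (- k%:R)%R) (const_mx k%:R%R)) < +oo)%E) ->
  measurable A -> m1 A = m2 A.
Proof.
move=> h1 h2; apply: (measure_unique oboxes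
  (fun k : nat => obox (const_mx (- k%:R)) (const_mx k%:R))) => //.
- exact: measurable_rV_oboxes.
- exact: oboxesI.
- by move=> k; do 2 eexists.
- exact: bigcup_obox.
- by move=> _ [a [b ->]].
Qed.

Lemma lebesgue_obox a b :
  lebesgue_rV m (obox a b) = (\prod_i Num.max 0 (b ord0 i - a ord0 i))%:E.
Proof.
have [ab|] := pselect (forall i, a ord0 i <= b ord0 i).
  rewrite lebesgue_rV_box//; congr EFin; apply: eq_bigr => i _.
  by rewrite max_r// subr_ge0.
move=> /existsNP[i /negP]; rewrite -ltNge => iab.
rewrite (_ : obox a b = set0).
  by rewrite measure0 (bigD1 i)//= max_l ?mul0r// subr_le0 ltW.
by apply/seteqP; split => // x /(_ i); lra.
Qed.

Lemma measurable_shift h : measT (fun x => x + h).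
Proof.
apply: measurable_fun_rV => i.
rewrite (_ : _ \o _ = (fun x => rV_coord i x + h ord0 i)); last first.
  by apply/funext => x; rewrite /rV_coord /= mxE.
by apply: measurable_funD => //; exact: measurable_rV_coord.
Qed.

(** Both sides are measures that agree on open boxes. *)
Lemma lebesgue_shift h A : measurable A ->
  lebesgue_rV m ((fun x => x + h) @^-1` A) = lebesgue_rV m A.
Proof.
move=> mA.
have mphi := measurable_shift h.
have [m1 m1E] : exists m1 : {measure set 'rV[R]_m -> \bar R},
    forall A, m1 A = lebesgue_rV m ((fun x => x + h) @^-1` A).
  by unshelve refine (ex_intro _ [the measure _ _ of pushforward (lebesgue_rV m) (fun x : 'rV[R]_m => x + h)] _).
have E a b : m1 (obox a b) = lebesgue_rV m (obox a b).
  rewrite m1E (_ : _ @^-1` _ = obox (a - h) (b - h)); last first.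
    by apply/seteqP; split => x /= hx i; have := hx i; rewrite !mxE; lra.
  by rewrite !lebesgue_obox; congr EFin; apply: eq_bigr => i _; rewrite !mxE; congr Num.max; ring.
rewrite -m1E; apply: (@measure_eq_oboxes m1 (lebesgue_rV m)) => // k.
by rewrite E lebesgue_obox ltry.
Qed.

Lemma ge0_integral_shift h (f : 'rV[R]_m -> \bar R) : measT f -> (forall x, 0 <= f x)%E ->
  (\int[lebesgue_rV m]_x f (x + h)%R = \int[lebesgue_rV m]_x f x)%E.
Proof.
move=> mf f0.
have mphi := measurable_shift h.
have := @ge0_integral_pushforward _ _ _ _ R _ mphi (lebesgue_rV m) setT f measurableT mf.
move=> /(_ (fun _ _ => f0 _)); rewrite preimage_setT => <-.
apply: eq_measure_integral => A mA _; exact: lebesgue_shift.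
Qed.

Lemma integral_shift h (f : 'rV[R]_m -> \bar R) : measT f ->
  (\int[lebesgue_rV m]_x f (x + h)%R = \int[lebesgue_rV m]_x f x)%E.
Proof.
move=> mf; rewrite [LHS]integralE [RHS]integralE; congr (_ - _)%E.
  by rewrite -(ge0_integral_shift h (measurable_funepos mf) (fun x => funepos_ge0 _ x)); apply: eq_integral => x _; rewrite !funeposE.
by rewrite -(ge0_integral_shift h (measurable_funeneg mf) (fun x => funeneg_ge0 _ x)); apply: eq_integral => x _; rewrite !funenegE.
Qed.

Lemma open_continuous_measurable_rV (D : set 'rV[R]_m) (f : 'rV[R]_m -> R) : open D ->
  {in D, continuous f} -> measurable_fun D f.
Proof.
move=> oD cf; apply: (measurability (@RGenOpens.G R)); first exact: RGenOpens.measurableE.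
move=> _ [_ [a [b ->]] <-]; apply: open_measurable_rV.
rewrite openE => x [Dx xab]; apply: filterI; first exact: open_nbhs_nbhs.
apply: cf; first by rewrite inE.
by apply: open_nbhs_nbhs; split => //; exact: interval_open.
Qed.

Lemma compact_sub_obox (K : set 'rV[R]_m) : compact K -> exists k : nat, K `<=` obox (const_mx (- k%:R)) (const_mx k%:R).
Proof.
move=> /compact_bounded[M [Mr MP]].
exists (Num.truncn (M + 1)).+1 => x Kx i; rewrite !mxE -ltr_norml.
rewrite (le_lt_trans (coord_le_norm _ _))// (le_lt_trans (MP (M+1) _ _ Kx)) ?ltrDl//.
exact: truncnS_gt.
Qed.

Lemma lebesgue_compact_fin (K : set 'rV[R]_m) : compact K -> (lebesgue_rV m K < +oo)%E.
Proof.
move=> cK; have [k kK] := compact_sub_obox cK.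
apply: (@le_lt_trans _ _ (lebesgue_rV m (obox (const_mx (- k%:R)) (const_mx k%:R)))).
  apply: le_measure => //; rewrite inE; first exact: compact_measurable_rV.
  exact: measurable_obox.
by rewrite lebesgue_obox ltry.
Qed.
End boxes.

Section cons.
Context {R : realType} (m : nat).
Lemma ge0_integral_rV_cons (f : 'rV[R]_(1 + m) -> \bar R) : measT f -> (forall x, 0 <= f x)%E ->
  (\int[lebesgue_rV (1 + m)]_z f z = \int[lebesgue_rV m]_y \int[lebesgue_measure]_t f (rV_cons (t, y)))%E.
Proof.
move=> mf f0.
have mphi := @measurable_rV_cons R m.
transitivity (\int[pushforward (lebesgue_measure \x lebesgue_rV m)%E (@rV_cons R m)]_z f z)%E.
  exact: eq_measure_integral.
have := @ge0_integral_pushforward _ _ _ _ R _ mphi (lebesgue_measure \x lebesgue_rV m)%E setT f measurableT mf.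
move=> /(_ (fun _ _ => f0 _)); rewrite preimage_setT => ->.
have mc : measT (f \o @rV_cons R m) by exact: measurableT_comp.
rewrite fubini_tonelli1//; last by move=> x; exact: f0.
have F := @fubini_tonelli _ _ _ _ R (@lebesgue_measure R) (lebesgue_rV m) (f \o @rV_cons R m) mc (fun _ => f0 _).
by rewrite F.
Qed.

Lemma shift_measurable_prod (k : nat) : measT (fun p : 'rV[R]_k * 'rV[R]_k => p.1 + p.2).
Proof.
apply: measurable_fun_rV => i.
rewrite (_ : _ \o _ = (fun x => rV_coord i x.1 + rV_coord i x.2)); last first.
  by apply/funext => x; rewrite /rV_coord /= mxE.
by apply: measurable_funD; apply: measurableT_comp (measurable_rV_coord i) _.
Qed.
End cons.

(** * Closed boxes and the Euclidean norm *)

Section cbox.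
Context {R : realType} (m : nat).
Implicit Types (a b x y : 'rV[R]_m).

Definition cbox a b : set 'rV[R]_m := [set x | forall i, a ord0 i <= x ord0 i <= b ord0 i].

Lemma compact_cbox a b : compact (cbox a b).
Proof.
rewrite (_ : cbox a b = [set x | forall i, `[a ord0 i, b ord0 i]%classic (x ord0 i)]).
  by apply: (@rV_compact R m (fun i => `[a ord0 i, b ord0 i]%classic)) => i; exact: segment_compact.
by apply/seteqP; split => x /= h i; have := h i; rewrite in_itv.
Qed.

Lemma enorm_ge0 x : 0 <= enorm x. Proof. exact: sqrtr_ge0. Qed.

Lemma sum_sqr_ge0 x : 0 <= \sum_i x ord0 i ^+ 2.
Proof. by apply: sumr_ge0 => i _; exact: sqr_ge0. Qed.

Lemma enorm_sqr x : enorm x ^+ 2 = \sum_i x ord0 i ^+ 2.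
Proof. by rewrite sqr_sqrtr// sum_sqr_ge0. Qed.

Lemma coord_le_enorm x i : `|x ord0 i| <= enorm x.
Proof.
rewrite -(@ler_pXn2r _ 2) ?nnegrE ?enorm_ge0// enorm_sqr (bigD1 i)//= real_normK ?num_real//.
by rewrite lerDl; apply: sumr_ge0 => j _; exact: sqr_ge0.
Qed.

Lemma enorm_eq0 x : enorm x = 0 -> x = 0.
Proof.
move=> x0; apply/rowP => i; rewrite mxE.
by have := coord_le_enorm x i; rewrite x0 normr_le0 => /eqP.
Qed.

Lemma enorm0 : enorm (0 : 'rV[R]_m) = 0.
Proof. by rewrite /enorm big1 ?sqrtr0// => i _; rewrite mxE expr0n. Qed.

Lemma enormZ (k : R) x : enorm (k *: x) = `|k| * enorm x.
Proof.
apply/eqP; rewrite -(@eqrXn2 _ 2) ?mulr_ge0 ?enorm_ge0//.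
rewrite exprMn !enorm_sqr real_normK ?num_real// mulr_sumr.
by apply/eqP; apply: eq_bigr => i _; rewrite mxE exprMn.
Qed.

Lemma dot_le_enorm x y : \sum_i x ord0 i * y ord0 i <= enorm x * enorm y.
Proof.
have [/enorm_eq0 ->|x0] := eqVneq (enorm x) 0.
  by rewrite enorm0 mul0r big1// => i _; rewrite mxE mul0r.
have [/enorm_eq0 ->|y0] := eqVneq (enorm y) 0.
  by rewrite enorm0 mulr0 big1// => i _; rewrite mxE mulr0.
have xy0 : 0 < enorm x * enorm y by rewrite mulr_gt0// lt_neqAle enorm_ge0 eq_sym ?x0 ?y0.
have : 0 <= \sum_i (enorm y * x ord0 i - enorm x * y ord0 i) ^+ 2.
  by apply: sumr_ge0 => i _; exact: sqr_ge0.
rewrite (eq_bigr (fun i => enorm y ^+ 2 * x ord0 i ^+ 2 +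
   (- (2 * (enorm x * enorm y)) * (x ord0 i * y ord0 i)) + enorm x ^+ 2 * y ord0 i ^+ 2)); last by move=> i _; ring.
rewrite !big_split/= -!mulr_sumr -!enorm_sqr.
set S := \sum_i _.
rewrite (_ : _ + _ = 2 * (enorm x * enorm y) * (enorm x * enorm y - S)); last by ring.
by rewrite pmulr_rge0 ?subr_ge0// mulr_gt0.
Qed.

Lemma enormD x y : enorm (x + y) <= enorm x + enorm y.
Proof.
rewrite -(@ler_pXn2r _ 2) ?nnegrE ?addr_ge0 ?enorm_ge0//.
rewrite enorm_sqr (eq_bigr (fun i => x ord0 i ^+ 2 + 2 * (x ord0 i * y ord0 i) + y ord0 i ^+ 2)); last by move=> i _; rewrite mxE; ring.
rewrite !big_split/= -mulr_sumr -!enorm_sqr; have := dot_le_enorm x y.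
by set S := \sum_i _ => h; nra.
Qed.

Lemma enorm_le_sum x : enorm x <= \sum_i `|x ord0 i|.
Proof.
rewrite -(@ler_pXn2r _ 2) ?nnegrE ?enorm_ge0 ?sumr_ge0//.
rewrite enorm_sqr expr2 mulr_suml; apply: ler_sum => i _.
rewrite -[leLHS]real_normK ?num_real// expr2 ler_wpM2l//.
by rewrite (bigD1 i)//= lerDl sumr_ge0.
Qed.
End cbox.

(** * The total variation of a vector measure is a measure *)

Section nneseries.
Context {R : realType}.

Lemma ereal_supD_le (A B : set (\bar R)) (c : \bar R) :
  (forall r, A r -> 0 <= r)%E -> (forall r, B r -> 0 <= r)%E ->
  A !=set0 -> B !=set0 ->
  (forall r s, A r -> B s -> r + s <= c)%E ->
  (ereal_sup A + ereal_sup B <= c)%E.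
Proof.
move=> A0 B0 [a0 Aa0] [b0 Bb0] h.
have c0 : (0 <= c)%E by apply: le_trans (h _ _ Aa0 Bb0); apply: adde_ge0; [exact: A0|exact: B0].
case: c c0 h => [c c0 h|_ _|//]; last by rewrite leey.
have fB s : B s -> s \is a fin_num.
  move=> Bs; rewrite ge0_fin_numE ?B0// (le_lt_trans _ (ltry c))//.
  by apply: le_trans (h _ _ Aa0 Bs); rewrite leeDr// A0.
have sA s : B s -> (ereal_sup A <= c%:E - s)%E.
  move=> Bs; apply: ge_ereal_sup => r Ar; rewrite leeBrDr ?fB//; exact: h.
have fA : ereal_sup A \is a fin_num.
  rewrite ge0_fin_numE; last by apply: (@le_trans _ _ a0); [exact: A0|exact: ereal_sup_ubound].
  apply: (le_lt_trans (sA _ Bb0)); have := fB _ Bb0; case: b0 {Bb0} => // b _.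
  by rewrite -EFinB ltry.
rewrite addeC -leeBrDr//; apply: ge_ereal_sup => s Bs.
by rewrite leeBrDr// addeC -leeBrDr ?fB// sA.
Qed.

(** For splitting the pieces of a partition of a disjoint union, which are
    indexed alternately by the two sets. *)
Lemma nneseries_even_odd (a : nat -> \bar R) : (forall i, 0 <= a i)%E ->
  (\sum_(j <oo) a j.*2 + \sum_(j <oo) a j.*2.+1 <= \sum_(j <oo) a j)%E.
Proof.
move=> a0; rewrite -nneseriesD//.
apply: lime_le; first by apply: is_cvg_nneseries => i _ _; rewrite adde_ge0.
apply: nearW => N.
apply: (@le_trans _ _ (\sum_(0 <= j < N.*2) a j)%E); last exact: nneseries_lim_ge.
elim: N => [|N IH]; first by rewrite !big_nil.
by rewrite doubleS !big_nat_recr//= -addeA leeD2r.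
Qed.
End nneseries.

Section tv.
Context {R : realType} (n : nat).
Local Notation V := ('rV[R]_(1 + n)).
Local Notation H := (@hspace R n).
Implicit Types (A B F : set V).

Definition t0 : 'I_(1 + n) := lshift n ord0.

Lemma open_hspace : open H.
Proof.
rewrite (_ : H = (fun z : V => z ord0 t0) @^-1` [set x | 0 < x]).
  by apply: open_comp => // z _; exact: coord_continuous.
by apply/seteqP; split.
Qed.

Definition exhaust (k : nat) : set V :=
  cbox (\row_i (if i == t0 then k.+1%:R^-1 else - k.+1%:R)) (const_mx k.+1%:R).

Lemma compact_exhaust k : compact (exhaust k). Proof. exact: compact_cbox. Qed.

Lemma measurable_exhaust k : measurable (exhaust k).
Proof. by apply: compact_measurable_rV; exact: compact_exhaust. Qed.

Lemma measurable_hspace : measurable H.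
Proof. by apply: open_measurable_rV; exact: open_hspace. Qed.

Lemma exhaust_hspace k : exhaust k `<=` H.
Proof.
move=> z /(_ t0); rewrite !mxE eqxx => /andP[h _].
by rewrite /H/hspace/= (lt_le_trans _ h).
Qed.

Lemma exhaust_nd : nondecreasing_seq exhaust.
Proof.
move=> i j ij; rewrite subsetEset => z h k; have := h k; rewrite !mxE.
have ij' : i.+1%:R <= j.+1%:R :> R by rewrite ler_nat.
have h2 : j.+1%:R^-1 <= i.+1%:R^-1 :> R by rewrite lef_pV2// posrE.
by move: ij' h2; move: (i.+1%:R : R) (j.+1%:R : R) (z _ _) => I J Z ? ?; case: ifP => _ /andP[h3 h4]; apply/andP; split; lra.
Qed.

Lemma bigcup_exhaust : \bigcup_k exhaust k = H.
Proof.
apply/seteqP; split => [z [k _] /exhaust_hspace//|z Hz].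
pose k1 := Num.truncn (tcoord z)^-1; pose k2 := Num.truncn `|z|.
exists (maxn k1 k2) => // i; rewrite !mxE.
have h1 : (tcoord z)^-1 < (maxn k1 k2).+1%:R.
  by rewrite (lt_le_trans (truncnS_gt _))// ler_nat ltnS leq_maxl.
have h2 : `|z| < (maxn k1 k2).+1%:R.
  by rewrite (lt_le_trans (truncnS_gt _))// ler_nat ltnS leq_maxr.
have := ltW (le_lt_trans (coord_le_norm z i) h2); rewrite ler_norml => /andP[h3 ->].
rewrite andbT; case: eqP => // ->.
rewrite -[leRHS]invrK lef_pV2// ?posrE ?invr_gt0//; exact: ltW.
Qed.

Lemma compactly_exhaust k A : A `<=` exhaust k -> compactly_in A.
Proof. by move=> Ak; exists (exhaust k); split => //; [exact: compact_exhaust|apply: exhaust_hspace]. Qed.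

Lemma compactly_inS A B : A `<=` B -> compactly_in B -> compactly_in A.
Proof. by move=> AB [K [cK KH BK]]; exists K; split => //; exact: subset_trans BK. Qed.

Lemma compactly_in_hspace A : compactly_in A -> A `<=` H.
Proof. by move=> [K [cK KH AK]] z /AK /KH. Qed.

Section tv_nu.
Variable nu : vector_measure (R:=R) n.
Hypothesis lf : vm_locally_finite nu.

Let sg A : \bar R := (\sum_i ((nu i).1 A + (nu i).2 A))%E.

Let sg_ge0 A : (0 <= sg A)%E. Proof. by apply: sume_ge0 => i _; rewrite adde_ge0. Qed.

Let fin1 i A : measurable A -> compactly_in A -> (nu i).1 A \is a fin_num.
Proof.
move=> mA [K [cK KH AK]]; have := (lf i).1 K cK KH => h.
rewrite ge0_fin_numE//; apply: le_lt_trans h; apply: le_measure => //; rewrite inE//.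
exact: compact_measurable_rV.
Qed.

Let fin2 i A : measurable A -> compactly_in A -> (nu i).2 A \is a fin_num.
Proof.
move=> mA [K [cK KH AK]]; have := (lf i).2 K cK KH => h.
rewrite ge0_fin_numE//; apply: le_lt_trans h; apply: le_measure => //; rewrite inE//.
exact: compact_measurable_rV.
Qed.

Let finsg A : measurable A -> compactly_in A -> sg A \is a fin_num.
Proof. by move=> mA cA; apply/sum_fin_numP => i _ _; rewrite fin_numD fin1// fin2. Qed.

Let sgU A B : measurable A -> measurable B -> A `&` B = set0 -> sg (A `|` B) = (sg A + sg B)%E.
Proof.
move=> mA mB AB; rewrite /sg -big_split/=; apply: eq_bigr => i _.
by rewrite !measureU// addeACA.
Qed.

Let sg_nneseries (G : (set V)^nat) : (forall j, measurable (G j)) -> trivIset setT G ->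
  (\sum_(j <oo) sg (G j) = sg (\bigcup_j G j))%E.
Proof.
move=> mG tG; rewrite /sg nneseries_sum//; last by move=> i j _; rewrite adde_ge0.
apply: eq_bigr => i _; rewrite nneseriesD//; by congr (_ + _)%E; rewrite measure_bigcup//; apply: eq_eseriesl => j; rewrite in_setT.
Qed.

Lemma enorm_vm_val_le A : measurable A -> compactly_in A -> ((enorm (vm_val nu A))%:E <= sg A)%E.
Proof.
move=> mA cA; apply: (@le_trans _ _ (\sum_i `|vm_val nu A ord0 i|)%:E).
  by rewrite lee_fin enorm_le_sum.
rewrite -sumEFin; apply: lee_sum => i _; rewrite mxE.
rewrite -(fineK (fin1 i mA cA)) -(fineK (fin2 i mA cA)) -EFinD lee_fin.
by rewrite (le_trans (ler_normB _ _))// !ger0_norm// ?fine_ge0.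
Qed.

Lemma vm_valU A B : measurable A -> measurable B -> compactly_in A -> compactly_in B -> A `&` B = set0 ->
  vm_val nu (A `|` B) = vm_val nu A + vm_val nu B.
Proof.
move=> mA mB cA cB AB; apply/rowP => i; rewrite !mxE !measureU//.
by rewrite !fineD ?fin1 ?fin2//; ring.
Qed.

(** The vector measure is only defined through differences of two possibly
    infinite measures; on compactly contained sets both are finite, so it is
    countably additive there. *)
Lemma enorm_vm_val_bigcup A (G : (set V)^nat) : measurable A -> compactly_in A ->
  (forall j, measurable (G j)) -> trivIset setT G -> A `<=` \bigcup_j G j ->
  ((enorm (vm_val nu A))%:E <= \sum_(j <oo) (enorm (vm_val nu (A `&` G j)))%:E)%E.
Proof.
move=> mA cA mG tG AG.
have cS B : B `<=` A -> compactly_in B by move=> BA; exact: compactly_inS cA.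
have mAG j : measurable (A `&` G j) by exact: measurableI.
set S := (X in (_ <= X)%E).
pose rest N := A `\` \bigcup_(j < N) G j.
have mrest N : measurable (rest N) by apply: measurableD => //; exact: bigcup_measurable.
have split_rest N : rest N = (A `&` G N) `|` rest N.+1.
  apply/seteqP; split => [z [Az nz]|z [[Az Gz]|[Az nz]]].
  - have [Gz|nGz] := pselect (G N z); [by left|right; split => // -[j /= ]].
    by rewrite ltnS leq_eqVlt => /predU1P[->//|jN Gj]; apply: nz; exists j.
  - split => // -[j /= jN Gj]; move/trivIsetP : tG => /(_ j N I I).
    by rewrite (negbT (ltn_eqF jN)) => /(_ isT); apply/eqP/set0P; exists z.
  - by split => // -[j /= jN Gj]; apply: nz; exists j => //=; exact: ltnW.
have dis N : (A `&` G N) `&` rest N.+1 = set0.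
  by apply/seteqP; split => // z [[_ Gz] [_ nz]]; apply: nz; exists N => /=.
have E1 N : ((enorm (vm_val nu A))%:E <=
    \sum_(0 <= j < N) (enorm (vm_val nu (A `&` G j)))%:E + (enorm (vm_val nu (rest N)))%:E)%E.
  elim: N => [|N IH].
    by rewrite big_nil add0e /rest bigcup_mkord big_ord0 setD0.
  apply: (le_trans IH); rewrite big_nat_recr//= -addeA leeD2l// split_rest vm_valU//.
  - by rewrite -EFinD lee_fin enormD.
  - by apply: cS => z [].
  - by apply: cS => z [].
have E2 N : (sg A = \sum_(0 <= j < N) sg (A `&` G j) + sg (rest N))%E.
  elim: N => [|N IH].
    by rewrite big_nil add0e /rest bigcup_mkord big_ord0 setD0.
  by rewrite IH big_nat_recr//= -addeA; congr (_ + _)%E; rewrite split_rest sgU.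
have S0 N : (\sum_(0 <= j < N) (enorm (vm_val nu (A `&` G j)))%:E <= S)%E.
  by apply: nneseries_lim_ge => i _ _; rewrite lee_fin enorm_ge0.
have fA := finsg mA cA.
have E3 : (\sum_(j <oo) sg (A `&` G j) = sg A)%E.
  rewrite sg_nneseries//; last exact: trivIset_setIl.
  by rewrite -setI_bigcupr setIidl.
have : ((enorm (vm_val nu A))%:E + sg A <= S + sg A)%E.
  rewrite -[X in (_ + X <= _)%E]E3 addeC -leeBrDr//.
  apply: lime_le; first by apply: is_cvg_nneseries => i _ _; exact: sg_ge0.
  apply: nearW => N; rewrite leeBrDr// (E2 N) addeCA leeD2l//.
  apply: (le_trans (E1 N)); apply: leeD => //.
  by apply: enorm_vm_val_le => //; apply: cS => z [].
by rewrite leeD2rE.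
Qed.

Local Notation tv := (vm_total_variation nu).
Local Notation part A F := [/\ forall j, measurable (F j) /\ compactly_in (F j), trivIset setT F & \bigcup_j F j = A].

Lemma tv_ge A (F : (set V)^nat) : part A F -> (\sum_(j <oo) (enorm (vm_val nu (F j)))%:E <= tv A)%E.
Proof. by move=> [h1 h2 h3]; apply: ereal_sup_ubound; exists F; split. Qed.

Lemma tv_le A c : (forall F : (set V)^nat, part A F -> (\sum_(j <oo) (enorm (vm_val nu (F j)))%:E <= c)%E) -> (tv A <= c)%E.
Proof. by move=> h; apply: ge_ereal_sup => r [F [h1 h2 h3 ->]]; exact: h. Qed.

Lemma part_ex A : measurable A -> A `<=` H -> exists F : (set V)^nat, part A F.
Proof.
move=> mA AH; exists (fun j => A `&` seqDU exhaust j); split.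
- move=> j; split.
    apply: measurableI => //; apply: seqDU_measurable => k; exact: measurable_exhaust.
  by apply: (@compactly_exhaust j) => z [_]; rewrite /seqDU => -[].
- exact/trivIset_setIl/trivIset_seqDU.
- by rewrite -setI_bigcupr -seqDU_bigcup_eq bigcup_exhaust setIidl.
Qed.

Let en_ge0 F : (0 <= (enorm (vm_val nu F))%:E)%E. Proof. by rewrite lee_fin enorm_ge0. Qed.

Lemma tv_ge0 A : measurable A -> A `<=` H -> (0 <= tv A)%E.
Proof.
move=> mA /(part_ex mA)[F pF]; apply: le_trans (tv_ge pF); exact: nneseries_ge0.
Qed.

(** Partitions of A and of B are interleaved into one partition of the union. *)
Lemma tv_superadd A B : measurable A -> measurable B -> A `<=` H -> B `<=` H -> A `&` B = set0 ->
  (tv A + tv B <= tv (A `|` B))%E.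
Proof.
move=> mA mB AH BH AB; apply: ereal_supD_le.
- by move=> _ [F [_ _ _ ->]]; exact: nneseries_ge0.
- by move=> _ [F [_ _ _ ->]]; exact: nneseries_ge0.
- by have [F [h1 h2 h3]] := part_ex mA AH; eexists; exists F; split.
- by have [F [h1 h2 h3]] := part_ex mB BH; eexists; exists F; split.
move=> _ _ [F [F1 F2 F3 ->]] [G [G1 G2 G3 ->]].
pose K j := if odd j then G j./2 else F j./2.
have pK : part (A `|` B) K.
  split.
  - by move=> j; rewrite /K; case: ifP.
  - apply/trivIsetP => i j _ _ ij; rewrite /K.
    have FA k : F k `<=` A by rewrite -F3; exact: bigcup_sup.
    have GB k : G k `<=` B by rewrite -G3; exact: bigcup_sup.
    case: ifPn => oi; case: ifPn => oj.
    + move/trivIsetP : G2; apply => //; apply: contra ij => /eqP ij.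
      by rewrite -(odd_double_half i) -(odd_double_half j) oi oj ij.
    + by rewrite setIC; apply/seteqP; split => // z [/FA Az /GB Bz]; rewrite -AB.
    + by apply/seteqP; split => // z [/FA Az /GB Bz]; rewrite -AB.
    + move/trivIsetP : F2; apply => //; apply: contra ij => /eqP ij.
      by rewrite -(odd_double_half i) -(odd_double_half j) (negbTE oi) (negbTE oj) ij.
  - apply/seteqP; split => [z [j _]|z].
      by rewrite /K; case: ifP => _ hz; [right; rewrite -G3|left; rewrite -F3]; exists j./2.
    case; [rewrite -F3|rewrite -G3] => -[j _ hz].
      by exists j.*2 => //; rewrite /K odd_double doubleK.
    by exists j.*2.+1 => //; rewrite /K /= odd_double /= uphalf_double.
apply: le_trans (tv_ge pK).
apply: le_trans (nneseries_even_odd _) => //.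
rewrite le_eqVlt; apply/orP; left; apply/eqP; congr (_ + _)%E; apply: eq_eseriesr => j _.
  by rewrite /K odd_double doubleK.
by rewrite /K /= odd_double /= uphalf_double.
Qed.

Lemma le_tv A B : measurable A -> measurable B -> A `<=` B -> B `<=` H -> (tv A <= tv B)%E.
Proof.
move=> mA mB AB BH.
have -> : B = A `|` (B `\` A) by rewrite setDUK.
apply: le_trans (tv_superadd _ _ _ _ _) => //.
- by rewrite leeDl// tv_ge0//; [exact: measurableD|move=> z [/BH]].
- exact: measurableD.
- exact: subset_trans BH.
- by move=> z [/BH].
- by rewrite setDE setICA setICr setI0.
Qed.

(** The upper bound refines a partition of the union by the sets A_j and
    exchanges the two sums; the lower bound is finite superadditivity and
    monotonicity. *)
Lemma tv_bigcup (A : (set V)^nat) : (forall j, measurable (A j)) -> (forall j, A j `<=` H) -> trivIset setT A ->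
  tv (\bigcup_j A j) = (\sum_(j <oo) tv (A j))%E.
Proof.
move=> mA AH tA; apply/eqP; rewrite eq_le; apply/andP; split.
  apply: tv_le => F [F1 F2 F3].
  apply: (@le_trans _ _ (\sum_(k <oo) \sum_(j <oo) (enorm (vm_val nu (F k `&` A j)))%:E)%E).
    apply: lee_nneseries => k _ //; have [mF cF] := F1 k.
    by apply: enorm_vm_val_bigcup => //; rewrite -F3; exact: bigcup_sup.
  rewrite nneseries_interchange//; apply: lee_nneseries => j _.
    by rewrite nneseries_ge0.
  apply: tv_ge; split.
  - move=> k; have [mF cF] := F1 k; split; first exact: measurableI.
    by apply: compactly_inS cF => z [].
  - exact: trivIset_setIr.
  - by rewrite -setI_bigcupl F3 setIidr//; exact: bigcup_sup.
apply: lime_le; first by apply: is_cvg_nneseries => i _ _; exact: tv_ge0.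
apply: nearW => N.
apply: (@le_trans _ _ (tv (\bigcup_(j < N) A j))).
  elim: N => [|N IH].
    by rewrite big_nil tv_ge0 // => [|z [j]//]; exact: bigcup_measurable.
  rewrite big_nat_recr//=.
  have -> : \bigcup_(j < N.+1) A j = (\bigcup_(j < N) A j) `|` A N.
    by rewrite !bigcup_mkord big_ord_recr.
  apply: le_trans (tv_superadd _ _ _ _ _) => //.
  - exact: leeD.
  - exact: bigcup_measurable.
  - by move=> z [j _ /AH].
  - apply/seteqP; split => // z [[j /= jN Aj] AN]; move/trivIsetP : tA => /(_ j N I I).
    by rewrite (negbT (ltn_eqF jN)) => /(_ isT); apply/eqP/set0P; exists z.
apply: le_tv.
- exact: bigcup_measurable.
- exact: bigcup_measurable.
- by move=> z [j _ Aj]; exists j.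
- by move=> z [j _ /AH].
Qed.

Lemma enorm_le_tv A : measurable A -> compactly_in A -> ((enorm (vm_val nu A))%:E <= tv A)%E.
Proof.
move=> mA cA; have mA' j : measurable (if j is 0%N then A else set0 : set V) by case: j.
apply: le_trans (tv_ge (F := fun j => if j is 0%N then A else set0) _).
  by apply: le_trans (nneseries_lim_ge 1 _) => //; rewrite big_nat1.
split => //.
- by move=> [|j]; split => //; exact: compactly_inS cA.
- by apply/trivIsetP => -[|i] [|j]//= _ _ _; rewrite ?setI0 ?set0I.
- by apply/seteqP; split => [z [[|j]]//|z Az]; exists 0%N.
Qed.

(** The total variation is at most the sum of all the positive and negative
    parts of the components. *)
Lemma tv_compactly_lty A : measurable A -> compactly_in A -> (tv A < +oo)%E.
Proof.
move=> mA cA; apply: (@le_lt_trans _ _ (sg A)); last by rewrite -ge0_fin_numE// finsg.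
apply: tv_le => F [F1 F2 F3].
rewrite -F3 -sg_nneseries//; last by move=> j; case: (F1 j).
by apply: lee_nneseries => // j _; have [? ?] := F1 j; exact: enorm_vm_val_le.
Qed.

Let tvm A : \bar R := if `[< measurable A >] then tv (A `&` H) else 0%E.

Let mH : measurable H := measurable_hspace.

Let tvm0 : tvm set0 = 0%E.
Proof.
rewrite /tvm asboolT// set0I; apply/eqP; rewrite eq_le tv_ge0// andbT.
apply: tv_le => F [F1 F2 F3]; rewrite eseries0// => j _ _.
have -> : F j = set0 by apply/seteqP; split => // z Fz; rewrite -F3; exists j.
by rewrite (_ : vm_val _ _ = 0) ?enorm0//; apply/rowP => i; rewrite !mxE !measure0 subrr.
Qed.

Let tvm_ge0 A : (0 <= tvm A)%E.
Proof. by rewrite /tvm; case: asboolP => // mA; apply: tv_ge0; [exact: measurableI|move=> z []]. Qed.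

Let tvm_sigma_additive : semi_sigma_additive tvm.
Proof.
move=> F mF tF mUF; rewrite /tvm asboolT// setI_bigcupl tv_bigcup.
- rewrite (eq_eseriesr (g := fun j => tvm (F j))); last by move=> j _; rewrite /tvm asboolT.
  rewrite (_ : (fun k => _) = (fun k => \sum_(0 <= i < k) tvm (F i))%E); first exact: is_cvg_nneseries.
  by apply/funext => k; apply: eq_bigr => j _; rewrite /tvm.
- by move=> j; exact: measurableI.
- by move=> j z [].
- exact: trivIset_setIr.
Qed.

HB.instance Definition _ := isMeasure.Build _ _ _ tvm tvm0 tvm_ge0 tvm_sigma_additive.

Let tvm_sigma_finite : sigma_finite setT tvm.
Proof.
exists (fun k => exhaust k `|` ~` H).
  apply/seteqP; split => // z _; have [Hz|nHz] := pselect (H z); last by exists 0%N => //; right.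
  by move: Hz; rewrite -bigcup_exhaust => -[k _ hk]; exists k => //; left.
move=> k; have mk := measurable_exhaust k.
have mkH : measurable (exhaust k `|` ~` H) by apply: measurableU => //; exact: measurableC.
split=> //; rewrite /tvm asboolT// setIUl setICl setU0 setIidl; last exact: exhaust_hspace.
by apply: tv_compactly_lty => //; exact: (@compactly_exhaust k).
Qed.

HB.instance Definition _ := @Measure_isSigmaFinite.Build _ _ _ tvm tvm_sigma_finite.

(** Extending the total variation by zero outside the half-space gives a measure
    on the whole space, to which Tonelli's theorem applies. *)
Lemma tv_measure : exists m : {sigma_finite_measure set V -> \bar R},
  forall A, measurable A -> m A = tv (A `&` H).
Proof. by exists tvm => A mA; rewrite /= /tvm asboolT. Qed.
End tv_nu.

Lemma tv_le_comb (nu nu1 nu2 : vector_measure (R:=R) n) (a : R) A :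
  vm_locally_finite nu1 -> vm_locally_finite nu2 ->
  (forall F, measurable F -> compactly_in F -> vm_val nu F = a *: vm_val nu1 F + vm_val nu2 F) ->
  (vm_total_variation nu A <= `|a|%:E * vm_total_variation nu1 A + vm_total_variation nu2 A)%E.
Proof.
move=> lf1 lf2 h; apply: tv_le => F [F1 F2 F3].
apply: (@le_trans _ _ (\sum_(j <oo) (`|a|%:E * (enorm (vm_val nu1 (F j)))%:E + (enorm (vm_val nu2 (F j)))%:E))%E).
  apply: lee_nneseries => j _; first by rewrite lee_fin enorm_ge0.
  have [mF cF] := F1 j; rewrite h// -EFinM -EFinD lee_fin -enormZ; exact: enormD.
rewrite nneseriesD; last 2 first.
- by move=> j _ _; rewrite mule_ge0// lee_fin enorm_ge0.
- by move=> j _ _; rewrite lee_fin enorm_ge0.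
rewrite nneseriesZl; last by move=> j _; rewrite lee_fin enorm_ge0.
by apply: leeD; [rewrite lee_wpmul2l//|]; exact: tv_ge.
Qed.

Lemma eq_tv (nu nu' : vector_measure (R:=R) n) A :
  (forall F, measurable F -> compactly_in F -> vm_val nu F = vm_val nu' F) ->
  vm_total_variation nu A = vm_total_variation nu' A.
Proof.
move=> h; congr ereal_sup; apply/seteqP; split => r [F [F1 F2 F3 ->]]; exists F; split => //;
  by apply: eq_eseriesr => j _; have [? ?] := F1 j; rewrite h.
Qed.
End tv.

(** * Test functions and uniqueness of the gradient *)

Section rho.
Context {R : realType}.
Implicit Types x h : R.

(** A once continuously differentiable profile: the square of the positive part.
    All the cutoffs and kernels below are built from it by algebra, so that
    first derivatives are explicit. *)
Definition rho x : R := Num.max x 0 ^+ 2.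

Lemma rho_ge0 x : 0 <= rho x. Proof. exact: sqr_ge0. Qed.

(** A quadratic remainder bound; it yields at the same time differentiability of
    rho and, later, of convolutions with it. *)
Lemma rho_expand x h : `|rho (x + h) - rho x - 2 * Num.max x 0 * h| <= h ^+ 2.
Proof.
rewrite /rho ler_norml; apply/andP; split;
  case: (leP x 0) => hx; case: (leP (x + h) 0) => hy; nra.
Qed.

Lemma is_derive_rho x : is_derive x 1 rho (2 * Num.max x 0).
Proof.
have H : (fun h => h^-1 *: ((rho \o shift x) (h *: 1) - rho x)) @ 0^' --> 2 * Num.max x 0.
  apply/cvgrPdist_le => e e0; near=> h.
  have h0 : h != 0 by near: h; exact: nbhs_dnbhs_neq.
  rewrite -[leLHS]normrN opprB /= /GRing.scale/= mulr1 (addrC h x).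
  have -> : h^-1 * (rho (x + h) - rho x) - 2 * Num.max x 0 = h^-1 * (rho (x + h) - rho x - 2 * Num.max x 0 * h).
    by rewrite [in RHS]mulrBr [h^-1 * (_ * h)]mulrC mulfK.
  rewrite normrM normfV ler_pdivrMl ?normr_gt0//.
  apply: (le_trans (rho_expand x h)).
  rewrite -(@ger0_norm _ (h ^+ 2)) ?sqr_ge0// normrX expr2 ler_wpM2l//.
  by near: h; exact: dnbhs0_le.
apply: DeriveDef; last exact/cvg_lim.
by apply/cvg_ex; exists (2 * Num.max x 0).
Unshelve. all: by end_near. Qed.

Lemma continuous_drho : continuous (fun x => 2 * Num.max x 0 : R).
Proof.
move=> x; apply: cvgM; first exact: cvg_cst.
by apply: continuous_max; [exact: cvg_id|exact: cvg_cst].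
Qed.

(** A cutoff with chi = 0 at 0 and chi = 1 from 1 on. *)
Definition chi x : R := 1 - rho (1 - x).

Lemma is_derive_chi x : is_derive x 1 chi (2 * Num.max (1 - x) 0).
Proof.
have h1 : is_derive x 1 (fun y : R => 1 - y) (-1).
  have := @is_deriveB R R R (cst (1:R)) id x 1 0 1 (is_derive_cst _ _ _) (is_derive_id _ _).
  by rewrite sub0r.
have h2 := is_derive_rho (1 - x).
have h3 : is_derive x 1 (rho \o (fun y => 1 - y)) (2 * Num.max (1 - x) 0 * -1).
  exact: is_derive1_comp.
have -> : chi = (fun y => cst 1 y - (rho \o (fun y => 1 - y)) y) by [].
have := @is_deriveB R R R (cst (1:R)) _ x 1 0 _ (is_derive_cst _ _ _) h3.
by rewrite sub0r mulrN1 opprK.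
Qed.

Lemma continuous_dchi : continuous (fun x => 2 * Num.max (1 - x) 0 : R).
Proof.
move=> x; have h : {for x, continuous (fun y : R => 1 - y)} by apply: cvgB; [exact: cvg_cst|exact: cvg_id].
exact: (continuous_comp h (@continuous_drho (1 - x))).
Qed.

Lemma chi_ge1 x : 1 <= x -> chi x = 1.
Proof. by move=> x1; rewrite /chi /rho max_r ?expr0n/= ?subr0// subr_le0. Qed.

Lemma chi_le0 : chi 0 = 0.
Proof. by rewrite /chi /rho subr0 max_l ?expr1n ?subrr// ler01. Qed.

Lemma chi01 x : 0 <= x -> 0 <= chi x <= 1.
Proof. by move=> x0; rewrite /chi /rho; case: (leP (1 - x) 0) => h; nra. Qed.
End rho.

Section C1.
Context {R : realType} (n : nat).
Local Notation V := ('rV[R]_(1 + n)).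
Implicit Types (f g : V -> R) (D : set V) (z v a : V) (r : R).

Lemma C1_onI D f (df : V -> V -> R) : open D ->
  (forall z, D z -> differentiable f z /\ forall v, 'D_v f z = df v z) ->
  (forall z v, D z -> {for z, continuous (df v)}) -> C1_on D f.
Proof.
move=> oD h1 h2 z Dz; split; first by case: (h1 z Dz).
move=> v; have E : {near z, df v =1 (fun w => 'D_v f w)}.
  by near=> w; rewrite (h1 w _).2//; near: w; exact: open_nbhs_nbhs.
have := h2 z v Dz; rewrite /prop_for/continuous_at (h1 z Dz).2 => h.
exact: cvg_trans (near_eq_cvg E) h.
Unshelve. all: by end_near. Qed.

Lemma C1_on_cont D f z : C1_on D f -> D z -> {for z, continuous f}.
Proof. by move=> h /h[/differentiable_continuous]. Qed.

Lemma C1_cst D (c : R) : open D -> C1_on D (fun=> c).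
Proof.
move=> oD; apply: (@C1_onI _ _ (fun _ _ => 0)) => //.
- by move=> z Dz; split; [exact: differentiable_cst|move=> v; exact: derive_cst].
- by move=> z v _; exact: cst_continuous.
Qed.

Lemma C1_coord D i : open D -> C1_on D (fun z => z ord0 i).
Proof.
move=> oD; apply: (@C1_onI _ _ (fun v _ => v ord0 i)) => //.
- move=> z Dz; split; first exact: differentiable_coord.
  move=> v; apply: cvg_lim => //; apply: cvg_near_cst; near=> h.
  have h0 : h != 0 by near: h; exact: nbhs_dnbhs_neq.
  by rewrite /= !mxE addrK /GRing.scale/= mulKf.
- by move=> z v _; exact: cst_continuous.
Unshelve. all: by end_near. Qed.

Lemma C1_mul D f g : open D -> C1_on D f -> C1_on D g -> C1_on D (fun z => f z * g z).
Proof.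
move=> oD hf hg; apply: (@C1_onI _ _ (fun v z => f z * 'D_v g z + g z * 'D_v f z)) => //.
- move=> z Dz; have [df _] := hf z Dz; have [dg _] := hg z Dz; split; first exact: differentiableM.
  by move=> v; apply: deriveM; exact: diff_derivable.
- move=> z v Dz; have cf := C1_on_cont hf Dz; have cg := C1_on_cont hg Dz.
  have := cvgD (cvgM cf ((hg z Dz).2 v)) (cvgM cg ((hf z Dz).2 v)); exact.
Qed.

Lemma C1_add D f g : open D -> C1_on D f -> C1_on D g -> C1_on D (fun z => f z + g z).
Proof.
move=> oD hf hg; apply: (@C1_onI _ _ (fun v z => 'D_v f z + 'D_v g z)) => //.
- move=> z Dz; have [df _] := hf z Dz; have [dg _] := hg z Dz; split; first exact: differentiableD.
  by move=> v; apply: deriveD; exact: diff_derivable.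
- by move=> z v Dz; have := cvgD ((hf z Dz).2 v) ((hg z Dz).2 v); exact.
Qed.

Lemma C1_sum D (I : Type) (s : seq I) (f : I -> V -> R) : open D ->
  (forall i, C1_on D (f i)) -> C1_on D (fun z => \sum_(i <- s) f i z).
Proof.
move=> oD hf; elim: s => [|i s IH].
  by under eq_fun do rewrite big_nil; exact: C1_cst.
by under eq_fun do rewrite big_cons; exact: C1_add.
Qed.

Lemma derive_comp1 f (g : R -> R) (dg : R -> R) z v : differentiable f z ->
  is_derive (f z) 1 g (dg (f z)) ->
  differentiable (fun w => g (f w)) z /\ 'D_v (fun w => g (f w)) z = dg (f z) * 'D_v f z.
Proof.
move=> df hg; have dg' : differentiable g (f z) by apply/derivable1_diffP; exact: ex_derive.
have dgf : differentiable (g \o f) z by exact: differentiable_comp.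
split => //.
have -> : (fun w => g (f w)) = g \o f by [].
rewrite (deriveE v dgf) (diff_comp df dg') /= (diff1E dg') /= -(deriveE v df).
by rewrite derive1E derive_val /GRing.scale/= mulrC.
Qed.

Lemma C1_comp1 D f (g : R -> R) (dg : R -> R) : open D -> C1_on D f ->
  (forall x : R, is_derive x 1 g (dg x)) -> continuous dg -> C1_on D (fun z => g (f z)).
Proof.
move=> oD hf hg cg; apply: (@C1_onI _ _ (fun v z => dg (f z) * 'D_v f z)) => //.
- move=> z Dz; have [df _] := hf z Dz.
  by split; [case: (derive_comp1 z df (hg _))|move=> v; case: (derive_comp1 v df (hg _))].
- move=> z v Dz; have cf := C1_on_cont hf Dz.
  have h : {for z, continuous (dg \o f)} by apply: continuous_comp => //; exact: cg.
  by have := cvgM h ((hf z Dz).2 v); exact.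
Qed.

Lemma C1_opp D f : open D -> C1_on D f -> C1_on D (fun z => - f z).
Proof.
move=> oD hf; under eq_fun do rewrite -mulN1r.
by apply: C1_mul => //; exact: C1_cst.
Qed.

Definition qbump (a : V) (r : R) z : R := rho (r ^+ 2 - \sum_i (z ord0 i - a ord0 i) ^+ 2).

Lemma C1_qbump a r : C1_on setT (qbump a r).
Proof.
apply: C1_comp1 is_derive_rho continuous_drho; first exact: openT.
apply: C1_add; [exact: openT|exact: C1_cst openT|].
apply: C1_opp; [exact: openT|].
apply: C1_sum; [exact: openT|] => i; under eq_fun do rewrite expr2.
have h : C1_on setT (fun z : V => z ord0 i - a ord0 i).
  by apply: C1_add; [exact: openT|exact: C1_coord openT|exact: C1_cst openT].
by apply: C1_mul => //; exact: openT.
Qed.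

Lemma qbump_ge0 a r z : 0 <= qbump a r z. Proof. exact: rho_ge0. Qed.

Lemma qbump_gt0 a r z : 0 <= r -> enorm (z - a) < r -> 0 < qbump a r z.
Proof.
move=> r0 h; rewrite /qbump /rho exprn_gt0// lt_max subr_gt0.
have -> : \sum_i (z ord0 i - a ord0 i) ^+ 2 = enorm (z - a) ^+ 2.
  by rewrite enorm_sqr; apply: eq_bigr => i _; rewrite !mxE.
by rewrite ltrXn2r// enorm_ge0.
Qed.

Lemma qbump_neq0 a r z : 0 <= r -> qbump a r z != 0 -> forall i, `|a ord0 i - z ord0 i| < r.
Proof.
move=> r0; rewrite /qbump /rho expf_eq0/= => h i; rewrite distrC.
have : 0 < r ^+ 2 - \sum_i (z ord0 i - a ord0 i) ^+ 2.
  by rewrite ltNge; apply/negP => h'; move: h; rewrite max_r// eqxx.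
rewrite subr_gt0.
have -> : \sum_i (z ord0 i - a ord0 i) ^+ 2 = enorm (z - a) ^+ 2.
  by rewrite enorm_sqr; apply: eq_bigr => j _; rewrite !mxE.
rewrite ltr_pXn2r ?nnegrE ?enorm_ge0// => h2.
by have := coord_le_enorm (z - a) i; rewrite !mxE => h3; exact: le_lt_trans h2.
Qed.

(** Indicators of open sets are limits of admissible test functions: U is a
    countable union of rational balls with compact closure in U, and
    chi (k * sum of the first k bumps) tends to 1 wherever some bump is
    positive. *)
Lemma open_approx (U : set V) : open U -> exists psi : nat -> V -> R,
  [/\ forall k, C1_on setT (psi k),
      forall k z, 0 <= psi k z <= 1,
      forall k, exists K, [/\ compact K, K `<=` U & forall z, psi k z != 0 -> K z] &
      forall z, psi k z @[k --> \oo] --> (\1_U z : R)].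
Proof.
move=> oU.
pose N : R := (1 + n).+1%:R.
pose r (k : nat) : R := (1 + n)%:R / k.+1%:R.
have r0 k : 0 <= r k by rewrite divr_ge0.
pose good (q : 'rV[rat]_(1+n) * nat) := `[< forall y : V, (forall i, `|ratpt q.1 ord0 i - y ord0 i| < N * q.2.+1%:R^-1) -> U y >].
pose b j z : R := if @unpickle ('rV[rat]_(1+n) * nat)%type j is Some q then
  if good q then qbump (ratpt q.1) (r q.2) z else 0 else 0.
have C1b j : C1_on setT (b j).
  rewrite /b; case: unpickle => [q|]; last exact: C1_cst openT.
  by case: (good q); [exact: C1_qbump|exact: C1_cst openT].
have b0 j z : 0 <= b j z.
  by rewrite /b; case: unpickle => [q|//]; case: ifP => _ //; exact: qbump_ge0.
have rN k : r k < N * k.+1%:R^-1 by rewrite /r /N ltr_pM2r ?invr_gt0// ltr_nat.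
have bsupp j : exists K, [/\ compact K, K `<=` U & forall z, b j z != 0 -> K z].
  rewrite /b; case: unpickle => [q|]; last by exists set0; split => // [|z]; [exact: compact0|rewrite eqxx].
  have [gq|gq] := boolP (good q); last by exists set0; split => // [|z]; [exact: compact0|rewrite eqxx].
  move/asboolP : gq => gq; exists (cbox (ratpt q.1 - const_mx (r q.2)) (ratpt q.1 + const_mx (r q.2))); split.
  - exact: compact_cbox.
  - move=> z hz; apply: gq => i; apply: le_lt_trans (rN q.2).
    by have := hz i; rewrite !mxE ler_distlC.
  - by move=> z /(qbump_neq0 (r0 _)) hz i; have := hz i; rewrite !mxE ltr_distlC => /andP[h1 h2]; rewrite (ltW h1) (ltW h2).
have bpos z : U z -> exists j, 0 < b j z.
  move=> Uz; have [q [k [h1 h2]]] := rat_ball (ler0n R (1 + n).+1) oU Uz.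
  exists (pickle (q, k)); rewrite /b pickleK.
  have -> : good (q, k) by apply/asboolP.
  apply: qbump_gt0 => //; apply: (le_lt_trans (enorm_le_sum _)).
  rewrite /r -[ltRHS]/((1 + n)%:R * (k.+1%:R)^-1) mulrC.
  rewrite -[X in _ < _ * X%:R](card_ord (1 + n)) -sumr_const mulr_sumr.
  move/ball_rVP : h1; rewrite invr_gt0 ltr0Sn => /(_ isT) h1.
  have E i : `|(z - ratpt q) ord0 i| < k.+1%:R^-1 by have := h1 i; rewrite !mxE distrC.
  apply: ltr_sum => [|i _]; first by apply/hasP; exists (t0 n); rewrite ?mem_index_enum.
  by rewrite mulr1.
(* The factor k makes the argument of chi eventually exceed 1 wherever some
   bump is positive. *)
pose F (k : nat) z := k%:R * \sum_(0 <= j < k) b j z.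
have F0 k z : 0 <= F k z by rewrite mulr_ge0// sumr_ge0.
exists (fun k z => chi (F k z)); split.
- move=> k; apply: C1_comp1 is_derive_chi _; first exact: openT.
    apply: C1_mul; [exact: openT|exact: C1_cst openT|].
    by apply: C1_sum; [exact: openT|].
  exact: continuous_dchi.
- by move=> k z; exact: chi01.
- move=> k.
  have [K [cK KU hK]] : exists K, [/\ compact K, K `<=` U & forall z, \sum_(0 <= j < k) b j z != 0 -> K z].
    elim: k => [|k [K [cK KU hK]]].
      by exists set0; split => // [|z]; [exact: compact0|rewrite big_nil eqxx].
    have [K' [cK' KU' hK']] := bsupp k.
    exists (K `|` K'); split => //; first exact: compactU.
      by move=> z [/KU|/KU'].
    move=> z; rewrite big_nat_recr//=; have [hz|/eqP hz] := pselect (b k z = 0).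
      by rewrite hz addr0 => /hK; left.
    by move=> _; right; exact: hK'.
  exists K; split => // z hz; apply: hK; apply: contra hz => /eqP hz.
  by rewrite /F hz mulr0 chi_le0.
- move=> z; rewrite indicE; have [Uz|nUz] := pselect (U z).
    rewrite mem_set//=; have [j bj] := bpos _ Uz.
    apply: cvg_near_cst; near=> k; apply: chi_ge1.
    have jk : (j < k)%N by near: k; exact: nbhs_infty_gt.
    have h1 : b j z <= \sum_(0 <= i < k) b i z.
      by rewrite big_mkord (bigD1 (Ordinal jk))//= lerDl sumr_ge0.
    have h2 : (b j z)^-1 <= k%:R by near: k; exact: nbhs_infty_ger.
    apply: (@le_trans _ _ (k%:R * b j z)); last by rewrite ler_wpM2l.
    by rewrite -ler_pdivrMr// div1r.
  rewrite memNset//=; apply: cvg_near_cst; apply: nearW => k.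
  rewrite /F big1 ?mulr0 ?chi_le0// => j _; apply/eqP/negPn/negP => h.
  by have [K [_ KU /(_ z h) /KU]] := bsupp j.
Unshelve. all: by end_near. Qed.
End C1.

Section approx.
Context d (T : measurableType d) (R : realType).
Variable m : {measure set T -> \bar R}.

Lemma cvg_Rintegral_approx (D W : set T) (g : T -> R) (psi : nat -> T -> R) :
  measurable D -> measurable W -> W `<=` D -> m.-integrable W (EFin \o g) ->
  (forall k, measurable_fun D (psi k)) ->
  (forall k z, 0 <= psi k z <= 1) -> (forall k z, ~ W z -> psi k z = 0) ->
  (forall z, psi k z @[k --> \oo] --> (\1_W z : R)) ->
  \int[m]_(z in D) (g z * psi k z) @[k --> \oo] --> \int[m]_(z in W) g z.
Proof.
move=> mD mW WD ig mpsi p01 psup pcvg.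
have E k : \int[m]_(z in D) (g z * psi k z) = \int[m]_(z in W) (g z * psi k z).
  rewrite -[in RHS](setIidr WD) Rintegral_mkcondr; apply: eq_Rintegral => z _.
  by rewrite patchE; case: ifPn => //; rewrite notin_setE => /psup ->; rewrite mulr0.
under eq_fun do rewrite E.
have mg : measurable_fun W (EFin \o g) by case/integrableP : ig.
have h1 : forall k, measurable_fun W (fun z => (g z * psi k z)%:E).
  move=> k; apply/measurable_EFinP; apply: measurable_funM; first exact/measurable_EFinP.
  exact: measurable_funS (mpsi k).
have h2 : {ae m, forall z, W z -> (g z * psi k z)%:E @[k --> \oo] --> (g z)%:E}.
  apply: aeW => z Wz; apply: cvg_EFin; first exact: nearW.
  have := pcvg z; rewrite indicE mem_set//= => h.
  by rewrite -[X in _ --> X]mulr1; apply: cvgM => //; exact: cvg_cst.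
have h3 : m.-integrable W (EFin \o (fun z => `|g z|)) by exact: integrable_norm.
have h4 : {ae m, forall z k, W z -> (`|(g z * psi k z)%:E| <= (`|g z|)%:E)%E}.
  apply: aeW => z k Wz; rewrite /= lee_fin normrM ler_piMr//.
  by have /andP[? ?] := p01 k z; rewrite ger0_norm.
have [_ _ h] := dominated_convergence mW h1 mg h2 h3 h4.
by apply: fine_cvg; rewrite fineK//; exact: integrable_fin_num.
Qed.
End approx.

Section gradient_unique.
Context {R : realType} (n : nat).
Local Notation V := ('rV[R]_(1 + n)).
Local Notation H := (@hspace R n).
Implicit Types (A B F : set V) (f : V -> R).

Lemma C1_measurable (D : set V) f : open D -> C1_on D f -> measurable_fun D f.
Proof.
move=> oD hf; apply: open_continuous_measurable_rV => // z; rewrite inE => Dz.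
exact: C1_on_cont hf Dz.
Qed.

Definition oexh (k : nat) : set V :=
  obox (\row_i (if i == t0 n then k.+1%:R^-1 else - k.+1%:R)) (const_mx k.+1%:R).

Lemma open_obox m (a b : 'rV[R]_m) : open (obox a b).
Proof.
rewrite (_ : obox a b = \big[setI/setT]_i
    ((fun z : 'rV[R]_m => z ord0 i) @^-1` `](a ord0 i), (b ord0 i)[%classic)).
  apply: big_ind => [|A B|i _]; [exact: openT|exact: openI|].
  apply: open_comp; last exact: interval_open.
  by move=> z _; exact: coord_continuous.
rewrite -bigcap_seq; apply/seteqP; split => x /= + i.
  by move=> /(_ i) xi _; rewrite /= in_itv.
by move=> /(_ i); rewrite /= in_itv/=; apply; rewrite mem_index_enum.
Qed.

Lemma oexh_exhaust k : oexh k `<=` exhaust k.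
Proof. by move=> z h i; have /andP[h1 h2] := h i; rewrite (ltW h1) (ltW h2). Qed.

Lemma compactly_oexh k : compactly_in (oexh k).
Proof. by apply: (@compactly_exhaust _ _ k); exact: oexh_exhaust. Qed.

Lemma compact_sub_oexh K : compact K -> K `<=` H -> exists k, K `<=` oexh k.
Proof.
move=> cK KH.
have cf : {within K, continuous (fun z : V => (tcoord z)^-1)}.
  apply: continuous_in_subspaceT => z; rewrite inE => /KH Hz.
  have h : tcoord z != 0 by rewrite gt_eqF.
  have := cvgV h (@coord_continuous R _ _ ord0 (t0 n) z); exact.
have /compact_bounded[M [Mr MP]] := continuous_compact cf cK.
have /compact_bounded[M' [Mr' MP']] := cK.
pose k := maxn (Num.truncn (M + 1)) (Num.truncn (M' + 1)).
have h1 : M + 1 < k.+1%:R.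
  by rewrite (lt_le_trans (truncnS_gt _))// ler_nat ltnS leq_maxl.
have h2 : M' + 1 < k.+1%:R.
  by rewrite (lt_le_trans (truncnS_gt _))// ler_nat ltnS leq_maxr.
exists k => z Kz i; rewrite !mxE.
have h3 : `|z| <= M' + 1 by apply: MP' Kz; rewrite ltrDl.
have := le_lt_trans (coord_le_norm z i) (le_lt_trans h3 h2).
rewrite ltr_norml => /andP[h4 ->]; rewrite andbT; case: eqP => // ->.
have t0z : 0 < tcoord z by exact: KH.
have h5 : `|(tcoord z)^-1| <= M + 1 by apply: (MP (M + 1)); [rewrite ltrDl|exists z].
rewrite invf_plt ?posrE//; apply: le_lt_trans h1; apply: le_trans h5; exact: ler_norm.
Qed.

Lemma vm_coord_cvg (m : {measure set V -> \bar R}) W (psi : nat -> V -> R) :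
  locally_finite m -> open W -> compactly_in W ->
  (forall k, C1_on setT (psi k)) -> (forall k z, 0 <= psi k z <= 1) ->
  (forall k z, psi k z != 0 -> W z) -> (forall z, psi k z @[k --> \oo] --> (\1_W z : R)) ->
  \int[m]_(z in H) psi k z @[k --> \oo] --> fine (m W).
Proof.
move=> lf oW cW psi1 psi2 psi3 psi4.
have mW := open_measurable_rV oW.
have Wfin : (m W < +oo)%E.
  have [K [cK KH WK]] := cW; apply: le_lt_trans (lf K cK KH).
  by apply: le_measure => //; rewrite inE//; exact: compact_measurable_rV.
have := @cvg_Rintegral_approx _ _ R m H W (cst 1) psi (@measurable_hspace R n) mW (compactly_in_hspace cW).
rewrite Rintegral_cst// mul1r.
have -> : (fun k => \int[m]_(z in H) (cst 1 z * psi k z)) = (fun k => \int[m]_(z in H) psi k z).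
  by apply/funext => k; apply: eq_Rintegral => z _; rewrite mul1r.
apply => //.
- by apply: measurable_bounded_integrable => //; exact: bounded_cst.
- move=> k; apply: (@measurable_funS _ _ _ _ setT) => //; apply: C1_measurable => //; exact: openT.
- by move=> k z nW; apply/eqP/negPn/negP => /psi3.
Qed.

(** Testing against approximations of the indicator of an open box identifies the
    values of both measures there.  These are differences of two measures, so
    the terms are rearranged into two positive measures, localised to a compact
    box where they are finite, and compared on the pi-system of open boxes. *)
Lemma gradient_unique (u : V -> R) nu nu' F : is_gradient u nu -> is_gradient u nu' ->
  measurable F -> compactly_in F -> vm_val nu F = vm_val nu' F.
Proof.
move=> [lf gu] [lf' gu'] mF cF; apply/rowP => i; rewrite !mxE.
have [K [cK KH FK]] := cF; have [k Kk] := compact_sub_oexh cK KH.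
have mO : measurable (oexh k) by exact: measurable_obox.
have lf1 m : locally_finite m -> forall A, measurable A -> A `<=` oexh k -> m A \is a fin_num.
  move=> lfm A mA Ak; rewrite ge0_fin_numE//.
  apply: le_lt_trans (lfm (exhaust k) _ _); [|exact: compact_exhaust|exact: exhaust_hspace].
  apply: le_measure; rewrite ?inE//; first exact: measurable_exhaust.
  by move=> z /Ak /oexh_exhaust.
have [f1 f2] := (lf1 _ (lf i).1, lf1 _ (lf i).2).
have [f1' f2'] := (lf1 _ (lf' i).1, lf1 _ (lf' i).2).
have op W : open W -> W `<=` oexh k ->
    fine ((nu i).1 W) - fine ((nu i).2 W) = fine ((nu' i).1 W) - fine ((nu' i).2 W).
  move=> oW Wk; have cW : compactly_in W by apply: compactly_inS (@compactly_oexh k).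
  have [psi [p1 p2 p3 p4]] := open_approx oW.
  have p3' j z : psi j z != 0 -> W z by have [L [_ LW h]] := p3 j => /h /LW.
  have C m : locally_finite m -> _ := fun lfm => vm_coord_cvg lfm oW cW p1 p2 p3' p4.
  have c1 : vm_integral nu i (psi j) @[j --> \oo] --> _ := cvgB (C _ (lf i).1) (C _ (lf i).2).
  have c2 : vm_integral nu' i (psi j) @[j --> \oo] --> _ := cvgB (C _ (lf' i).1) (C _ (lf' i).2).
  have E j : vm_integral nu i (psi j) = vm_integral nu' i (psi j).
    have tj : test_function (psi j).
      split; first exact: p1.
      have [L [cL LW h]] := p3 j; exists L; split => //.
      by move=> z /LW /Wk /oexh_exhaust /exhaust_hspace.
    by have := gu i _ tj; rewrite (gu' i _ tj) => /eqP; rewrite eqr_opp => /eqP ->.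
  have e1 := cvg_lim (@Rhausdorff R) (c1 _); have e2 := cvg_lim (@Rhausdorff R) (c2 _).
  by rewrite -[LHS]e1 -[RHS]e2 (funext E).
pose m1 : {measure set V -> \bar R} := mrestr (measure_add (nu i).1 (nu' i).2) mO.
pose m2 : {measure set V -> \bar R} := mrestr (measure_add (nu i).2 (nu' i).1) mO.
have m1E A : m1 A = ((nu i).1 (A `&` oexh k) + (nu' i).2 (A `&` oexh k))%E by exact: measure_addE.
have m2E A : m2 A = ((nu i).2 (A `&` oexh k) + (nu' i).1 (A `&` oexh k))%E by exact: measure_addE.
have : m1 F = m2 F.
  apply: measure_eq_oboxes => //.
    move=> a b; rewrite m1E m2E.
    have mW : measurable (obox a b `&` oexh k) by apply: measurableI; exact: measurable_obox.
    have sW : obox a b `&` oexh k `<=` oexh k by move=> z [].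
    have := op _ (openI (@open_obox _ a b) (@open_obox _ _ _)) sW.
    rewrite -(fineK (f1 _ mW sW)) -(fineK (f2 _ mW sW)) -(fineK (f1' _ mW sW)) -(fineK (f2' _ mW sW)).
    by rewrite -!EFinD => h; congr EFin; move: h; rewrite -/(oexh k) /=; lra.
  move=> j; rewrite m1E.
  set W := _ `&` _; have mW : measurable W by apply: measurableI => //; exact: measurable_obox.
  have sW : W `<=` oexh k by move=> z [].
  by rewrite lte_add_pinfty// -ge0_fin_numE//; [exact: f1|exact: f2'].
rewrite m1E m2E setIidl; last exact: subset_trans Kk.
have sF : F `<=` oexh k by exact: subset_trans Kk.
rewrite -(fineK (f1 _ mF sF)) -(fineK (f2 _ mF sF)) -(fineK (f1' _ mF sF)) -(fineK (f2' _ mF sF)).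
rewrite -!EFinD => -[]; rewrite /=; lra.
Qed.

Lemma is_gradient_grad (u : V -> R) : (exists nu, is_gradient u nu) -> is_gradient u (grad u).
Proof. by move=> h; rewrite /grad; case: pselect => // h'; case: cid. Qed.
End gradient_unique.

(** * Test functions against the total variation *)

Section count.
Context {R : realType}.
(** The discrete layer-cake formula: a nonnegative number is, up to an error 1,
    the number of integers below it. *)
Lemma count_lt (N : nat) (y : R) : 0 <= y ->
  Num.min y N%:R <= \sum_(k < N) (k%:R < y)%R%:R <= Num.min (y + 1) N%:R.
Proof.
move=> y0; elim: N => [|N /andP[h1 h2]].
  rewrite big_ord0; apply/andP; split; first by rewrite ge_min lexx orbT.
  by rewrite le_min lexx andbT; lra.
rewrite big_ord_recr/=; have : N%:R + 1 = N.+1%:R :> R := natr1 _; move: h1 h2; set S := \sum_(k < N) _ => h1 h2 E.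
rewrite -E; move: h1 h2; case: (ltP N%:R y) => hy.
  move=> h1; rewrite le_min => /andP[h2 h3]; apply/andP; split.
    by rewrite ge_min; apply/orP; right; rewrite lerD2r.
  by rewrite le_min; apply/andP; split; rewrite ?mulr1n; lra.
move=> h1; rewrite le_min => /andP[h2 h3]; rewrite addr0; apply/andP; split.
  by rewrite ge_min h1.
by rewrite le_min h2; lra.
Qed.
End count.

Section layer.
Context {R : realType} (n : nat).
Local Notation V := ('rV[R]_(1 + n)).
Local Notation H := (@hspace R n).

(** An inequality between two measures on sets, up to an additive constant M,
    passes to integrals of functions with values in [0, 1] with the same M:
    psi is an average of the indicators of its superlevel sets, up to 1/N. *)
Lemma le_integral_layer d (T : measurableType d) (a b : {measure set T -> \bar R}) (D K : set T) (psi : T -> R) (M : R) :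
  measurable D -> measurable K -> K `<=` D -> (b K < +oo)%E -> 0 <= M ->
  measurable_fun D psi -> (forall z, 0 <= psi z <= 1) -> (forall z, psi z != 0 -> K z) ->
  (forall A, measurable A -> A `<=` K -> (a A <= b A + M%:E)%E) ->
  (\int[a]_(z in D) (psi z)%:E <= \int[b]_(z in D) (psi z)%:E + M%:E)%E.
Proof.
move=> mD mK KD bK M0 mpsi p01 pK ab.
have intK (m : {measure set T -> \bar R}) : (\int[m]_(z in D) (psi z)%:E = \int[m]_(z in K) (psi z)%:E)%E.
  rewrite -[in RHS](setIidr KD) integral_mkcondr; apply: eq_integral => z _.
  by rewrite patchE; case: ifPn => //; rewrite notin_setE => h; congr EFin; apply/eqP/negPn/negP => /pK.
rewrite !intK.
have mpsiK : measurable_fun K psi by exact: measurable_funS mpsi.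
pose A (N k : nat) := K `&` [set z | k%:R < N%:R * psi z].
have mA N k : measurable (A N k).
  have : measurable_fun K (fun z => N%:R * psi z) by apply: measurable_funM.
  move=> /(_ mK _ (measurable_itv `]k%:R, +oo[)).
  by rewrite (_ : K `&` _ = A N k)//; apply/seteqP; split => z /=; rewrite in_itv/= andbT.
have AE N k z : K z -> (z \in A N k) = (k%:R < N%:R * psi z).
  by move=> Kz; apply/idP/idP; rewrite inE /A /=; [case|split].
have mI N k : measurable_fun K (fun z => (k%:R < N%:R * psi z)%R%:R : R).
  apply: (@eq_measurable_fun _ _ _ _ K (\1_(A N k) : T -> R)); last exact: measurable_indic.
  move=> z; rewrite inE => Kz; rewrite indicE AE//.
have key N : (0 < N)%N -> (N%:R%:E * \int[a]_(z in K) (psi z)%:E <= N%:R%:E * (\int[b]_(z in K) (psi z)%:E + M%:E) + b K)%E.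
  move=> N0.
  have p0 z : (0 <= (psi z)%:E)%E by rewrite lee_fin; case/andP: (p01 z).
  have E (m : {measure set T -> \bar R}) : (\sum_(k < N) m (A N k) = \int[m]_(z in K) (\sum_(k < N) (k%:R < N%:R * psi z)%R%:R)%:E)%E.
    under [RHS]eq_integral do rewrite -sumEFin.
    rewrite ge0_integral_sum//; last by move=> k; apply/measurable_EFinP; exact: mI.
    apply: eq_bigr => k _.
    transitivity (\int[m]_(z in K) (\1_(A N k) z)%:E)%E.
      by rewrite integral_indic// setIidl// => z [].
    by apply: eq_integral => z; rewrite inE => Kz; rewrite indicE AE.
  apply: (@le_trans _ _ (\sum_(k < N) a (A N k))%E).
    rewrite E -ge0_integralZl//; last by apply/measurable_EFinP.
    apply: ge0_le_integral => //.
    - by move=> z _; rewrite -EFinM lee_fin mulr_ge0//; case/andP: (p01 z).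
    - by apply/measurable_EFinP; apply: measurable_funM.
    - by apply/measurable_EFinP; apply: measurable_sum => k; exact: mI.
    - move=> z _; rewrite -EFinM lee_fin.
      have Np : 0 <= N%:R * psi z by rewrite mulr_ge0//; case/andP: (p01 z).
      have /andP[h _] := count_lt N Np; apply: le_trans h; rewrite min_l//.
      by rewrite ler_piMr//; case/andP: (p01 z).
  apply: (@le_trans _ _ (\sum_(k < N) (b (A N k) + M%:E))%E).
    by apply: lee_sum => k _; apply: ab => //; move=> z [].
  rewrite big_split/= E sumEFin sumr_const card_ord.
  have -> : (M *+ N)%:E = (N%:R%:E * M%:E)%E by rewrite -EFinM mulr_natl.
  rewrite muleDr//; last by rewrite ge0_adde_def// inE ?lee_fin// integral_ge0.
  rewrite [leRHS]addeAC leeD2r//.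
  rewrite -ge0_integralZl//; last by apply/measurable_EFinP.
  rewrite -[X in (_ + X)%E]mul1e -integral_cst// -ge0_integralD//; last 2 first.
  - by move=> z _; rewrite mule_ge0.
  - by apply/measurable_EFinP; apply: measurable_funM.
  apply: ge0_le_integral => //.
  - by move=> z _; rewrite lee_fin sumr_ge0.
  - by apply/measurable_EFinP; apply: measurable_sum => k; exact: mI.
  - by apply: emeasurable_funD => //; apply/measurable_EFinP; apply: measurable_funM.
  - move=> z _; rewrite -EFinM -EFinD lee_fin.
    have Np : 0 <= N%:R * psi z by rewrite mulr_ge0//; case/andP: (p01 z).
    by have /andP[_ h] := count_lt N Np; apply: (le_trans h); rewrite ge_min lexx.
have b0 : (0 <= \int[b]_(z in K) (psi z)%:E)%E.
  by apply: integral_ge0 => z _; rewrite lee_fin; case/andP: (p01 z).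
apply/lee_addgt0Pr => e e0.
case: (\int[b]_(z in K) (psi z)%:E)%E b0 key => [x|//|//] x0 key; last by rewrite !addye// leey.
pose N := (Num.truncn (fine (b K) / e)).+1.
have := key N isT.
have bfin : b K = (fine (b K))%:E by rewrite fineK// ge0_fin_numE.
rewrite bfin.
case: (\int[a]_(z in K) (psi z)%:E)%E => [y| |]; last by rewrite leNye.
  rewrite -[leLHS]/((N%:R * y)%:E) -[leRHS]/((N%:R * (x + M) + fine (b K))%:E) lee_fin => h.
  rewrite -[leRHS]/((x + M + e)%:E) lee_fin.
  have h2 : fine (b K) < N%:R * e by rewrite -ltr_pdivrMr//; exact: truncnS_gt.
  have : N%:R * y <= N%:R * (x + M + e) by rewrite mulrDr; lra.
  by rewrite ler_pM2l.
by rewrite gt0_muley ?lte_fin ?ltr0Sn// leye_eq.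
Qed.

(** The positive part of a component exceeds the negative part on any subset of
    K by at most the total variation of K, and the layer-cake comparison
    carries this over to integrals. *)
Lemma vm_integral_le (nu : vector_measure (R:=R) n) i K (psi : V -> R) :
  vm_locally_finite nu -> compact K -> K `<=` H -> measurable_fun H psi ->
  (forall z, 0 <= psi z <= 1) -> (forall z, psi z != 0 -> K z) ->
  `|vm_integral nu i psi| <= fine (vm_total_variation nu K).
Proof.
move=> lf cK KH mpsi p01 pK.
have mK := compact_measurable_rV cK.
have cinK A : A `<=` K -> compactly_in A by move=> AK; exists K.
have tvfin A : measurable A -> A `<=` K -> vm_total_variation nu A \is a fin_num.
  move=> mA AK; rewrite ge0_fin_numE; first by apply: tv_compactly_lty => //; exact: cinK.
  by apply: tv_ge0 => //; exact: subset_trans KH.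
have fin1 (m : {measure set V -> \bar R}) : locally_finite m -> forall A, measurable A -> A `<=` K -> m A \is a fin_num.
  move=> lfm A mA AK; rewrite ge0_fin_numE//; apply: le_lt_trans (lfm K cK KH).
  by apply: le_measure => //; rewrite inE.
set T := fine _.
have T0 : 0 <= T by rewrite fine_ge0// tv_ge0.
have ab A : measurable A -> A `<=` K -> `|fine ((nu i).1 A) - fine ((nu i).2 A)| <= T.
  move=> mA AK; have := coord_le_enorm (vm_val nu A) i; rewrite mxE => h; apply: (le_trans h).
  rewrite -lee_fin (le_trans (enorm_le_tv _ mA (cinK _ AK)))//.
  rewrite /T fineK ?tvfin//; exact: le_tv.
have int_fin (m : {measure set V -> \bar R}) : locally_finite m -> (\int[m]_(z in H) (psi z)%:E)%E \is a fin_num.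
  move=> lfm; rewrite ge0_fin_numE; last by apply: integral_ge0 => z _; rewrite lee_fin; case/andP: (p01 z).
  have E : (\int[m]_(z in H) (psi z)%:E = \int[m]_(z in K) (psi z)%:E)%E.
    rewrite -[in RHS](setIidr KH) integral_mkcondr; apply: eq_integral => z _.
    by rewrite patchE; case: ifPn => //; rewrite notin_setE => h; congr EFin; apply/eqP/negPn/negP => /pK.
  rewrite E; apply: (@le_lt_trans _ _ (\int[m]_(z in K) (cst 1 z))%E).
    apply: ge0_le_integral => //.
    - by move=> z _; rewrite lee_fin; case/andP: (p01 z).
    - by apply/measurable_EFinP; exact: (measurable_funS (@measurable_hspace R n) KH mpsi).
    - by move=> z _; rewrite lee_fin; case/andP: (p01 z).
  by rewrite integral_cst// mul1e -ge0_fin_numE// fin1.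
have [l1 l2] := lf i.
have le1 A : measurable A -> A `<=` K -> ((nu i).1 A <= (nu i).2 A + T%:E)%E.
  move=> mA AK; rewrite -(fineK (fin1 _ l1 _ mA AK)) -(fineK (fin1 _ l2 _ mA AK)) -EFinD lee_fin.
  by have := ab A mA AK; rewrite ler_norml => /andP[]; lra.
have le2 A : measurable A -> A `<=` K -> ((nu i).2 A <= (nu i).1 A + T%:E)%E.
  move=> mA AK; rewrite -(fineK (fin1 _ l1 _ mA AK)) -(fineK (fin1 _ l2 _ mA AK)) -EFinD lee_fin.
  by have := ab A mA AK; rewrite ler_norml => /andP[]; lra.
have mH := @measurable_hspace R n.
have i1 := le_integral_layer mH mK KH (l2 K cK KH) T0 mpsi p01 pK le1.
have i2 := le_integral_layer mH mK KH (l1 K cK KH) T0 mpsi p01 pK le2.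
move: i1 i2; rewrite /vm_integral /Rintegral.
rewrite -(fineK (int_fin _ l1)) -(fineK (int_fin _ l2)) -!EFinD !lee_fin ler_norml /= => i1 i2.
by apply/andP; split; lra.
Qed.
End layer.

(** * The Poincare inequality on boxes *)

Section deriv_shift.
Context {R : realType} (n : nat).
Local Notation V := ('rV[R]_(1 + n)).
Local Notation mu := (lebesgue_rV (1 + n)).
Local Notation H := (@hspace R n).
Implicit Types (psi U : V -> R) (z h : V) (K : set V).

Lemma support_open_derive0 psi K v z : compact K -> (forall z, psi z != 0 -> K z) -> ~ K z -> 'D_v psi z = 0.
Proof.
move=> cK pK nK; have oK : open (~` K).
  by apply: closed_openC; apply: compact_closed => //; exact: norm_hausdorff.
have E : {near z, psi =1 cst 0}.
  near=> w; have nKw : (~` K) w by near: w; exact: open_nbhs_nbhs.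
  by apply/eqP/negPn/negP => /pK.
by rewrite (near_eq_derive _ E); exact: derive_cst.
Unshelve. all: by end_near. Qed.

Lemma compact_support_bounded (g : V -> R) K : continuous g -> compact K ->
  (forall z, ~ K z -> g z = 0) -> exists2 M, 0 <= M & forall z, `|g z| <= M.
Proof.
move=> cg cK gK.
have /compact_bounded[M [Mr MP]] : compact (g @` K).
  by apply: continuous_compact => //; exact: continuous_subspaceT.
exists (`|M| + 1) => [|z]; first by rewrite addr_ge0.
have [Kz|nK] := pselect (K z); last by rewrite gK// normr0 addr_ge0.
by apply: (MP (`|M| + 1)); [rewrite ltr_pwDr// ler_norm|exists z].
Qed.

Lemma is_derive_line psi h z (s : R) : C1_on setT psi ->
  is_derive s 1 (fun s : R => psi (z - s *: h)) (- 'D_h psi (z - s *: h)).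
Proof.
move=> hpsi; have [dpsi _] := hpsi (z - s *: h) I.
have E : (fun t : R => t^-1 *: (((fun s : R => psi (z - s *: h)) \o shift s) (t *: 1) - psi (z - s *: h))) =
    (fun t : R => t^-1 *: ((psi \o shift (z - s *: h)) (t *: - h) - psi (z - s *: h))).
  apply/funext => t /=; congr (_ *: (psi _ - _)).
  have -> : t *: (1 : R) = t by rewrite /GRing.scale/= mulr1.
  by rewrite scalerDl scalerN opprD addrCA.
apply: DeriveDef.
  by rewrite /derivable E; exact: (@diff_derivable _ _ _ psi (z - s *: h) (- h)).
have -> : - 'D_h psi (z - s *: h) = 'D_(- h) psi (z - s *: h).
  by rewrite (deriveE _ dpsi) (deriveE _ dpsi) linearN.
by rewrite /derive E.
Qed.

Lemma measurable_fun_shift d (T : measurableType d) (f : V -> T) h :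
  measT f -> measT (fun z => f (z + h)).
Proof. by move=> mf; apply: measurableT_comp mf _; exact: measurable_shift. Qed.

(** The difference quotients are dominated by the bounded derivative of psi, so
    differentiation under the integral is dominated convergence. *)
Lemma derive_shift_integral U psi h K (s : R) :
  mu.-integrable setT (EFin \o U) -> C1_on setT psi -> compact K -> (forall z, psi z != 0 -> K z) ->
  is_derive s 1 (fun s : R => \int[mu]_z (U z * psi (z - s *: h)))
    (- \int[mu]_z (U z * 'D_h psi (z - s *: h))).
Proof.
move=> iU hpsi cK pK.
have mU : measT U by apply/measurable_EFinP; case/integrableP : iU.
have cpsi : continuous psi by move=> z; exact: C1_on_cont hpsi I.
have cD : continuous ('D_h psi) by move=> z; case: (hpsi z I) => _; exact.
have mpsi : measT psi by apply: (C1_measurable openT).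
have mD : measT ('D_h psi).
  by apply: open_continuous_measurable_rV; [exact: openT|move=> z _; exact: cD].
have pK0 z : ~ K z -> psi z = 0 by move=> nK; apply/eqP/negPn/negP => /pK.
have [M M0 hM] := compact_support_bounded cpsi cK pK0.
have [M' M'0 hM'] := compact_support_bounded cD cK (fun z => @support_open_derive0 _ _ _ _ cK pK).
pose f (s : R) z := U z * psi (z - s *: h).
have bint (g : V -> R) B : measT g -> 0 <= B -> (forall z, `|g z| <= B) ->
    mu.-integrable setT (EFin \o (fun z => U z * g z)).
  move=> mg B0 hB; apply: (@le_integrable _ _ _ mu setT measurableT _ (EFin \o (fun z => U z * B))).
  - by apply/measurable_EFinP; exact: measurable_funM.
  - by move=> z _; rewrite /= lee_fin !normrM ler_wpM2l// (le_trans (hB z))// ler_norm.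
  - have -> : EFin \o (fun z => U z * B) = (fun z => (U z)%:E * B%:E)%E by apply/funext => z; rewrite /= EFinM.
    exact: integrableZr.
have d1 z (t : R) := is_derive_line h z t hpsi.
have d2 z (t : R) : is_derive t 1 (f ^~ z) (U z * - 'D_h psi (z - t *: h)).
  exact: (@is_deriveZ _ _ _ _ (U z) _ _ _ (d1 z t)).
have E t z : partial1of2 f t z = U z * - 'D_h psi (z - t *: h).
  by rewrite partial1of2E; have := d2 z t => ?; rewrite derive_val.
have sI : (s - 1 < s < s + 1) by apply/andP; split; lra.
have Is : `]s - 1, s + 1[%classic s by rewrite /= in_itv.
have h1 (x : R) : `]s - 1, s + 1[%classic x -> mu.-integrable setT (EFin \o f x).
  move=> _; apply: (bint (fun z => psi (z - x *: h)) M) => //.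
  exact: measurable_fun_shift.
have h2 (x : R) z : `]s - 1, s + 1[%classic x -> setT z -> derivable (f ^~ z) x 1.
  by move=> _ _; have := d2 z x => ?; exact: ex_derive.
pose G z := `|U z| * M'.
have h3 z : 0 <= G z by rewrite mulr_ge0.
have h4 : mu.-integrable setT (EFin \o G).
  have -> : EFin \o G = (fun z => `|U z|%:E * M'%:E)%E by apply/funext => z; rewrite /= EFinM.
  by apply: integrableZr => //; exact: integrable_norm.
have h5 (x : R) z : `]s - 1, s + 1[%classic x -> setT z -> `|partial1of2 f x z| <= G z.
  by move=> _ _; rewrite E normrM normrN ler_wpM2l.
have r1 := differentiation_under_integral measurableT Is h1 h2 h3 h4 h5.
have r2 := derivable_under_integral measurableT Is h1 h2 h3 h4 h5.
apply: DeriveDef; first exact: r2.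
rewrite -derive1E r1 -[RHS]mulN1r -RintegralZl//; last first.
  apply: (bint (fun z => 'D_h psi (z - s *: h)) M') => //; exact: (measurable_fun_shift (- (s *: h)) mD).
by apply: eq_Rintegral => z _; rewrite E mulN1r mulrN.
Qed.
End deriv_shift.

Section Rintegral_sum.
Context d (T : measurableType d) (R : realType) (m : {measure set T -> \bar R}) (D : set T).
Hypothesis mD : measurable D.

Lemma integrable_mulc (c : R) (f : T -> R) : m.-integrable D (EFin \o f) ->
  m.-integrable D (EFin \o (fun z => c * f z)).
Proof.
move=> h; have -> : EFin \o (fun z => c * f z) = (fun z => c%:E * (f z)%:E)%E by apply/funext => z; rewrite /= EFinM.
exact: integrableZl.
Qed.

Lemma integrable_sumR (I : Type) (s : seq I) (f : I -> T -> R) :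
  (forall i, m.-integrable D (EFin \o f i)) -> m.-integrable D (EFin \o (fun z => \sum_(i <- s) f i z)).
Proof.
move=> h; elim: s => [|i s IH].
  rewrite (_ : _ \o _ = cst 0%E); first exact: integrable0.
  by apply/funext => z /=; rewrite big_nil.
rewrite (_ : _ \o _ = ((EFin \o f i) \+ (EFin \o (fun z => (\sum_(i <- s) f i z)%R)))%E); first exact: integrableD.
by apply/funext => z /=; rewrite big_cons EFinD.
Qed.

Lemma Rintegral_sum (I : Type) (s : seq I) (f : I -> T -> R) :
  (forall i, m.-integrable D (EFin \o f i)) ->
  \int[m]_(z in D) (\sum_(i <- s) f i z) = \sum_(i <- s) \int[m]_(z in D) f i z.
Proof.
move=> h; elim: s => [|i s IH].
  rewrite big_nil; under eq_Rintegral do rewrite big_nil.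
  by rewrite /Rintegral integral0.
rewrite big_cons -IH -RintegralD//; last exact: integrable_sumR.
by apply: eq_Rintegral => z _; rewrite big_cons.
Qed.
End Rintegral_sum.

Section translation.
Context {R : realType} (n : nat).
Local Notation V := ('rV[R]_(1 + n)).
Local Notation mu := (lebesgue_rV (1 + n)).
Local Notation H := (@hspace R n).
Implicit Types (u psi U : V -> R) (z h : V) (K W : set V).

Lemma derive_sum_coord psi z h : differentiable psi z ->
  'D_h psi z = \sum_i h ord0 i * 'D_(delta_mx ord0 i) psi z.
Proof.
move=> d; rewrite deriveE// [in LHS](row_sum_delta h) linear_sum/=; apply: eq_bigr => i _.
by rewrite linearZ/= deriveE.
Qed.

Lemma continuous_shift h : continuous (fun z : V => z + h).
Proof. by move=> z; exact: (@cvgD _ _ _ (nbhs z) _ id (cst h) z h cvg_id (cvg_cst _)). Qed.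

Lemma C1_shift psi h : C1_on setT psi -> C1_on setT (fun z => psi (z + h)) /\
  forall v z, 'D_v (fun z => psi (z + h)) z = 'D_v psi (z + h).
Proof.
move=> hpsi.
have E v z : 'D_v (fun z => psi (z + h)) z = 'D_v psi (z + h).
  by rewrite /derive/=; under eq_fun do rewrite -addrA.
have d z : differentiable (fun z => psi (z + h)) z.
  apply: (@differentiable_comp _ _ _ _ (fun z => z + h) psi); last by case: (hpsi (z + h) I).
  by apply: differentiableD; [exact: ex_diff|exact: differentiable_cst].
split => // z _; split => // v.
rewrite (funext (E v)).
have c : {for z + h, continuous ('D_v psi)} by case: (hpsi (z + h) I) => _; exact.
exact: (continuous_comp (@continuous_shift h z) c).
Qed.

Lemma L1loc_patch u K : L1loc u -> compact K -> K `<=` H -> mu.-integrable setT (EFin \o (u \_ K)).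
Proof.
move=> [mu_ iu] cK KH; have := iu K cK KH.
rewrite (integrable_mkcond _ (compact_measurable_rV cK)).
by congr (_.-integrable _ _); apply/funext => z; rewrite /= !patchE; case: ifP.
Qed.

(** For psi approximating the indicator of W, the s-derivative of the integral
    of u psi(z - s h) is, by definition of the gradient, the integral of the
    test function psi(. - s h) against h . grad u, hence bounded by the total
    variation; the mean value theorem on [0, 1] concludes. *)
Lemma translation_estimate u nu K W h : L1loc u -> is_gradient u nu -> compact K -> K `<=` H -> open W ->
  (forall (s : R) z, 0 <= s <= 1 -> W z -> K (z + s *: h)) ->
  `|\int[mu]_(z in W) ((u \_ K) (z + h) - (u \_ K) z)| <=
   (\sum_i `|h ord0 i|) * fine (vm_total_variation nu K).
Proof.
move=> iu [lf gu] cK KH oW WK.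
have mK := compact_measurable_rV cK.
have mW := open_measurable_rV oW.
set U := u \_ K; have iU : mu.-integrable setT (EFin \o U) by exact: L1loc_patch.
have mU : measT U by apply/measurable_EFinP; case/integrableP : iU.
set T := fine _.
have iUh : mu.-integrable setT (EFin \o (fun z => U (z + h))).
  apply/integrableP; split; first by apply/measurable_EFinP; exact: measurable_fun_shift.
  have /integrableP[_] := iU.
  rewrite -(@ge0_integral_shift _ _ h (fun z => `|(EFin \o U) z|)%E)//.
  by apply: measurableT_comp => //; apply/measurable_EFinP.
have WsubK : W `<=` K by move=> z Wz; rewrite -[z]addr0 -(scale0r h); apply: WK => //; rewrite lexx ler01.
have [psi [p1 p2 p3 p4]] := open_approx oW.
have mpsi k : measT (psi k) by exact: (C1_measurable openT (p1 k)).
have p3' k z : ~ W z -> psi k z = 0.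
  by move=> nW; have [L [_ LW hL]] := p3 k; apply/eqP/negPn/negP => /hL /LW.
have key k : `|\int[mu]_z (U z * psi k (z - h)) - \int[mu]_z (U z * psi k z)| <= (\sum_i `|h ord0 i|) * T.
  have [L [cL LW pL]] := p3 k.
  pose F (s : R) := \int[mu]_z (U z * psi k (z - s *: h)).
  have dF s := derive_shift_integral h s iU (p1 k) cL pL.
  pose dFs (s : R) := - \int[mu]_z (U z * 'D_h (psi k) (z - s *: h)).
  have bound (s : R) : 0 <= s <= 1 -> `|dFs s| <= (\sum_i `|h ord0 i|) * T.
    move=> s01; pose ps z := psi k (z - s *: h).
    have [C1ps Dps] := C1_shift (- (s *: h)) (p1 k).
    have psK z : ps z != 0 -> K z.
      move=> /pL /LW Wz; rewrite -[z](subrK (s *: h)); exact: WK.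
    have tps : test_function ps.
      split => //; exists K; split => //; exact: psK.
    have cps z : differentiable ps z by case: (C1ps z I).
    have -> : dFs s = \sum_i (h ord0 i * vm_integral nu i ps).
      rewrite /dFs.
      have -> : \int[mu]_z (U z * 'D_h (psi k) (z - s *: h)) = \int[mu]_(z in K) (\sum_i h ord0 i * (u z * 'D_(delta_mx ord0 i) ps z)).
        rewrite [RHS]Rintegral_mkcond; apply: eq_Rintegral => z _; rewrite /U !patchE.
        case: ifP => _; last by rewrite mul0r.
        rewrite -Dps -/ps derive_sum_coord// mulr_sumr; apply: eq_bigr => i _; ring.
      have iD i : mu.-integrable K (EFin \o (fun z => u z * 'D_(delta_mx ord0 i) ps z)).
        have cD : continuous ('D_(delta_mx ord0 i) ps) by move=> z; case: (C1ps z I) => _; exact.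
        have [M M0 hM] := compact_support_bounded cD cK (fun z => @support_open_derive0 _ _ ps K _ _ cK psK).
        apply: (@le_integrable _ _ _ mu K mK _ (fun z => (u z)%:E * M%:E)%E).
        - apply/measurable_EFinP; apply: measurable_funM.
            by apply/measurable_EFinP; case/integrableP : (iu.2 K cK KH).
          apply: measurable_funTS; apply: open_continuous_measurable_rV; first exact: openT.
          by move=> z _; exact: cD.
        - by move=> z _; rewrite /= lee_fin !normrM ler_wpM2l// (le_trans (hM z))// ler_norm.
        - by apply: integrableZr => //; exact: iu.2.
      rewrite Rintegral_sum//; last by move=> i; apply: integrable_mulc.
      rewrite -sumrN; apply: eq_bigr => i _.
      rewrite RintegralZl// -mulrN; congr (_ * _).
      rewrite -[RHS]opprK -gu//; congr (- _).
      rewrite -[in LHS](setIidr KH) Rintegral_mkcondr; apply: eq_Rintegral => z _.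
      rewrite patchE; case: ifPn => //; rewrite notin_setE => nK.
      by rewrite (support_open_derive0 _ cK psK)// mulr0.
    apply: (le_trans (ler_norm_sum _ _ _)); rewrite mulr_suml; apply: ler_sum => i _.
    rewrite normrM ler_wpM2l//; apply: vm_integral_le => //.
    - by apply: measurable_funTS; exact: (C1_measurable openT C1ps).
    - by move=> z; exact: p2.
  have cF : {within `[0, 1], continuous F}.
    apply: continuous_subspaceT => s; apply: differentiable_continuous; apply/derivable1_diffP.
    by have := dF s => ?; exact: ex_derive.
  have [c c01 Fc] := @MVT R F dFs 0 1 ltr01 (fun s _ => dF s) cF.
  have -> : \int[mu]_z (U z * psi k (z - h)) = F 1 by rewrite /F; under [RHS]eq_Rintegral do rewrite scale1r.
  have -> : \int[mu]_z (U z * psi k z) = F 0 by rewrite /F; under [RHS]eq_Rintegral do rewrite scale0r subr0.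
  rewrite Fc subr0 mulr1; apply: bound.
  by move: c01; rewrite in_itv/= => /andP[h1 h2]; rewrite !ltW.
have E k : \int[mu]_z (U z * psi k (z - h)) = \int[mu]_z (U (z + h) * psi k z).
  rewrite /Rintegral; congr fine.
  rewrite -(@integral_shift _ _ h (fun z => (U z * psi k (z - h))%:E)).
    by apply: eq_integral => z _; rewrite addrK.
  apply/measurable_EFinP; apply: measurable_funM => //.
  exact: (measurable_fun_shift (- h) (mpsi k)).
have iW f : mu.-integrable setT f -> mu.-integrable W f by apply: integrableS.
have c1 := cvg_Rintegral_approx measurableT mW (@subsetT _ W) (iW _ iUh) mpsi p2 p3' p4.
have c2 := cvg_Rintegral_approx measurableT mW (@subsetT _ W) (iW _ iU) mpsi p2 p3' p4.
rewrite RintegralB//; [|exact: iW|exact: iW].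
have c3 := cvg_norm (cvgB c1 c2).
rewrite -(cvg_lim (@Rhausdorff R) (c3 _ _)); apply: limr_le; first by apply/cvg_ex; eexists; exact: (c3 _ _).
apply: nearW => k.
by have := key k; rewrite E.
Qed.
End translation.

Section poincare.
Context {R : realType} (n : nat).
Local Notation V := ('rV[R]_(1 + n)).
Local Notation mu := (lebesgue_rV (1 + n)).
Local Notation H := (@hspace R n).

(** The left side is the double integral of u(z) - u(w) over W x W'.  Writing
    z = w + h and integrating first in w, each slice is a difference of
    translates and is bounded by [translation_estimate]; only translations h
    not exceeding the side lengths contribute. *)
Lemma poincare_box (u : V -> R) nu (a b : V) (W W' : set V) : L1loc u -> is_gradient u nu ->
  (forall i, a ord0 i < b ord0 i) -> cbox a b `<=` H ->
  open W -> open W' -> W `<=` cbox a b -> W' `<=` cbox a b ->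
  `|fine (mu W') * \int[mu]_(z in W) u z - fine (mu W) * \int[mu]_(z in W') u z| <=
  (\prod_i (4 * (b ord0 i - a ord0 i))) * ((\sum_i (b ord0 i - a ord0 i)) * fine (vm_total_variation nu (cbox a b))).
Proof.
move=> iu gu ab KH oW oW' WK W'K.
set K := cbox a b; have cK : compact K by exact: compact_cbox.
have mK := compact_measurable_rV cK.
have mW := open_measurable_rV oW; have mW' := open_measurable_rV oW'.
set U := u \_ K; have iU : mu.-integrable setT (EFin \o U) by exact: L1loc_patch.
have mU : measT U by apply/measurable_EFinP; case/integrableP : iU.
set B := (\sum_i _) * _.
have lf := gu.1.
have T0 : 0 <= fine (vm_total_variation nu K) by rewrite fine_ge0// tv_ge0.
have B0 : 0 <= B by rewrite mulr_ge0// sumr_ge0// => i _; rewrite subr_ge0 ltW.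
have Wfin A : measurable A -> A `<=` K -> mu A \is a fin_num.
  move=> mA AK; rewrite ge0_fin_numE//; apply: le_lt_trans (lebesgue_compact_fin cK).
  by apply: le_measure => //; rewrite inE.
have fW := Wfin W mW WK; have fW' := Wfin W' mW' W'K.
have UE A : A `<=` K -> \int[mu]_(z in A) U z = \int[mu]_(z in A) u z.
  by move=> AK; apply: eq_Rintegral => z; rewrite inE => /AK Kz; rewrite /U patchE mem_set.
(* The pair (w, h) stands for the points w in W' and z = h + w in W. *)
pose Phi (p : V * V) : R := \1_W' p.1 * (\1_W (p.2 + p.1) * (U (p.2 + p.1) - U p.1)).
have mi1 (A : set V) : measurable A -> measT (\1_A : V -> R) by exact: measurable_indic.
have mPhi : measT Phi.
  have ms : measT (fun p : V * V => p.2 + p.1).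
    rewrite (_ : (fun p => _) = (fun p : V * V => p.1 + p.2)); last by apply/funext => p; rewrite addrC.
    exact: shift_measurable_prod.
  apply: measurable_funM; first by apply: measurableT_comp measurable_fst; exact: mi1.
  apply: measurable_funM; first by apply: measurableT_comp ms; exact: mi1.
  apply: measurable_funB; first exact: measurableT_comp ms.
  exact: measurableT_comp measurable_fst.
have mPhi1 w : measT (fun h => Phi (w, h)) by exact: measurableT_comp mPhi (pair1_measurable w).
have mPhi2 h : measT (fun w => Phi (w, h)) by exact: measurableT_comp mPhi (pair2_measurable h).
have iUW : mu.-integrable W (EFin \o U) by exact: integrableS iU.
have iUW' : mu.-integrable W' (EFin \o U) by exact: integrableS iU.
have icW c : mu.-integrable W (EFin \o (fun=> c : R)).
  apply: measurable_bounded_integrable => //; first by rewrite -ge0_fin_numE.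
  exact: bounded_cst.
have shiftE (g : V -> \bar R) w : measT g -> (\int[mu]_h g (h + w)%R = \int[mu]_z g z)%E.
  exact: integral_shift.
have inner w : (\int[mu]_h (Phi (w, h))%:E = (\1_W' w * (\int[mu]_(z in W) U z - U w * fine (mu W)))%:E)%E.
  rewrite /Phi/= (shiftE (fun z => (\1_W' w * (\1_W z * (U z - U w)))%:E)%R); last first.
    apply/measurable_EFinP; apply: measurable_funM => //; apply: measurable_funM; first exact: mi1.
    exact: measurable_funB.
  under eq_integral do rewrite EFinM.
  have iUw : mu.-integrable W (EFin \o (fun z => U z - U w)).
    have := integrableB mW iUW (icW (U w)); exact.
  have E : (\int[mu]_z (\1_W z * (U z - U w))%:E = (\int[mu]_(z in W) (U z - U w))%:E)%E.
    rewrite /Rintegral fineK; last exact: integrable_fin_num.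
    rewrite [RHS]integral_mkcond; apply: eq_integral => z _; rewrite patchE indicE.
    by case: ifP => _; rewrite ?mul1r ?mul0r.
  have i1 : mu.-integrable setT (fun z => (\1_W z * (U z - U w))%:E).
    have := iUw; rewrite (integrable_mkcond _ mW); congr (_.-integrable _ _); apply/funext => z.
    by rewrite /= patchE indicE; case: ifP => _; rewrite ?mul1r ?mul0r.
  rewrite integralZl// E -EFinM RintegralB//; congr (_ * (_ - _))%:E.
  by rewrite Rintegral_cst.
have innerabs w : (\int[mu]_h `|(Phi (w, h))%:E| <= (\1_W' w * (\int[mu]_(z in W) `|U z| + `|U w| * fine (mu W)))%:E)%E.
  have iaW : mu.-integrable W (EFin \o (fun z => `|U z| + `|U w|)).
    have := integrableD mW (integrable_norm iUW) (icW `|U w|); exact.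
  have -> : \int[mu]_(z in W) `|U z| + `|U w| * fine (mu W) = \int[mu]_(z in W) (`|U z| + `|U w|).
    by rewrite RintegralD ?Rintegral_cst//; exact: integrable_norm.
  rewrite EFinM /Rintegral fineK; last exact: integrable_fin_num.
  rewrite [X in (_ <= _ * X)%E]integral_mkcond.
  have m2 : measT ((fun z => (`|U z| + `|U w|)%:E) \_ W).
    by rewrite -(measurable_restrictT _ mW); case/integrableP : iaW.
  have m2p z : (0 <= ((fun z => (`|U z| + `|U w|)%:E) \_ W) z)%E.
    by rewrite patchE; case: ifP => // _; rewrite lee_fin addr_ge0.
  rewrite -ge0_integralZl//.
  rewrite -[X in (_ <= X)%E](shiftE _ w); last by apply: emeasurable_funM => //.
  apply: ge0_le_integral => //.
  - by apply: measurableT_comp => //; apply/measurable_EFinP; exact: mPhi1.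
  - apply: (@measurable_fun_shift R n _ _ (fun z => (\1_W' w)%:E * ((fun z => (`|U z| + `|U w|)%:E) \_ W) z)%E).
    exact: emeasurable_funM.
  - move=> h _; rewrite /Phi/= patchE !indicE.
    case: ifP => _; last by rewrite mul0r mulr0 normr0 mule0.
    rewrite mul1r normrM -EFinM lee_fin ger0_norm// ler_wpM2l//; exact: ler_normB.
have iPhi : (mu \x mu)%E.-integrable setT (EFin \o Phi).
  apply/integrable12ltyP; first by apply/measurable_EFinP.
  apply: (@le_lt_trans _ _ (\int[mu]_w (\1_W' w * (\int[mu]_(z in W) `|U z| + `|U w| * fine (mu W)))%:E)%E).
    apply: ge0_le_integral => //.
    - by move=> w _; exact: integral_ge0.
    - have maP : measT (fun p => `|(EFin \o Phi) p|%E) by apply: measurableT_comp => //; apply/measurable_EFinP.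
      exact: (@measurable_fun_fubini_tonelli_F _ _ _ _ R mu _ maP (fun p => abse_ge0 _)).
    - apply/measurable_EFinP; apply: measurable_funM; first exact: mi1.
      apply: measurable_funD => //; apply: measurable_funM => //; exact: measurableT_comp.
    - by move=> w _; exact: innerabs.
  have -> : (\int[mu]_w (\1_W' w * (\int[mu]_(z in W) `|U z| + `|U w| * fine (mu W)))%:E =
      \int[mu]_(w in W') (\int[mu]_(z in W) `|U z| + `|U w| * fine (mu W))%:E)%E.
    rewrite [RHS]integral_mkcond; apply: eq_integral => w _; rewrite patchE indicE.
    by case: ifP => _; rewrite ?mul1r ?mul0r.
  rewrite -ge0_fin_numE; last first.
    apply: integral_ge0 => w _; rewrite lee_fin addr_ge0// ?mulr_ge0// ?fine_ge0//.
    by apply: integral_ge0 => ? _; rewrite lee_fin.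
  apply: integrable_fin_num => //.
  have := integrableD mW' (_ : mu.-integrable W' (EFin \o (fun=> \int[mu]_(z in W) `|U z|))) (_ : mu.-integrable W' (fun w => (`|U w|)%:E * (fine (mu W))%:E)%E).
  apply.
    apply: measurable_bounded_integrable => //; first by rewrite -ge0_fin_numE.
    exact: bounded_cst.
  apply: integrableZr => //; exact: integrable_norm.
have := Fubini iPhi.
under [X in X = _ -> _]eq_integral do rewrite inner.
have -> : (\int[mu]_w (\1_W' w * (\int[mu]_(z in W) U z - U w * fine (mu W)))%:E =
  (fine (mu W') * \int[mu]_(z in W) u z - fine (mu W) * \int[mu]_(z in W') u z)%:E)%E.
  transitivity (\int[mu]_(w in W') (\int[mu]_(z in W) U z - U w * fine (mu W))%:E)%E.
    rewrite [RHS]integral_mkcond; apply: eq_integral => w _; rewrite patchE indicE.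
    by case: ifP => _; rewrite ?mul1r ?mul0r.
  have j1 : mu.-integrable W' (EFin \o (fun=> \int[mu]_(z in W) U z)).
    apply: measurable_bounded_integrable => //; first by rewrite -ge0_fin_numE.
    exact: bounded_cst.
  have j2 : mu.-integrable W' (EFin \o (fun w => U w * fine (mu W))).
    rewrite (_ : _ \o _ = fun w => (U w)%:E * (fine (mu W))%:E)%E; first exact: integrableZr.
    by apply/funext => w /=; rewrite EFinM.
  have j3 := integrableB mW' j1 j2.
  rewrite -[LHS]fineK; last exact: (integrable_fin_num mW' j3).
  rewrite -/(Rintegral mu W' (fun w => \int[mu]_(z in W) U z - U w * fine (mu W))).
  rewrite RintegralB// Rintegral_cst// RintegralZr// !UE//.
  by congr EFin; rewrite mulrC [X in _ - X]mulrC.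
move=> FE.
rewrite -lee_fin -abse_EFin FE.
(* Translations outside this box move W' away from W. *)
pose cc : V := \row_i (2 * (b ord0 i - a ord0 i)).
pose D := obox (- cc) cc.
have mD : measurable D by exact: measurable_obox.
have slice h : (`|\int[mu]_w (Phi (w, h))%:E| <= B%:E * (\1_D h)%:E)%E.
  pose E := [set w | W' w /\ W (h + w)].
  have oE : open E.
    have -> : E = W' `&` ((fun w => w + h) @^-1` W) by apply/seteqP; split => w /=; rewrite addrC.
    apply: openI => //.
    by apply: open_comp => // w _; exact: continuous_shift.
  have PhiE w : Phi (w, h) = ((fun w => U (w + h) - U w) \_ E) w.
    rewrite /Phi /= patchE !indicE (addrC h).
    have -> : (w \in E) = (w \in W') && (w + h \in W).
      apply/idP/andP; rewrite !inE /E /= addrC; [by case|by move=> [? ?]].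
    by case: (w \in W'); case: (_ \in W); rewrite /= ?mul0r ?mul1r.
  have EK : E `<=` K by move=> w [/W'K].
  have -> : (\int[mu]_w (Phi (w, h))%:E = \int[mu]_(w in E) (U (w + h) - U w)%:E)%E.
    rewrite [RHS]integral_mkcond; apply: eq_integral => w _; rewrite PhiE /= !patchE.
    by case: ifP.
  have mE := open_measurable_rV oE.
  have iUh : mu.-integrable E (EFin \o (fun w => U (w + h) - U w)).
    have iUh : mu.-integrable setT (EFin \o (fun z => U (z + h))).
      apply/integrableP; split; first by apply/measurable_EFinP; exact: measurable_fun_shift.
      have /integrableP[_] := iU.
      rewrite -(@ge0_integral_shift _ _ h (fun z => `|(EFin \o U) z|)%E)//.
      by apply: measurableT_comp => //; apply/measurable_EFinP.
    have h1 : mu.-integrable E (EFin \o (fun z => U (z + h))) by exact: integrableS iUh.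
    have h2 : mu.-integrable E (EFin \o U) by exact: integrableS iU.
    have := integrableB mE h1 h2; exact.
  rewrite -[X in `|X|%E]fineK; last exact: (integrable_fin_num mE iUh).
  rewrite -/(Rintegral mu E (fun w => U (w + h) - U w)) abse_EFin -EFinM lee_fin.
  have [E0|/set0P[w0 [W'w0 Ww0]]] := eqVneq E set0.
    by rewrite E0 Rintegral_set0 normr0 mulr_ge0// indicE ler0n.
  have hb i : `|h ord0 i| <= b ord0 i - a ord0 i.
    have := WK _ Ww0 i; have := W'K _ W'w0 i; rewrite !mxE ler_norml => /andP[? ?] /andP[? ?].
    by apply/andP; split; lra.
  have -> : \1_D h = 1 :> R.
    rewrite indicE mem_set// => i; rewrite !mxE -ltr_norml.
    by apply: (le_lt_trans (hb i)); have := ab i; lra.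
  rewrite mulr1; apply: le_trans (translation_estimate iu gu cK KH oE _) _.
    move=> s w /andP[s0 s1] [W'w Ww] i; have := WK _ Ww i; have := W'K _ W'w i.
    by rewrite !mxE => /andP[? ?] /andP[? ?]; apply/andP; split; nra.
  by rewrite ler_wpM2r//; apply: ler_sum => i _; exact: hb.
have mG : measT (fun h => \int[mu]_w (Phi (w, h))%:E)%E.
  exact: (measurable_fubini_G iPhi).
apply: (le_trans (le_abse_integral _ _ _)) => //.
apply: (@le_trans _ _ (\int[mu]_h (B%:E * (\1_D h)%:E))%E).
  apply: ge0_le_integral => //.
  - exact: measurableT_comp.
  - by apply: emeasurable_funM => //; apply/measurable_EFinP; exact: mi1.
  - by move=> h _; exact: slice.
rewrite ge0_integralZl//; last by apply/measurable_EFinP; exact: mi1.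
have -> : (\int[mu]_h (\1_D h)%:E = (\prod_i Num.max 0 (cc ord0 i - (- cc) ord0 i))%:E)%E.
  by rewrite integral_indic// setIT; exact: lebesgue_obox.
rewrite -EFinM lee_fin mulrC ler_wpM2r//.
apply: ler_prod => i _; rewrite !mxE le_max lexx/= opprK.
rewrite ge_max; have := ab i => abi.
by rewrite mulr_ge0 ?subr_ge0 ?(ltW abi)//=; lra.
Qed.
End poincare.

(** * Garsia and Doob inequalities for nested partitions *)

Section powR_ineq.
Context {R : realType}.
Implicit Types (a b s c p : R) (C : \bar R).

(** The tangent inequality for the convex function x^p. *)
Lemma powR_convex a b p : 0 <= a -> a <= b -> 1 < p -> b `^ p - a `^ p <= p * ((b - a) * b `^ (p - 1)).
Proof.
move=> a0 ab p1; have p0 : 0 < p by apply: lt_trans p1.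
have b0 : 0 <= b by exact: le_trans ab.
pose q := p / (p - 1).
have pm1 : 0 < p - 1 by rewrite subr_gt0.
have q0 : 0 < q by rewrite divr_gt0.
have pq : p^-1 + q^-1 = 1 by rewrite /q invf_div; field; rewrite !gt_eqF.
have := conjugate_powR a0 (powR_ge0 b (p - 1)) p0 q0 pq.
have -> : (b `^ (p - 1)) `^ q = b `^ p.
  by rewrite -powRrM /q mulrCA divff ?gt_eqF// mulr1.
have -> : b `^ p / q = b `^ p * (1 - p^-1) by congr (_ * _); rewrite -pq; ring.
have E : b * b `^ (p - 1) = b `^ p by rewrite mulr_powRB1.
move=> h; have {}h : p * (a * b `^ (p - 1)) <= a `^ p + b `^ p * (p - 1).
  rewrite -(ler_pM2l p0) in h; apply: (le_trans h).
  by rewrite le_eqVlt; apply/orP; left; apply/eqP; field; rewrite gt_eqF.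
by rewrite mulrBl E mulrBr; lra.
Qed.

(** A pointwise Young inequality whose first term can be absorbed into the left
    side of the Garsia estimate; C may be infinite. *)
Lemma young_absorb s C p k : 0 <= s -> (0 <= C)%E -> 1 < p -> 0 < k ->
  (k%:E * (C * (s `^ (p - 1))%:E) <= (2^-1 * s `^ p)%:E + (k * (2 * k) `^ (p - 1))%:E * C `^ p)%E.
Proof.
move=> s0 C0 p1 k0; have p0 : 0 < p by apply: lt_trans p1.
have pm1 : 0 < p - 1 by rewrite subr_gt0.
have K0 : 0 < k * (2 * k) `^ (p - 1) by rewrite mulr_gt0// powR_gt0// mulr_gt0.
case: C C0 => [c c0|_|//]; last first.
  by rewrite poweRyr ?gt_eqF// gt0_muley ?lte_fin// addey// leey.
rewrite lee_fin in c0.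
rewrite poweR_EFin -!EFinM -EFinD lee_fin.
have [h|h] := leP (2 * k * c) s.
  apply: (@le_trans _ _ (2^-1 * s `^ p)); last by rewrite lerDl mulr_ge0 ?powR_ge0// ltW.
  rewrite -(mulr_powRB1 s0 p0) mulrA [leRHS]mulrA ler_wpM2r ?powR_ge0//; lra.
apply: (@le_trans _ _ (k * (2 * k) `^ (p - 1) * c `^ p)); last by rewrite lerDr mulr_ge0// powR_ge0.
rewrite -(mulr_powRB1 c0 p0).
rewrite -mulrA ler_pM2l// mulrCA ler_wpM2l// -powRM//; last by rewrite mulr_ge0// ltW.
by apply: ge0_ler_powR; rewrite ?nnegrE ?(ltW pm1)// ?mulr_ge0//; exact: ltW.
Qed.

(** Convexity bounds the increments of T^p by p s_j T_(j+1)^(p-1), and Abel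
    summation moves the difference onto T^(p-1), leaving tails of the sum. *)
Lemma sum_abel (s T : nat -> R) (p : R) (L : nat) : 1 < p -> (forall k, 0 <= s k) ->
  (forall k, T k = \sum_(j < k) s j) ->
  T L `^ p <= p * \sum_(k < L) ((T k.+1 `^ (p - 1) - T k `^ (p - 1)) * \sum_(k <= j < L) s j).
Proof.
move=> p1 s0 TE; have p0 : 0 < p by apply: lt_trans p1.
have pm1 : 0 < p - 1 by rewrite subr_gt0.
have T0 k : 0 <= T k by rewrite TE; exact: sumr_ge0.
have TS k : T k.+1 = T k + s k by rewrite !TE big_ord_recr.
have -> : \sum_(k < L) ((T k.+1 `^ (p - 1) - T k `^ (p - 1)) * \sum_(k <= j < L) s j) =
    \sum_(j < L) s j * T j.+1 `^ (p - 1).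
  elim: L => [|L IH]; first by rewrite !big_ord0.
  rewrite !big_ord_recr/= -IH big_nat1.
  rewrite (eq_bigr (fun k : 'I_L => (T k.+1 `^ (p - 1) - T k `^ (p - 1)) * (\sum_(k <= j < L) s j) +
     (T k.+1 `^ (p - 1) - T k `^ (p - 1)) * s L)); last first.
    by move=> k _; rewrite big_nat_recr/= ?mulrDr// ltnW.
  rewrite big_split/= -addrA; congr (_ + _).
  rewrite -mulr_suml -mulrDl mulrC; congr (_ * _).
  rewrite -(big_mkord predT (fun k => T k.+1 `^ (p - 1) - T k `^ (p - 1))) telescope_sumr//.
  have -> : T 0%N = 0 by rewrite TE big_ord0.
  by rewrite powR0 ?gt_eqF//; ring.
elim: L => [|L IH]; first by rewrite big_ord0 mulr0 TE big_ord0 powR0// gt_eqF.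
rewrite big_ord_recr/= mulrDr.
have := @powR_convex (T L) (T L.+1) p (T0 _) _ p1; rewrite TS lerDl => /(_ (s0 _)).
rewrite addrAC subrr add0r; lra.
Qed.

Fixpoint runmax (f : nat -> R) (k : nat) : R :=
  if k is k'.+1 then Num.max (runmax f k') (f k') else 0.

Lemma runmax_ge0 (f : nat -> R) k : 0 <= runmax f k.
Proof. by elim: k => //= k IH; rewrite le_max IH. Qed.

Lemma runmax_ge (f : nat -> R) j k : (j < k)%N -> f j <= runmax f k.
Proof.
elim: k => // k IH; rewrite ltnS leq_eqVlt => /orP[/eqP ->|/IH h]; rewrite /= le_max ?lexx ?orbT//.
by rewrite h.
Qed.

Lemma runmax_le (f : nat -> R) (M : R) k : 0 <= M -> (forall j, (j < k)%N -> f j <= M) -> runmax f k <= M.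
Proof.
move=> M0; elim: k => //= k IH h; rewrite ge_max h// andbT; apply: IH => j jk; apply: h; exact: ltnW.
Qed.

Lemma eq_runmax (f g : nat -> R) k : (forall j, (j < k)%N -> f j = g j) -> runmax f k = runmax g k.
Proof. by elim: k => //= k IH h; rewrite h// IH// => j jk; apply: h; exact: ltnW. Qed.

(** The power of the running maximum only grows at indices where f attains it. *)
Lemma runmax_abel (f : nat -> R) (p : R) (L : nat) : 1 < p ->
  runmax f L `^ p <= p / (p - 1) * \sum_(k < L) ((runmax f k.+1 `^ (p - 1) - runmax f k `^ (p - 1)) * f k).
Proof.
move=> p1; have p0 : 0 < p by apply: lt_trans p1.
have pm1 : 0 < p - 1 by rewrite subr_gt0.
set q := p / (p - 1).
have q1 : 1 < q by rewrite /q ltr_pdivlMr// mul1r ltrBlDr ltrDl.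
elim: L => [|L IH]; first by rewrite big_ord0 mulr0 /= powR0// gt_eqF.
rewrite big_ord_recr/= mulrDr.
have [h|h] := leP (f L) (runmax f L).
  by rewrite subrr mul0r mulr0 addr0.
have f0 : 0 <= f L by apply: le_trans (ltW h); exact: runmax_ge0.
have r0 := runmax_ge0 f L.
have ab : runmax f L `^ (p - 1) <= f L `^ (p - 1).
  by apply: ge0_ler_powR; rewrite ?nnegrE ?(ltW pm1)// ltW.
have := powR_convex (powR_ge0 _ _) ab q1.
rewrite -!powRrM.
have -> : (p - 1) * q = p by rewrite /q mulrCA divff ?mulr1// gt_eqF.
have -> : (p - 1) * (q - 1) = 1 by rewrite /q; field; rewrite gt_eqF.
rewrite powRr1// => hh.
rewrite -lerBlDr; move: IH; rewrite -/(runmax f L); lra.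
Qed.
End powR_ineq.

Lemma measurable_poweRT d (T : measurableType d) (R : realType) (p : R) (f : T -> \bar R) :
  measT f -> measT (fun x => f x `^ p)%E.
Proof. exact: measurableT_comp (measurable_poweR p). Qed.

Lemma ge0_intZ d (T : measurableType d) (R : realType) (mu : {measure set T -> \bar R}) (D : set T)
    (f : T -> \bar R) (k : R) : measurable D -> measurable_fun D f -> (forall x, D x -> 0 <= f x)%E -> 0 <= k ->
  (\int[mu]_(x in D) (k%:E * f x) = k%:E * \int[mu]_(x in D) f x)%E.
Proof. by move=> mD mf f0 k0; rewrite ge0_integralZl// lee_fin. Qed.

Arguments ge0_intZ {d T R} mu {D f k}.

Section garsia.
Context d (T : measurableType d) (R : realType) (mu : {measure set T -> \bar R}) (I : countType).
Implicit Types (q : T -> I).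

Lemma cell_nat_E q (j : nat) : exists o : option I, [set x | pickle (q x) = j] = [set x | Some (q x) = o].
Proof.
have [[x <-]|h] := pselect (exists x, pickle (q x) = j).
  exists (Some (q x)); apply/seteqP; split => y /=; first by move=> /(pcan_inj pickleK) ->.
  by move=> [->].
by exists None; apply/seteqP; split => y //= hy; case: h; exists y.
Qed.

Lemma cells_integral_le q (D : set T) (f g : T -> \bar R) : measurable D ->
  (forall i, measurable [set x | q x = i]) ->
  measurable_fun D f -> measurable_fun D g ->
  (forall x, D x -> 0 <= f x)%E -> (forall x, D x -> 0 <= g x)%E ->
  (forall i, \int[mu]_(x in D `&` [set x | q x = i]) f x <= \int[mu]_(x in D `&` [set x | q x = i]) g x)%E ->
  (\int[mu]_(x in D) f x <= \int[mu]_(x in D) g x)%E.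
Proof.
move=> mD mq mf mg f0 g0 h.
pose F (j : nat) := D `&` [set x | pickle (q x) = j].
have mF j : measurable (F j).
  apply: measurableI => //; have [[i|] ->] := cell_nat_E q j.
    by rewrite (_ : [set x | _] = [set x | q x = i])//; apply/seteqP; split => x /=; [case|move=> ->].
  by rewrite (_ : [set x | _] = set0)//; apply/seteqP; split.
have DE : D = \bigcup_j F j by apply/seteqP; split => [x Dx|x [j _ []]//]; exists (pickle (q x)).
have tF : trivIset setT F.
  by apply/trivIsetP => i j _ _ ij; apply/seteqP; split => // x [[_ /= xi] [_ /= xj]]; move: ij; rewrite -xi -xj eqxx.
rewrite DE !ge0_integral_bigcup//; rewrite -?DE//.
apply: lee_nneseries => j _.
  by move=> _; apply: integral_ge0 => x [Dx _]; exact: f0.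
rewrite /F; have [[i|] ->] := cell_nat_E q j.
  have -> : [set x | Some (q x) = Some i] = [set x | q x = i] by apply/seteqP; split => x /= => [[]|->].
  exact: h.
have -> : [set x : T | Some (q x) = None] = set0 by apply/seteqP; split.
by rewrite setI0 !integral_set0.
Qed.

Lemma adapted_measurable q (f : T -> R) : (forall i, measurable [set x | q x = i]) ->
  (forall x y, q x = q y -> f x = f y) -> measT f.
Proof.
move=> mq fq _ Y mY; rewrite setTI.
rewrite (_ : f @^-1` Y = \bigcup_i (if `[< exists2 x, q x = i & Y (f x) >] then [set x | q x = i] else set0)).
  by apply: countable_bigcupT_measurable => // i; case: ifP.
apply/seteqP; split => x /=.
  by move=> Yx; exists (q x) => //; rewrite asboolT//; exists x.
by move=> [i _]; case: asboolP => // -[y yi Yy] xi; rewrite (fq x y)// xi yi.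
Qed.

(** The common core of the two martingale inequalities.  The weights
    T_(k+1)^(p-1) - T_k^(p-1) are constant on the cells of generation k, so r_k
    may be replaced by C under the integral; the weights then telescope to
    T_L^(p-1) and the power of T_L is absorbed by Young's inequality.
    Absorption needs the integral to be finite, whence the bound M and the
    restriction to one cell B. *)
Lemma garsia_abs (q : nat -> T -> I) (Tk r : nat -> T -> R) (C : T -> \bar R) (L : nat) (p c M : R) (B : set T) (i0 : I) :
  1 < p -> 0 < c ->
  (forall k i, measurable [set x | q k x = i]) ->
  (forall j k x y, (j <= k)%N -> q k x = q k y -> q j x = q j y) ->
  (forall x, Tk 0%N x = 0) -> (forall k x, Tk k x <= Tk k.+1 x) ->
  (forall j x y, q j x = q j y -> Tk j.+1 x = Tk j.+1 y) ->
  (forall k x, 0 <= r k x) -> (forall k, measT (r k)) ->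
  measT C -> (forall x, 0 <= C x)%E ->
  B = [set x | q 0%N x = i0] -> (mu B < +oo)%E ->
  (forall x, B x -> Tk L x <= M) ->
  (forall x, Tk L x `^ p <= c * \sum_(k < L) ((Tk k.+1 x `^ (p - 1) - Tk k x `^ (p - 1)) * r k x)) ->
  (forall k i, (k < L)%N -> [set x | q k x = i] `<=` B -> \int[mu]_(x in [set x | q k x = i]) (r k x)%:E <=
      \int[mu]_(x in [set x | q k x = i]) C x)%E ->
  (\int[mu]_(x in B) (Tk L x `^ p)%:E <=
     (2 * (c * (2 * c) `^ (p - 1)))%:E * \int[mu]_(x in B) (C x `^ p))%E.
Proof.
move=> p1 c0 mq nest Tk00 TkS adapt Rk0 mRk mC C0 BE muB SM abel pot.
have p0 : 0 < p by apply: lt_trans p1.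
have pm1 : 0 < p - 1 by rewrite subr_gt0.
have mB : measurable B by rewrite BE.
pose S x := Tk L x.
have Tk0 k x : 0 <= Tk k x by elim: k => [|k IH]; rewrite ?Tk00//; apply: le_trans (TkS _ _).
pose w k x := Tk k.+1 x `^ (p - 1) - Tk k x `^ (p - 1).
have w0 k x : 0 <= w k x.
  by rewrite subr_ge0; apply: ge0_ler_powR; rewrite ?nnegrE ?(ltW pm1).
pose Rk := r.
have mTk k : measT (Tk k).
  case: k => [|k]; last by apply: adapted_measurable (mq k) (adapt k).
  by rewrite (_ : Tk 0%N = cst 0)//; apply/funext => x; rewrite Tk00.
have mS : measT S by exact: mTk.
have S0 x : 0 <= S x by exact: Tk0.
(* The weights are determined by the cell of generation k. *)
have wadapt k x y : q k x = q k y -> w k x = w k y.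
  move=> qxy; rewrite /w (adapt _ _ _ qxy); congr (_ - _ `^ _).
  by case: k qxy => [_|k qxy]; rewrite ?Tk00//; apply: adapt; apply: nest qxy.
have mw k : measT (w k) by apply: adapted_measurable (mq k) (wadapt k).
have mpow (f : T -> R) (e : R) : measT f -> measT (fun x => f x `^ e).
  by move=> mf; exact: (measurableT_comp (measurable_powR e) mf).
have mCp : measT (fun x => C x `^ p)%E by exact: (measurable_poweRT p mC).
set K := c * _.
have K0 : 0 < K by rewrite mulr_gt0// powR_gt0// mulr_gt0.
have step k : (k < L)%N -> (\int[mu]_(x in B) (w k x * Rk k x)%:E <= \int[mu]_(x in B) ((w k x)%:E * C x))%E.
  move=> kL; apply: (@cells_integral_le (q k)) => //.
  - by apply/measurable_EFinP/measurable_funTS; exact: measurable_funM.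
  - by apply: measurable_funTS; apply: emeasurable_funM => //; exact/measurable_EFinP.
  - by move=> x _; rewrite lee_fin mulr_ge0.
  - by move=> x _; rewrite mule_ge0// lee_fin.
  move=> i; have [[x0 [Bx0 /= qx0]]|h] := pselect (exists x, (B `&` [set x | q k x = i]) x); last first.
    have -> : B `&` [set x | q k x = i] = set0 by apply/seteqP; split => // x hx; apply: h; exists x.
    by rewrite !integral_set0.
  have -> : B `&` [set x | q k x = i] = [set x | q k x = i].
    apply: setIidr => x /= qx; rewrite BE /=; move: Bx0; rewrite BE /= => <-.
    by apply: (nest 0%N k) => //; rewrite qx qx0.
  have cw x : [set x | q k x = i] x -> w k x = w k x0 by move=> /= qx; apply: wadapt; rewrite qx qx0.
  have -> : (\int[mu]_(x in [set x | q k x = i]) (w k x * Rk k x)%:E = (w k x0)%:E * \int[mu]_(x in [set x | q k x = i]) (Rk k x)%:E)%E.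
    transitivity (\int[mu]_(x in [set x | q k x = i]) ((w k x0)%:E * (Rk k x)%:E))%E.
      by apply: eq_integral => x; rewrite inE => /cw ->; rewrite EFinM.
    have mRi : measurable_fun [set x | q k x = i] (fun x => (Rk k x)%:E) by apply/measurable_EFinP/measurable_funTS.
    by rewrite (ge0_intZ mu (mq k i) mRi)// => x _; rewrite lee_fin.
  have -> : (\int[mu]_(x in [set x | q k x = i]) ((w k x)%:E * C x) = (w k x0)%:E * \int[mu]_(x in [set x | q k x = i]) C x)%E.
    transitivity (\int[mu]_(x in [set x | q k x = i]) ((w k x0)%:E * C x))%E.
      by apply: eq_integral => x; rewrite inE => /cw ->.
    have mCi : measurable_fun [set x | q k x = i] C by apply: measurable_funTS.
    by rewrite (ge0_intZ mu (mq k i) mCi).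
  apply: lee_wpmul2l; first by rewrite lee_fin.
  apply: pot => // x /= qx; rewrite BE /=; move: Bx0; rewrite BE /= => <-.
  by apply: (nest 0%N k) => //; rewrite qx qx0.
have e1 : (\int[mu]_(x in B) (S x `^ p)%:E <= \int[mu]_(x in B) (c%:E * (C x * (S x `^ (p - 1))%:E)))%E.
  apply: (@le_trans _ _ (\int[mu]_(x in B) (\sum_(k < L) (c%:E * (w k x * Rk k x)%:E)))%E).
    apply: ge0_le_integral => //.
    - by move=> x _; rewrite lee_fin powR_ge0.
    - by apply/measurable_EFinP/measurable_funTS; exact: mpow.
    - apply: emeasurable_sum => k; apply: emeasurable_funM => //.
      by apply/measurable_EFinP/measurable_funTS; exact: measurable_funM.
    - move=> x _; have := abel x.
      by rewrite -lee_fin /= EFinM -sumEFin ge0_sume_distrr// => k _; rewrite lee_fin mulr_ge0//; exact: w0.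
  rewrite ge0_integral_sum//; last 2 first.
  - by move=> k; apply: emeasurable_funM => //; apply/measurable_EFinP/measurable_funTS; exact: measurable_funM.
  - by move=> k x _; rewrite mule_ge0// lee_fin ?mulr_ge0// ltW.
  apply: (@le_trans _ _ (\sum_(k < L) \int[mu]_(x in B) (c%:E * ((w k x)%:E * C x)))%E).
    apply: lee_sum => k' _.
    have m1 : measurable_fun B (fun x => (w k' x * Rk k' x)%:E).
      by apply/measurable_EFinP/measurable_funTS; exact: measurable_funM.
    have m2 : measurable_fun B (fun x => (w k' x)%:E * C x)%E.
      by apply: measurable_funTS; apply: emeasurable_funM => //; exact/measurable_EFinP.
    rewrite (ge0_intZ mu mB m1) ?(ltW c0)//; last by move=> x _; rewrite lee_fin mulr_ge0.
    rewrite (ge0_intZ mu mB m2) ?(ltW c0)//; last by move=> x _; rewrite mule_ge0// lee_fin.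
    by apply: lee_wpmul2l; [rewrite lee_fin ltW|exact: step].
  rewrite -ge0_integral_sum//; last 2 first.
  - by move=> k; apply: measurable_funTS; do 2!(apply: emeasurable_funM => //); exact/measurable_EFinP.
  - by move=> k x _; rewrite !mule_ge0// lee_fin// ltW.
  rewrite le_eqVlt; apply/orP; left; apply/eqP; apply: eq_integral => x _.
  rewrite -ge0_sume_distrr; last by move=> k _; rewrite mule_ge0// lee_fin.
  congr (_ * _)%E; rewrite -ge0_sume_distrl; last by move=> k _; rewrite lee_fin.
  rewrite muleC; congr (_ * _)%E; rewrite sumEFin; congr EFin.
  rewrite -(big_mkord predT (fun k => w k x)) /w telescope_sumr//.
  by rewrite Tk00 powR0 ?gt_eqF// subr0.
have e2 : (\int[mu]_(x in B) (c%:E * (C x * (S x `^ (p - 1))%:E)) <= 2^-1%:E * \int[mu]_(x in B) (S x `^ p)%:E + K%:E * \int[mu]_(x in B) (C x `^ p))%E.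
  have m1 : measurable_fun B (fun x => (S x `^ p)%:E) by apply/measurable_EFinP/measurable_funTS; exact: mpow.
  have m2 : measurable_fun B (fun x => C x `^ p)%E by apply: measurable_funTS.
  have h0 : 0 <= 2^-1 :> R by rewrite invr_ge0.
  have <- := ge0_intZ mu mB m1 (fun x _ => powR_ge0 (S x) p : (0 <= (S x `^ p)%:E)%E) h0.
  have <- := ge0_intZ mu mB m2 (fun x _ => poweR_ge0 _ _) (ltW K0).
  have n1 x : (0 <= 2^-1%:E * (S x `^ p)%:E)%E by rewrite mule_ge0// lee_fin ?invr_ge0// powR_ge0.
  have n2 x : (0 <= K%:E * C x `^ p)%E by rewrite mule_ge0// ?poweR_ge0// lee_fin ltW.
  have q1 : measurable_fun B (fun x => 2^-1%:E * (S x `^ p)%:E)%E.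
    by apply: emeasurable_funM => //; apply/measurable_EFinP/measurable_funTS; exact: mpow.
  have q2 : measurable_fun B (fun x => K%:E * C x `^ p)%E.
    by apply: emeasurable_funM => //; apply: measurable_funTS.
  rewrite -ge0_integralD//.
  apply: ge0_le_integral => //.
  - move=> x _; rewrite !mule_ge0// lee_fin ?powR_ge0//; exact: ltW.
  - apply: measurable_funTS; do 2!(apply: emeasurable_funM => //).
    by apply/measurable_EFinP; exact: mpow.
  - exact: emeasurable_funD.
  - by move=> x _; rewrite -EFinM; apply: young_absorb.
have fS : (\int[mu]_(x in B) (S x `^ p)%:E)%E \is a fin_num.
  rewrite ge0_fin_numE; last by apply: integral_ge0 => x _; rewrite lee_fin powR_ge0.
  apply: (@le_lt_trans _ _ (\int[mu]_(x in B) (cst (M `^ p)%:E x))%E).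
    apply: ge0_le_integral => //.
    - by move=> x _; rewrite lee_fin powR_ge0.
    - by apply/measurable_EFinP/measurable_funTS; exact: mpow.
    - move=> x Bx; rewrite lee_fin; have := SM x Bx => h.
      apply: ge0_ler_powR; rewrite ?nnegrE ?(ltW p0)//.
      exact: le_trans h.
  rewrite integral_cst//; apply: lte_mul_pinfty => //; rewrite ?lee_fin ?powR_ge0//.
have e3 := le_trans e1 e2.
move: fS e3 {e1 e2}; case: (\int[mu]_(x in B) (S x `^ p)%:E)%E => [a|//|//] _.
have : (0 <= \int[mu]_(x in B) (C x `^ p))%E by apply: integral_ge0 => x _; exact: poweR_ge0.
case: (\int[mu]_(x in B) (C x `^ p))%E => [b|_|//]; last first.
  by move=> _; rewrite gt0_muley ?leey// lte_fin mulr_gt0.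
by move=> _; rewrite -!EFinM -EFinD !lee_fin; lra.
Qed.

(** If the conditional average of the tail of an adapted sum is dominated by
    that of C, then the sum is dominated by C in L^p. *)
Lemma garsia (q : nat -> T -> I) (s : nat -> T -> R) (C : T -> \bar R) (L : nat) (p M : R) (B : set T) (i0 : I) :
  1 < p -> (0 < L)%N ->
  (forall k i, measurable [set x | q k x = i]) ->
  (forall j k x y, (j <= k)%N -> q k x = q k y -> q j x = q j y) ->
  (forall j x y, q j x = q j y -> s j x = s j y) ->
  (forall k x, 0 <= s k x) -> measT C -> (forall x, 0 <= C x)%E ->
  B = [set x | q 0%N x = i0] -> (mu B < +oo)%E ->
  (forall x, B x -> \sum_(j < L) s j x <= M) ->
  (forall k i, (k < L)%N -> \int[mu]_(x in [set x | q k x = i]) (\sum_(k <= j < L) s j x)%:E <=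
      \int[mu]_(x in [set x | q k x = i]) C x)%E ->
  (\int[mu]_(x in B) ((\sum_(j < L) s j x) `^ p)%:E <=
     (2 * (p * (2 * p) `^ (p - 1)))%:E * \int[mu]_(x in B) (C x `^ p))%E.
Proof.
move=> p1 L0 mq nest adapt s0 mC C0 BE muB SM pot.
have p0 : 0 < p by apply: lt_trans p1.
have ms j : measT (s j) by apply: adapted_measurable (mq j) (adapt j).
apply: (@garsia_abs q (fun k x => \sum_(j < k) s j x) (fun k x => \sum_(k <= j < L) s j x) C L p p M B i0) => //.
- by move=> x; rewrite big_ord0.
- by move=> k x; rewrite big_ord_recr/= lerDl.
- by move=> j x y qxy; apply: eq_bigr => i _; apply: adapt; apply: nest qxy; rewrite -ltnS.
- by move=> k x; exact: sumr_ge0.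
- by move=> k; apply: measurable_sum => j.
- by move=> x; exact: (@sum_abel R (s ^~ x) (fun k => \sum_(j < k) s j x) p L p1 (fun k => s0 k x) (fun=> erefl)).
- by move=> k i kL _; exact: pot.
Qed.

Lemma le1D_poweR (C : \bar R) (p : R) : (0 <= C)%E -> 1 < p -> (C <= 1 + C `^ p)%E.
Proof.
move=> C0 p1; have p0 : 0 < p by apply: lt_trans p1.
case: C C0 => [c||] // c0; last by rewrite poweRyr ?gt_eqF// addey.
rewrite lee_fin in c0; rewrite poweR_EFin -EFinD lee_fin.
have [c1|c1] := leP c 1; first by apply: (le_trans c1); rewrite lerDl powR_ge0.
apply: (@le_trans _ _ (c `^ p)); last by rewrite lerDr.
by rewrite -{1}(powRr1 c0); apply: ler_powR => //; exact: ltW.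
Qed.

Lemma integral_lty_of_poweR (C : T -> \bar R) (p : R) (A : set T) : 1 < p -> measurable A -> (mu A < +oo)%E ->
  measT C -> (forall x, 0 <= C x)%E -> (\int[mu]_x (C x `^ p) < +oo)%E ->
  (\int[mu]_(x in A) C x < +oo)%E.
Proof.
move=> p1 mA Afin mC C0 Cp.
have mCp : measT (fun x => C x `^ p)%E by exact: (measurable_poweRT p mC).
apply: (@le_lt_trans _ _ (\int[mu]_(y in A) (1 + C y `^ p))%E).
  apply: ge0_le_integral => //.
  - exact: measurable_funTS.
  - by apply: measurable_funTS; apply: emeasurable_funD.
  - by move=> y _; exact: le1D_poweR.
rewrite ge0_integralD//; last 2 first.
- by move=> y _; exact: poweR_ge0.
- exact: measurable_funTS.
rewrite integral_cst// mul1e; apply: lte_add_pinfty => //.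
apply: le_lt_trans Cp; apply: ge0_subset_integral => //.
by move=> y _; exact: poweR_ge0.
Qed.

Definition cellavg (q : nat -> T -> I) (C : T -> \bar R) (k : nat) (x : T) : R :=
  fine (\int[mu]_(y in [set y | q k y = q k x]) C y) / fine (mu [set y | q k y = q k x]).

(** The averages of C over a cell have, by definition, the same integral over
    that cell as C, so the core inequality applies to their running maximum.
    The bound dl on the measure of cells only serves to keep the averages
    bounded. *)
Lemma doob (q : nat -> T -> I) (C : T -> \bar R) (L : nat) (p dl : R) :
  1 < p -> 0 < dl ->
  (forall k i, measurable [set x | q k x = i]) ->
  (forall j k x y, (j <= k)%N -> q k x = q k y -> q j x = q j y) ->
  measT C -> (forall x, 0 <= C x)%E -> (\int[mu]_x (C x `^ p) < +oo)%E ->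
  (forall k x, (k < L)%N -> dl%:E <= mu [set y | q k y = q k x])%E ->
  (forall k x, mu [set y | q k y = q k x] < +oo)%E ->
  (\int[mu]_x (runmax (fun k => cellavg q C k x) L `^ p)%:E <=
     (2 * (p / (p - 1) * (2 * (p / (p - 1))) `^ (p - 1)))%:E * \int[mu]_x (C x `^ p))%E.
Proof.
move=> p1 dl0 mq nest mC C0 Cp cellge cellfin.
have p0 : 0 < p by apply: lt_trans p1.
have pm1 : 0 < p - 1 by rewrite subr_gt0.
have c0 : 0 < p / (p - 1) by rewrite divr_gt0.
set K := 2 * _; have K0 : 0 <= K by rewrite mulr_ge0// mulr_ge0 ?powR_ge0// ltW.
have mCp : measT (fun x => C x `^ p)%E by exact: (measurable_poweRT p mC).
pose f k x := cellavg q C k x.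
have f0 k x : 0 <= f k x by rewrite divr_ge0// fine_ge0// integral_ge0.
have adapt k x y : q k x = q k y -> f k x = f k y by move=> qxy; rewrite /f /cellavg qxy.
have mf k : measT (f k) by exact: adapted_measurable (mq k) (adapt k).
have Cint k x : (\int[mu]_(y in [set y | q k y = q k x]) C y < +oo)%E.
  by apply: integral_lty_of_poweR Cp.
have mr L' : measT (fun x => runmax (f ^~ x) L').
  elim: L' => [|k IH] /=; first exact: measurable_cst.
  exact: measurable_maxr.
rewrite -(ge0_intZ mu measurableT mCp)//; last by move=> x _; exact: poweR_ge0.
apply: (@cells_integral_le (q 0%N)) => //.
- by apply/measurable_EFinP; exact: (measurableT_comp (measurable_powR p) (mr L)).
- by apply: emeasurable_funM.
- by move=> x _; rewrite lee_fin powR_ge0.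
- by move=> x _; rewrite mule_ge0 ?poweR_ge0// lee_fin.
move=> i0; rewrite setTI.
have mCpB : measurable_fun [set x | q 0%N x = i0] (fun x => C x `^ p)%E by exact: measurable_funTS.
rewrite (ge0_intZ mu (mq 0%N i0) mCpB)//; last by move=> x _; exact: poweR_ge0.
have [[x0 qx0]|h] := pselect (exists x, q 0%N x = i0); last first.
  have -> : [set x | q 0%N x = i0] = set0 by apply/seteqP; split => // x hx; apply: h; exists x.
  by rewrite !integral_set0 mule0.
set B := [set x | q 0%N x = i0].
have mB : measurable B by exact: mq.
have cellB k x : B x -> [set y | q k y = q k x] `<=` B.
  by move=> Bx y /= qy; rewrite /B /=; rewrite -Bx; apply: nest qy.
have CB : (\int[mu]_(x in B) C x < +oo)%E by rewrite /B -qx0; exact: Cint.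
apply: (@garsia_abs q (fun k x => runmax (f ^~ x) k) f C L p (p / (p - 1)) (fine (\int[mu]_(x in B) C x) / dl) B i0) => //.
- by move=> k x /=; rewrite le_max lexx.
- move=> j x y qxy; apply: eq_runmax => k kj; apply: adapt; apply: nest qxy.
  by rewrite -ltnS.
- by rewrite /B -qx0; exact: cellfin.
- move=> x Bx; apply: runmax_le; first by rewrite divr_ge0 ?fine_ge0 ?integral_ge0// ltW.
  move=> k kL; rewrite /f /cellavg.
  have mk : fine (mu [set y | q k y = q k x]) >= dl.
    by rewrite -lee_fin fineK ?cellge// ge0_fin_numE.
  apply: ler_pM; rewrite ?invr_ge0 ?fine_ge0 ?integral_ge0//.
    apply: fine_le; rewrite ?ge0_fin_numE ?integral_ge0//.
    by apply: ge0_subset_integral => //; [exact: measurable_funTS|exact: cellB].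
  by rewrite lef_pV2 ?posrE//; apply: lt_le_trans mk.
- by move=> x; exact: runmax_abel.
- move=> k i kL iB.
  have [[x qx]|h] := pselect (exists x, q k x = i); last first.
    have -> : [set x | q k x = i] = set0 by apply/seteqP; split => // x hx; apply: h; exists x.
    by rewrite !integral_set0.
  rewrite -qx (eq_integral (fun=> (f k x)%:E)); last by move=> y; rewrite inE => /= /adapt ->.
  have mk : 0 < fine (mu [set y | q k y = q k x]).
    rewrite fine_gt0// cellfin andbT; apply: lt_le_trans (cellge _ _ kL); by rewrite lte_fin.
  rewrite integral_cst// /f /cellavg.
  rewrite -[X in (_ * X)%E](fineK (x := mu _)); last by rewrite ge0_fin_numE.
  rewrite -EFinM divfK ?gt_eqF// fineK// ge0_fin_numE ?Cint//.
  exact: integral_ge0.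
Qed.
End garsia.

(** * Boxes over cubes and the dyadic potential *)

Section rows.
Context {R : realType} (n : nat).
Local Notation X := ('rV[R]_n).
Local Notation V := ('rV[R]_(1 + n)).

Definition rowtx (t : R) (x : X) : V := row_mx (const_mx t) x.

Lemma rowtx_t t x : tcoord (rowtx t x) = t.
Proof. by rewrite /tcoord /rowtx row_mxEl mxE. Qed.

Lemma rowtx_x t x : xcoord (rowtx t x) = x.
Proof. by rewrite /xcoord /rowtx row_mxKr. Qed.

Lemma forall_rowtx (P : 'I_(1 + n) -> Prop) : (forall i, P i) <-> P (t0 n) /\ forall j, P (rshift 1 j).
Proof.
split=> [h|[h1 h2] i]; first by split.
by case: (split_ordP i) => j ->; rewrite ?(ord1 j).
Qed.

Lemma rowtxE0 t x : rowtx t x ord0 (t0 n) = t. Proof. exact: rowtx_t. Qed.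

Lemma rowtxES t x j : rowtx t x ord0 (rshift 1 j) = x ord0 j.
Proof. by rewrite /rowtx row_mxEr. Qed.

Lemma xcoordE (z : V) j : xcoord z ord0 j = z ord0 (rshift 1 j).
Proof. by rewrite /xcoord mxE. Qed.

Lemma cbox_rowtx (a b : R) (p q : X) z :
  cbox (rowtx a p) (rowtx b q) z <-> a <= tcoord z <= b /\ cbox p q (xcoord z).
Proof.
rewrite /cbox /=; split=> [/(forall_rowtx (fun i => _ <= z ord0 i <= _))[h1 h2]|[h1 h2]].
  split; first by move: h1; rewrite !rowtxE0.
  by move=> j; move: (h2 j); rewrite !rowtxES xcoordE.
apply/(forall_rowtx (fun i => _ <= z ord0 i <= _)); split; first by rewrite !rowtxE0.
by move=> j; rewrite !rowtxES -xcoordE.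
Qed.

Lemma obox_rowtx (a b : R) (p q : X) z :
  obox (rowtx a p) (rowtx b q) z <-> a < tcoord z < b /\ obox p q (xcoord z).
Proof.
rewrite /obox /=; split=> [/(forall_rowtx (fun i => _ < z ord0 i < _))[h1 h2]|[h1 h2]].
  split; first by move: h1; rewrite !rowtxE0.
  by move=> j; move: (h2 j); rewrite !rowtxES xcoordE.
apply/(forall_rowtx (fun i => _ < z ord0 i < _)); split; first by rewrite !rowtxE0.
by move=> j; rewrite !rowtxES -xcoordE.
Qed.

Lemma cube_obox (a : X) l : cube a l = obox a (a + const_mx l).
Proof. by apply/seteqP; split => x h i; have := h i; rewrite !mxE. Qed.

Lemma lebesgue_cube (a : X) l : 0 <= l -> lebesgue_rV n (cube a l) = (l ^+ n)%:E.
Proof.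
move=> l0; rewrite cube_obox.
have -> := lebesgue_obox a (a + const_mx l); congr EFin.
rewrite (eq_bigr (fun=> l)) ?prodr_const ?card_ord// => i _.
by rewrite !mxE addrAC subrr add0r; apply/max_idPr.
Qed.

Lemma carleson_box_obox (a : X) l : carleson_box a l = obox (rowtx 0 a) (rowtx l (a + const_mx l)).
Proof. by apply/seteqP; split => z; rewrite obox_rowtx -cube_obox. Qed.

Lemma measurable_carleson_box (a : X) l : measurable (carleson_box a l).
Proof. by rewrite carleson_box_obox; exact: measurable_obox. Qed.

Lemma carleson_box_hspace (a : X) l : carleson_box a l `<=` @hspace R n.
Proof. by move=> z [/andP[]]. Qed.

(** The supremum of w(Q) / |Q| over the cubes Q containing x.  The Carleson
    functional and the maximal function are both of this form. *)
Definition cubesup (w : X -> R -> \bar R) (x : X) : \bar R :=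
  ereal_sup [set r | exists a l, [/\ 0 < l, cube a l x & r = (w a l / lebesgue_rV n (cube a l))%E]].

(** Cubes are open, so the functional is lower semicontinuous. *)
Lemma measurable_cubesup (w : X -> R -> \bar R) : measT (cubesup w).
Proof.
apply: (measurability _ (ErealGenOInfty.measurableE R)) => /= _ [_ [a ->]] <-.
rewrite setTI; apply: open_measurable_rV; rewrite preimage_itvoy openE => x /= ax.
have [_ [a' [l [l0 cx ->]]] h] := ereal_sup_gt ax.
have oc : open (cube a' l) by rewrite cube_obox; exact: open_obox.
apply: (filterS _ (open_nbhs_nbhs (conj oc cx))) => y cy /=.
by apply: (lt_le_trans h); apply: ereal_sup_ubound; exists a', l.
Qed.

Lemma cubesup_ge0 (w : X -> R -> \bar R) x : (forall a l, 0 <= w a l)%E -> (0 <= cubesup w x)%E.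
Proof.
move=> w0; pose a : X := x - const_mx 1.
have cx : cube a 2 x by move=> i; rewrite !mxE; lra.
have h : (w a 2%R / lebesgue_rV n (cube a 2) <= cubesup w x)%E.
  by apply: ereal_sup_ubound; exists a, 2; split => //; lra.
by apply: le_trans h; rewrite mule_ge0// inve_ge0.
Qed.

Lemma measurable_carleson (m : set V -> \bar R) : measT (carleson m).
Proof. exact: (measurable_cubesup (fun a l => m (carleson_box a l))). Qed.

Lemma carleson_ge0 (m : {measure set V -> \bar R}) x : (0 <= carleson m x)%E.
Proof. by apply: (@cubesup_ge0 (fun a l => m (carleson_box a l))). Qed.

Definition hbox (a b : X) : set X := [set x | forall i, a ord0 i <= x ord0 i < b ord0 i].

Lemma measurable_hbox a b : measurable (hbox a b).
Proof.
rewrite (_ : hbox a b = \big[setI/setT]_i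
    (rV_coord i @^-1` `[(a ord0 i), (b ord0 i)[)).
  apply: bigsetI_measurable => i _; rewrite -[X in measurable X]setTI.
  by apply: measurable_rV_coord => //; exact: measurable_itv.
rewrite -bigcap_seq; apply/seteqP; split => x /= + i.
  by move=> /(_ i) xi _; rewrite /= in_itv.
by move=> /(_ i); rewrite /= in_itv/=; apply; rewrite mem_index_enum.
Qed.
End rows.

Section cells.
Context {R : realType} (n : nat).
Local Notation X := ('rV[R]_n).
Local Notation V := ('rV[R]_(1 + n)).
Local Notation muX := (lebesgue_rV n).

Definition qcell (s : R) (x : X) : 'rV[int]_n := \row_i Num.floor (x ord0 i / s).
Definition qpt (s : R) (i : 'rV[int]_n) : X := \row_j (s * (i ord0 j)%:~R).

Lemma qcellP s i : 0 < s -> [set x | qcell s x = i] = hbox (qpt s i) (qpt s i + const_mx s).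
Proof.
move=> s0; apply/seteqP; split => x /=.
  move=> <- j; rewrite !mxE; have /andP[h1 h2] := floor_itv (x ord0 j / s).
  rewrite mulrC -ler_pdivlMr// h1/=.
  by move: h2; rewrite intrD ltr_pdivrMr// mulrDl mul1r.
move=> h; apply/rowP => j; rewrite mxE; apply: floor_def.
have := h j; rewrite !mxE => /andP[h1 h2].
rewrite ler_pdivlMr// mulrC h1/= ltr_pdivrMr// intrD mulrDl mul1r mulrC; lra.
Qed.

Lemma measurable_qcell s i : 0 < s -> measurable [set x | qcell s x = i].
Proof. by move=> s0; rewrite qcellP//; exact: measurable_hbox. Qed.

Lemma qcell_measure_ge s v i : 0 < s -> ((s ^+ n)%:E <= muX [set x | qcell s (x + v) = i])%E.
Proof.
move=> s0; rewrite -(lebesgue_cube (qpt s i - v) (ltW s0)).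
have mc : measurable [set x | qcell s (x + v) = i].
  have := measurable_shift v measurableT (measurable_qcell i s0).
  by rewrite setTI.
apply: (@le_measure _ _ _ muX); rewrite ?inE//.
  by rewrite cube_obox; exact: measurable_obox.
move=> x h /=; have : hbox (qpt s i) (qpt s i + const_mx s) (x + v).
  by move=> j; have := h j; rewrite !mxE => /andP[h1 h2]; apply/andP; split; lra.
by rewrite -qcellP.
Qed.

Lemma qcell_measure_le s v i : 0 < s -> (muX [set x | qcell s (x + v) = i] <= ((2 * s) ^+ n)%:E)%E.
Proof.
move=> s0; rewrite -(lebesgue_cube (qpt s i - v - const_mx s)); last by rewrite mulr_ge0// ltW.
have mc : measurable [set x | qcell s (x + v) = i].
  have := measurable_shift v measurableT (measurable_qcell i s0).
  by rewrite setTI.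
apply: (@le_measure _ _ _ muX); rewrite ?inE//.
  by rewrite cube_obox; exact: measurable_obox.
move=> x /= h j; have : [set y | qcell s y = i] (x + v) by [].
by rewrite qcellP// => /(_ j); rewrite !mxE => /andP[h1 h2]; apply/andP; split; lra.
Qed.

Lemma qcell_in s x j : 0 < s -> qpt s (qcell s x) ord0 j <= x ord0 j < qpt s (qcell s x) ord0 j + s.
Proof.
move=> s0; have : [set y | qcell s y = qcell s x] x by [].
by rewrite qcellP// => /(_ j); rewrite !mxE.
Qed.

Lemma qcell_nested (d : nat) s x y : 0 < s -> qcell s x = qcell s y -> qcell (2 ^+ d * s) x = qcell (2 ^+ d * s) y.
Proof.
move=> s0 /rowP h; apply/rowP => j; have := h j; rewrite !mxE => {}h.
have d0 : 0 < 2 ^+ d :> R by rewrite exprn_gt0.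
have aux (z : R) (k : int) : (k <= Num.floor (z / (2 ^+ d * s))) = (k * 2 ^+ d <= Num.floor (z / s)).
  rewrite !floor_ge_int !ler_pdivlMr// ?mulr_gt0// intrM rmorphXn/= mulrA.
  by [].
by apply/eqP; rewrite eq_le aux -h -aux lexx/= aux h -aux lexx.
Qed.

(** The box of size s at height s above the cell i; the aperture c is chosen to
    contain the Whitney regions based in the cell. *)
Definition wbox (c s : R) (i : 'rV[int]_n) : set V :=
  cbox (rowtx (s / c) (qpt s i - const_mx (c * s))) (rowtx (c * s) (qpt s i + const_mx (c * s))).

Lemma wboxP c s i z : wbox c s i z <->
  s / c <= tcoord z <= c * s /\ forall j, `|xcoord z ord0 j - qpt s i ord0 j| <= c * s.
Proof.
rewrite /wbox cbox_rowtx; split => -[h1 h2]; split => // j.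
  by have := h2 j; rewrite ler_distl !mxE.
by have := h2 j; rewrite ler_distl !mxE.
Qed.

Lemma measurable_wbox c s i : measurable (wbox c s i).
Proof. apply: compact_measurable_rV; exact: compact_cbox. Qed.

Lemma wbox_hspace c s i : 0 < c -> 0 < s -> wbox c s i `<=` @hspace R n.
Proof.
move=> c0 s0 z /wboxP[/andP[h _] _]; apply: lt_le_trans h; exact: divr_gt0.
Qed.

(** A point at height t lies in boxes of at most r consecutive dyadic
    generations: the indices concerned span an interval of length r. *)
Lemma overlap (s0 c t : R) (r k L : nat) : 1 <= c -> 0 < s0 -> c ^+ 2 < 2 ^+ r ->
  \sum_(k <= j < L) ((s0 / 2 ^+ j / c <= t <= c * (s0 / 2 ^+ j))%R%:R : R) <= r%:R.
Proof.
move=> c1 s00 cr; pose P j := s0 / 2 ^+ j / c <= t <= c * (s0 / 2 ^+ j).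
have c0 : 0 < c by exact: lt_le_trans c1.
have [[j0 Pj0]|h] := pselect (exists j, P j); last first.
  rewrite big1 ?ler0n// => j _; case: (boolP (_ && _)) => // Pj.
  by case: h; exists j.
have exP : exists j, P j by exists j0.
case: (ex_minnP exP) => a Pa amin.
have Pb j : P j -> (a <= j < a + r)%N.
  move=> Pj; rewrite amin//= ltnNge; apply/negP => jr.
  move: Pa Pj => /andP[Pa _] /andP[_ Pj].
  have := le_trans Pa Pj; rewrite ler_pdivrMr//.
  have -> : (j = a + r + (j - (a + r)))%N by rewrite subnKC.
  rewrite !exprD; set d := (_ - _)%N.
  have e1 : 1 <= 2 ^+ d :> R by rewrite exprn_ege1// ler1n.
  have ea : 0 < 2 ^+ a :> R by rewrite exprn_gt0.
  have er : 0 < 2 ^+ r :> R by rewrite exprn_gt0.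
  have ed : 0 < 2 ^+ d :> R by rewrite exprn_gt0.
  apply/negP; rewrite -ltNge.
  have -> : c * (s0 / (2 ^+ a * 2 ^+ r * 2 ^+ d)) * c = (s0 / 2 ^+ a) * (c ^+ 2 / (2 ^+ r * 2 ^+ d)).
    by field; rewrite !gt_eqF.
  rewrite gtr_pMr ?divr_gt0// ltr_pdivrMr ?mulr_gt0// mul1r.
  by apply: (lt_le_trans cr); rewrite ler_peMr// ltW.
apply: (@le_trans _ _ (\sum_(k <= j < L) ((minn r (j.+1 - a))%:R - (minn r (j - a))%:R : R))).
  apply: ler_sum => j _; rewrite -/(P j); case: (boolP (P j)) => [/Pb/andP[h1 h2]|_] /=.
    rewrite subSn// !(minn_idPr _) ?natrS ?ltn_subLR ?leq_subLR// ?(ltnW h2)//; lra.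
  by rewrite subr_ge0 ler_nat leq_min geq_minl/= (leq_trans (geq_minr _ _))// leq_sub2r.
have [kL|Lk] := leqP k L; last by rewrite big_geq ?ler0n// ltnW.
rewrite (telescope_sumr (fun j => (minn r (j - a))%:R))//.
by rewrite lerBlDr -natrD ler_nat (leq_trans (geq_minl _ _))// leq_addr.
Qed.
End cells.

Section potential.
Context {R : realType} (n : nat).
Local Notation X := ('rV[R]_n).
Local Notation V := ('rV[R]_(1 + n)).
Local Notation muX := (lebesgue_rV n).
Variables (m : {sigma_finite_measure set V -> \bar R}) (c : R).
Hypothesis c1 : 1 <= c.
Hypothesis mfin : forall K : set V, compact K -> K `<=` @hspace R n -> (m K < +oo)%E.
Let c0 : 0 < c. Proof. exact: lt_le_trans c1. Qed.

Implicit Types s : R.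

(** The contribution of the scale s to the dyadic potential. *)
Definition wavg (s : R) (x : X) : R := fine (m (wbox c s (qcell s x))) / s ^+ n.

Lemma wavg_ge0 s x : 0 < s -> 0 <= wavg s x.
Proof. by move=> s0; rewrite divr_ge0 ?fine_ge0// exprn_ge0// ltW. Qed.

Lemma wbox_fin s i : 0 < s -> (m (wbox c s i) < +oo)%E.
Proof. by move=> s0; apply: mfin; [exact: compact_cbox|exact: wbox_hspace]. Qed.

(** Tonelli: for fixed z the points x whose box contains z lie in a cube of
    side comparable to s, and this cancels the factor s^(-n). *)
Lemma level_bound (s : R) (Q : set X) (Ph : set V) : 0 < s -> measurable Q -> measurable Ph ->
  (forall x z, Q x -> wbox c s (qcell s x) z -> Ph z) ->
  (\int[muX]_(x in Q) (wavg s x)%:E <=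
    ((2 * (c + 2)) ^+ n)%:E * \int[m]_(z in Ph) ((s / c <= tcoord z <= c * s)%R%:R)%:E)%E.
Proof.
move=> s0 mQ mPh QP.
pose E : set (X * V) := [set p | Q p.1 /\ wbox c s (qcell s p.1) p.2].
have cs0 : 0 <= 2 * (c + 2) * s by rewrite !mulr_ge0// ?ltW// addr_gt0.
have mE : measurable E.
  rewrite (_ : E = \bigcup_i ((Q `&` [set x | qcell s x = i]) `*` wbox c s i)).
    apply: countable_bigcupT_measurable => // i; apply: measurableX; last exact: measurable_wbox.
    by apply: measurableI => //; exact: measurable_qcell.
  apply/seteqP; split => -[x z] /=; first by move=> [Qx w]; exists (qcell s x).
  by move=> [i _ [[Qx /= <-]]].
pose st (z : V) : bool := s / c <= tcoord z <= c * s.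
have mst : measurable [set z | st z].
  rewrite (_ : [set z | _] = rV_coord (t0 n) @^-1` `[s / c, c * s]).
    by rewrite -[X in measurable X]setTI; apply: measurable_rV_coord => //; exact: measurable_itv.
  by apply/seteqP; split => z /=; rewrite in_itv.
have e1 : (\int[muX]_(x in Q) (wavg s x)%:E = ((s ^+ n)^-1)%:E * \int[muX]_x m (xsection E x))%E.
  have mF : measT (fun x => m (xsection E x)).
    by have := indic_measurable_fun_fubini_tonelli_F m mE; rewrite indic_fubini_tonelli_FE.
  rewrite -(ge0_intZ muX _ mF)//; last by rewrite invr_ge0 exprn_ge0// ltW.
  rewrite [LHS]integral_mkcond; apply: eq_integral => x _; rewrite patchE.
  case: ifPn => [|/negP] xQ.
    have -> : xsection E x = wbox c s (qcell s x).
      by apply/seteqP; split => z; rewrite xsectionP /E /=; [case|move=> ?; split => //; exact: set_mem].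
    rewrite /wavg EFinM fineK 1?muleC// ge0_fin_numE//; exact: wbox_fin.
  have -> : xsection E x = set0; last by rewrite measure0 mule0.
  by apply/seteqP; split => // z; rewrite xsectionP => -[/mem_set].
have e2 : (\int[muX]_x m (xsection E x) = \int[m]_z muX (ysection E z))%E.
  by have := indic_fubini_tonelli muX m mE; rewrite indic_fubini_tonelli_FE// indic_fubini_tonelli_GE.
have e3 z : (muX (ysection E z) <= ((2 * (c + 2) * s) ^+ n)%:E * ((\1_Ph z : R) * (st z)%:R)%:E)%E.
  have [[x xE]|h] := pselect (exists x, ysection E z x); last first.
    have -> : ysection E z = set0 by apply/seteqP; split => // x xE; apply: h; exists x.
    by rewrite measure0 mule_ge0// lee_fin ?exprn_ge0// mulr_ge0.
  have -> : (\1_Ph z : R) = 1.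
    by move: xE; rewrite ysectionP => -[Qx w]; rewrite indicE mem_set//; exact: QP w.
  have -> : st z by move: xE; rewrite ysectionP => -[_ /wboxP[]].
  rewrite mulr1 mule1.
  apply: (@le_trans _ _ (muX (cube (xcoord z - const_mx ((c + 2) * s)) (2 * (c + 2) * s)))); last first.
    by rewrite lebesgue_cube.
  apply: le_measure; rewrite ?inE.
  - exact: measurable_ysection.
  - by rewrite cube_obox; exact: measurable_obox.
  move=> y; rewrite ysectionP => -[_ /wboxP[_ h]] j; rewrite !mxE.
  have /andP[h1 h2] := qcell_in y j s0.
  have := h j; rewrite /= ler_distl => /andP[h3 h4].
  rewrite -xcoordE; move: h1 h2 h3 h4; set a := qpt _ _ _ _; set b := xcoord _ _ _; set d := y _ _.
  have cs : 0 < c * s by rewrite mulr_gt0.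
  move=> *; lra.
rewrite e1 e2.
have mst' : measT (fun z => ((\1_Ph z : R) * (st z)%:R)%:E).
  apply/measurable_EFinP; apply: measurable_funM; first exact: measurable_indic.
  rewrite (_ : (fun z => _) = \1_[set z | st z]); first exact: measurable_indic.
  by apply/funext => z; rewrite indicE; congr ((nat_of_bool _)%:R); apply/idP/idP => h; [exact/mem_set|exact: set_mem h].
apply: (@le_trans _ _ (((s ^+ n)^-1)%:E * \int[m]_z (((2 * (c + 2) * s) ^+ n)%:E * ((\1_Ph z : R) * (st z)%:R)%:E))%E).
  apply: lee_wpmul2l; first by rewrite lee_fin invr_ge0 exprn_ge0// ltW.
  apply: ge0_le_integral => //.
  - by have := indic_measurable_fun_fubini_tonelli_G muX mE; rewrite indic_fubini_tonelli_GE.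
  - by apply: emeasurable_funM.
rewrite (ge0_intZ m _ mst') ?exprn_ge0//.
rewrite muleA -EFinM; have -> : (s ^+ n)^-1 * (2 * (c + 2) * s) ^+ n = (2 * (c + 2)) ^+ n.
  by rewrite exprMn mulrC mulfK// expf_neq0// gt_eqF.
apply: lee_wpmul2l; first by rewrite lee_fin exprn_ge0// mulr_ge0//; have := c0; lra.
rewrite [leRHS]integral_mkcond le_eqVlt; apply/orP; left; apply/eqP; apply: eq_integral => z _.
by rewrite patchE indicE; case: ifP => _; rewrite ?mul1r ?mul0r.
Qed.

(** All boxes of generation k or later over a cell of generation k lie in one
    Carleson box of comparable size.  By bounded overlap the sum of the
    level bounds is at most a constant times the measure of this box, that is,
    at most |Q| times the value of the Carleson functional anywhere on Q. *)
Lemma potential (s0 : R) (r k L : nat) i : 0 < s0 -> c ^+ 2 < 2 ^+ r ->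
  (\int[muX]_(x in [set x | qcell (s0 / 2 ^+ k) x = i]) (\sum_(k <= j < L) wavg (s0 / 2 ^+ j) x)%:E <=
   \int[muX]_(x in [set x | qcell (s0 / 2 ^+ k) x = i])
      (((2 * (c + 2)) ^+ n * r%:R * (2 * c + 5) ^+ n)%:E * carleson m x))%E.
Proof.
move=> s00 cr; set s := s0 / 2 ^+ k; set Q := [set x | _].
have pos j : 0 < s0 / 2 ^+ j by rewrite divr_gt0// exprn_gt0.
have sp : 0 < s by exact: pos.
have mQ : measurable Q by exact: measurable_qcell.
pose a := qpt s i - const_mx ((c + 2) * s); pose l := (2 * c + 5) * s.
have l0 : 0 < l by rewrite mulr_gt0//; have := c0; lra.
pose Ph := carleson_box a l.
have mPh : measurable Ph by exact: measurable_carleson_box.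
have sj j : (k <= j)%N -> s0 / 2 ^+ j <= s.
  by move=> kj; rewrite ler_pM2l// lef_pV2 ?posrE ?exprn_gt0// ler_weXn2l// ler1n.
have Qin x j : Q x -> qpt s i ord0 j <= x ord0 j < qpt s i ord0 j + s.
  by rewrite /Q qcellP// => /(_ j); rewrite !mxE.
have incl j x z : (k <= j)%N -> Q x -> wbox c (s0 / 2 ^+ j) (qcell (s0 / 2 ^+ j) x) z -> Ph z.
  move=> kj Qx /wboxP[/andP[h1 h2] h3]; have sjk := sj _ kj; have pj := pos j.
  have cs : c * (s0 / 2 ^+ j) <= c * s by rewrite ler_pM2l.
  split.
    rewrite (lt_le_trans _ h1) ?divr_gt0//=.
    apply: (le_lt_trans h2); apply: (le_lt_trans cs); rewrite /l ltr_pM2r//; have := c0; lra.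
  move=> o; have := h3 o; rewrite ler_distl => /andP[h4 h5].
  have /andP[h6 h7] := qcell_in x o pj; have /andP[h8 h9] := Qin _ o Qx.
  rewrite /a /l !mxE /=; rewrite /= in h4 h5.
  move: h4 h5 h6 h7 h8 h9 cs sjk; rewrite xcoordE !mxE; move=> *; lra.
have e1 : (\int[muX]_(x in Q) (\sum_(k <= j < L) wavg (s0 / 2 ^+ j) x)%:E <=
    ((2 * (c + 2)) ^+ n * r%:R)%:E * m Ph)%E.
  have mw j : measT (wavg (s0 / 2 ^+ j)).
    apply: (@adapted_measurable _ _ _ _ (qcell (s0 / 2 ^+ j))).
      by move=> ?; exact: measurable_qcell.
    by move=> x y; rewrite /wavg => ->.
  under eq_integral do rewrite -sumEFin.
  rewrite ge0_integral_sum//; last 2 first.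
  - by move=> j; apply/measurable_EFinP/measurable_funTS.
  - by move=> j x _; rewrite lee_fin wavg_ge0.
  pose st j (z : V) : R := (s0 / 2 ^+ j / c <= tcoord z <= c * (s0 / 2 ^+ j))%R%:R.
  have mst j : measurable_fun Ph (fun z => (st j z)%:E).
    apply/measurable_EFinP/measurable_funTS.
    rewrite (_ : st j = \1_(rV_coord (t0 n) @^-1` `[s0 / 2 ^+ j / c, c * (s0 / 2 ^+ j)])).
      apply: measurable_indic; rewrite -[X in measurable X]setTI.
      by apply: measurable_rV_coord => //; exact: measurable_itv.
    apply/funext => z; rewrite indicE; congr ((nat_of_bool _)%:R).
    by apply/idP/idP => h; [apply/mem_set; rewrite /= in_itv|have := set_mem h; rewrite /= in_itv].
  have C0 : 0 <= (2 * (c + 2)) ^+ n by rewrite exprn_ge0// mulr_ge0//; have := c0; lra.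
  apply: (@le_trans _ _ (\sum_(k <= j < L) (((2 * (c + 2)) ^+ n)%:E * \int[m]_(z in Ph) (st j z)%:E))%E).
    rewrite big_nat_cond [leRHS]big_nat_cond; apply: lee_sum => j /andP[/andP[kj _] _]; apply: level_bound => // x z Qx; exact: incl.
  rewrite -ge0_sume_distrr; last by move=> j _; apply: integral_ge0 => z _; rewrite lee_fin.
  rewrite -ge0_integral_sum//; last by move=> j z _; rewrite lee_fin.
  rewrite EFinM -muleA; apply: lee_wpmul2l; first by rewrite lee_fin.
  rewrite -integral_cst//; apply: ge0_le_integral => //.
  - by move=> z _; rewrite sumEFin lee_fin sumr_ge0.
  - by apply: emeasurable_sum.
  - by move=> z _; rewrite sumEFin lee_fin; exact: overlap.
apply: (le_trans e1).
have cl x : Q x -> (m Ph / (l ^+ n)%:E <= carleson m x)%E.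
  move=> Qx; apply: ereal_sup_ubound; exists a, l; split => //.
    move=> o; have /andP[h8 h9] := Qin _ o Qx; have := mulr_gt0 c0 sp.
    by rewrite /a /l !mxE in h8 h9 *; move=> ?; lra.
  by rewrite lebesgue_cube// ltW.
have K0 : 0 <= (2 * (c + 2)) ^+ n * r%:R * (2 * c + 5) ^+ n.
  by rewrite !mulr_ge0// exprn_ge0// ?mulr_ge0//; have := c0; lra.
have mC : measurable_fun Q (carleson m) by apply: measurable_funTS; exact: measurable_carleson.
rewrite (ge0_intZ muX mQ mC)//; last by move=> x _; exact: carleson_ge0.
have QV : ((s ^+ n)%:E <= muX Q)%E.
  by have := qcell_measure_ge 0 i sp; under eq_set do rewrite addr0.
have e2 : ((m Ph / (l ^+ n)%:E) * (s ^+ n)%:E <= \int[muX]_(x in Q) carleson m x)%E.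
  apply: (@le_trans _ _ (\int[muX]_(x in Q) (cst (m Ph / (l ^+ n)%:E) x))%E).
    by rewrite integral_cst//; apply: lee_wpmul2l => //; rewrite mule_ge0// inve_ge0 lee_fin exprn_ge0// ltW.
  apply: ge0_le_integral => //.
  by move=> x _; rewrite mule_ge0// inve_ge0 lee_fin exprn_ge0// ltW.
rewrite [in leRHS]EFinM -muleA; apply: lee_wpmul2l.
  by rewrite lee_fin mulr_ge0// exprn_ge0// mulr_ge0//; have := c0; lra.
apply: (@le_trans _ _ (((2 * c + 5) ^+ n)%:E * (m Ph / (l ^+ n)%:E * (s ^+ n)%:E)))%E; last first.
  by apply: lee_wpmul2l => //; rewrite lee_fin exprn_ge0//; have := c0; lra.
rewrite inver gt_eqF ?exprn_gt0// -muleA -EFinM muleCA -EFinM.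
have -> : (2 * c + 5) ^+ n * ((l ^+ n)^-1 * s ^+ n) = 1.
  by rewrite mulrCA -exprMn mulVf// expf_neq0// gt_eqF.
by rewrite mule1.
Qed.

Definition dyconst (r : nat) (p : R) : R :=
  2 * (p * (2 * p) `^ (p - 1)) * ((2 * (c + 2)) ^+ n * r%:R * (2 * c + 5) ^+ n) `^ p.

Lemma dyconst_ge0 r p : 1 < p -> 0 <= dyconst r p.
Proof.
move=> p1; have p0 : 0 < p by apply: lt_trans p1.
by rewrite mulr_ge0 ?powR_ge0// mulr_ge0// mulr_ge0 ?powR_ge0// ltW.
Qed.

Lemma measurable_wavg s : 0 < s -> measT (wavg s).
Proof.
move=> s0; apply: (@adapted_measurable _ _ _ _ (qcell s)).
  by move=> ?; exact: measurable_qcell.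
by move=> x y; rewrite /wavg => ->.
Qed.

Lemma dyadic_sum_le s0 (r L : nat) (p : R) : 1 < p -> 0 < s0 -> (0 < L)%N -> c ^+ 2 < 2 ^+ r ->
  (\int[muX]_x ((\sum_(j < L) wavg (s0 / 2 ^+ j) x) `^ p)%:E <=
    (dyconst r p)%:E * \int[muX]_x (carleson m x `^ p))%E.
Proof.
move=> p1 s00 L0 cr; have p0 : 0 < p by apply: lt_trans p1.
have pos j : 0 < s0 / 2 ^+ j by rewrite divr_gt0// exprn_gt0.
have mS : measT (fun x => ((\sum_(j < L) wavg (s0 / 2 ^+ j) x) `^ p)%:E).
  apply/measurable_EFinP; apply: (measurableT_comp (measurable_powR p)).
  by apply: measurable_sum => j; exact: measurable_wavg.
have mCp : measT (fun x => carleson m x `^ p)%E.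
  by apply: (measurable_poweRT p); exact: measurable_carleson.
rewrite -(ge0_intZ muX measurableT mCp); last 2 first.
- by move=> x _; exact: poweR_ge0.
- exact: dyconst_ge0.
apply: (@cells_integral_le _ _ _ _ _ (qcell s0)) => //.
- by move=> i; exact: measurable_qcell.
- by apply: emeasurable_funM.
- by move=> x _; rewrite lee_fin powR_ge0.
- by move=> x _; rewrite mule_ge0 ?poweR_ge0// lee_fin dyconst_ge0.
move=> i; rewrite setTI.
set CC := (2 * (c + 2)) ^+ n * r%:R * (2 * c + 5) ^+ n.
have CC0 : 0 <= CC by rewrite !mulr_ge0// exprn_ge0// ?mulr_ge0//; have := c0; lra.
pose B := [set x | qcell s0 x = i].
have mB : measurable B by exact: measurable_qcell.
have s01 : s0 / 2 ^+ 0 = s0 by rewrite expr0 divr1.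
pose big := cbox (rowtx (s0 / 2 ^+ L / c) (qpt s0 i - const_mx ((c + 2) * s0)))
   (rowtx (c * s0) (qpt s0 i + const_mx ((c + 3) * s0))).
have bigH : big `<=` @hspace R n.
  by move=> z /cbox_rowtx[/andP[h _] _]; apply: lt_le_trans h; rewrite divr_gt0.
have mbig : (m big < +oo)%E by apply: mfin => //; exact: compact_cbox.
have := @garsia _ _ R muX _ (fun k => qcell (s0 / 2 ^+ k)) (fun k => wavg (s0 / 2 ^+ k))
  (fun x => CC%:E * carleson m x)%E L p (\sum_(j < L) (fine (m big) / (s0 / 2 ^+ j) ^+ n)) B i p1 L0.
move=> H; apply: (le_trans (H _ _ _ _ _ _ _ _ _ _)) => {H}.
- by move=> k j; exact: measurable_qcell.
- move=> j k x y jk /(@qcell_nested _ _ (k - j) _ _ _ (pos k)).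
  have -> // : 2 ^+ (k - j) * (s0 / 2 ^+ k) = s0 / 2 ^+ j.
  rewrite -{2}(subnKC jk) exprD; field; rewrite !gt_eqF ?exprn_gt0//.
- by move=> j x y; rewrite /wavg => ->.
- by move=> k x; exact: wavg_ge0.
- by apply: emeasurable_funM => //; exact: measurable_carleson.
- by move=> x; rewrite mule_ge0 ?carleson_ge0// lee_fin.
- by rewrite s01.
- apply: (@le_lt_trans _ _ (muX (cbox (qpt s0 i) (qpt s0 i + const_mx s0)))).
    apply: le_measure; rewrite ?inE//; first by apply: compact_measurable_rV; exact: compact_cbox.
    by rewrite /B qcellP// => x h j; have /andP[-> /ltW ->] := h j.
  by apply: lebesgue_compact_fin; exact: compact_cbox.
- move=> x Bx; apply: ler_sum => j _; rewrite /wavg ler_pM2r ?invr_gt0 ?exprn_gt0//.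
  apply: fine_le; rewrite ?ge0_fin_numE//; first exact: wbox_fin.
  apply: le_measure; rewrite ?inE//; first exact: measurable_wbox.
    by apply: compact_measurable_rV; exact: compact_cbox.
  move=> z /wboxP[/andP[h1 h2] h3].
  have sj : s0 / 2 ^+ j <= s0 by rewrite ler_pdivrMr ?exprn_gt0// ler_peMr ?(ltW s00)// exprn_ege1// ler1n.
  have sL : s0 / 2 ^+ L <= s0 / 2 ^+ j.
    by rewrite ler_pM2l// lef_pV2 ?posrE ?exprn_gt0// ler_weXn2l ?ler1n// ltnW.
  have cs : c * (s0 / 2 ^+ j) <= c * s0 by rewrite ler_pM2l.
  apply/cbox_rowtx; split.
    by rewrite (le_trans _ h1)/= ?(le_trans h2)// ler_pM2r// invr_gt0.
  move=> o; have := h3 o; rewrite ler_distl => /andP[h4 h5].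
  have /andP[h6 h7] := qcell_in x o (pos j).
  have : hbox (qpt s0 i) (qpt s0 i + const_mx s0) x by rewrite -qcellP.
  move=> /(_ o) /andP[]; rewrite !mxE in h4 h5 h6 h7 *; rewrite /= => h8 h9; have := c0.
  by move: h4 h5 h6 h7 h8 h9 cs sj; move=> *; lra.
- by move=> k j _; exact: potential.
have mCB : measurable_fun B (fun x => carleson m x `^ p)%E by exact: measurable_funTS.
rewrite (ge0_intZ muX mB mCB) ?dyconst_ge0//; last by move=> x _; exact: poweR_ge0.
rewrite le_eqVlt; apply/orP; left; apply/eqP.
rewrite /dyconst -/CC [in RHS]EFinM -muleA; congr (_ * _)%E.
rewrite -(ge0_intZ muX mB mCB) ?powR_ge0//; last by move=> x _; exact: poweR_ge0.
by apply: eq_integral => x _; rewrite poweRM ?lee_fin ?carleson_ge0// poweR_EFin.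
Qed.

(** The sums over the generations from 2^M down to 2^(-M) increase with M, and
    the L^p bound is uniform in M and in the size of the coarsest cells, so
    monotone convergence gives one majorant for all of them. *)
Lemma dyadic_square (r : nat) (p : R) : 1 < p -> c ^+ 2 < 2 ^+ r -> exists A : X -> \bar R,
  [/\ measT A, forall x, (0 <= A x)%E,
      (\int[muX]_x A x <= (dyconst r p)%:E * \int[muX]_x (carleson m x `^ p))%E &
      forall M x, (((\sum_(j < M.*2.+1) wavg (2 ^+ M / 2 ^+ j) x) `^ p)%:E <= A x)%E].
Proof.
move=> p1 cr; have p0 : 0 < p by apply: lt_trans p1.
have pos M j : 0 < 2 ^+ M / 2 ^+ j :> R by rewrite divr_gt0// exprn_gt0.
pose S M x := \sum_(j < M.*2.+1) wavg (2 ^+ M / 2 ^+ j) x.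
have S0 M x : 0 <= S M x by apply: sumr_ge0 => j _; exact: wavg_ge0.
have SS M x : S M x <= S M.+1 x.
  have -> : S M.+1 x = wavg (2 ^+ M.+1 / 2 ^+ 0) x + S M x + wavg (2 ^+ M.+1 / 2 ^+ (M.*2.+2)) x.
    rewrite {1}/S doubleS big_ord_recr/= big_ord_recl; congr (_ + _ + _).
    apply: eq_bigr => j _; rewrite lift0 !exprS.
    by rewrite -mulf_div divff ?mul1r// gt_eqF.
  by rewrite addrAC lerDr addr_ge0// wavg_ge0.
pose g M x := (S M x `^ p)%:E.
have gnd x : {homo g ^~ x : a b / (a <= b)%N >-> (a <= b)%E}.
  apply/nondecreasing_seqP => M; rewrite lee_fin; apply: ge0_ler_powR; rewrite ?nnegrE ?(ltW p0)//.
have mg M : measT (g M).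
  apply/measurable_EFinP; apply: (measurableT_comp (measurable_powR p)).
  by apply: measurable_sum => j; exact: measurable_wavg.
have g0 M x : (0 <= g M x)%E by rewrite lee_fin powR_ge0.
have cg x : cvgn (g ^~ x) by exact: ereal_nondecreasing_is_cvgn (gnd x).
exists (fun x => limn (g ^~ x)); split.
- by apply: (@emeasurable_fun_cvg _ _ _ _ g) => // x _; exact: cg.
- by move=> x; apply: lime_ge => //; apply: nearW.
- rewrite monotone_convergence//.
  apply: lime_le.
    apply: ereal_nondecreasing_is_cvgn => a b ab; apply: ge0_le_integral => // x _; exact: gnd.
  by apply: nearW => M; exact: dyadic_sum_le.
- by move=> M x; apply: lime_ge => //; exists M => // N /= MN; exact: (gnd x).
Qed.
End potential.

(** * From dyadic oscillation to limits *)

Section chain.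
Context {R : realType}.
Variables (F s : R -> R) (C A : R).
Hypothesis C0 : 0 <= C.
Hypothesis s_ge0 : forall d : R, 0 < d -> 0 <= s d.
Hypothesis osc : forall d t t' : R, 0 < d -> d / 2 <= t <= d -> d / 2 <= t' <= d -> `|F t - F t'| <= C * s d.
Hypothesis sumA : forall M, \sum_(j < M.*2.+1) s (2 ^+ M / 2 ^+ j) <= A.

(** Adjacent dyadic ranges share an endpoint, through which the oscillations
    are chained. *)
Lemma chain_step (d t : R) k l : 0 < d -> (k <= l)%N -> d / 2 ^+ l <= t <= d / 2 ^+ k ->
  `|F t - F (d / 2 ^+ k)| <= C * \sum_(k <= j < l) s (d / 2 ^+ j).
Proof.
move=> d0; elim: l t => [|l IH] t.
  by rewrite leqn0 => /eqP -> /le_anti <-; rewrite subrr normr0 big_geq// mulr0.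
rewrite leq_eqVlt => /orP[/eqP -> /le_anti <-|]; first by rewrite subrr normr0 big_geq// mulr0.
rewrite ltnS => kl /andP[h1 h2].
have dl : 0 < d / 2 ^+ l by rewrite divr_gt0// exprn_gt0.
rewrite big_nat_recr//= mulrDr.
have [h|h] := leP (d / 2 ^+ l) t.
  apply: (le_trans (IH _ kl _)); first by rewrite h.
  by rewrite lerDl mulr_ge0// s_ge0.
have dk : d / 2 ^+ l <= d / 2 ^+ l <= d / 2 ^+ k.
  by rewrite lexx/= ler_pM2l// lef_pV2 ?posrE ?exprn_gt0// ler_weXn2l ?ler1n.
have e1 := IH _ kl dk.
have e2 : `|F t - F (d / 2 ^+ l)| <= C * s (d / 2 ^+ l).
  have hh : d / 2 ^+ l / 2 = d / 2 ^+ l.+1 by rewrite exprSr invfM mulrA.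
  apply: osc => //; first by rewrite hh h1 ltW.
  by rewrite lexx andbT ler_pdivrMr// ler_pMr// ler1n.
rewrite [leRHS]addrC; apply: le_trans (lerD e2 e1).
by rewrite -[X in `|X| <= _](subrKA (F (d / 2 ^+ l))) ler_normD.
Qed.

Lemma pow2_large (x : R) : exists M : nat, x <= 2 ^+ M.
Proof.
exists (Num.trunc `|x|).+1; apply: (le_trans (ler_norm _)).
apply: (@le_trans _ _ (Num.trunc `|x|).+1%:R); first exact/ltW/truncnS_gt.
by rewrite -natrX ler_nat ltnW// ltn_expl.
Qed.

Lemma pow2_small (x : R) : 0 < x -> exists M : nat, (2 ^+ M)^-1 <= x.
Proof.
move=> x0; have [M h] := pow2_large x^-1; exists M.
by rewrite invf_ple ?posrE ?exprn_gt0.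
Qed.

Lemma chain_bound (t t' : R) : 0 < t -> 0 < t' -> `|F t - F t'| <= 2 * C * A.
Proof.
move=> t0 t'0.
have [m1 h1] := pow2_large t; have [m2 h2] := pow2_large t'.
have [m3 h3] := pow2_small t0; have [m4 h4] := pow2_small t'0.
(* The dyadic range from 2^(-M) to 2^M contains both heights. *)
pose M := maxn (maxn m1 m2) (maxn m3 m4).
have key u m m' : (m <= M)%N -> (m' <= M)%N -> u <= 2 ^+ m -> (2 ^+ m')^-1 <= u ->
    `|F u - F (2 ^+ M / 2 ^+ 0)| <= C * A.
  move=> mM m'M hu hu'.
  have d0 : 0 < 2 ^+ M :> R by rewrite exprn_gt0.
  have := @chain_step (2 ^+ M) u 0 M.*2 d0 (leq0n _) _.
  move=> H; apply: (le_trans (H _)); last first.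
    rewrite ler_wpM2l//; apply: le_trans (sumA M).
    rewrite big_mkord big_ord_recr/= lerDl s_ge0// divr_gt0// exprn_gt0//.
  rewrite expr0 divr1; apply/andP; split.
    apply: le_trans hu'; rewrite -addnn exprD invfM mulrA divff ?gt_eqF// mul1r.
    by rewrite lef_pV2 ?posrE ?exprn_gt0// ler_weXn2l// ler1n.
  by apply: (le_trans hu); rewrite ler_weXn2l// ler1n.
have k1 := key t m1 m3 _ _ h1 h3; have k2 := key t' m2 m4 _ _ h2 h4.
have {}k1 : `|F t - F (2 ^+ M / 2 ^+ 0)| <= C * A by apply: k1; rewrite /M !leq_max leqnn ?orbT.
have {}k2 : `|F t' - F (2 ^+ M / 2 ^+ 0)| <= C * A by apply: k2; rewrite /M !leq_max leqnn ?orbT.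
rewrite distrC in k2; have := lerD k1 k2.
have -> : C * A + C * A = 2 * C * A by ring.
move=> H; apply: le_trans H.
by rewrite -[X in `|X| <= _](subrKA (F (2 ^+ M / 2 ^+ 0))) ler_normD.
Qed.

Lemma chain_cvg : cvg (F t @[t --> 0^'+]).
Proof.
pose S L := \sum_(j < L) s (1 / 2 ^+ j).
have pos j : 0 < 1 / 2 ^+ j :> R by rewrite divr_gt0// exprn_gt0.
have SA L : S L <= A.
  apply: le_trans (sumA L); rewrite /S.
  rewrite -(big_mkord predT (fun j => s (2 ^+ L / 2 ^+ j))) (@big_cat_nat _ _ _ L)//=; last by rewrite -addnn ltnW// ltnS leq_addr.
  rewrite -[leLHS]add0r lerD//; first by apply: sumr_ge0 => j _; rewrite s_ge0// divr_gt0// exprn_gt0.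
  rewrite -[X in \sum_(X <= _ < _) _]add0n big_addn -addnn -addSn addnK big_mkord big_ord_recr/= -[leLHS]addr0 lerD//; last first.
    by rewrite s_ge0// divr_gt0// exprn_gt0.
  apply: ler_sum => j _; rewrite exprD invfM.
  by rewrite mulrCA divff ?mulr1 ?div1r// gt_eqF// exprn_gt0.
have Snd : nondecreasing_seq S.
  by apply/nondecreasing_seqP => L; rewrite /S big_ord_recr/= lerDl s_ge0.
have cS : cvgn S.
  apply: nondecreasing_is_cvgn => //; exists A => _ [L _ <-]; exact: SA.
apply: cauchy_cvg; apply: cauchy_exP => e e0.
have e1 : 0 < e / (C + 1) by rewrite divr_gt0// ltr_wpDl.
have [k _ hk] : \forall k \near \oo, `|limn S - S k| < e / (C + 1).
  by move/cvgrPdist_lt : cS => /(_ _ e1).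
exists (F (1 / 2 ^+ k)).
suff : \forall t \near 0^'+, ball (F (1 / 2 ^+ k)) e (F t) by [].
near=> t.
have t0 : 0 < t by near: t; exact: nbhs_right_gt.
have tk : t <= 1 / 2 ^+ k.
  by near: t; exact: nbhs_right_le.
have [l hl] := pow2_small t0.
pose l' := maxn l k.
have hl' : 1 / 2 ^+ l' <= t.
  by rewrite div1r; apply: le_trans hl; rewrite lef_pV2 ?posrE ?exprn_gt0// ler_weXn2l ?ler1n// leq_maxl.
have := @chain_step 1 t k l' ltr01 (leq_maxr _ _); rewrite hl' tk => /(_ isT) h.
rewrite /ball/= distrC; apply: (le_lt_trans h).
have -> : \sum_(k <= j < l') s (1 / 2 ^+ j) = S l' - S k.
  rewrite /S -!(big_mkord predT (fun j => s (1 / 2 ^+ j))) (@big_cat_nat _ _ _ k 0 l')//= ?leq_maxr//.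
  by rewrite addrAC subrr add0r.
have h1 := hk k (leqnn k); have h2 : S l' <= limn S by exact: nondecreasing_cvgn_le.
have h3 := le_lt_trans (ler_norm _) h1.
apply: (@le_lt_trans _ _ (C * (limn S - S k))).
  by rewrite ler_wpM2l// lerB.
have h4 : S k <= limn S by exact: nondecreasing_cvgn_le.
apply: (@le_lt_trans _ _ ((C + 1) * (limn S - S k))); first by rewrite ler_wpM2r ?subr_ge0// lerDl.
by rewrite mulrC -ltr_pdivlMr// ltr_wpDl.
Unshelve. all: by end_near. Qed.

Lemma chain_le (t : R) : F t @[t --> +oo] --> 0 -> 0 < t -> `|F t| <= 2 * C * A.
Proof.
move=> F0 t0; apply/ler_addgt0Pr => e e0.
have [t' t'0 h] : exists2 t', 0 < t' & `|F t'| <= e.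
  have /cvgrPdist_le /(_ e e0) h : F t @[t --> +oo] --> 0 by exact: F0.
  near (pinfty_nbhs R) => u; exists u; first by near: u; exact: nbhs_pinfty_gt.
  by rewrite -normrN -[- _]add0r; near: u.
apply: le_trans (lerD (chain_bound t0 t'0) h).
rewrite -[X in `|X| <= _](subrK (F t')); exact: ler_normD.
Unshelve. all: by end_near. Qed.

Lemma chain_lim : F t @[t --> +oo] --> 0 -> `|lim (F t @[t --> 0^'+])| <= 2 * C * A.
Proof.
move=> F0; have cF := chain_cvg.
have h : `|F t| @[t --> 0^'+] --> `|lim (F t @[t --> 0^'+])| by apply: cvg_norm.
rewrite -(cvg_lim (@Rhausdorff R) h); apply: limr_le; first by apply/cvg_ex; eexists; exact: h.
near=> t; apply: chain_le => //; near: t; exact: nbhs_right_gt.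
Unshelve. all: by end_near. Qed.
End chain.

Section lnorm.
Context d (T : measurableType d) (R : realType) (mu : {measure set T -> \bar R}).
Implicit Types (f g : T -> \bar R) (p C : R).

Lemma Lnorm_fin f p : 0 < p -> ('N[mu]_p%:E[f] < +oo)%E <-> (\int[mu]_x (`|f x| `^ p) < +oo)%E.
Proof.
move=> p0; have p0' : p != 0 by rewrite gt_eqF.
rewrite -poweR_Lnorm//; have := Lnorm_ge0 mu p%:E f.
by case: ('N[mu]_p%:E[f])%E => [r r0|_|//]; rewrite ?poweR_EFin ?ltry// poweRyr.
Qed.

Lemma Lnorm_le f g p C : 0 < p -> 0 <= C ->
  (\int[mu]_x (`|f x| `^ p) <= C%:E * \int[mu]_x (`|g x| `^ p))%E ->
  ('N[mu]_p%:E[f] <= (C `^ p^-1)%:E * 'N[mu]_p%:E[g])%E.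
Proof.
move=> p0 C0 h; have p0' : p != 0 by rewrite gt_eqF.
have pi : 0 < p^-1 by rewrite invr_gt0.
have i0 (k : T -> \bar R) : (0 <= \int[mu]_x (`|k x| `^ p))%E by apply: integral_ge0 => x _; exact: poweR_ge0.
rewrite unlock -poweR_EFin -poweRM ?lee_fin//.
apply: gt0_ler_poweR => //; [exact: ltW| |]; rewrite in_itv/= leey andbT//.
by rewrite mule_ge0// lee_fin.
Qed.

Lemma mulEFin_lty (k : R) (x : \bar R) : (0 <= x)%E -> (x < +oo)%E -> (k%:E * x < +oo)%E.
Proof. by case: x => [a _ _||] //; rewrite -EFinM ltry. Qed.

Lemma integral_poweR_ge0 (D : set T) f p : (0 <= \int[mu]_(x in D) (f x `^ p))%E.
Proof. by apply: integral_ge0 => x _; exact: poweR_ge0. Qed.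
End lnorm.

Lemma dist_half (R : realType) (L a b K : R) : `|L - a| < K / 2 -> `|L - b| < K / 2 -> `|a - b| <= K.
Proof.
rewrite !ltr_norml => /andP[? ?] /andP[? ?]; rewrite ler_norml; apply/andP; split; lra.
Qed.

Lemma dist_tri3 (R : realType) (a b t t' K e : R) :
  `|a - t| <= e / 2 -> `|b - t'| <= e / 2 -> `|a - b| <= K -> `|t - t'| <= K + e.
Proof.
rewrite !ler_norml => /andP[? ?] /andP[? ?] /andP[? ?]; apply/andP; split; lra.
Qed.

(** * Measurability of a limit at zero *)

Section measurable_limit.
Context d (T : measurableType d) (R : realType).
Variable F : R -> T -> R.
Hypothesis mF : forall t : R, 0 < t -> measT (F t).
Hypothesis Frat : forall (t e a : R) x, 0 < t -> 0 < e -> 0 < a ->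
  exists q : rat, [/\ 0 < ratr q :> R, t - a < ratr q < t & `|F (ratr q) x - F t x| <= e].

(** Rational parameters suffice in the Cauchy criterion, since values at rational
    points to the left approximate F at every t. *)
Definition osc_le (k m : nat) : set T := \bigcap_(q in [set q : rat * rat |
    0 < (ratr q.1 : R) < m.+1%:R^-1 /\ 0 < (ratr q.2 : R) < m.+1%:R^-1])
  [set x | `|F (ratr q.1) x - F (ratr q.2) x| <= k.+1%:R^-1].

Lemma osc_leP k m x : osc_le k m x <->
  forall t t' : R, 0 < t < m.+1%:R^-1 -> 0 < t' < m.+1%:R^-1 -> `|F t x - F t' x| <= k.+1%:R^-1.
Proof.
split=> [h t t' /andP[t0 tm] /andP[t'0 t'm]|h]; last by move=> [q q'] /= [h1 h2]; exact: h.
apply/ler_addgt0Pr => e e0.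
have e2 : 0 < e / 2 by rewrite divr_gt0.
have [q [q0 /andP[_ qt] hq]] := Frat x t0 e2 t0.
have [q' [q'0 /andP[_ qt'] hq']] := Frat x t'0 e2 t'0.
have := h (q, q'); rewrite /= q0 q'0 (lt_trans qt) ?(lt_trans qt')// => /(_ (conj isT isT)).
exact: dist_tri3 hq hq'.
Qed.

Lemma measurable_osc_le k m : measurable (osc_le k m).
Proof.
rewrite -[osc_le k m]setCK; apply: measurableC; rewrite /osc_le setC_bigcap bigcup_mkcond.
apply: countable_bigcupT_measurable => // -[q q']; case: ifPn => // /set_mem /= [/andP[q0 _] /andP[q'0 _]].
apply: measurableC.
have mm : measT (fun x => `|F (ratr q) x - F (ratr q') x|).
  by apply: measurableT_comp => //; apply: measurable_funB; exact: mF.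
have := mm measurableT `]-oo, k.+1%:R^-1]%classic (measurable_itv _); rewrite setTI.
by congr (measurable _); apply/seteqP; split => x /=; rewrite in_itv.
Qed.

Lemma cvg_osc x : cvg (F t x @[t --> 0^'+]) <-> (\bigcap_k \bigcup_m osc_le k m) x.
Proof.
split=> [cF k _|h].
  have k0 : 0 < k.+1%:R^-1 / 2 :> R by rewrite divr_gt0.
  have /cvgrPdist_lt /(_ _ k0) H : F t x @[t --> 0^'+] --> lim (F t x @[t --> 0^'+]) by exact: cF.
  have [e /= e0 he] : exists2 e : R, 0 < e & forall t, 0 < t < e -> `|lim (F t x @[t --> 0^'+]) - F t x| < k.+1%:R^-1 / 2.
    have [e /= e0 he] := H; exists e => // t /andP[t0 te]; apply: he => //.
    by rewrite /ball_/= sub0r normrN gtr0_norm.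
  have [m hm] : exists m : nat, m.+1%:R^-1 < e.
    exists (Num.trunc e^-1); rewrite invf_plt ?posrE//; exact: truncnS_gt.
  exists m => //; apply/osc_leP => t t' /andP[t0 tm] /andP[t'0 t'm].
  have h1 := he t; have h2 := he t'.
  rewrite t0 (lt_trans tm hm) in h1; rewrite t'0 (lt_trans t'm hm) in h2.
  exact: dist_half (h1 isT) (h2 isT).
apply: cauchy_cvg; apply: cauchy_exP => e e0.
have [k hk] : exists k : nat, k.+1%:R^-1 < e.
  exists (Num.trunc e^-1); rewrite invf_plt ?posrE//; exact: truncnS_gt.
have [m _ /osc_leP hm] := h k I.
exists (F (m.+2%:R^-1) x).
suff : \forall t \near 0^'+, ball (F (m.+2%:R^-1) x) e (F t x) by [].
near=> t; rewrite /ball/=; apply: le_lt_trans hk; apply: hm.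
  by rewrite invr_gt0 ltr0n/= ltf_pV2 ?posrE ?ltr0n// ltr_nat.
apply/andP; split; first by near: t; exact: nbhs_right_gt.
near: t; apply: nbhs_right_lt; by rewrite invr_gt0.
Unshelve. all: by end_near. Qed.

Lemma measurable_cvg_at0 : measurable [set x | cvg (F t x @[t --> 0^'+])].
Proof.
rewrite (_ : [set x | _] = \bigcap_k \bigcup_m osc_le k m).
  apply: bigcapT_measurable => k.
  by apply: bigcup_measurable => m _; exact: measurable_osc_le.
by apply/seteqP; split => x /cvg_osc.
Qed.

Lemma measurable_lim_at0 : measT (fun x => (lim (F t x @[t --> 0^'+]))%:E).
Proof.
set Q := [set x | cvg (F t x @[t --> 0^'+])].
have mQ : measurable Q := measurable_cvg_at0.
pose g (j : nat) (x : T) := (F (j.+1%:R^-1) x * \1_Q x + (point : R) * \1_(~` Q) x)%:E.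
apply: (@emeasurable_fun_cvg _ _ _ _ g).
  have m1 : measT (\1_Q : T -> R) by exact: measurable_indic.
  have m2 : measT (\1_(~` Q) : T -> R) by apply: measurable_indic; exact: measurableC.
  move=> j; have m3 : measT (F (j.+1%:R^-1)) by apply: mF; rewrite invr_gt0.
  by apply/measurable_EFinP; apply: measurable_funD; apply: measurable_funM.
move=> x _; apply: cvg_EFin; first exact: nearW.
have [Qx|nQx] := pselect (Q x).
  have -> : fine \o g^~ x = fun j => F (j.+1%:R^-1) x.
    apply/funext => j; rewrite /g /= !indicE mem_set// memNset; last by move=> /(_ Qx).
    by rewrite mulr1 mulr0 addr0.
  apply: (@cvg_comp _ _ _ (fun j : nat => j.+1%:R^-1 : R) (fun t => F t x) _ (0^'+)); last exact: Qx.
  move=> A [e /= e0 he]; have /cvgrPdist_lt /(_ e e0) := @cvg_harmonic R.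
  by apply: filterS => j hj; apply: he => //=; rewrite invr_gt0.
have -> : lim (F t x @[t --> 0^'+]) = point by apply: dvgP.
have -> : fine \o g^~ x = fun j => point.
  apply/funext => j; rewrite /g /= !indicE memNset// mem_set//.
  by rewrite mulr1 mulr0 add0r.
exact: cvg_cst.
Qed.
End measurable_limit.

(** * Whitney averages and the trace estimate *)

Section whitney.
Context {R : realType} (n : nat) (c0 c1 : R).
Hypotheses (hc0 : 1 < c0) (hc1 : 0 < c1).
Local Notation X := ('rV[R]_n).
Local Notation V := ('rV[R]_(1 + n)).
Local Notation mu := (lebesgue_rV (1 + n)).
Local Notation H := (@hspace R n).
Let c00 : 0 < c0. Proof. exact: lt_trans hc0. Qed.

Definition wc : R := 2 * c0 + c1 + 1.

Lemma wc_ge1 : 1 <= wc. Proof. rewrite /wc; have := c00; have := hc1; lra. Qed.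

Lemma whitneyP (t : R) (x : X) z : 0 < t ->
  whitney c0 c1 t x z <-> (c0^-1 * t < tcoord z < c0 * t /\ enorm (xcoord z - x) < c1 * t).
Proof. by move=> t0; rewrite /whitney /= ltr_pdivlMr// ltr_pdivrMr. Qed.

Lemma whitney_hspace (t : R) (x : X) : 0 < t -> whitney c0 c1 t x `<=` H.
Proof. by move=> t0 z /whitneyP-/(_ t0)[/andP[h _] _]; apply: lt_trans h; rewrite mulr_gt0// invr_gt0. Qed.

Lemma whitney_wbox (s t : R) (x : X) : 0 < s -> s / 2 <= t <= s -> whitney c0 c1 t x `<=` wbox wc s (qcell s x).
Proof.
move=> s0 /andP[h1 h2] z; have t0 : 0 < t by apply: lt_le_trans h1; rewrite divr_gt0.
have hc00 := c00.
have w0 : 0 < wc by apply: lt_le_trans wc_ge1.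
move=> /whitneyP-/(_ t0)[/andP[h3 h4] h5]; apply/wboxP; split.
  apply/andP; split.
    apply: le_trans (ltW h3); rewrite ler_pdivrMr//.
    apply: (@le_trans _ _ (c0^-1 * t * (2 * c0))).
      have -> : c0^-1 * t * (2 * c0) = t * 2 by field; rewrite gt_eqF.
      by rewrite -ler_pdivrMr.
    by rewrite ler_pM2l ?mulr_gt0 ?invr_gt0// /wc; have := hc1; lra.
  apply: (le_trans (ltW h4)); apply: (@le_trans _ _ (c0 * s)); first by rewrite ler_pM2l.
  by rewrite ler_pM2r// /wc; have := hc1; lra.
move=> j; have /andP[h6 h7] := qcell_in x j s0.
have h8 : `|xcoord z ord0 j - x ord0 j| <= enorm (xcoord z - x).
  by have := coord_le_enorm (xcoord z - x) j; rewrite !mxE.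
have h9 := le_lt_trans h8 h5.
have h10 : c1 * t <= c1 * s by rewrite ler_pM2l.
have h11 : 0 < c0 * s by rewrite mulr_gt0.
suff aux (A B D : R) : `|A - B| < c1 * t -> D <= B -> B < D + s -> `|A - D| <= wc * s by exact: aux h9 h6 h7.
rewrite ltr_norml => /andP[? ?] ? ?; rewrite ler_norml /wc; apply/andP; split; lra.
Qed.

Lemma continuous_dist2 (x : X) : continuous (fun z : V => \sum_i (z ord0 (rshift 1 i) - x ord0 i) ^+ 2).
Proof.
have oT : open [set: V] by exact: openT.
move=> z; have : C1_on setT (fun z : V => \sum_i (z ord0 (rshift 1 i) - x ord0 i) ^+ 2).
  apply: C1_sum => // i.
  have hh : C1_on setT (fun z : V => z ord0 (rshift 1 i) - x ord0 i).
    by apply: C1_add => //; [exact: C1_coord|exact: C1_cst].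
  rewrite (_ : (fun z => _) = (fun z : V => (z ord0 (rshift 1 i) - x ord0 i) * (z ord0 (rshift 1 i) - x ord0 i))).
    exact: C1_mul.
  by apply/funext => w; rewrite expr2.
by move/C1_on_cont => /(_ z I).
Qed.

Lemma enorm_lt m (v : 'rV[R]_m) (r : R) : 0 <= r -> (enorm v < r) = (\sum_i v ord0 i ^+ 2 < r ^+ 2).
Proof. by move=> r0; rewrite -enorm_sqr ltr_sqr ?nnegrE ?enorm_ge0. Qed.

Lemma open_whitney (t : R) (x : X) : 0 < t -> open (whitney c0 c1 t x).
Proof.
move=> t0; have ct : 0 < c1 * t by rewrite mulr_gt0.
rewrite (_ : whitney _ _ _ _ = (@tcoord R n) @^-1` `]c0^-1 * t, c0 * t[ `&`
   (fun z : V => \sum_i (z ord0 (rshift 1 i) - x ord0 i) ^+ 2) @^-1` `]-oo, (c1 * t) ^+ 2[).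
  apply: openI; apply: open_comp => //.
  - by move=> z _; exact: coord_continuous.
  - by move=> z _; exact: continuous_dist2.
apply/seteqP; split => z; rewrite /= !in_itv/= => hz.
  move/whitneyP : hz => /(_ t0)[h1 h2]; split => //.
  move: h2; rewrite enorm_lt ?(ltW ct)//; congr (_ < _); apply: eq_bigr => i _.
  by rewrite !mxE.
apply/whitneyP => //; split; first by case: hz.
case: hz => _; rewrite enorm_lt ?(ltW ct)//; congr (_ < _); apply: eq_bigr => i _.
by rewrite !mxE.
Qed.

Lemma measurable_whitney (t : R) (x : X) : 0 < t -> measurable (whitney c0 c1 t x).
Proof. by move=> t0; apply: open_measurable_rV; exact: open_whitney. Qed.

Lemma whitney_compact (t : R) (x : X) : 0 < t ->
  exists K, [/\ compact K, K `<=` H & whitney c0 c1 t x `<=` K].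
Proof.
move=> t0; exists (wbox wc t (qcell t x)); split.
- exact: compact_cbox.
- by apply: wbox_hspace => //; apply: lt_le_trans wc_ge1.
- by apply: whitney_wbox => //; rewrite lexx andbT ler_pdivrMr// ler_pMr// ler1n.
Qed.

Definition wk : R := Num.min (c0 - 1) (c1 / n.+1%:R).

Lemma wk_gt0 : 0 < wk.
Proof. by rewrite lt_min subr_gt0 hc0 divr_gt0. Qed.

Lemma whitney_ge (t : R) (x : X) : 0 < t -> (((wk * t) ^+ (1 + n))%:E <= mu (whitney c0 c1 t x))%E.
Proof.
move=> t0; have hc00 := c00; have k0 := wk_gt0.
pose a := rowtx t x; pose b := rowtx (c0 * t) (x + const_mx (c1 / n.+1%:R * t)).
apply: (@le_trans _ _ (mu (obox a b))); last first.
  apply: le_measure; rewrite ?inE; [exact: measurable_obox|exact: measurable_whitney|].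
  move=> z /obox_rowtx[/andP[h1 h2] h3]; apply/whitneyP => //; split.
    by rewrite h2 andbT; apply: lt_trans h1; rewrite gtr_pMl// invf_lt1.
  have ct : 0 < c1 * t by rewrite mulr_gt0.
  apply: (le_lt_trans (enorm_le_sum _)).
  apply: (@le_lt_trans _ _ (\sum_(i < n) c1 / n.+1%:R * t)).
    apply: ler_sum => i _; have := h3 i; rewrite !mxE => /andP[h4 h5].
    by rewrite ger0_norm ?subr_ge0 ?(ltW h4)// lerBlDl ltW.
  rewrite sumr_const card_ord -[_ *+ n]mulr_natl.
  have -> : n%:R * (c1 / n.+1%:R * t) = c1 * t * (n%:R / n.+1%:R) by ring.
  by rewrite gtr_pMr// ltr_pdivrMr// mul1r ltr_nat.
have -> := lebesgue_obox a b.
rewrite lee_fin -[X in _ ^+ X]card_ord -prodr_const.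
apply: ler_prod => i _; rewrite mulr_ge0 ?(ltW k0) ?(ltW t0)//=.
rewrite le_max; apply/orP; right.
case: (split_ordP i) => j ->.
  rewrite /a /b (ord1 j) !rowtxE0.
  have : wk <= c0 - 1 by rewrite /wk ge_min lexx.
  by move=> h; rewrite -[X in _ <= _ - X]mul1r -mulrBl ler_pM2r.
rewrite /a /b !rowtxES !mxE addrAC subrr add0r ler_pM2r//.
by rewrite /wk ge_min lexx orbT.
Qed.

Lemma whitney_fin (t : R) (x : X) : 0 < t -> (mu (whitney c0 c1 t x) < +oo)%E.
Proof.
move=> t0; have [K [cK KH WK]] := whitney_compact x t0.
apply: le_lt_trans (lebesgue_compact_fin cK).
by apply: le_measure; rewrite ?inE//; [exact: measurable_whitney|exact: compact_measurable_rV].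
Qed.

Lemma whitney_fine_ge (t : R) (x : X) : 0 < t -> (wk * t) ^+ (1 + n) <= fine (mu (whitney c0 c1 t x)).
Proof.
move=> t0; rewrite -lee_fin fineK; first exact: whitney_ge.
by rewrite ge0_fin_numE//; exact: whitney_fin.
Qed.

Lemma whitney_fine_gt0 (t : R) (x : X) : 0 < t -> 0 < fine (mu (whitney c0 c1 t x)).
Proof.
by move=> t0; apply: lt_le_trans (whitney_fine_ge x t0); rewrite exprn_gt0// mulr_gt0// wk_gt0.
Qed.

(** The Poincare constant of the enclosing box, whose sides are at most 2 wc s,
    divided by a lower bound for the product of the two volumes. *)
Definition wosc : R := (8 * wc) ^+ (1 + n) * ((1 + n)%:R * (2 * wc)) / ((wk / 2) ^+ (1 + n)) ^+ 2.

Lemma wosc_ge0 : 0 <= wosc.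
Proof.
have := wk_gt0; have := wc_ge1; move=> h1 h2.
by rewrite divr_ge0// ?sqr_ge0// mulr_ge0 ?exprn_ge0// ?mulr_ge0//; lra.
Qed.

(** Both regions are contained in one box of size s, and their volumes are
    comparable with s^(1+n). *)
Lemma whitney_osc (u : V -> R) nu (m : {sigma_finite_measure set V -> \bar R}) (s t t' : R) (x : X) :
  L1loc u -> is_gradient u nu ->
  (forall K, compact K -> K `<=` H -> m K = vm_total_variation nu K) ->
  0 < s -> s / 2 <= t <= s -> s / 2 <= t' <= s ->
  `|whitney_avg c0 c1 u t x - whitney_avg c0 c1 u t' x| <= wosc * wavg m wc s x.
Proof.
move=> uL gu mE s0 ht ht'.
have pos r : s / 2 <= r <= s -> 0 < r by move=> /andP[h _]; apply: lt_le_trans h; rewrite divr_gt0.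
have t0 := pos _ ht; have t'0 := pos _ ht'.
have w0 : 0 < wc by apply: lt_le_trans wc_ge1.
set i := qcell s x.
pose a := rowtx (s / wc) (qpt s i - const_mx (wc * s)).
pose b := rowtx (wc * s) (qpt s i + const_mx (wc * s)).
have w1 : 1 < wc by rewrite /wc; have := hc0; have := hc1; lra.
have wcs : s / wc < wc * s.
  apply: (@lt_trans _ _ s); first by rewrite ltr_pdivrMr// ltr_pMr.
  by rewrite ltr_pMl.
have sw : 0 < s / wc by rewrite divr_gt0.
have ws : 0 < wc * s by rewrite mulr_gt0.
have ltab o : a ord0 o < b ord0 o <= a ord0 o + 2 * (wc * s).
  case: (split_ordP o) => j ->.
    rewrite /a /b (ord1 j) !rowtxE0; apply/andP; split; last by lra.
    exact: wcs.
  by rewrite /a /b !rowtxES !mxE; apply/andP; split; lra.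
have bH : cbox a b `<=` H by exact: wbox_hspace.
have := @poincare_box R n u nu a b (whitney c0 c1 t x) (whitney c0 c1 t' x) uL gu
  (fun o => proj1 (andP (ltab o))) bH (@open_whitney t x t0) (@open_whitney t' x t'0)
  (@whitney_wbox s t x s0 ht) (@whitney_wbox s t' x s0 ht').
rewrite -mE//; last exact: compact_cbox.
rewrite /whitney_avg; set A := \int[_]_(z in _) u z; set B := \int[_]_(z in _) u z.
set v := fine (mu (whitney c0 c1 t x)); set v' := fine (mu (whitney c0 c1 t' x)); set T := fine (m _) => h.
have vp : 0 < v by exact: whitney_fine_gt0.
have v'p : 0 < v' by exact: whitney_fine_gt0.
have -> : v^-1 * A - v'^-1 * B = (v' * A - v * B) / (v * v') by field; rewrite !gt_eqF.
rewrite normrM normfV (gtr0_norm (mulr_gt0 vp v'p)) ler_pdivrMr ?mulr_gt0//.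
apply: (le_trans h).
have T0 : 0 <= T by exact: fine_ge0.
have hP : \prod_i (4 * (b ord0 i - a ord0 i)) <= (8 * wc * s) ^+ (1 + n).
  rewrite -[X in _ ^+ X]card_ord -prodr_const; apply: ler_prod => o _.
  have /andP[? ?] := ltab o; apply/andP; split; lra.
have hS : \sum_i (b ord0 i - a ord0 i) <= (1 + n)%:R * (2 * wc * s).
  rewrite mulr_natl -[X in _ *+ X]card_ord -sumr_const; apply: ler_sum => o _.
  have /andP[? ?] := ltab o; lra.
have S0 : 0 <= \sum_i (b ord0 i - a ord0 i).
  by apply: sumr_ge0 => o _; have /andP[? ?] := ltab o; lra.
have P0 : 0 <= \prod_i (4 * (b ord0 i - a ord0 i)).
  by apply: prodr_ge0 => o _; have /andP[? ?] := ltab o; lra.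
apply: (@le_trans _ _ ((8 * wc * s) ^+ (1 + n) * (((1 + n)%:R * (2 * wc * s)) * T))).
  apply: ler_pM => //; first by rewrite mulr_ge0.
  by rewrite ler_wpM2r.
have k0 := wk_gt0.
have hv r : s / 2 <= r <= s -> (wk / 2 * s) ^+ (1 + n) <= fine (mu (whitney c0 c1 r x)).
  move=> hr; apply: le_trans (whitney_fine_ge x (pos _ hr)).
  move/andP : hr => [hr _]; apply: lerXn2r; rewrite ?nnegrE.
  - by rewrite mulr_ge0 ?divr_ge0// ltW.
  - by rewrite mulr_ge0 ?(ltW k0)//; apply: le_trans hr; rewrite divr_ge0// ltW.
  by rewrite mulrAC -mulrA ler_pM2l.
apply: (@le_trans _ _ (wosc * wavg m wc s x * ((wk / 2 * s) ^+ (1 + n) * (wk / 2 * s) ^+ (1 + n)))); last first.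
  apply: ler_wpM2l; first by rewrite mulr_ge0 ?wosc_ge0// wavg_ge0.
  have q0 : 0 <= (wk / 2 * s) ^+ (1 + n) by rewrite exprn_ge0// mulr_ge0 ?divr_ge0// ltW.
  by apply: ler_pM => //; exact: hv.
rewrite /wosc /wavg -/i -/T le_eqVlt; apply/orP; left; apply/eqP.
rewrite !exprMn !exprS !expr0.
have sn : s ^+ n != 0 by rewrite expf_neq0// gt_eqF.
have kn : (wk / 2) ^+ n != 0 by rewrite expf_neq0// gt_eqF// divr_gt0.
have k1 : wk != 0 by rewrite gt_eqF.
have s1 : s != 0 by rewrite gt_eqF.
rewrite !exprMn in kn *.
move: kn; rewrite mulf_eq0 negb_or => /andP[kn kn'].
by field; rewrite sn k1 kn' kn.
Qed.
End whitney.

Section whitney_measurable.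
Context {R : realType} (n : nat) (c0 c1 : R).
Hypotheses (hc0 : 1 < c0) (hc1 : 0 < c1).
Local Notation X := ('rV[R]_n).
Local Notation V := ('rV[R]_(1 + n)).
Local Notation mu := (lebesgue_rV (1 + n)).
Local Notation H := (@hspace R n).
Let c00 : 0 < c0. Proof. exact: lt_trans hc0. Qed.

Lemma hyperplane_null (a : R) : mu [set z : V | tcoord z = a] = 0%E.
Proof.
have mS : measurable [set z : V | tcoord z = a].
  rewrite (_ : [set z | _] = rV_coord (t0 n) @^-1` [set a]).
    by rewrite -[X in measurable X]setTI; apply: measurable_rV_coord.
  by apply/seteqP; split => z.
rewrite -[X in mu X]setIT -integral_indic// ge0_integral_rV_cons; last 2 first.
- by apply/measurable_EFinP; exact: measurable_indic.
- by move=> z; rewrite lee_fin.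
apply: integral0_eq => y _.
transitivity (\int[lebesgue_measure]_t (\1_[set a] t : R)%:E)%E; last first.
  by rewrite integral_indic// setIT; exact: lebesgue_measure_set1.
apply: eq_integral => t _; congr EFin; rewrite !indicE; congr ((nat_of_bool _)%:R).
have tE : tcoord (rV_cons (t, y)) = t by rewrite /tcoord /rV_cons row_mxEl mxE.
apply/idP/idP => /set_mem /= h; apply/mem_set => /=; first by rewrite -[LHS]tE.
by rewrite tE.
Qed.

(** As t_j increases to t, the indicators of the Whitney regions converge except
    on the hyperplane at height c0^(-1) t, whose points may belong to all the
    regions at t_j but not to the limit; it is a null set. *)
Lemma whitney_left_cont (g : V -> R) (t : R) (tj : nat -> R) x :
  (forall K, compact K -> K `<=` H -> mu.-integrable K (EFin \o g)) -> 0 < t ->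
  (forall j, t / 2 <= tj j < t) -> tj j @[j --> \oo] --> t ->
  \int[mu]_(z in whitney c0 c1 (tj j) x) g z @[j --> \oo] --> \int[mu]_(z in whitney c0 c1 t x) g z.
Proof.
move=> gi tp tjt ctj; have hc00 := c00.
pose D := wbox (wc c0 c1) t (qcell t x).
have mD : measurable D by exact: measurable_wbox.
have DH : D `<=` H by apply: wbox_hspace => //; apply: lt_le_trans (wc_ge1 hc0 hc1).
have gD : mu.-integrable D (EFin \o g) by apply: gi => //; exact: compact_cbox.
have tjp j : 0 < tj j by have /andP[h _] := tjt j; apply: lt_le_trans h; rewrite divr_gt0.
have WD j : whitney c0 c1 (tj j) x `<=` D.
  by apply: whitney_wbox => //; have /andP[-> /ltW ->] := tjt j.
have WDt : whitney c0 c1 t x `<=` D.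
  by apply: whitney_wbox => //; rewrite lexx andbT ler_pdivrMr// ler_pMr// ler1n.
have E r : 0 < r -> whitney c0 c1 r x `<=` D ->
    (\int[mu]_(z in whitney c0 c1 r x) (g z)%:E = \int[mu]_(z in D) ((g z * \1_(whitney c0 c1 r x) z)%:E))%E.
  move=> r0 WrD; rewrite [LHS]integral_mkcond [RHS]integral_mkcond; apply: eq_integral => z _.
  rewrite !patchE indicE; case: ifPn => [zW|zW].
    by rewrite mulr1 mem_set//; apply: WrD; exact: set_mem.
  by rewrite mulr0; case: ifP.
have mg : measurable_fun D g by apply/measurable_EFinP; case/integrableP : gD.
have mi r : 0 < r -> measurable_fun D (fun z => (g z * \1_(whitney c0 c1 r x) z)%:E).
  move=> r0; apply/measurable_EFinP; apply: measurable_funM => //.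
  by apply: measurable_indic; exact: measurable_whitney.
have [|||||h1 h2 h3] := @dominated_convergence _ _ _ mu D mD
    (fun j z => (g z * \1_(whitney c0 c1 (tj j) x) z)%:E)
    (fun z => (g z * \1_(whitney c0 c1 t x) z)%:E) (fun z => `|(g z)%:E|%E).
- by move=> j; exact: mi.
- exact: mi.
- exists [set z | tcoord z = c0^-1 * t]; split; last 2 first.
  + exact: hyperplane_null.
  + move=> z /= hz; apply: contrapT => zt; apply: hz => zD.
    apply: cvg_EFin; first exact: nearW.
    apply: cvgMr.
    have [zW|zW] := pselect (whitney c0 c1 t x z).
      rewrite indicE mem_set//; apply: (@cvg_trans _ (1%R @[j --> \oo])); last exact: cvg_cst.
      apply: near_eq_cvg.
      have /whitneyP-/(_ tp)[/andP[z1 z2] z3] := zW.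
      have n1 : \forall j \near \oo, tcoord z / c0 < tj j.
        by apply: (cvgr_gt _ ctj); rewrite ltr_pdivrMr// mulrC.
      have n2 : \forall j \near \oo, enorm (xcoord z - x) / c1 < tj j.
        by apply: (cvgr_gt _ ctj); rewrite ltr_pdivrMr// mulrC.
      near=> j; rewrite indicE mem_set//; apply/whitneyP; first exact: tjp.
      split; last by rewrite -ltr_pdivrMl// mulrC; near: j.
      apply/andP; split; last by rewrite -ltr_pdivrMl// mulrC; near: j.
      by apply: lt_trans z1; rewrite ltr_pM2l ?invr_gt0//; have /andP[] := tjt j.
    rewrite indicE memNset//; apply: (@cvg_trans _ (0%R @[j --> \oo])); last exact: cvg_cst.
    apply: near_eq_cvg.
    have [z3|z3] := leP (tcoord z) (c0^-1 * t); last first.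
      apply: nearW => j; rewrite indicE memNset// => /whitneyP-/(_ (tjp j))[/andP[w1 w2] w3].
      have /andP[_ jt] := tjt j.
      apply: zW; apply/whitneyP => //; split.
        by rewrite z3/= (lt_trans w2)// ltr_pM2l.
      by rewrite (lt_trans w3)// ltr_pM2l.
    have z4 : tcoord z * c0 < t.
      by rewrite -ltr_pdivlMr// mulrC lt_neqAle z3 andbT; apply/eqP.
    have n1 : \forall j \near \oo, tcoord z * c0 < tj j by exact: (cvgr_gt _ ctj).
    near=> j; rewrite indicE memNset// => /whitneyP-/(_ (tjp j))[/andP[w1 w2] w3].
    have : tj j < tcoord z * c0 by rewrite -ltr_pdivrMr// mulrC.
    by apply/negP; rewrite -leNgt ltW//; near: j.
  + rewrite (_ : [set z | _] = rV_coord (t0 n) @^-1` [set c0^-1 * t]).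
      by rewrite -[X in measurable X]setTI; apply: measurable_rV_coord.
    by apply/seteqP; split => z.
- exact: integrable_abse.
- apply: nearW => z j zD; rewrite lee_fin normrM; apply: ler_piMr => //.
  by rewrite indicE; case: (_ \in _); rewrite ?normr1 ?normr0.
rewrite /Rintegral; apply: fine_cvg; rewrite E// fineK; last exact: integrable_fin_num.
apply: cvg_trans h3; apply: near_eq_cvg; apply: nearW => j /=.
by rewrite E.
Unshelve. all: by end_near. Qed.

Lemma whitney_avg_left (u : V -> R) (t e a : R) x : L1loc u -> 0 < t -> 0 < e -> 0 < a ->
  exists q : rat, [/\ 0 < ratr q :> R, t - a < ratr q < t &
     `|whitney_avg c0 c1 u (ratr q) x - whitney_avg c0 c1 u t x| <= e].
Proof.
move=> uL tp e0 a0.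
pose d (j : nat) : R := Num.min (Num.min (t / 2) a) (j.+1%:R^-1).
have d0 j : 0 < d j by rewrite !lt_min a0 invr_gt0 ltr0n divr_gt0.
have ex j : exists q : rat, ratr q \in `](t - d j), t[.
  by apply: rat_in_itvoo; rewrite ltrBlDr ltrDl.
pose q j := projT1 (cid (ex j)).
have qP j : t - d j < ratr (q j) < t by have := projT2 (cid (ex j)); rewrite in_itv.
have qh j : t / 2 <= ratr (q j) < t.
  have /andP[h1 ->] := qP j; rewrite andbT; apply/ltW; apply: le_lt_trans h1.
  have : d j <= t / 2 by rewrite /d !ge_min lexx.
  lra.
have qt : (ratr (q j) : R) @[j --> \oo] --> t.
  apply: (@squeeze_cvgr _ _ _ _ (fun j : nat => t - j.+1%:R^-1) (fun=> t)); last exact: cvg_cst.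
    apply: nearW => j; have /andP[h1 /ltW ->] := qP j; rewrite andbT; apply: le_trans (ltW h1).
    by rewrite lerD2l lerN2 /d ge_min lexx orbT.
  rewrite -[X in _ --> X]subr0; apply: cvgB; [exact: cvg_cst|exact: cvg_harmonic].
have c1' := whitney_left_cont (x := x) (proj2 uL) tp qh qt.
have c2' : \int[mu]_(z in whitney c0 c1 (ratr (q j)) x) 1 @[j --> \oo] --> \int[mu]_(z in whitney c0 c1 t x) 1.
  apply: (@whitney_left_cont (fun=> 1)) => // K cK KH.
  have mK := compact_measurable_rV cK.
  have := @measurable_bounded_integrable _ _ _ mu (fun=> 1) _ mK (lebesgue_compact_fin cK).
  by apply=> //; exact: bounded_cst.
have pos j : 0 < ratr (q j) :> R by have /andP[h _] := qh j; apply: lt_le_trans h; rewrite divr_gt0.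
have eW r : 0 < r -> \int[mu]_(z in whitney c0 c1 r x) 1 = fine (mu (whitney c0 c1 r x)).
  by move=> r0; rewrite Rintegral_cst ?mul1r//; exact: measurable_whitney.
have c3 : whitney_avg c0 c1 u (ratr (q j)) x @[j --> \oo] --> whitney_avg c0 c1 u t x.
  rewrite /whitney_avg -(eW _ tp); apply: (@cvg_trans _ ((\int[mu]_(z in whitney c0 c1 (ratr (q j)) x) 1)^-1 *
       \int[mu]_(z in whitney c0 c1 (ratr (q j)) x) u z @[j --> \oo])).
    by apply: near_eq_cvg; apply: nearW => j; rewrite eW.
  apply: cvgM => //; apply: cvgV => //.
  by rewrite eW// gt_eqF// whitney_fine_gt0.
have [N _ hN] : \forall j \near \oo, `|whitney_avg c0 c1 u t x - whitney_avg c0 c1 u (ratr (q j)) x| < e.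
  by move/cvgrPdist_lt : c3 => /(_ _ e0).
exists (q N); split => //; last by rewrite distrC ltW//; exact: (hN N (leqnn N)).
have /andP[h1 ->] := qP N; rewrite andbT; apply: le_lt_trans h1.
by rewrite lerD2l lerN2 /d !ge_min lexx orbT.
Qed.

Lemma measurable_whitney_prod (t : R) : 0 < t ->
  measurable [set p : X * V | whitney c0 c1 t p.1 p.2].
Proof.
move=> tp; have ct : 0 <= c1 * t by rewrite mulr_ge0// ltW.
have mc i : measT (fun p : X * V => p.2 ord0 i).
  exact: (measurableT_comp (measurable_rV_coord i) measurable_snd).
have mx i : measT (fun p : X * V => p.1 ord0 i).
  exact: (measurableT_comp (measurable_rV_coord i) measurable_fst).
pose f (p : X * V) := \sum_i (p.2 ord0 (rshift 1 i) - p.1 ord0 i) ^+ 2.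
have mf : measT f.
  by apply: measurable_sum => i; apply: measurable_funX; apply: measurable_funB.
rewrite (_ : [set p | _] = (fun p : X * V => p.2 ord0 (t0 n)) @^-1` `]c0^-1 * t, c0 * t[ `&`
    f @^-1` `]-oo, (c1 * t) ^+ 2[).
  apply: measurableI; rewrite -[X in measurable X]setTI.
    by apply: mc => //; exact: measurable_itv.
  by apply: mf => //; exact: measurable_itv.
apply/seteqP; split => -[y z]; rewrite /= !in_itv/=.
  move=> /whitneyP-/(_ tp)[h1 h2]; split => //; move: h2; rewrite enorm_lt//.
  by congr (_ < _); apply: eq_bigr => i _; rewrite !mxE.
move=> [h1 h2]; apply/whitneyP => //; split => //; rewrite enorm_lt//; move: h2.
by congr (_ < _); apply: eq_bigr => i _; rewrite !mxE.
Qed.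

Lemma measurable_whitney_integral (g : V -> \bar R) (t : R) : 0 < t -> measurable_fun H g -> (forall z, 0 <= g z)%E ->
  measT (fun x : X => \int[mu]_(z in whitney c0 c1 t x) g z)%E.
Proof.
move=> tp mg g0; have mE := measurable_whitney_prod tp.
have mg' : measT (g \_ H).
  by apply/(measurable_restrictT _ (@measurable_hspace R n)).
pose F (p : X * V) := ((g \_ H) p.2 * (\1_[set p : X * V | whitney c0 c1 t p.1 p.2] p)%:E)%E.
have mF : measT F.
  apply: emeasurable_funM; first by apply: (measurableT_comp mg'); exact: measurable_snd.
  by apply/measurable_EFinP; exact: measurable_indic.
have F0 p : (0 <= F p)%E.
  by rewrite mule_ge0// patchE; case: ifP.
have := measurable_fun_fubini_tonelli_F (m2 := mu) F mF F0.
congr (measurable_fun _ _); apply/funext => x; rewrite /fubini_F [RHS]integral_mkcond.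
apply: eq_integral => z _; rewrite /F !patchE indicE /=.
have -> : ((x, z) \in [set p : X * V | whitney c0 c1 t p.1 p.2]) = (z \in whitney c0 c1 t x).
  by apply/idP/idP => /set_mem ?; apply/mem_set.
case: (boolP (z \in whitney c0 c1 t x)) => zW; last by rewrite mule0.
by rewrite mule1 mem_set//; apply: (whitney_hspace hc0 tp); exact: set_mem zW.
Qed.

Lemma measurable_whitney_avg (u : V -> R) (t : R) : 0 < t -> measurable_fun H u ->
  measT (whitney_avg c0 c1 u t : X -> R).
Proof.
move=> tp mu'; have meu : measurable_fun H (EFin \o u) by exact/measurable_EFinP.
apply: measurable_funM.
  rewrite (_ : (fun x => _) = fun x : X => (fine (\int[mu]_(z in whitney c0 c1 t x) (cst 1%E z))) `^ (-1)).
    apply: (measurableT_comp (measurable_powR (-1))).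
    apply: (measurableT_comp (fine_measurable measurableT)).
    by apply: (measurable_whitney_integral tp) => //; exact: measurable_cst.
  apply/funext => x; rewrite integral_cst ?mul1e; last exact: measurable_whitney.
  by rewrite powR_inv1// fine_ge0.
apply: (measurableT_comp (fine_measurable measurableT)).
rewrite (_ : (fun x => _) = fun x : X => (\int[mu]_(z in whitney c0 c1 t x) ((EFin \o u)^\+ z) -
    \int[mu]_(z in whitney c0 c1 t x) ((EFin \o u)^\- z))%E); last by apply/funext => x; rewrite integralE.
apply: emeasurable_funB; apply: measurable_whitney_integral => //.
  exact: measurable_funepos.
exact: measurable_funeneg.
Qed.

Lemma measurable_whitney_trace (u : V -> R) : L1loc u ->
  measT (EFin \o (whitney_trace c0 c1 u : X -> R)).
Proof.
move=> uL; apply: measurable_lim_at0.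
  by move=> t tp; apply: measurable_whitney_avg => //; case: uL.
by move=> t e a x; exact: whitney_avg_left.
Qed.
End whitney_measurable.

Section trace.
Context {R : realType} (n : nat) (c0 c1 p : R).
Hypotheses (hc0 : 1 < c0) (hc1 : 0 < c1) (p1 : 1 < p).
Local Notation X := ('rV[R]_n).
Local Notation V := ('rV[R]_(1 + n)).
Local Notation mu := (lebesgue_rV (1 + n)).
Local Notation muX := (lebesgue_rV n).
Local Notation H := (@hspace R n).

Lemma carleson_tv nu (m : {measure set V -> \bar R}) :
  (forall A, measurable A -> m A = vm_total_variation nu (A `&` H)) ->
  carleson (vm_total_variation nu) = carleson m :> (X -> \bar R).
Proof.
move=> mE; apply/funext => x; congr ereal_sup; apply/seteqP; split => r [a [l [l0 ax ->]]]; exists a, l; split => //.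
  by rewrite mE ?setIidl//; [exact: carleson_box_hspace|exact: measurable_carleson_box].
by rewrite mE ?setIidl//; [exact: carleson_box_hspace|exact: measurable_carleson_box].
Qed.

Lemma Cgrad_measure (u : V -> R) : BVloc u -> exists m : {sigma_finite_measure set V -> \bar R},
  (forall A, measurable A -> m A = vm_total_variation (grad u) (A `&` H)) /\ Cgrad u = carleson m.
Proof.
move=> [uL gu]; have [lf _] := is_gradient_grad gu.
have [m mE] := tv_measure lf; exists m; split => //; exact: carleson_tv.
Qed.

Lemma whitney_avg_le (u : V -> R) (t : R) (x : X) : L1loc u -> 0 < t ->
  `|whitney_avg c0 c1 u t x| <= whitney_avg c0 c1 (fun z => `|u z|) t x.
Proof.
move=> uL tp; rewrite /whitney_avg normrM normfV (gtr0_norm (whitney_fine_gt0 hc0 hc1 x tp)).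
apply: ler_wpM2l; first by rewrite invr_ge0 ltW// whitney_fine_gt0.
apply: le_normr_Rintegral; first exact: measurable_whitney.
have [K [cK KH WK]] := whitney_compact hc0 hc1 x tp.
apply: (integrableS _ _ WK); [exact: compact_measurable_rV|exact: measurable_whitney|exact: (proj2 uL)].
Qed.

(** Where the dyadic potential is finite, the Whitney averages are Cauchy as t
    tends to 0, and their limit is controlled by the potential because
    they vanish at infinity. *)
Lemma trace_bound : exists2 C, 0 <= C & forall u : V -> R, V0 c0 c1 p u ->
  [/\ {ae muX, forall x, cvg (whitney_avg c0 c1 u t x @[t --> 0^'+])},
      Lp p (EFin \o whitney_trace c0 c1 u) &
      ('N[muX]_p%:E[EFin \o whitney_trace c0 c1 u] <= C%:E * 'N[muX]_p%:E[Cgrad u])%E].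
Proof.
have p0 : 0 < p by apply: lt_trans p1.
have [r hr] : exists r : nat, wc c0 c1 ^+ 2 < 2 ^+ r.
  have [M h] := pow2_large (wc c0 c1 ^+ 2 + 1); exists M; apply: lt_le_trans h; lra.
pose w := 2 * wosc n c0 c1.
have w0 : 0 <= w by rewrite mulr_ge0// wosc_ge0.
pose K := w `^ p * dyconst n (wc c0 c1) r p.
have K0 : 0 <= K by rewrite mulr_ge0 ?powR_ge0// dyconst_ge0.
exists (K `^ p^-1); first exact: powR_ge0.
move=> u [uBV [mC NC] uinf].
have [m [mE CE]] := Cgrad_measure uBV.
have [uL gu] := uBV; have gr := is_gradient_grad gu; have [lf _] := gr.
have mK (A : set V) : compact A -> A `<=` H -> m A = vm_total_variation (grad u) A.
  by move=> cA AH; rewrite mE ?setIidl//; exact: compact_measurable_rV.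
have mfin (A : set V) : compact A -> A `<=` H -> (m A < +oo)%E.
  move=> cA AH; rewrite mK//; apply: tv_compactly_lty => //; first exact: compact_measurable_rV.
  by exists A; split.
have [A [mA A0 iA hA]] := dyadic_square (wc_ge1 hc0 hc1) mfin p1 hr.
have Cp : (\int[muX]_x (`|Cgrad u x| `^ p) = \int[muX]_x (carleson m x `^ p))%E.
  by apply: eq_integral => x _; rewrite CE gee0_abs// carleson_ge0.
have iCfin : (\int[muX]_x (carleson m x `^ p) < +oo)%E by rewrite -Cp; exact/Lnorm_fin.
have iAfin : (\int[muX]_x A x < +oo)%E.
  apply: (le_lt_trans iA); apply: mulEFin_lty => //; exact: integral_poweR_ge0.
have Afin : {ae muX, forall x, A x \is a fin_num}.
  have : {ae muX, forall x, setT x -> A x \is a fin_num}.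
    apply: integrable_ae => //; apply/integrableP; split => //.
    by under eq_integral do rewrite gee0_abs//.
  by apply: filterS => x; apply.
have key x : A x \is a fin_num -> cvg (whitney_avg c0 c1 u t x @[t --> 0^'+]) /\
    `|whitney_trace c0 c1 u x| <= w * (fine (A x) `^ p^-1).
  move=> Ax; pose s d := wavg m (wc c0 c1) d x.
  have s0 d : 0 < d -> 0 <= s d by move=> d0; exact: wavg_ge0.
  have osc d t t' : 0 < d -> d / 2 <= t <= d -> d / 2 <= t' <= d ->
      `|whitney_avg c0 c1 u t x - whitney_avg c0 c1 u t' x| <= wosc n c0 c1 * s d.
    by move=> d0 ht ht'; exact: whitney_osc gr mK d0 ht ht'.
  have sumA M : \sum_(j < M.*2.+1) s (2 ^+ M / 2 ^+ j) <= fine (A x) `^ p^-1.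
    have := hA M x; rewrite -{1}(fineK Ax) lee_fin => h.
    have S0 : 0 <= \sum_(j < M.*2.+1) s (2 ^+ M / 2 ^+ j).
      by apply: sumr_ge0 => j _; rewrite s0// divr_gt0// exprn_gt0.
    have -> : \sum_(j < M.*2.+1) s (2 ^+ M / 2 ^+ j) = ((\sum_(j < M.*2.+1) s (2 ^+ M / 2 ^+ j)) `^ p) `^ p^-1.
      by rewrite -powRrM divff ?gt_eqF// powRr1.
    apply: ge0_ler_powR; rewrite ?invr_ge0 ?(ltW p0) ?nnegrE ?powR_ge0//; exact: fine_ge0.
  split; first exact: (chain_cvg (wosc_ge0 n hc0 hc1) s0 osc sumA).
  have u0 : whitney_avg c0 c1 u t x @[t --> +oo] --> 0.
    apply: (@norm_cvg0 _ _ _ _ _ (fun t => whitney_avg c0 c1 u t x)).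
    apply: (@squeeze_cvgr _ _ _ _ (fun=> 0) (fun t => whitney_avg c0 c1 (fun z => `|u z|) t x)).
    - near=> t; have tp : 0 < t by near: t; exact: nbhs_pinfty_gt.
      by rewrite normr_ge0/=; exact: whitney_avg_le.
    - exact: cvg_cst.
    - exact: uinf.
  rewrite /w; exact: (chain_lim (wosc_ge0 n hc0 hc1) s0 osc sumA u0).
have le : (\int[muX]_x (`|(EFin \o whitney_trace c0 c1 u) x| `^ p) <= K%:E * \int[muX]_x (`|Cgrad u x| `^ p))%E.
  rewrite Cp; apply: (@le_trans _ _ ((w `^ p)%:E * \int[muX]_x A x)%E); last first.
    by rewrite /K EFinM -muleA; apply: lee_wpmul2l => //; rewrite lee_fin powR_ge0.
  rewrite -(ge0_intZ muX measurableT mA)// ?powR_ge0//.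
  apply: ae_ge0_le_integral => //.
  - by move=> x _; exact: poweR_ge0.
  - apply: (measurable_poweRT p); apply: measurableT_comp => //.
    exact: measurable_whitney_trace.
  - by move=> x _; rewrite mule_ge0// lee_fin powR_ge0.
  - by apply: emeasurable_funM.
  move: Afin; apply: filterS => x Ax _; have [_ h] := key x Ax.
  rewrite /= -(fineK Ax) -EFinM lee_fin.
  have e1 : fine (A x) = (fine (A x) `^ p^-1) `^ p by rewrite -powRrM mulVf ?gt_eqF// powRr1// fine_ge0.
  rewrite {1}e1 -powRM ?powR_ge0//; apply: ge0_ler_powR; rewrite ?nnegrE ?(ltW p0)//.
  by rewrite mulr_ge0// powR_ge0.
split; first by move: Afin; apply: filterS => x /key[].
- split; first exact: measurable_whitney_trace.
  apply/Lnorm_fin => //; apply: (le_lt_trans le); rewrite Cp.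
  apply: mulEFin_lty => //; exact: integral_poweR_ge0.
exact: Lnorm_le.
Unshelve. all: by end_near. Qed.
End trace.

(** * The Hardy-Littlewood maximal theorem *)

Section einf.
Context {R : realType}.
Implicit Types u : (\bar R)^nat.

Lemma limn_einf_ge u (c : \bar R) (N : nat) : (forall k, (N <= k)%N -> (c <= u k)%E) -> (c <= limn_einf u)%E.
Proof.
move=> h; rewrite limn_einf_lim; apply: lime_ge; first exact: is_cvg_einfs.
exists N => // k /= Nk; apply/ereal_infP => _ [j /= kj <-]; apply: h; exact: leq_trans kj.
Qed.

Lemma limn_einf_le u (c : \bar R) : (forall k, (u k <= c)%E) -> (limn_einf u <= c)%E.
Proof.
move=> h; rewrite limn_einf_lim; apply: lime_le; first exact: is_cvg_einfs.
apply: nearW => k; apply: le_trans (h k); apply: ereal_inf_lbound; exists k => //=.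
Qed.
End einf.

Section sum_pow.
Context {R : realType}.

Lemma sum_powR_le (I : finType) (a : I -> R) (p : R) : 0 < p -> (forall i, 0 <= a i) ->
  (\sum_i a i) `^ p <= #|I|%:R `^ p * \sum_i a i `^ p.
Proof.
move=> p0 a0; have S0 : 0 <= \sum_i a i by exact: sumr_ge0.
have [i0|h] := pickP (fun _ : I => true); last first.
  by rewrite big_pred0 ?powR0 ?gt_eqF// mulr_ge0 ?powR_ge0// sumr_ge0// => i _; exact: powR_ge0.
move=> _; pose j := [arg max_(i > i0) a i]%O.
have ja i : a i <= a j by rewrite /j; case: arg_maxP => // k _; apply.
apply: (@le_trans _ _ (#|I|%:R `^ p * a j `^ p)).
  rewrite -powRM//; apply: ge0_ler_powR; rewrite ?nnegrE ?(ltW p0) ?mulr_ge0//.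
  rewrite mulr_natl -sumr_const; exact: ler_sum.
rewrite ler_wpM2l ?powR_ge0// (bigD1 j)//= lerDl sumr_ge0// => i _; exact: powR_ge0.
Qed.
End sum_pow.

Section third.
Context {R : realType}.
Implicit Types (a l s : R).

Lemma floor_neq (u v : R) : Num.floor u <> Num.floor v -> exists m : int, u < m%:~R <= v \/ v < m%:~R <= u.
Proof.
move=> h; have [uv|vu|] := ltgtP (Num.floor u) (Num.floor v); last by [].
  exists (Num.floor v); left; rewrite floor_le andbT ltNge -floor_ge_int -ltNge.
  exact: uv.
exists (Num.floor u); right; rewrite floor_le andbT ltNge -floor_ge_int -ltNge.
exact: vu.
Qed.

(** The one-third trick.  If an interval shorter than s / 3 met an endpoint of
    both the grid s Z and its translate by 2^k s / 3, then 3 m + 2^k would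
    vanish for an integer m, but 3 does not divide 2^k. *)
Lemma floor_third a l s (k : nat) : 0 < s -> 3 * l < s ->
  (forall y y', a < y < a + l -> a < y' < a + l -> Num.floor (y / s) = Num.floor (y' / s)) \/
  (forall y y', a < y < a + l -> a < y' < a + l ->
     Num.floor ((y + 2 ^+ k * s / 3) / s) = Num.floor ((y' + 2 ^+ k * s / 3) / s)).
Proof.
move=> s0 ls; apply: contrapT => /not_orP[/existsNP[y /existsNP[y' /not_implyP[/andP[y1 y2] /not_implyP[/andP[y3 y4] h1]]]]
  /existsNP[w /existsNP[w' /not_implyP[/andP[w1 w2] /not_implyP[/andP[w3 w4] h2]]]]].
have [m hm] : exists m : int, a < m%:~R * s < a + l.
  have [m h] := floor_neq h1; exists m.
  by case: h; rewrite ltr_pdivrMr// ler_pdivlMr// => /andP[h3 h4]; apply/andP; split; lra.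
have [m' hm'] : exists m : int, a < m%:~R * s - 2 ^+ k * s / 3 < a + l.
  have [m' h] := floor_neq h2; exists m'.
  by case: h; rewrite ltr_pdivrMr// ler_pdivlMr// => /andP[h3 h4]; apply/andP; split; lra.
pose z : int := 3 * (m - m') + 2 ^+ k.
have zE : z%:~R * (s / 3) = m%:~R * s - (m'%:~R * s - 2 ^+ k * s / 3) :> R.
  by rewrite /z rmorphD/= rmorphM/= rmorphB/= rmorphXn/=; field.
have z1 : `|z%:~R * (s / 3)| < s / 3 :> R.
  rewrite zE; move: hm hm' => /andP[? ?] /andP[? ?]; rewrite ltr_norml; apply/andP; split; lra.
have s3 : 0 < s / 3 by rewrite divr_gt0.
have z0 : z = 0.
  apply/eqP; rewrite -absz_eq0 -leqn0 -ltnS.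
  move: z1; rewrite normrM (gtr0_norm s3) gtr_pMl// -intr_norm -[1]/(1%:~R) ltr_int.
  by rewrite -abszE ltz_nat.
have : (2 ^ k = 3 * `|m' - m|)%N.
  have : (2 : int) ^+ k = 3 * (m' - m) by move: z0; rewrite /z addrC => /eqP; rewrite addr_eq0 => /eqP ->; rewrite -mulrN opprB.
  by move=> /(congr1 absz); rewrite abszX abszM.
move=> h; have : (3 %| 2 ^ k)%N by rewrite h dvdn_mulr.
by rewrite Euclid_dvdX//.
Qed.
End third.

Section maximal.
Context {R : realType} (n : nat).
Local Notation X := ('rV[R]_n).
Local Notation muX := (lebesgue_rV n).
Implicit Types F : X -> \bar R.

Definition maxfun F : X -> \bar R := cubesup (fun a l => \int[muX]_(y in cube a l) F y)%E.

(** The same shift 2^J / 3 serves all generations: modulo the grid of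
    generation k it is a third of a cell, up to sign. *)
Definition third_shift (J : nat) (b : {ffun 'I_n -> bool}) : X := \row_i (if b i then 2 ^+ J / 3 else 0).

Definition gridq (J : nat) (b : {ffun 'I_n -> bool}) (k : nat) (x : X) : 'rV[int]_n :=
  qcell (2 ^+ J / 2 ^+ k) (x + third_shift J b).

(** The dyadic maximal function over the 2J generations from 2^J down to
    2^(-J+1) of a shifted grid. *)
Definition gridmax F (J : nat) b (x : X) : R :=
  runmax (fun k => cellavg muX (gridq J b) F k x) (J.*2).

(** Each coordinate separately chooses between the unshifted and the shifted
    grid. *)
Lemma cube_in_grid (a : X) (l : R) (J k : nat) : 3 * l < 2 ^+ J / 2 ^+ k ->
  exists b, forall x y, cube a l x -> cube a l y -> gridq J b k x = gridq J b k y.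
Proof.
move=> ls; set s := 2 ^+ J / 2 ^+ k in ls.
have s0 : 0 < s by rewrite divr_gt0// exprn_gt0.
have E : 2 ^+ J / 3 = 2 ^+ k * s / 3 by rewrite /s; field; rewrite expf_neq0.
pose P i := forall y y', a ord0 i < y < a ord0 i + l -> a ord0 i < y' < a ord0 i + l -> Num.floor (y / s) = Num.floor (y' / s).
(* Shift exactly the coordinates in which the cube meets the unshifted grid. *)
exists [ffun i => ~~ `[< P i >]] => x y cx cy; apply/rowP => i.
rewrite !mxE ffunE; case: asboolP => [h|h] /=; first by rewrite !addr0; apply: h; [exact: cx|exact: cy].
have [//|h'] := floor_third (a ord0 i) k s0 ls.
by rewrite E; apply: h'; [exact: cx|exact: cy].
Qed.

Lemma level_exists (l : R) : 0 < l -> exists J0 : nat, forall J, (J0 <= J)%N ->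
  exists2 k, (k < J.*2)%N & 3 * l < 2 ^+ J / 2 ^+ k <= 6 * l.
Proof.
move=> l0; have [m1 h1] := pow2_large (3 * l + 1).
have [m2 h2] := pow2_small (mulr_gt0 (ltr0Sn R 2) l0).
exists (maxn m1 m2) => J; rewrite geq_max => /andP[J1 J2].
pose P k := 3 * l < 2 ^+ J / 2 ^+ k.
have P0 : P 0%N.
  rewrite /P expr0 divr1; apply: (@lt_le_trans _ _ (2 ^+ m1)); first by apply: lt_le_trans h1; rewrite ltrDl.
  by rewrite ler_weXn2l// ler1n.
have PN : ~~ P J.*2.
  rewrite /P -leNgt -addnn exprD invfM mulrA divff ?mul1r ?expf_neq0//.
  by apply: le_trans h2; rewrite lef_pV2 ?posrE ?exprn_gt0// ler_weXn2l// ler1n.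
have [k kN /andP[Pk nPk]] : exists2 k, (k < J.*2)%N & P k && ~~ P k.+1.
  elim: (J.*2) PN => [|N IH] PN; first by rewrite P0 in PN.
  have [PN'|/IH[k kN h]] := boolP (P N); first by exists N => //; rewrite PN' PN.
  by exists k => //; exact: ltnW.
exists k => //; apply/andP; split => //; move: nPk; rewrite /P -leNgt exprSr invfM mulrA ler_pdivrMr// => h.
by apply: (le_trans h); lra.
Qed.

Lemma gridq_measurable J b k i : measurable [set x | gridq J b k x = i].
Proof.
have s0 : 0 < 2 ^+ J / 2 ^+ k :> R by rewrite divr_gt0// exprn_gt0.
by have := measurable_shift (third_shift J b) measurableT (measurable_qcell i s0); rewrite setTI.
Qed.

Lemma gridq_nested J b j k x y : (j <= k)%N -> gridq J b k x = gridq J b k y -> gridq J b j x = gridq J b j y.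
Proof.
move=> jk; rewrite /gridq => /(@qcell_nested _ _ (k - j)).
have s0 : 0 < 2 ^+ J / 2 ^+ k :> R by rewrite divr_gt0// exprn_gt0.
have -> : 2 ^+ (k - j) * (2 ^+ J / 2 ^+ k) = 2 ^+ J / 2 ^+ j :> R.
  by rewrite -{2}(subnKC jk) exprD; field; rewrite !expf_neq0.
exact.
Qed.

(** A cube of side l lies in a cell of side at most 6 l of one of the 2^n grids;
    the factor 12^n includes the crude bound (2 s)^n for the volume of a
    cell of side s. *)
Lemma cubeavg_le_gridmax F (p : R) (a : X) (l : R) (x : X) : 1 < p -> measT F -> (forall x, 0 <= F x)%E ->
  (\int[muX]_x (F x `^ p) < +oo)%E -> 0 < l -> cube a l x ->
  exists J0 : nat, forall J, (J0 <= J)%N -> exists b,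
    (\int[muX]_(y in cube a l) F y / muX (cube a l) <= (12 ^+ n * gridmax F J b x)%:E)%E.
Proof.
move=> p1 mF F0 Fp l0 cx; have [J0 hJ0] := level_exists l0.
exists J0 => J /hJ0[k kJ /andP[h1 h2]].
have [b hb] := cube_in_grid a h1; exists b.
set s := 2 ^+ J / 2 ^+ k in h1 h2.
have s0 : 0 < s by rewrite divr_gt0// exprn_gt0.
set A := [set y | gridq J b k y = gridq J b k x].
have mA : measurable A by exact: gridq_measurable.
have QA : cube a l `<=` A by move=> y cy; exact: hb.
have A1 : ((s ^+ n)%:E <= muX A)%E by exact: qcell_measure_ge.
have A2 : (muX A <= ((2 * s) ^+ n)%:E)%E by exact: qcell_measure_le.
have Afin : (muX A < +oo)%E by apply: le_lt_trans A2 _; rewrite ltry.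
have IA : (\int[muX]_(y in A) F y < +oo)%E by exact: integral_lty_of_poweR Fp.
have I0 : (0 <= \int[muX]_(y in A) F y)%E by apply: integral_ge0.
have mQ : measurable (cube a l) by rewrite cube_obox; exact: measurable_obox.
apply: (@le_trans _ _ ((12 ^+ n * cellavg muX (gridq J b) F k x)%:E)); last first.
  by rewrite lee_fin ler_wpM2l ?exprn_ge0//; exact: (runmax_ge (fun k => cellavg muX (gridq J b) F k x)).
rewrite lebesgue_cube ?(ltW l0)// inver gt_eqF ?exprn_gt0//.
apply: (@le_trans _ _ (\int[muX]_(y in A) F y * (l ^+ n)^-1%:E)%E).
  apply: lee_wpmul2r; first by rewrite lee_fin invr_ge0 exprn_ge0// ltW.
  by apply: ge0_subset_integral => //; exact: measurable_funTS.
rewrite /cellavg -/A -[X in (X * _ <= _)%E]fineK ?ge0_fin_numE// -EFinM lee_fin mulrCA.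
apply: ler_wpM2l; first exact: fine_ge0.
have v0 : 0 < fine (muX A).
  by rewrite fine_gt0// Afin andbT; apply: lt_le_trans A1; rewrite lte_fin exprn_gt0.
rewrite ler_pdivlMr// mulrC ler_pdivrMr ?exprn_gt0//.
apply: (@le_trans _ _ ((2 * s) ^+ n)); first by rewrite -lee_fin fineK ?ge0_fin_numE.
rewrite -exprMn lerXn2r ?nnegrE ?mulr_ge0 ?(ltW l0) ?(ltW s0)//; lra.
Qed.

Definition doobc (p : R) : R := 2 * (p / (p - 1) * (2 * (p / (p - 1))) `^ (p - 1)).
Definition maxc (p : R) : R :=
  (12 ^+ n) `^ p * (#|{ffun 'I_n -> bool}|%:R `^ p * (#|{ffun 'I_n -> bool}|%:R * doobc p)).

Lemma maxc_gt0 p : 1 < p -> 0 < maxc p.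
Proof.
move=> p1; have p0 : 0 < p by apply: lt_trans p1.
have N0 : 0 < #|{ffun 'I_n -> bool}|%:R :> R by rewrite ltr0n; apply/card_gt0P; exists [ffun=> true].
have c0 : 0 < p / (p - 1) by rewrite divr_gt0// subr_gt0.
have d0 : 0 < doobc p by rewrite /doobc mulr_gt0// mulr_gt0// powR_gt0// mulr_gt0.
by rewrite /maxc mulr_gt0 ?powR_gt0 ?exprn_gt0// mulr_gt0 ?powR_gt0// mulr_gt0.
Qed.

Lemma measurable_gridmax F J b : measT (gridmax F J b).
Proof.
rewrite /gridmax; elim: J.*2 => [|k IH] /=; first exact: measurable_cst.
apply: measurable_maxr => //.
apply: (@adapted_measurable _ _ _ _ (gridq J b k)); first by move=> i; exact: gridq_measurable.
by move=> x y qxy; rewrite /cellavg qxy.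
Qed.

(** For each J the maximum over the 2^n grids is estimated by Doob's inequality;
    each cube is eventually captured as J grows, so that the maximal function is
    below a lower limit, and Fatou's lemma concludes. *)
Lemma maximal_bound F (p : R) : 1 < p -> measT F -> (forall x, 0 <= F x)%E ->
  (\int[muX]_x (maxfun F x `^ p) <= (maxc p)%:E * \int[muX]_x (F x `^ p))%E.
Proof.
move=> p1 mF F0; have p0 : 0 < p by apply: lt_trans p1.
have pm1 : 0 < p - 1 by rewrite subr_gt0.
have p0' : p != 0 by rewrite gt_eqF.
have I0 : (0 <= \int[muX]_x (F x `^ p))%E by apply: integral_ge0 => x _; exact: poweR_ge0.
have [Fp|] := ltP (\int[muX]_x (F x `^ p))%E +oo%E; last first.
  by rewrite leye_eq => /eqP ->; rewrite gt0_muley ?leey// lte_fin maxc_gt0.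
pose Z J x := \sum_b gridmax F J b x.
have g0 J b x : 0 <= gridmax F J b x by exact: runmax_ge0.
have Z0 J x : 0 <= Z J x by exact: sumr_ge0.
have C0 : 0 <= 12 ^+ n :> R by rewrite exprn_ge0.
pose h J x := ((12 ^+ n * Z J x) `^ p)%:E.
have mh J : measT (h J).
  apply/measurable_EFinP; apply: (measurableT_comp (measurable_powR p)).
  apply: measurable_funM => //; apply: measurable_sum => b; exact: measurable_gridmax.
have h0 J x : (0 <= h J x)%E by rewrite lee_fin powR_ge0.
have hint J : (\int[muX]_x h J x <= (maxc p)%:E * \int[muX]_x (F x `^ p))%E.
  have mg b : measT (fun x => (gridmax F J b x `^ p)%:E).
    by apply/measurable_EFinP; apply: (measurableT_comp (measurable_powR p)); exact: measurable_gridmax.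
  apply: (@le_trans _ _ (\int[muX]_x (((12 ^+ n) `^ p * (#|{ffun 'I_n -> bool}|%:R `^ p))%:E *
      \sum_b (gridmax F J b x `^ p)%:E)))%E.
    apply: ge0_le_integral => //.
    - by apply: emeasurable_funM => //; apply: emeasurable_sum.
    - move=> x _; rewrite sumEFin -EFinM lee_fin /h powRM// -mulrA ler_wpM2l ?powR_ge0//.
      exact: sum_powR_le.
  rewrite (ge0_intZ muX); last 4 first.
  - exact: measurableT.
  - exact: emeasurable_sum.
  - by move=> x _; rewrite sumEFin lee_fin sumr_ge0// => b _; exact: powR_ge0.
  - by rewrite mulr_ge0// powR_ge0.
  rewrite ge0_integral_sum//; last by move=> b x _; rewrite lee_fin powR_ge0.
  rewrite [maxc p](_ : _ = (12 ^+ n) `^ p * #|{ffun 'I_n -> bool}|%:R `^ p * (#|{ffun 'I_n -> bool}|%:R * doobc p)); last by rewrite /maxc mulrA.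
  rewrite [in leRHS]EFinM -muleA; apply: lee_wpmul2l; first by rewrite lee_fin mulr_ge0// powR_ge0.
  apply: (@le_trans _ _ (\sum_(b : {ffun 'I_n -> bool}) ((doobc p)%:E * \int[muX]_x (F x `^ p)))%E).
    apply: lee_sum => b _.
    have s0 : 0 < 2 ^+ J / 2 ^+ J.*2 :> R by rewrite divr_gt0// exprn_gt0.
    apply: (@doob _ _ R muX _ (gridq J b) F J.*2 p ((2 ^+ J / 2 ^+ J.*2) ^+ n)) => //.
    - by move=> k i; exact: gridq_measurable.
    - exact: gridq_nested.
    - move=> k x kJ; have sk : 0 < 2 ^+ J / 2 ^+ k :> R by rewrite divr_gt0// exprn_gt0.
      apply: le_trans (qcell_measure_ge _ _ sk); rewrite lee_fin.
      rewrite lerXn2r ?nnegrE ?(ltW sk) ?(ltW s0)// ler_pM2l ?exprn_gt0// lef_pV2 ?posrE ?exprn_gt0//.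
      by rewrite ler_weXn2l ?ler1n// ltnW.
    - move=> k x; have sk : 0 < 2 ^+ J / 2 ^+ k :> R by rewrite divr_gt0// exprn_gt0.
      by apply: le_lt_trans (qcell_measure_le _ _ sk) _; rewrite ltry.
  move: Fp I0; case: (\int[muX]_x _)%E => [r _ _||] //.
  by rewrite -EFinM sumEFin -EFinM lee_fin sumr_const -[_ *+ _]mulr_natl mulrA.
apply: (@le_trans _ _ (\int[muX]_x (limn_einf (h ^~ x)))%E); last first.
  apply: (le_trans (fatou muX measurableT mh (fun J x _ => h0 J x))).
  exact: limn_einf_le.
apply: ge0_le_integral => //.
- by move=> x _; exact: poweR_ge0.
- by apply: (measurable_poweRT p); exact: measurable_cubesup.
- rewrite /limn_einf; apply: measurableT_comp => //.
  by apply: (measurable_fun_limn_esup (f := fun J x => (- h J x)%E)) => J; apply: measurableT_comp.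
move=> x _; set A := limn_einf _.
have A0 : (0 <= A)%E by apply: (@limn_einf_ge _ _ _ 0%N).
have pi : 0 < p^-1 by rewrite invr_gt0.
have M0 : (0 <= maxfun F x)%E by apply: cubesup_ge0 => a l; exact: integral_ge0.
have -> : A = ((A `^ p^-1) `^ p)%E by rewrite -poweRrM mulVf// poweRe1.
apply: gt0_ler_poweR => //; [exact: ltW|by rewrite in_itv/= leey M0|by rewrite in_itv/= leey poweR_ge0|].
apply: ge_ereal_sup => _ [a [l [l0 cx ->]]].
set v := (_ / _)%E.
have v0 : (0 <= v)%E by rewrite mule_ge0 ?inve_ge0// integral_ge0.
have -> : v = ((v `^ p) `^ p^-1)%E by rewrite -poweRrM mulfV// poweRe1.
apply: gt0_ler_poweR => //; [exact: ltW|by rewrite in_itv/= leey poweR_ge0|by rewrite in_itv/= leey A0|].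
have [J0 hJ] := cubeavg_le_gridmax p1 mF F0 Fp l0 cx.
apply: (@limn_einf_ge _ _ _ J0) => J /hJ[b hb].
rewrite /h -poweR_EFin; apply: gt0_ler_poweR; [exact: ltW|by rewrite in_itv/= leey v0| |].
  by rewrite in_itv/= leey lee_fin mulr_ge0.
apply: (le_trans hb); rewrite lee_fin ler_wpM2l// /Z (bigD1 b)//= lerDl.
by apply: sumr_ge0.
Qed.
End maximal.

(** * Density of boxes in the Lebesgue spaces *)

Section pw.
Context d (T : measurableType d) (R : realType) (mu : {measure set T -> \bar R}).
Variable p : R.
Hypothesis p0 : 0 < p.
Implicit Types (f g h : T -> R).

(** The p-th power of the L^p norm, which suffices for the estimates below and
    avoids p-th roots. *)
Definition pw f : \bar R := (\int[mu]_x (`|f x| `^ p)%:E)%E.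

Lemma pw_ge0 f : (0 <= pw f)%E.
Proof. by apply: integral_ge0 => x _; rewrite lee_fin powR_ge0. Qed.

Lemma measurable_pw f : measT f -> measT (fun x => (`|f x| `^ p)%:E).
Proof.
move=> mf; apply/measurable_EFinP; apply: (measurableT_comp (measurable_powR p)).
exact: measurableT_comp.
Qed.

Lemma powR_add_le (a b : R) : 0 <= a -> 0 <= b -> (a + b) `^ p <= 2 `^ p * (a `^ p + b `^ p).
Proof.
move=> a0 b0; wlog ab : a b a0 b0 / a <= b.
  move=> H; have [ab|/ltW ba] := leP a b; first exact: H.
  by rewrite addrC [X in _ * X]addrC; exact: H.
apply: (@le_trans _ _ ((2 * b) `^ p)).
  by apply: ge0_ler_powR; rewrite ?nnegrE ?(ltW p0) ?addr_ge0 ?mulr_ge0//; lra.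
by rewrite powRM// ler_wpM2l ?powR_ge0// lerDr powR_ge0.
Qed.

Lemma le_pw f g (c : R) : 0 <= c -> measT f -> measT g ->
  (forall x, `|f x| <= c * `|g x|) -> (pw f <= (c `^ p)%:E * pw g)%E.
Proof.
move=> c0 mf mg fg; rewrite -(ge0_intZ mu measurableT (measurable_pw mg)) ?powR_ge0//.
apply: ge0_le_integral => //.
- exact: measurable_pw.
- by apply: emeasurable_funM => //; exact: measurable_pw.
- move=> x _; rewrite -EFinM lee_fin -powRM//; apply: ge0_ler_powR; rewrite ?nnegrE ?(ltW p0) ?mulr_ge0//.
Qed.

Lemma pwD f g : measT f -> measT g ->
  (pw (fun x => f x + g x)%R <= (2 `^ p)%:E * (pw f + pw g))%E.
Proof.
move=> mf mg; have m1 := measurable_pw mf; have m2 := measurable_pw mg.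
have n1 (k : T -> R) x : (0 <= (`|k x| `^ p)%:E)%E by rewrite lee_fin powR_ge0.
rewrite /pw -ge0_integralD//.
have ms : measT (fun x => (`|f x| `^ p)%:E + (`|g x| `^ p)%:E)%E.
  by apply: emeasurable_funD; exact: measurable_pw.
rewrite -(ge0_intZ mu measurableT ms) ?powR_ge0//; last by move=> x _; rewrite adde_ge0.
apply: ge0_le_integral => //.
- by apply: measurable_pw; exact: measurable_funD.
- exact: emeasurable_funM.
- move=> x _; rewrite -EFinD -EFinM lee_fin; apply: le_trans (powR_add_le _ _) => //.
  by apply: ge0_ler_powR; rewrite ?nnegrE ?(ltW p0) ?addr_ge0//; exact: ler_normD.
Qed.

Lemma pw_dct (f : nat -> T -> R) h : (forall j, measT (f j)) -> measT h ->
  (forall j x, `|f j x| <= `|h x|) -> (pw h < +oo)%E -> (forall x, f j x @[j --> \oo] --> 0) ->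
  pw (f j) @[j --> \oo] --> 0%E.
Proof.
move=> mf mh fh hp f0.
have hi : mu.-integrable setT (fun x => (`|h x| `^ p)%:E).
  apply/integrableP; split; first exact: measurable_pw.
  rewrite (eq_integral (fun x => (`|h x| `^ p)%:E))// => x _.
  by rewrite gee0_abs// lee_fin powR_ge0.
have [|||||_ _ h3] := @dominated_convergence _ _ _ mu setT measurableT (fun j x => (`|f j x| `^ p)%:E) (fun=> 0%E) (fun x => (`|h x| `^ p)%:E).
- by move=> j; exact: measurable_pw.
- exact: measurable_cst.
- apply: nearW => x _; apply: cvg_EFin; first exact: nearW.
  apply/cvgrPdist_le => e e0.
  have d0 : 0 < e `^ p^-1 by rewrite powR_gt0.
  have /cvgrPdist_le /(_ _ d0) := f0 x; apply: filterS => j; rewrite !sub0r !normrN => hj.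
  rewrite (ger0_norm (powR_ge0 _ _)).
  have -> : e = (e `^ p^-1) `^ p by rewrite -powRrM mulVf ?gt_eqF// powRr1// ltW.
  by apply: ge0_ler_powR; rewrite ?nnegrE ?(ltW p0)// powR_ge0.
- exact: hi.
- apply: nearW => x j _; rewrite gee0_abs ?lee_fin ?powR_ge0//.
  by apply: ge0_ler_powR; rewrite ?nnegrE ?(ltW p0).
by move: h3; rewrite integral0.
Qed.
End pw.

Section density.
Context {R : realType} (n : nat) (p : R).
Hypothesis p0 : 0 < p.
Local Notation X := ('rV[R]_n).
Local Notation muX := (lebesgue_rV n).
Local Notation pw := (@pw _ X R muX p).
Variable G : (X -> R) -> Prop.
Hypothesis G_box : forall a b, G (\1_(obox a b)).
Hypothesis G_comb : forall (c : R) (f g : X -> R), measT f -> measT g ->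
  G f -> G g -> G (fun x => c * f x + g x).
Hypothesis G_closed : forall (f : X -> R) (h : nat -> X -> R), measT f -> (forall j, measT (h j)) ->
  (forall j, G (h j)) -> pw (fun x => f x - h j x) @[j --> \oo] --> 0%E -> G f.

Let box (N : nat) : set X := obox (const_mx (- N%:R)) (const_mx N%:R).
Let mbox N : measurable (box N). Proof. exact: measurable_obox. Qed.

Let boxfin N : (muX (box N) < +oo)%E.
Proof. by rewrite /box; have -> := lebesgue_obox (const_mx (- N%:R)) (const_mx N%:R : X); rewrite ltry. Qed.

Let mind (A : set X) : measurable A -> measT (\1_A : X -> R).
Proof. exact: measurable_indic. Qed.

Let Gbx N : G (\1_(box N)). Proof. exact: G_box. Qed.

Let pw_ind (A : set X) (g : X -> R) : (forall x, A x -> `|g x| <= 1) -> (forall x, ~ A x -> g x = 0) ->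
  measurable A -> measT g -> (pw g <= muX A)%E.
Proof.
move=> g1 g0 mA mg; rewrite -[muX A]mul1e -integral_cst// [leRHS]integral_mkcond.
apply: ge0_le_integral => //.
- exact: measurable_pw.
- by apply/(measurable_restrictT _ mA); exact: measurable_cst.
- move=> x _; rewrite patchE; case: ifPn => [/set_mem Ax|/negP xA].
    apply: (@le_trans _ _ (1 `^ p)%:E); last by rewrite powR1.
    rewrite lee_fin; apply: ge0_ler_powR; rewrite ?nnegrE ?(ltW p0)//; exact: g1.
  have -> : g x = 0 by apply: g0 => /mem_set.
  by rewrite normr0 powR0 ?gt_eqF//; apply: lexx.
Qed.

(** Dynkin's theorem: the sets whose truncated indicator lies in G form a
    Dynkin system containing the boxes. *)
Let Gset N A : measurable A -> G (\1_(A `&` box N)).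
Proof.
rewrite measurable_rV_oboxes => sA; move: A sA.
apply: (@dynkin_induction _ _ (@oboxes R n) (fun A => G (\1_(A `&` box N)))).
- exact: measurable_rV_oboxes.
- exact: oboxesI.
- by rewrite setTI; exact: G_box.
- move=> _ [a [b ->]]; have [c [e ->]] : oboxes (obox a b `&` box N).
    by apply: oboxesI; [exists a, b|exists (const_mx (- N%:R)), (const_mx N%:R)].
  exact: G_box.
- move=> A mA GA; have -> : \1_(~` A `&` box N) = (fun x => -1 * \1_(A `&` box N) x + \1_(box N) x) :> (X -> R).
    apply/funext => x; rewrite !indicE !in_setI in_setC.
    by case: (x \in A); case: (x \in box N); rewrite /= ?mulr0 ?mulr1 ?addr0 ?add0r ?addNr.
  by apply: G_comb => //; apply: mind; exact: measurableI.
- move=> F mF tF GF.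
  pose h j (x : X) : R := \sum_(k < j) \1_(F k `&` box N) x.
  have mh j : measT (h j) by apply: measurable_sum => k; apply: mind; exact: measurableI.
  have mU : measurable (\bigcup_k F k) by exact: bigcup_measurable.
  have Gh j : G (h j).
    elim: j => [|j IH].
      rewrite (_ : h 0%N = fun x => -1 * \1_(box N) x + \1_(box N) x).
        by apply: G_comb => //; exact: mind.
      by apply/funext => x; rewrite /h big_ord0 mulN1r addNr.
    rewrite (_ : h j.+1 = fun x => 1 * \1_(F j `&` box N) x + h j x).
      by apply: G_comb => //; apply: mind; exact: measurableI.
    by apply/funext => x; rewrite /h big_ord_recr/= mul1r addrC.
  have hE j x : (\bigcup_k F k `&` box N) x -> h j x = \1_(\bigcup_(k < j) F k) x.
    move=> [[k0 _ Fk0] bx]; rewrite indicE; have [kj|jk] := ltnP k0 j.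
      rewrite mem_set; last by exists k0.
      rewrite /h (bigD1 (Ordinal kj))//= indicE mem_set// big1 ?addr0// => i ik.
      rewrite indicE memNset// => -[Fi _]; move/negP: ik; apply; apply/eqP/val_inj => /=.
      by apply: (tF i k0) => //; exists x.
    rewrite memNset; last first.
      move=> [i /= ij Fi]; have ik : i = k0 by apply: (tF i k0) => //; exists x.
      by move: ij; rewrite ik ltnNge jk.
    rewrite /h big1// => i _; rewrite indicE memNset// => -[Fi _].
    have ik : i = k0 :> nat by apply: (tF i k0) => //; exists x.
    by have := ltn_ord i; rewrite ik ltnNge jk.
  have hN j x : ~ (\bigcup_k F k `&` box N) x -> h j x = 0.
    move=> nx; rewrite /h big1// => i _; rewrite indicE memNset// => -[Fi bx]; apply: nx; split => //.
    by exists i.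
  apply: (G_closed (h := h)) => //; first by apply: mind; exact: measurableI.
  apply: (@pw_dct _ _ _ _ p p0 _ (\1_(box N))).
  + by move=> j; apply: measurable_funB => //; apply: mind; exact: measurableI.
  + exact: mind.
  + move=> j x; have [ux|ux] := pselect ((\bigcup_k F k `&` box N) x).
      rewrite hE// !indicE !(mem_set ux) (mem_set ux.2).
      by case: (_ \in _); rewrite ?subrr ?subr0 ?normr0 ?normr1.
    by rewrite hN// indicE memNset// subr0 normr0.
  + apply: le_lt_trans (boxfin N); apply: pw_ind => //.
    * by move=> x bx; rewrite indicE mem_set// normr1.
    * by move=> x bx; rewrite indicE memNset.
  + move=> x; have [ux|ux] := pselect ((\bigcup_k F k `&` box N) x); last first.
      rewrite (_ : (fun j => _) = fun=> 0); first exact: cvg_cst.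
      by apply/funext => j; rewrite hN// indicE memNset// subr0.
    have [[k0 _ Fk0] bx] := ux.
    apply: (@cvg_trans _ (0 @[j --> \oo])); last exact: cvg_cst.
    apply: near_eq_cvg; exists k0.+1 => // j /= kj.
    by rewrite hE// !indicE (mem_set ux) mem_set ?subrr//; exists k0.
Qed.

(** Layer-cake approximation by step functions that stay below f + 1/j, with
    dominated convergence. *)
Let Gpos N (f : X -> R) : measT f -> (forall x, 0 <= f x) -> (forall x, ~ box N x -> f x = 0) ->
  (pw f < +oo)%E -> G f.
Proof.
move=> mf f0 fN fp.
pose A (j i : nat) : set X := [set x | i%:R < j.+1%:R * f x].
have mA j i : measurable (A j i).
  have mm : measT (fun x => j.+1%:R * f x) by exact: measurable_funM.
  have := mm measurableT `]i%:R, +oo[%classic (measurable_itv _); rewrite setTI.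
  by congr (measurable _); apply/seteqP; split => x /=; rewrite in_itv/= andbT.
pose h j (x : X) : R := j.+1%:R^-1 * \sum_(i < j.+1 ^ 2) \1_(A j i `&` box N) x.
have mI j i : measT (\1_(A j i `&` box N) : X -> R) by apply: mind; exact: measurableI.
have ms j m : measT (fun x => \sum_(i < m) \1_(A j i `&` box N) x : R).
  by apply: measurable_sum => i.
have mh j : measT (h j) by apply: measurable_funM.
have G0 : G (fun=> 0).
  rewrite (_ : (fun=> 0) = fun x => -1 * \1_(box N) x + \1_(box N) x); first by apply: G_comb => //; exact: mind.
  by apply/funext => x; rewrite mulN1r addNr.
have Gs j m : G (fun x => \sum_(i < m) \1_(A j i `&` box N) x).
  elim: m => [|m IH]; first by rewrite (_ : (fun x => _) = fun=> 0)//; apply/funext => x; rewrite big_ord0.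
  rewrite (_ : (fun x => _) = fun x => 1 * \1_(A j m `&` box N) x + \sum_(i < m) \1_(A j i `&` box N) x).
    by apply: G_comb => //; exact: Gset.
  by apply/funext => x; rewrite big_ord_recr/= mul1r addrC.
have Gh j : G (h j).
  rewrite (_ : h j = fun x => j.+1%:R^-1 * (\sum_(i < j.+1 ^ 2) \1_(A j i `&` box N) x) + 0).
    by apply: G_comb => //; exact: measurable_cst.
  by apply/funext => x; rewrite addr0.
have hN j x : ~ box N x -> h j x = 0.
  by move=> bx; rewrite /h big1 ?mulr0// => i _; rewrite indicE memNset// => -[].
have hbd j x : box N x -> Num.min (f x) j.+1%:R <= h j x <= Num.min (f x + j.+1%:R^-1) j.+1%:R.
  move=> bx; have jp : 0 < j.+1%:R :> R by rewrite ltr0n.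
  have y0 : 0 <= j.+1%:R * f x by rewrite mulr_ge0.
  have := @count_lt R (j.+1 ^ 2) _ y0.
  have -> : \sum_(k < j.+1 ^ 2) ((k%:R < j.+1%:R * f x)%R%:R : R) = j.+1%:R * h j x.
    rewrite /h mulrA divff ?gt_eqF// mul1r; apply: eq_bigr => i _; rewrite indicE.
    congr ((nat_of_bool _)%:R); apply/idP/idP => hh; first by apply/mem_set; split.
    by case: (set_mem hh).
  rewrite natrX expr2.
  have -> : Num.min (j.+1%:R * f x) (j.+1%:R * j.+1%:R) = j.+1%:R * Num.min (f x) j.+1%:R :> R.
    by rewrite minr_pMr// ltW.
  have -> : Num.min (j.+1%:R * f x + 1) (j.+1%:R * j.+1%:R) = j.+1%:R * Num.min (f x + j.+1%:R^-1) j.+1%:R :> R.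
    by rewrite minr_pMr ?(ltW jp)// mulrDr divff ?gt_eqF.
  by rewrite !ler_pM2l.
apply: (G_closed (h := h)) => //.
apply: (@pw_dct _ _ _ _ p p0 _ (fun x => f x + \1_(box N) x)) => //.
- by move=> j; exact: measurable_funB.
- by apply: measurable_funD => //; exact: mind.
- move=> j x; have [bx|bx] := pselect (box N x); last first.
    by rewrite hN// fN// subr0 normr0.
  rewrite indicE mem_set// [X in _ <= X]ger0_norm ?addr_ge0//.
  have := hbd j x bx; rewrite /= le_min ge_min => /andP[h1 /andP[h2 h3]].
  have j1 : j.+1%:R^-1 <= 1 :> R by rewrite invf_le1 ?ler1n.
  have h0 : 0 <= h j x by rewrite /h mulr_ge0// sumr_ge0// => i _; rewrite indicE.
  rewrite ler_norml; move: h1 h2 j1 h0 (f0 x); generalize (j.+1%:R^-1 : R) => r.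
  by move=> *; apply/andP; split; lra.
- apply: (le_lt_trans (pwD muX p0 mf (mind (mbox N)))).
  apply: (@le_lt_trans _ _ ((2 `^ p)%:E * (pw f + muX (box N))))%E.
    apply: lee_wpmul2l; first by rewrite lee_fin powR_ge0.
    apply: leeD => //; apply: pw_ind => //.
      by move=> x bx; rewrite indicE mem_set// normr1.
    by move=> x bx; rewrite indicE memNset.
  have : (pw f + muX (box N) < +oo)%E by apply: lte_add_pinfty.
  have : (0 <= pw f + muX (box N))%E by rewrite adde_ge0// pw_ge0.
  by case: (_ + _)%E => // r _ _; rewrite -EFinM ltry.
- move=> x; have [bx|bx] := pselect (box N x); last first.
    by rewrite (_ : (fun j => _) = fun=> 0); [exact: cvg_cst|apply/funext => j; rewrite hN// fN// subr0].
  apply/cvgrPdist_le => e e0.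
  have [j0 hj0] : exists j0 : nat, f x + e^-1 <= j0%:R.
    by exists (Num.trunc (f x + e^-1)).+1; exact/ltW/truncnS_gt.
  exists j0 => // j /= j0j; rewrite sub0r normrN.
  have jl : f x + e^-1 <= j.+1%:R by apply: (le_trans hj0); rewrite ler_nat ltnW.
  have ei : 0 < e^-1 by rewrite invr_gt0.
  have je : j.+1%:R^-1 <= e.
    rewrite invf_ple ?posrE//; apply: le_trans jl; rewrite lerDr//.
  have := hbd j x bx; rewrite le_min => /andP[h1 /andP[h2 _]].
  move: h1; rewrite (min_idPl _); last by apply: le_trans jl; rewrite lerDl ltW.
  have aux (a b r : R) : a <= b -> b <= a + r -> r <= e -> `|a - b| <= e.
    by move=> *; rewrite ler_norml; apply/andP; split; lra.
  by move=> h1; exact: aux h1 h2 je.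
Qed.

(** Positive and negative parts, truncated to growing boxes, reduce the claim
    to [Gpos]. *)
Lemma Lp_density (f : X -> R) : measT f -> (pw f < +oo)%E -> G f.
Proof.
move=> mf fp.
have Gb N (g : X -> R) : measT g -> (forall x, 0 <= g x <= `|f x|) -> (forall x, ~ box N x -> g x = 0) -> G g.
  move=> mg gf gN; apply: (@Gpos N) => //; first by move=> x; have /andP[] := gf x.
  apply: le_lt_trans fp; have := @le_pw _ _ _ muX p p0 g f 1 ler01 mg mf.
  rewrite powR1 mul1e; apply => x; rewrite mul1r; have /andP[h0 h1] := gf x.
  by rewrite ger0_norm.
pose fp' x := Num.max (f x) 0; pose fm x := Num.max (- f x) 0.
have mp : measT fp' by apply: measurable_maxr.
have mm : measT fm by apply: measurable_maxr => //; exact: measurableT_comp.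
have fE x : f x = fp' x - fm x.
  by rewrite /fp' /fm; case: (leP (f x) 0) => h; case: (leP (- f x) 0) => h'; lra.
have bp x : 0 <= fp' x <= `|f x|.
  by rewrite /fp' le_max lexx orbT ge_max ler_norm normr_ge0.
have bm x : 0 <= fm x <= `|f x|.
  by rewrite /fm le_max lexx orbT ge_max -normrN ler_norm normr_ge0.
pose h N (x : X) := -1 * (fm x * \1_(box N) x) + fp' x * \1_(box N) x.
have mI N : measT (\1_(box N) : X -> R) by exact: mind.
have mh N : measT (h N).
  by apply: measurable_funD; apply: measurable_funM => //; exact: measurable_funM.
have hE N x : h N x = f x * \1_(box N) x by rewrite /h fE; ring.
have Gh N : G (h N).
  apply: G_comb => //; [exact: measurable_funM|exact: measurable_funM| |].
    apply: (@Gb N); first exact: measurable_funM.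
      move=> x; have /andP[h1 h2] := bm x; rewrite indicE; case: (_ \in _); rewrite ?mulr1 ?mulr0 ?h1 ?h2 ?lexx//=.
    by move=> x bx; rewrite indicE memNset// mulr0.
  apply: (@Gb N); first exact: measurable_funM.
    move=> x; have /andP[h1 h2] := bp x; rewrite indicE; case: (_ \in _); rewrite ?mulr1 ?mulr0 ?h1 ?h2 ?lexx//=.
  by move=> x bx; rewrite indicE memNset// mulr0.
apply: (G_closed (h := h)) => //.
apply: (@pw_dct _ _ _ _ p p0 _ f) => //.
- by move=> j; exact: measurable_funB.
- move=> j x; rewrite hE indicE; case: (_ \in _); rewrite ?mulr1 ?mulr0 ?subrr ?subr0 ?normr0//.
- move=> x; apply: (@cvg_trans _ (0 @[j --> \oo])); last exact: cvg_cst.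
  have [k _ kx] : (\bigcup_k box k) x by rewrite bigcup_obox.
  apply: near_eq_cvg; exists k => // j /= kj.
  rewrite hE indicE mem_set ?mulr1 ?subrr// => i; have := kx i; rewrite !mxE => /andP[h1 h2].
  have kj' : k%:R <= j%:R :> R by rewrite ler_nat.
  by apply/andP; split; [apply: le_lt_trans h1; rewrite lerN2|apply: lt_le_trans h2 _].
Qed.
End density.

(** * Smoothing by a compactly supported kernel *)

Section ker.
Context {R : realType} (n : nat).

Lemma sqr_normr (x : R) : `|x| ^+ 2 = x ^+ 2.
Proof. by rewrite real_normK ?num_real. Qed.

Local Notation X := ('rV[R]_n).
Implicit Types (v w h x y : X) (s dl : R).

Definition kq s v : R := 1 - (\sum_i v ord0 i ^+ 2) / s ^+ 2.
(** The unnormalised smoothing kernel, the square of the positive part of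
    1 - |v|^2 / s^2. *)
Definition ker s v : R := rho (kq s v).
Definition dker s (i : 'I_n) v : R := 2 * Num.max (kq s v) 0 * (2 * v ord0 i / s ^+ 2).

Lemma kq_le1 s v : kq s v <= 1.
Proof. by rewrite lerBlDr lerDl divr_ge0 ?sqr_ge0// sumr_ge0// => i _; exact: sqr_ge0. Qed.

Lemma maxkq s v : 0 <= Num.max (kq s v) 0 <= 1.
Proof. by rewrite le_max lexx orbT ge_max kq_le1 ler01. Qed.

Lemma ker_ge0 s v : 0 <= ker s v. Proof. exact: rho_ge0. Qed.

Lemma ker_le1 s v : ker s v <= 1.
Proof. by rewrite /ker /rho expr_le1//; have /andP[] := maxkq s v. Qed.

Lemma kq_out s v i : 0 < s -> s <= `|v ord0 i| -> kq s v <= 0.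
Proof.
move=> s0 h; rewrite subr_le0 ler_pdivlMr ?exprn_gt0// mul1r (bigD1 i)//=.
apply: (@le_trans _ _ (v ord0 i ^+ 2)).
  by rewrite -[leRHS]sqr_normr lerXn2r ?nnegrE// ltW.
by rewrite lerDl sumr_ge0// => j _; exact: sqr_ge0.
Qed.

Lemma ker_out s v i : 0 < s -> s <= `|v ord0 i| -> ker s v = 0.
Proof. by move=> s0 h; rewrite /ker /rho (max_idPr (kq_out s0 h)) expr0n. Qed.

Lemma dker_out s j v i : 0 < s -> s <= `|v ord0 i| -> dker s j v = 0.
Proof. by move=> s0 h; rewrite /dker (max_idPr (kq_out s0 h)) mulr0 mul0r. Qed.

Lemma ker_in s v : 0 < s -> (forall i, `|v ord0 i| <= s / (2 * n%:R)) -> 2^-1 <= ker s v.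
Proof.
move=> s0 h; have q : 3 / 4 <= kq s v.
  rewrite /kq lerBrDr -lerBrDl ler_pdivrMr ?exprn_gt0//.
  apply: (@le_trans _ _ (\sum_(i < n) (s / (2 * n%:R)) ^+ 2)).
    apply: ler_sum => i _; rewrite -[leLHS]sqr_normr lerXn2r ?nnegrE// divr_ge0 ?(ltW s0)// mulr_ge0.
  rewrite sumr_const card_ord -[_ *+ n]mulr_natl.
  have [->|n0] := eqVneq n 0%N; first by rewrite mul0r mulr_ge0 ?sqr_ge0//; lra.
  have n1 : 1 <= n%:R :> R by rewrite ler1n lt0n.
  have -> : n%:R * (s / (2 * n%:R)) ^+ 2 = n%:R^-1 * (s ^+ 2 / 4) :> R.
    by field; rewrite pnatr_eq0.
  have -> : (1 - 3 / 4) * s ^+ 2 = 1 * (s ^+ 2 / 4) by field.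
  by rewrite ler_wpM2r ?divr_ge0 ?sqr_ge0// invf_le1// (lt_le_trans ltr01).
rewrite /ker /rho (max_idPl _); last by apply: le_trans q; rewrite divr_ge0.
apply: (@le_trans _ _ ((3 / 4) ^+ 2)); first by lra.
by rewrite lerXn2r ?nnegrE//; lra.
Qed.

Lemma kq_lip s v w dl : 0 < s -> (forall i, `|v ord0 i| <= 3 * s) -> (forall i, `|w ord0 i| <= 3 * s) ->
  (forall i, `|v ord0 i - w ord0 i| <= dl) -> `|kq s v - kq s w| <= 6 * n%:R * dl / s.
Proof.
move=> s0 hv hw hd.
have -> : kq s v - kq s w = - ((\sum_i (v ord0 i - w ord0 i) * (v ord0 i + w ord0 i)) / s ^+ 2).
  have -> : \sum_i (v ord0 i - w ord0 i) * (v ord0 i + w ord0 i) = \sum_i v ord0 i ^+ 2 - \sum_i w ord0 i ^+ 2.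
    by rewrite -sumrB; apply: eq_bigr => i _; ring.
  by rewrite /kq; ring.
rewrite normrN normrM normfV (ger0_norm (sqr_ge0 _)) ler_pdivrMr ?exprn_gt0//.
apply: (le_trans (ler_norm_sum _ _ _)).
apply: (@le_trans _ _ (\sum_(i < n) (dl * (6 * s)))).
  apply: ler_sum => i _; rewrite normrM; apply: ler_pM => //.
  by apply: (le_trans (ler_normD _ _)); have := hv i; have := hw i; lra.
rewrite sumr_const card_ord -[_ *+ n]mulr_natl.
by rewrite le_eqVlt; apply/orP; left; apply/eqP; field; rewrite gt_eqF.
Qed.

Lemma rho_lip (a b : R) : a <= 1 -> b <= 1 -> `|rho a - rho b| <= 2 * `|a - b|.
Proof.
move=> a1 b1; rewrite /rho subr_sqr normrM mulrC; apply: ler_pM => //.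
  rewrite ger0_norm; last by rewrite addr_ge0// le_max lexx orbT.
  have : Num.max a 0 <= 1 by rewrite ge_max a1 ler01.
  have : Num.max b 0 <= 1 by rewrite ge_max b1 ler01.
  lra.
have /andP[? ?] : - `|a - b| <= a - b <= `|a - b| by rewrite -ler_norml.
rewrite ler_norml; case: (leP a 0) => ha; case: (leP b 0) => hb; apply/andP; split; have := normr_ge0 (a - b); lra.
Qed.

Lemma ker_lip s v w dl : 0 < s -> (forall i, `|v ord0 i| <= 3 * s) -> (forall i, `|w ord0 i| <= 3 * s) ->
  (forall i, `|v ord0 i - w ord0 i| <= dl) -> `|ker s v - ker s w| <= 12 * n%:R * dl / s.
Proof.
move=> s0 hv hw hd; apply: (le_trans (rho_lip (kq_le1 _ _) (kq_le1 _ _))).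
have -> : 12 * n%:R * dl / s = 2 * (6 * n%:R * dl / s) by ring.
by rewrite ler_pM2l// kq_lip.
Qed.

Lemma dker_le s i v : 0 < s -> `|dker s i v| <= 4 / s.
Proof.
move=> s0; have [h|h] := leP s `|v ord0 i|.
  by rewrite (dker_out i s0 h) normr0 divr_ge0// ltW.
have /andP[q0 q1] := maxkq s v.
rewrite /dker 2!normrM (ger0_norm q0) normrM normfV (ger0_norm (sqr_ge0 s)) normrM.
rewrite (ger0_norm (ler0n R 2)).
have -> : 4 / s = 2 * 1 * (2 * s / s ^+ 2) by field; rewrite gt_eqF.
have e1 : 2 * Num.max (kq s v) 0 <= 2 * 1 by rewrite ler_pM2l.
have e2 : 2 * `|v ord0 i| / s ^+ 2 <= 2 * s / s ^+ 2.
  by rewrite ler_pM2r ?invr_gt0 ?exprn_gt0// ler_pM2l// ltW.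
have e3 : 0 <= 2 * Num.max (kq s v) 0 by rewrite mulr_ge0.
have e4 : 0 <= 2 * `|v ord0 i| / s ^+ 2 by apply: divr_ge0; [apply: mulr_ge0|exact: sqr_ge0].
exact: ler_pM.
Qed.

Lemma dker_lip s j v w dl : 0 < s -> (forall i, `|v ord0 i| <= 3 * s) -> (forall i, `|w ord0 i| <= 3 * s) ->
  (forall i, `|v ord0 i - w ord0 i| <= dl) -> `|dker s j v - dker s j w| <= (4 / s ^+ 2 * (18 * n%:R + 1)) * dl.
Proof.
move=> s0 hv hw hd; have dl0 : 0 <= dl by apply: le_trans (hd j).
have hq := kq_lip s0 hv hw hd.
set a := Num.max (kq s v) 0; set b := Num.max (kq s w) 0.
have ab : `|a - b| <= 6 * n%:R * dl / s.
  apply: le_trans hq; rewrite /a /b.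
  have /andP[? ?] : - `|kq s v - kq s w| <= kq s v - kq s w <= `|kq s v - kq s w| by rewrite -ler_norml.
  rewrite ler_norml; case: (leP (kq s v) 0) => ha; case: (leP (kq s w) 0) => hb; apply/andP; split;
    have := normr_ge0 (kq s v - kq s w); lra.
have /andP[b0 b1] : 0 <= b <= 1 := maxkq s w.
have -> : dker s j v - dker s j w = 4 / s ^+ 2 * ((a - b) * v ord0 j + b * (v ord0 j - w ord0 j)).
  by rewrite /dker -/a -/b; ring.
have s2 : 0 <= 4 / s ^+ 2 by rewrite divr_ge0 ?sqr_ge0.
rewrite normrM (ger0_norm s2) -mulrA ler_wpM2l//.
apply: (le_trans (ler_normD _ _)); rewrite !normrM (ger0_norm b0).
have -> : (18 * n%:R + 1) * dl = (6 * n%:R * dl / s) * (3 * s) + 1 * dl by field; rewrite gt_eqF.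
by apply: lerD; apply: ler_pM.
Qed.

(** The second-order remainder inside the support; together with
    [ker_rem_out] it makes the convolution differentiable by integrating the
    bound, without passing derivatives under the integral. *)
Lemma ker_rem_in s v h dl : 0 < s -> dl <= s -> (forall i, `|v ord0 i| <= 2 * s) -> (forall i, `|h ord0 i| <= dl) ->
  `|ker s (v - h) - ker s v - \sum_i dker s i v * h ord0 i| <= ((5 * n%:R / s) ^+ 2 + 2 * n%:R / s ^+ 2) * dl ^+ 2.
Proof.
move=> s0 ds hv hh.
pose d : R := (\sum_i (2 * v ord0 i * h ord0 i - h ord0 i ^+ 2)) / s ^+ 2.
have qE : kq s (v - h) = kq s v + d.
  rewrite /kq /d -addrA; congr (_ + _); rewrite -mulNr -mulNr -mulrDl -!sumrN -big_split/=; congr (_ / _).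
  by apply: eq_bigr => i _; rewrite !mxE; ring.
have [n0|n0] := posnP n.
  have e0 (i : 'I_n) : False by have := leq_ltn_trans (leq0n i) (ltn_ord i); rewrite n0.
  have -> : v - h = v by apply/rowP => i; case: (e0 i).
  rewrite subrr sub0r big1 ?oppr0 ?normr0; last by move=> i; case: (e0 i).
  by rewrite mulr_ge0 ?sqr_ge0// addr_ge0 ?sqr_ge0// divr_ge0 ?sqr_ge0// mulr_ge0.
have dl0 : 0 <= dl by apply: le_trans (hh (Ordinal n0)).
set m := Num.max (kq s v) 0; have /andP[m0 m1] : 0 <= m <= 1 := maxkq s v.
have dE : \sum_i dker s i v * h ord0 i = 2 * m * d + 2 * m * ((\sum_i h ord0 i ^+ 2) / s ^+ 2).
  rewrite -mulrDr /d -mulrDl -big_split/= mulr_suml mulr_sumr; apply: eq_bigr => i _.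
  by rewrite /dker -/m; ring.
rewrite dE /ker qE opprD addrA.
apply: (le_trans (ler_normB _ _)); rewrite [in leRHS]mulrDl; apply: lerD.
  apply: (le_trans (rho_expand _ _)); rewrite -exprMn -[leLHS]sqr_normr lerXn2r ?nnegrE//.
    by rewrite mulr_ge0// divr_ge0 ?mulr_ge0// ltW.
  rewrite normrM normfV (ger0_norm (sqr_ge0 s)) ler_pdivrMr ?exprn_gt0//.
  apply: (le_trans (ler_norm_sum _ _ _)).
  apply: (@le_trans _ _ (\sum_(i < n) (5 * s * dl))); last first.
    rewrite sumr_const card_ord -[_ *+ n]mulr_natl le_eqVlt; apply/orP; left; apply/eqP; field; rewrite gt_eqF//.
  apply: ler_sum => i _; apply: (le_trans (ler_normB _ _)).
  rewrite normrX !normrM (ger0_norm (ler0n R 2)).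
  apply: (@le_trans _ _ (2 * (2 * s) * dl + dl * dl)).
    apply: lerD; last by rewrite expr2 ler_pM.
    by apply: ler_pM; rewrite ?mulr_ge0// ler_pM2l.
  have : dl * dl <= s * dl by rewrite ler_wpM2r.
  lra.
have S0 : 0 <= \sum_i h ord0 i ^+ 2 by apply: sumr_ge0 => i _; exact: sqr_ge0.
rewrite ger0_norm; last by rewrite mulr_ge0 ?mulr_ge0 ?invr_ge0 ?sqr_ge0.
have -> : 2 * n%:R / s ^+ 2 * dl ^+ 2 = 2 * 1 * ((n%:R * dl ^+ 2) / s ^+ 2) by ring.
apply: ler_pM; rewrite ?mulr_ge0 ?invr_ge0 ?sqr_ge0//; first by rewrite ler_pM2l.
rewrite ler_pM2r ?invr_gt0 ?exprn_gt0//.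
apply: (@le_trans _ _ (\sum_(i < n) dl ^+ 2)).
  by apply: ler_sum => i _; rewrite -[leLHS]sqr_normr lerXn2r ?nnegrE.
by rewrite sumr_const card_ord -[_ *+ n]mulr_natl.
Qed.

Lemma ker_rem_out s v h dl i : 0 < s -> dl <= s -> 2 * s < `|v ord0 i| -> (forall i, `|h ord0 i| <= dl) ->
  ker s (v - h) - ker s v - \sum_i dker s i v * h ord0 i = 0.
Proof.
move=> s0 ds hv hh; have v1 : s <= `|v ord0 i| by lra.
have v2 : s <= `|(v - h) ord0 i|.
  rewrite !mxE; have := hh i; have := lerB_dist (v ord0 i) (h ord0 i); lra.
rewrite (ker_out s0 v1) (ker_out s0 v2) subrr sub0r big1 ?oppr0// => j _.
by rewrite (dker_out j s0 v1) mul0r.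
Qed.

Lemma measurable_kq s : measT (kq s).
Proof.
apply: measurable_funB => //; apply: measurable_funM => //; apply: measurable_sum => i.
by apply: measurable_funX; exact: measurable_rV_coord.
Qed.

Lemma measurable_ker s : measT (ker s).
Proof. by apply: measurable_funX; apply: measurable_maxr => //; exact: measurable_kq. Qed.

Lemma measurable_dker s i : measT (dker s i).
Proof.
apply: measurable_funM.
  by apply: measurable_funM => //; apply: measurable_maxr => //; exact: measurable_kq.
by apply: measurable_funM => //; apply: measurable_funM => //; exact: measurable_rV_coord.
Qed.
End ker.

Section smoothing.
Context {R : realType} (n : nat).
Local Notation X := ('rV[R]_n).
Local Notation muX := (lebesgue_rV n).
Implicit Types (v w h x y : X) (s dl : R) (g J : X -> R).

(** Integrability on every cube: what the smoothing of g at all points needs. *)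
Definition locint g : Prop := measT g /\
  forall a l, 0 < l -> muX.-integrable (cube a l) (EFin \o g).

(** The cube around x containing the support of every kernel of scale s
    centred at a point within s of x. *)
Definition bcube x s : set X := cube (x - const_mx (2 * s)) (4 * s).

Lemma bcubeP x s w : bcube x s w <-> forall i, `|w ord0 i - x ord0 i| < 2 * s.
Proof.
split=> h i; have := h i; rewrite ?mxE.
  by move=> /andP[? ?]; rewrite ltr_norml; apply/andP; split; lra.
by rewrite ltr_norml => /andP[? ?]; apply/andP; split; lra.
Qed.

Lemma measurable_cube (a : X) (l : R) : measurable (cube a l).
Proof. by rewrite cube_obox; exact: measurable_obox. Qed.

Definition Icube g x s : R := \int[muX]_(w in bcube x s) `|g w|.

Lemma Icube_ge0 g x s : 0 <= Icube g x s.
Proof. exact: Rintegral_ge0. Qed.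

Lemma integral_test g J (M : R) x s : locint g -> 0 < s -> measT J -> 0 <= M ->
  (forall w, `|J w| <= M) -> (forall w, ~ bcube x s w -> J w = 0) ->
  muX.-integrable setT (EFin \o (fun w => g w * J w)) /\ `|\int[muX]_w (g w * J w)| <= M * Icube g x s.
Proof.
move=> [mg ig] s0 mJ M0 JM J0.
have mB : measurable (bcube x s) by exact: measurable_cube.
have gB : muX.-integrable (bcube x s) (EFin \o g) by apply: ig; rewrite mulr_gt0.
have gJB : muX.-integrable (bcube x s) (EFin \o (fun w => g w * J w)).
  have bM : [bounded J w | w in bcube x s].
    by exists M; split; [exact: num_real|move=> r Mr w _ /=; apply: (le_trans (JM w)); exact: ltW].
  have := integrableMr mB (measurable_funTS mJ) bM gB.
  by congr (_.-integrable _ _); apply/funext => w /=; rewrite -EFinM mulrC.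
have patchE' : (fun w => g w * J w) = (fun w => g w * J w) \_ (bcube x s).
  apply/funext => w; rewrite patchE; case: ifPn => // /negP wB.
  by rewrite J0 ?mulr0// => /mem_set.
have I1 : muX.-integrable setT (EFin \o (fun w => g w * J w)).
  rewrite patchE'; have := gJB; rewrite (integrable_mkcond _ mB).
  by congr (_.-integrable _ _); apply/funext => w; rewrite /= !patchE; case: ifP.
split => //.
have -> : \int[muX]_w (g w * J w) = \int[muX]_(w in bcube x s) (g w * J w).
  by rewrite [RHS]Rintegral_mkcond -patchE'.
apply: (le_trans (le_normr_Rintegral mB gJB)).
have gBn : muX.-integrable (bcube x s) (EFin \o (fun w => `|g w|)).
  by have := integrable_abse gB.
rewrite /Icube -RintegralZl//; apply: le_Rintegral => //.
- by have := integrable_abse gJB.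
- by apply: integrable_mulc.
- by move=> w _; rewrite normrM mulrC ler_wpM2r.
Qed.

Definition csum s : R := fine (\int[muX]_w (ker s w)%:E)%E.

Lemma integral_ker_shift s y : (\int[muX]_w (ker s (w - y))%:E = \int[muX]_w (ker s w)%:E)%E.
Proof.
rewrite -(ge0_integral_shift (- y) (f := fun w => (ker s w)%:E))//.
  by apply/measurable_EFinP; exact: measurable_ker.
by move=> w; rewrite lee_fin ker_ge0.
Qed.

Lemma ker_supp s v : 0 < s -> ~ bcube 0 s v -> ker s v = 0.
Proof.
move=> s0 nb; have [i hi] : exists i, s <= `|v ord0 i|.
  apply: contrapT => hn; apply: nb; apply/bcubeP => i; rewrite mxE subr0.
  rewrite ltNge; apply/negP => h; apply: hn; exists i; lra.
exact: ker_out hi.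
Qed.

Lemma integral_ker_fin s : 0 < s -> (\int[muX]_w (ker s w)%:E < +oo)%E.
Proof.
move=> s0; have mB : measurable (bcube 0 s : set X) by exact: measurable_cube.
apply: (@le_lt_trans _ _ (muX (bcube 0 s : set X))); last first.
  by rewrite /bcube lebesgue_cube ?mulr_ge0 ?(ltW s0)// ltry.
rewrite -[leRHS]mul1e -integral_cst// [leRHS]integral_mkcond; apply: ge0_le_integral => //.
- by move=> w _; rewrite lee_fin ker_ge0.
- by apply/measurable_EFinP; exact: measurable_ker.
- by apply/(measurable_restrictT _ mB); exact: measurable_cst.
- move=> w _; rewrite patchE; case: ifPn => [_|/negP wB]; first by rewrite /cst lee_fin ker_le1.
  have -> : ker s w = 0 by apply: ker_supp => // /mem_set.
  exact: lexx.
Qed.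

Lemma csumE s y : 0 < s -> \int[muX]_w ker s (w - y) = csum s.
Proof. by move=> s0; rewrite /Rintegral integral_ker_shift. Qed.

Hypothesis n0 : (0 < n)%N.

Lemma csum_ge s : 0 < s -> 2^-1 * (s / n%:R) ^+ n <= csum s.
Proof.
move=> s0; have nR : 0 < n%:R :> R by rewrite ltr0n.
pose a : X := const_mx (- (s / (2 * n%:R))).
have sn : 0 <= s / n%:R by rewrite divr_ge0// ltW.
have mB : measurable (cube a (s / n%:R)) by exact: measurable_cube.
rewrite -lee_fin /csum fineK; last first.
  by rewrite ge0_fin_numE ?integral_ker_fin// integral_ge0// => w _; rewrite lee_fin ker_ge0.
rewrite EFinM -(lebesgue_cube a sn) -integral_cst// [leLHS]integral_mkcond.
apply: ge0_le_integral => //.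
- by move=> w _; rewrite patchE; case: ifP => // _; rewrite /cst lee_fin invr_ge0.
- by apply/(measurable_restrictT _ mB); exact: measurable_cst.
- by apply/measurable_EFinP; exact: measurable_ker.
- move=> w _; rewrite patchE; case: ifPn => [/set_mem wB|_]; last by rewrite lee_fin ker_ge0.
  rewrite /cst lee_fin; apply: ker_in => // i; have := wB i; rewrite mxE.
  have -> : s / n%:R = s / (2 * n%:R) + s / (2 * n%:R) by field; rewrite gt_eqF.
  set r := s / (2 * n%:R); move=> /andP[? ?]; rewrite ler_norml; apply/andP; split; lra.
Qed.

Lemma csum_gt0 s : 0 < s -> 0 < csum s.
Proof.
move=> s0; apply: lt_le_trans (csum_ge s0).
by rewrite mulr_gt0// ?invr_gt0// exprn_gt0// divr_gt0// ltr0n.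
Qed.

Definition Pk g s y : R := (csum s)^-1 * \int[muX]_w (g w * ker s (w - y)).

Lemma near_supp s x y w : 0 < s -> (forall i, `|y ord0 i - x ord0 i| <= s) -> ~ bcube x s w ->
  exists i, s <= `|(w - y) ord0 i|.
Proof.
move=> s0 yx nb; apply: contrapT => hn; apply: nb; apply/bcubeP => j.
have h1 : `|(w - y) ord0 j| < s.
  by rewrite ltNge; apply/negP => h; apply: hn; exists j.
have -> : w ord0 j - x ord0 j = (w - y) ord0 j + (y ord0 j - x ord0 j) by rewrite !mxE; ring.
by apply: (le_lt_trans (ler_normD _ _)); have := yx j; lra.
Qed.

Lemma measurable_kershift (k : X -> R) y : measT k -> measT (fun w => k (w - y)).
Proof. by move=> mk; have := measurableT_comp mk (measurable_shift (- y)). Qed.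

Lemma Pk_integrable g s y : locint g -> 0 < s ->
  muX.-integrable setT (EFin \o (fun w => g w * ker s (w - y))).
Proof.
move=> lg s0; have [] // := @integral_test g (fun w => ker s (w - y)) 1 y s lg s0.
- by apply: measurable_kershift; exact: measurable_ker.
- by move=> w; rewrite ger0_norm ?ker_ge0// ker_le1.
- move=> w nb; have [|i hi] := @near_supp s y y w s0 _ nb; first by move=> i; rewrite subrr normr0 ltW.
  exact: ker_out hi.
Qed.

Lemma Pk_le g s x y : locint g -> 0 < s -> (forall i, `|y ord0 i - x ord0 i| <= s) ->
  `|Pk g s y| <= (csum s)^-1 * Icube g x s.
Proof.
move=> lg s0 yx; have c0 := csum_gt0 s0.
rewrite /Pk normrM gtr0_norm ?invr_gt0// ler_pM2l ?invr_gt0//.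
have [] // := @integral_test g (fun w => ker s (w - y)) 1 x s lg s0; last by rewrite mul1r.
- by apply: measurable_kershift; exact: measurable_ker.
- by move=> w; rewrite ger0_norm ?ker_ge0// ker_le1.
- by move=> w nb; have [i hi] := near_supp s0 yx nb; exact: ker_out hi.
Qed.

Lemma Pk_lip g s x y y' dl : locint g -> 0 < s -> (forall i, `|y ord0 i - x ord0 i| <= s) ->
  (forall i, `|y' ord0 i - x ord0 i| <= s) -> (forall i, `|y ord0 i - y' ord0 i| <= dl) ->
  `|Pk g s y - Pk g s y'| <= 12 * n%:R * dl / s * ((csum s)^-1 * Icube g x s).
Proof.
move=> lg s0 yx y'x yy'; have c0 := csum_gt0 s0.
have dl0 : 0 <= dl by apply: le_trans (yy' (Ordinal n0)).
rewrite /Pk -mulrBr -RintegralB//; [|exact: Pk_integrable|exact: Pk_integrable].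
rewrite normrM gtr0_norm ?invr_gt0// mulrCA ler_pM2l ?invr_gt0//.
have [] // := @integral_test g (fun w => ker s (w - y) - ker s (w - y')) (12 * n%:R * dl / s) x s lg s0.
- by apply: measurable_funB; apply: measurable_kershift; exact: measurable_ker.
- by rewrite divr_ge0 ?(ltW s0)// !mulr_ge0.
- move=> w; have [wb|nb] := pselect (bcube x s w); last first.
    have [i hi] := near_supp s0 yx nb; have [j hj] := near_supp s0 y'x nb.
    by rewrite (ker_out s0 hi) (ker_out s0 hj) subrr normr0 divr_ge0 ?(ltW s0)// !mulr_ge0.
  have hb (z : X) : (forall i, `|z ord0 i - x ord0 i| <= s) -> forall i, `|(w - z) ord0 i| <= 3 * s.
    move=> zx i; have -> : (w - z) ord0 i = (w ord0 i - x ord0 i) - (z ord0 i - x ord0 i) by rewrite !mxE; ring.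
    by apply: (le_trans (ler_normB _ _)); have /bcubeP/(_ i) := wb; have := zx i; lra.
  apply: ker_lip => //; [exact: hb|exact: hb|].
  move=> i; have -> : (w - y) ord0 i - (w - y') ord0 i = - (y ord0 i - y' ord0 i) by rewrite !mxE; ring.
  by rewrite normrN.
- move=> w nb; have [i hi] := near_supp s0 yx nb; have [j hj] := near_supp s0 y'x nb.
  by rewrite (ker_out s0 hi) (ker_out s0 hj) subrr.
move=> _; congr (_ <= _); congr (`|_|); congr Rintegral; apply/funext => w; ring.
Qed.

Definition dPk g s (i : 'I_n) y : R := (csum s)^-1 * \int[muX]_w (g w * dker s i (w - y)).

Lemma dPk_integrable g s i y : locint g -> 0 < s ->
  muX.-integrable setT (EFin \o (fun w => g w * dker s i (w - y))).
Proof.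
move=> lg s0; have [] // := @integral_test g (fun w => dker s i (w - y)) (4 / s) y s lg s0.
- by apply: measurable_kershift; exact: measurable_dker.
- by rewrite divr_ge0// ltW.
- by move=> w; exact: dker_le.
- move=> w nb; have [|j hj] := @near_supp s y y w s0 _ nb; first by move=> j; rewrite subrr normr0 ltW.
  exact: dker_out hj.
Qed.

Lemma dPk_le g s i x y : locint g -> 0 < s -> (forall i, `|y ord0 i - x ord0 i| <= s) ->
  `|dPk g s i y| <= 4 / s * ((csum s)^-1 * Icube g x s).
Proof.
move=> lg s0 yx; have c0 := csum_gt0 s0.
rewrite /dPk normrM gtr0_norm ?invr_gt0// mulrCA ler_pM2l ?invr_gt0//.
have [] // := @integral_test g (fun w => dker s i (w - y)) (4 / s) x s lg s0.
- by apply: measurable_kershift; exact: measurable_dker.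
- by rewrite divr_ge0// ltW.
- by move=> w; exact: dker_le.
- by move=> w nb; have [j hj] := near_supp s0 yx nb; exact: dker_out hj.
Qed.

Lemma dPk_lip g s i y y' dl : locint g -> 0 < s -> dl <= s -> (forall i, `|y ord0 i - y' ord0 i| <= dl) ->
  `|dPk g s i y - dPk g s i y'| <= (4 / s ^+ 2 * (18 * n%:R + 1)) * ((csum s)^-1 * Icube g y s) * dl.
Proof.
move=> lg s0 ds yy'; have c0 := csum_gt0 s0.
have dl0 : 0 <= dl by apply: le_trans (yy' (Ordinal n0)).
have yx j : `|y ord0 j - y ord0 j| <= s by rewrite subrr normr0 ltW.
have y'x j : `|y' ord0 j - y ord0 j| <= s by rewrite distrC; apply: le_trans ds.
have K0 : 0 <= 4 / s ^+ 2 * (18 * n%:R + 1) :> R by rewrite mulr_ge0 ?divr_ge0 ?sqr_ge0// addr_ge0 ?mulr_ge0.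
rewrite /dPk -mulrBr -RintegralB//; [|exact: dPk_integrable|exact: dPk_integrable].
rewrite normrM gtr0_norm ?invr_gt0//.
have -> : (4 / s ^+ 2 * (18 * n%:R + 1)) * ((csum s)^-1 * Icube g y s) * dl =
  (csum s)^-1 * ((4 / s ^+ 2 * (18 * n%:R + 1)) * dl * Icube g y s) by ring.
rewrite ler_pM2l ?invr_gt0//.
have [] // := @integral_test g (fun w => dker s i (w - y) - dker s i (w - y')) ((4 / s ^+ 2 * (18 * n%:R + 1)) * dl) y s lg s0.
- by apply: measurable_funB; apply: measurable_kershift; exact: measurable_dker.
- by rewrite mulr_ge0.
- move=> w; have [wb|nb] := pselect (bcube y s w); last first.
    have [j hj] := near_supp s0 yx nb; have [k hk] := near_supp s0 y'x nb.
    by rewrite (dker_out i s0 hj) (dker_out i s0 hk) subrr normr0 mulr_ge0.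
  have hb (z : X) : (forall i, `|z ord0 i - y ord0 i| <= s) -> forall i, `|(w - z) ord0 i| <= 3 * s.
    move=> zx j; have -> : (w - z) ord0 j = (w ord0 j - y ord0 j) - (z ord0 j - y ord0 j) by rewrite !mxE; ring.
    by apply: (le_trans (ler_normB _ _)); have /bcubeP/(_ j) := wb; have := zx j; lra.
  apply: dker_lip => //; [exact: hb|exact: hb|].
  move=> j; have -> : (w - y) ord0 j - (w - y') ord0 j = - (y ord0 j - y' ord0 j) by rewrite !mxE; ring.
  by rewrite normrN.
- move=> w nb; have [j hj] := near_supp s0 yx nb; have [k hk] := near_supp s0 y'x nb.
  by rewrite (dker_out i s0 hj) (dker_out i s0 hk) subrr.
move=> _; congr (_ <= _); congr (`|_|); congr Rintegral; apply/funext => w; ring.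
Qed.

(** The linear approximation of the smoothed function with a quadratic error,
    locally uniform because it is controlled by the integral of |g| on a cube. *)
Lemma Pk_rem g s y h dl : locint g -> 0 < s -> dl <= s -> (forall i, `|h ord0 i| <= dl) ->
  `|Pk g s (y + h) - Pk g s y - \sum_i dPk g s i y * h ord0 i| <=
    ((5 * n%:R / s) ^+ 2 + 2 * n%:R / s ^+ 2) * ((csum s)^-1 * Icube g y s) * dl ^+ 2.
Proof.
move=> lg s0 ds hh; have c0 := csum_gt0 s0.
have dl0 : 0 <= dl by apply: le_trans (hh (Ordinal n0)).
set K := _ + 2 * n%:R / s ^+ 2.
have K0 : 0 <= K by rewrite addr_ge0 ?sqr_ge0// divr_ge0 ?sqr_ge0// mulr_ge0.
have iS : muX.-integrable setT (EFin \o (fun w => \sum_i (h ord0 i * (g w * dker s i (w - y))))).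
  by apply: integrable_sumR => // i; apply: integrable_mulc => //; exact: dPk_integrable.
have SE : \sum_i dPk g s i y * h ord0 i = (csum s)^-1 * \int[muX]_w (\sum_i (h ord0 i * (g w * dker s i (w - y)))).
  rewrite Rintegral_sum//; last by move=> i; apply: integrable_mulc => //; exact: dPk_integrable.
  rewrite mulr_sumr; apply: eq_bigr => i _; rewrite RintegralZl//; last exact: dPk_integrable.
  by rewrite /dPk; ring.
rewrite SE /Pk -!mulrBr -RintegralB//; [|exact: Pk_integrable|exact: Pk_integrable].
have iB : muX.-integrable setT (EFin \o (fun w => g w * ker s (w - (y + h)) - g w * ker s (w - y))).
  have := integrableB measurableT (Pk_integrable (y + h) lg s0) (Pk_integrable y lg s0).
  by congr (_.-integrable _ _); apply/funext => w.
rewrite -RintegralB//.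
rewrite normrM gtr0_norm ?invr_gt0//.
have -> : K * ((csum s)^-1 * Icube g y s) * dl ^+ 2 = (csum s)^-1 * (K * dl ^+ 2 * Icube g y s) by ring.
rewrite ler_pM2l ?invr_gt0//.
have [] // := @integral_test g (fun w => ker s (w - y - h) - ker s (w - y) - \sum_i dker s i (w - y) * h ord0 i) (K * dl ^+ 2) y s lg s0.
- apply: measurable_funB; last first.
    by apply: measurable_sum => i; apply: measurable_funM => //; apply: measurable_kershift; exact: measurable_dker.
  apply: measurable_funB; last by apply: measurable_kershift; exact: measurable_ker.
  have := @measurable_kershift (ker s) (y + h) (measurable_ker s).
  by congr (measurable_fun _ _); apply/funext => w; rewrite opprD addrA.
- by rewrite mulr_ge0 ?sqr_ge0.
- move=> w; have [[i hi]|hn] := pselect (exists i, 2 * s < `|(w - y) ord0 i|).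
    by rewrite (ker_rem_out s0 ds hi hh) normr0 mulr_ge0 ?sqr_ge0.
  apply: ker_rem_in => // i; rewrite leNgt; apply/negP => h1; apply: hn; by exists i.
- move=> w nb; have [i hi] : exists i, 2 * s <= `|(w - y) ord0 i|.
    apply: contrapT => hn; apply: nb; apply/bcubeP => j; rewrite ltNge; apply/negP => h1; apply: hn; exists j.
    by rewrite !mxE.
  have v1 : s <= `|(w - y) ord0 i| by lra.
  have v2 : s <= `|(w - y - h) ord0 i|.
    have -> : (w - y - h) ord0 i = (w - y) ord0 i - h ord0 i by rewrite !mxE.
    have := hh i; have := lerB_dist ((w - y) ord0 i) (h ord0 i); lra.
  rewrite (ker_out s0 v1) (ker_out s0 v2) subrr sub0r big1 ?oppr0// => j _.
  by rewrite (dker_out j s0 v1) mul0r.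
move=> _; congr (_ <= _); congr (`|_|); congr Rintegral; apply/funext => w.
rewrite opprD addrA !mulrBr mulr_sumr; congr (_ - _); apply: eq_bigr => i _; ring.
Qed.
End smoothing.

Section quadratic_diff.
Context {R : realType} (n : nat).
Local Notation V := ('rV[R]_(1 + n)).

Definition dotv (a h : V) : R := \sum_i a ord0 i * h ord0 i.

Lemma dotv_linear (a : V) : linear (dotv a).
Proof.
move=> k u v; rewrite /dotv scaler_sumr -big_split/=; apply: eq_bigr => i _.
by rewrite !mxE mulrDr mulrCA.
Qed.

HB.instance Definition _ (a : V) := GRing.isLinear.Build R V R *:%R (dotv a) (dotv_linear a).

Lemma dotv_continuous (a : V) : continuous (dotv a).
Proof.
move=> z; have oT : open [set: V] by exact: openT.
have : C1_on setT (dotv a).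
  apply: C1_sum => // i; apply: C1_mul => //; first exact: C1_cst.
  exact: C1_coord.
by move/C1_on_cont => /(_ z I).
Qed.

(** A quadratic error bound identifies the differential. *)
Lemma quadratic_differentiable (f : V -> R) (z a : V) (C dl : R) : 0 < dl -> 0 <= C ->
  (forall h, `|h| <= dl -> `|f (z + h) - f z - dotv a h| <= C * `|h| ^+ 2) ->
  differentiable f z /\ forall v, 'D_v f z = dotv a v.
Proof.
move=> dl0 C0 hf.
have E : f \o shift z = cst (f z) + dotv a +o_ (0 : V) id.
  apply/eqaddoP => e e0.
  have e1 : 0 < e / (C + 1) by rewrite divr_gt0// ltr_wpDl.
  have n1 := @nbhs0_le R V dl dl0; have n2 := @nbhs0_le R V _ e1.
  near=> h.
  have h1 : `|h| <= dl by near: h; exact: n1.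
  have h2 : `|h| <= e / (C + 1) by near: h; exact: n2.
  have -> : (f \o shift z - (cst (f z) + dotv a)) h = f (z + h) - f z - dotv a h.
    by rewrite !fctE /= opprD addrA [h + z]addrC.
  apply: (le_trans (hf h h1)); rewrite expr2 mulrA ler_wpM2r//.
  apply: (@le_trans _ _ (C * (e / (C + 1)))); first by rewrite ler_wpM2l.
  by rewrite mulrA ler_pdivrMr ?ltr_wpDl// mulrC ler_wpM2l ?(ltW e0)// lerDl.
have dE : 'd f z = dotv a :> (V -> R) by apply: diff_unique E; exact: dotv_continuous.
have df : differentiable f z.
  by apply/diff_locallyP; rewrite dE; split => //; exact: dotv_continuous.
by split => // v; rewrite deriveE// dE.
Unshelve. all: by end_near. Qed.
End quadratic_diff.

Lemma continuous_of_modulus (R : realType) m (f : 'rV[R]_m -> R) (z : 'rV[R]_m) :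
  (forall e, 0 < e -> exists2 d : R, 0 < d & forall z' : 'rV[R]_m, `|z - z'| <= d -> `|f z - f z'| <= e) ->
  {for z, continuous f}.
Proof.
move=> h; apply/(@cvgrPdist_le _ R^o _ (nbhs z)) => e e0; have [d d0 hd] := h e e0.
by apply/(@nbhs_ballP R ('rV[R]_m)); exists d => //= z'; rewrite -ball_normE /= => /ltW; exact: hd.
Qed.

Section smoothing2.
Context {R : realType} (n : nat).
Hypothesis n0 : (0 < n)%N.
Local Notation X := ('rV[R]_n).
Local Notation V := ('rV[R]_(1 + n)).
Local Notation muX := (lebesgue_rV n).
Implicit Types (v w h x y : X) (s dl : R) (g : X -> R).

Lemma cube_fin (a : X) (l : R) : 0 < l -> (muX (cube a l) < +oo)%E.
Proof. by move=> l0; have -> := lebesgue_cube a (ltW l0); rewrite ltry. Qed.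

Definition dPkv g s y : V := rowtx 0 (\row_i dPk g s i y).

Lemma dotv_rowtx (a : R) (b : X) (h : V) : dotv (rowtx a b) h = a * tcoord h + \sum_i b ord0 i * xcoord h ord0 i.
Proof.
rewrite /dotv big_split_ord/= big_ord1 row_mxEl mxE; congr (_ + _).
by apply: eq_bigr => i _; rewrite rowtxES xcoordE.
Qed.

Lemma xcoordD (z h : V) : xcoord (z + h) = xcoord z + xcoord h.
Proof. by apply/rowP => i; rewrite !mxE. Qed.

Lemma xcoord_le_norm (h : V) i : `|xcoord h ord0 i| <= `|h|.
Proof. by rewrite xcoordE; exact: coord_le_norm. Qed.

Lemma Pk_derive g s (z : V) : locint g -> 0 < s ->
  differentiable (fun z : V => Pk g s (xcoord z)) z /\
  forall v : V, 'D_v (fun z : V => Pk g s (xcoord z)) z = \sum_i dPk g s i (xcoord z) * xcoord v ord0 i.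
Proof.
move=> lg s0; set y := xcoord z.
pose C := ((5 * n%:R / s) ^+ 2 + 2 * n%:R / s ^+ 2) * ((csum n s)^-1 * Icube g y s).
have C0 : 0 <= C.
  rewrite /C !mulr_ge0 ?invr_ge0 ?Icube_ge0 ?(ltW (csum_gt0 n0 s0))//.
  by rewrite addr_ge0 ?sqr_ge0// divr_ge0 ?sqr_ge0// mulr_ge0.
have [|df dE] := @quadratic_differentiable R n (fun z : V => Pk g s (xcoord z)) z (dPkv g s y) C s s0 C0.
  move=> h hs; rewrite xcoordD dotv_rowtx mul0r add0r.
  have := @Pk_rem R n n0 g s y (xcoord h) `|h| lg s0 hs (xcoord_le_norm h).
  congr (_ <= _); congr (`|_|); congr (_ - _); apply: eq_bigr => i _; by rewrite mxE.
split => // v; rewrite dE dotv_rowtx mul0r add0r; apply: eq_bigr => i _; by rewrite mxE.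
Qed.

Lemma continuous_dPk g s i : locint g -> 0 < s -> continuous (fun z : V => dPk g s i (xcoord z)).
Proof.
move=> lg s0 z; apply: continuous_of_modulus => e e0.
set K := (4 / s ^+ 2 * (18 * n%:R + 1)) * ((csum n s)^-1 * Icube g (xcoord z) s).
have K0 : 0 <= K.
  apply: mulr_ge0; last by rewrite mulr_ge0 ?invr_ge0 ?Icube_ge0 ?(ltW (csum_gt0 n0 s0)).
  by apply: mulr_ge0; [rewrite divr_ge0 ?sqr_ge0|rewrite addr_ge0// mulr_ge0].
exists (Num.min s (e / (K + 1))); first by rewrite lt_min s0 divr_gt0// ltr_wpDl.
move=> z'; rewrite le_min => /andP[h1 h2].
apply: (le_trans (@dPk_lip R n n0 g s i (xcoord z) (xcoord z') `|z - z'| lg s0 h1 _)).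
  move=> j; have -> : xcoord z ord0 j - xcoord z' ord0 j = xcoord (z - z') ord0 j by rewrite !mxE.
  exact: xcoord_le_norm.
rewrite -/K; apply: (@le_trans _ _ (K * (e / (K + 1)))); first by rewrite ler_wpM2l.
by rewrite mulrA ler_pdivrMr ?ltr_wpDl// mulrC ler_wpM2l ?(ltW e0)// lerDl.
Qed.

Lemma Pk_C1 g s (D : set V) : open D -> locint g -> 0 < s -> C1_on D (fun z => Pk g s (xcoord z)).
Proof.
move=> oD lg s0.
apply: (@C1_onI _ _ _ _ (fun v z : V => \sum_i dPk g s i (xcoord z) * xcoord v ord0 i)) => //.
  by move=> z Dz; exact: Pk_derive.
move=> z v Dz; elim: (index_enum _) => [|i l IH].
  have -> : (fun z0 : V => \sum_(i <- [::]) dPk g s i (xcoord z0) * xcoord v ord0 i) = fun=> 0.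
    by apply/funext => w; rewrite big_nil.
  exact: (@cst_continuous V R^o).
have -> : (fun z0 : V => \sum_(j <- i :: l) dPk g s j (xcoord z0) * xcoord v ord0 j) = fun z0 =>
   dPk g s i (xcoord z0) * xcoord v ord0 i + \sum_(j <- l) dPk g s j (xcoord z0) * xcoord v ord0 j.
  by apply/funext => w; rewrite big_cons.
have c1 : {for z, continuous (fun z0 : V => xcoord v ord0 i)} by exact: (@cst_continuous V R^o).
by have := cvgD (cvgM (@continuous_dPk g s i lg s0 z) c1) IH; exact.
Qed.

Lemma continuous_Pk g s : locint g -> 0 < s -> continuous (Pk g s).
Proof.
move=> lg s0 y; apply: continuous_of_modulus => e e0.
set K := 12 * n%:R / s * ((csum n s)^-1 * Icube g y s).
have K0 : 0 <= K.
  by rewrite /K !mulr_ge0 ?invr_ge0 ?Icube_ge0 ?(ltW (csum_gt0 n0 s0)) ?(ltW s0).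
exists (Num.min s (e / (K + 1))); first by rewrite lt_min s0 divr_gt0// ltr_wpDl.
move=> y'; rewrite le_min => /andP[h1 h2].
have hj j : `|y ord0 j - y' ord0 j| <= `|y - y'|.
  have -> : y ord0 j - y' ord0 j = (y - y') ord0 j by rewrite !mxE.
  exact: coord_le_norm.
apply: (le_trans (@Pk_lip R n n0 g s y y y' `|y - y'| lg s0 _ _ hj)).
- by move=> j; rewrite subrr normr0 ltW.
- by move=> j; rewrite distrC; apply: le_trans h1; exact: hj.
have -> : 12 * n%:R * `|y - y'| / s * ((csum n s)^-1 * Icube g y s) = K * `|y - y'| by rewrite /K; ring.
apply: (@le_trans _ _ (K * (e / (K + 1)))); first by rewrite ler_wpM2l.
by rewrite mulrA ler_pdivrMr ?ltr_wpDl// mulrC ler_wpM2l ?(ltW e0)// lerDl.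
Qed.

Lemma measurable_Pk g s : locint g -> 0 < s -> measT (Pk g s).
Proof. by move=> lg s0; apply: open_continuous_measurable_rV; [exact: openT|move=> y _; exact: continuous_Pk]. Qed.

Definition Mf g : X -> \bar R := maxfun (fun w => (`|g w|)%:E).
Definition kC : R := 2 * (4 * n%:R) ^+ n.

Lemma kC_ge0 : 0 <= kC. Proof. by rewrite mulr_ge0// exprn_ge0// mulr_ge0. Qed.

Lemma measurable_Mf g : measT (Mf g).
Proof. exact: measurable_cubesup. Qed.

Lemma Mf_ge0 g x : (0 <= Mf g x)%E.
Proof. by apply: cubesup_ge0 => a l; apply: integral_ge0 => w _; rewrite lee_fin. Qed.

Lemma bcube_center x s : 0 < s -> bcube x s x.
Proof. by move=> s0; apply/bcubeP => i; rewrite subrr normr0 mulr_gt0. Qed.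

(** The cube has side 4 s and the kernel has mass at least a multiple of s^n. *)
Lemma Icube_le_Mf g x s : locint g -> 0 < s -> (((csum n s)^-1 * Icube g x s)%:E <= kC%:E * Mf g x)%E.
Proof.
move=> lg s0; have c0 := csum_gt0 n0 s0; have s4 : 0 < 4 * s by rewrite mulr_gt0.
have I1 : (\int[muX]_(w in bcube x s) (`|g w|)%:E)%E = (Icube g x s)%:E.
  rewrite /Icube /Rintegral fineK//; apply: integrable_fin_num; first exact: measurable_cube.
  by have := integrable_abse (lg.2 (x - const_mx (2 * s)) (4 * s) s4).
have h : ((Icube g x s)%:E / ((4 * s) ^+ n)%:E <= Mf g x)%E.
  apply: ereal_sup_ubound; exists (x - const_mx (2 * s)), (4 * s); split => //; first exact: bcube_center.
  by rewrite lebesgue_cube ?ltW// -I1.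
apply: (@le_trans _ _ (kC%:E * ((Icube g x s)%:E / ((4 * s) ^+ n)%:E)))%E; last first.
  by apply: lee_wpmul2l => //; rewrite lee_fin kC_ge0.
rewrite inver gt_eqF ?exprn_gt0// -!EFinM lee_fin mulrCA [leRHS]mulrC [leLHS]mulrC.
rewrite mulrC; apply: ler_wpM2r; first exact: Icube_ge0.
rewrite -[leRHS]invrK lef_pV2 ?posrE//; last first.
  by rewrite invr_gt0 divr_gt0 ?exprn_gt0// mulr_gt0// exprn_gt0// mulr_gt0// ltr0n.
apply: le_trans (csum_ge n0 s0); rewrite invf_div /kC.
have nR : n%:R != 0 :> R by rewrite pnatr_eq0 -lt0n.
rewrite le_eqVlt; apply/orP; left; apply/eqP.
rewrite !exprMn exprVn; field.
by rewrite !expf_neq0.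
Qed.

Lemma Pk_le_Mf g s x y : locint g -> 0 < s -> (forall i, `|y ord0 i - x ord0 i| <= s) ->
  ((`|Pk g s y|)%:E <= kC%:E * Mf g x)%E.
Proof.
move=> lg s0 yx; apply: le_trans (Icube_le_Mf x lg s0); rewrite lee_fin; exact: Pk_le.
Qed.

Lemma locintB g (a : R) : locint g -> locint (fun w => g w - a).
Proof.
move=> [mg ig]; split; first exact: measurable_funB.
move=> b l l0; have mB := measurable_cube b l.
have ia : muX.-integrable (cube b l) (EFin \o (fun=> a)).
  apply: measurable_bounded_integrable => //; last exact: bounded_cst.
  exact: cube_fin.
by have := integrableB mB (ig b l l0) ia; congr (_.-integrable _ _); apply/funext => w.
Qed.

Lemma PkD g g' (a : R) s y : locint g -> locint g' -> 0 < s ->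
  Pk (fun w => a * g w + g' w) s y = a * Pk g s y + Pk g' s y.
Proof.
move=> lg lg' s0; rewrite /Pk mulrCA -mulrDr; congr (_ * _).
rewrite -RintegralZl//; last exact: Pk_integrable.
rewrite -RintegralD//; [|by apply: integrable_mulc => //; exact: Pk_integrable|exact: Pk_integrable].
by congr Rintegral; apply/funext => w; ring.
Qed.

Lemma locint_cst (a : R) : locint (fun _ : X => a).
Proof.
split => // b l l0; apply: measurable_bounded_integrable => //; [exact: measurable_cube| |exact: bounded_cst].
exact: cube_fin.
Qed.

Lemma Pk_cst (a : R) s y : 0 < s -> Pk (fun=> a) s y = a.
Proof.
move=> s0; rewrite /Pk RintegralZl//; last first.
  have := Pk_integrable y (locint_cst 1) s0.
  by congr (_.-integrable _ _); apply/funext => w /=; rewrite mul1r.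
by rewrite csumE// mulrCA mulVf ?mulr1// gt_eqF// csum_gt0.
Qed.

Lemma PkB g (a : R) s y : locint g -> 0 < s -> Pk g s y - a = Pk (fun w => g w - a) s y.
Proof.
move=> lg s0; have := @PkD g (fun=> - a) 1 s y lg (locint_cst (- a)) s0.
rewrite Pk_cst// mul1r => <-; congr (Pk _ _ _); apply/funext => w; by rewrite mul1r.
Qed.

Section Lp.
Variable p : R.
Hypothesis p1 : 1 < p.
Local Notation pw := (@pw _ X R muX p).
Let p0 : 0 < p. Proof. exact: lt_trans p1. Qed.

Lemma locint_pw g : measT g -> (pw g < +oo)%E -> locint g.
Proof.
move=> mg gp; split => // a l l0; have mB := measurable_cube a l.
apply/integrableP; split; first by apply/measurable_EFinP; exact: measurable_funTS.
apply: (@integral_lty_of_poweR _ _ _ muX (fun w => (`|g w|)%:E) p) => //.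
- exact: cube_fin.
- by apply/measurable_EFinP; exact: measurableT_comp.
Qed.

Lemma Mf_pw g : measT g -> (\int[muX]_x (Mf g x `^ p) <= (maxc n p)%:E * pw g)%E.
Proof.
move=> mg; have := @maximal_bound R n (fun w => (`|g w|)%:E) p p1.
by apply=> //; apply/measurable_EFinP; exact: measurableT_comp.
Qed.

Definition kCp : R := kC `^ p * maxc n p.

Lemma kCp_ge0 : 0 <= kCp. Proof. by rewrite mulr_ge0 ?powR_ge0// ltW// maxc_gt0. Qed.

(** Uniform boundedness on L^p, through the maximal function. *)
Lemma Pk_pw g s : measT g -> (pw g < +oo)%E -> 0 < s ->
  (pw (Pk g s) <= kCp%:E * pw g)%E.
Proof.
move=> mg gp s0; have lg := locint_pw mg gp.
apply: (@le_trans _ _ ((kC `^ p)%:E * \int[muX]_x (Mf g x `^ p)))%E; last first.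
  by rewrite /kCp EFinM -muleA; apply: lee_wpmul2l; [rewrite lee_fin powR_ge0|exact: Mf_pw].
have mM : measT (fun x => Mf g x `^ p)%E.
  by apply: (measurable_poweRT p); exact: measurable_Mf.
rewrite -(ge0_intZ muX measurableT mM) ?powR_ge0//; last by move=> x _; exact: poweR_ge0.
apply: ge0_le_integral => //.
- by apply: measurable_pw; exact: measurable_Pk.
- exact: emeasurable_funM.
- move=> x _; rewrite -poweR_EFin -poweR_EFin -poweRM ?lee_fin ?kC_ge0 ?Mf_ge0//.
  have h : ((`|Pk g s x|)%:E <= kC%:E * Mf g x)%E.
    by apply: Pk_le_Mf => // i; rewrite subrr normr0 ltW.
  apply: gt0_ler_poweR => //; [exact: ltW|by rewrite in_itv/= leey lee_fin normr_ge0|].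
  by rewrite in_itv/= leey mule_ge0 ?Mf_ge0// lee_fin kC_ge0.
Qed.
End Lp.

End smoothing2.

Section approx.
Context {R : realType} (n : nat).
Hypothesis n0 : (0 < n)%N.
Local Notation X := ('rV[R]_n).
Local Notation muX := (lebesgue_rV n).
Implicit Types (v w h x y : X) (s dl : R) (g : X -> R).

Lemma locint_indic (a b : X) : locint (\1_(obox a b)).
Proof.
have mI : measT (\1_(obox a b) : X -> R) by apply: measurable_indic; exact: measurable_obox.
split => // c l l0; apply: measurable_bounded_integrable => //; first exact: measurable_cube.
- exact: cube_fin.
- exact: measurable_funTS.
- rewrite /bounded_near; near=> M => x _ /=; apply: (@le_trans _ _ 1); rewrite ?indicE; [case: (_ \in _); rewrite ?normr1 ?normr0|near: M; exact: nbhs_pinfty_ge].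
Unshelve. all: by end_near. Qed.

Lemma Pk_indic (a b : X) s : 0 < s -> forall x,
  `|Pk (\1_(obox a b)) s x - \1_(obox a b) x| <=
    \1_(obox (a - const_mx s) (b + const_mx s) `\` obox (a + const_mx s) (b - const_mx s)) x.
Proof.
move=> s0 x; have c0 := csum_gt0 n0 s0; have lB := locint_indic a b; have l1 := @locint_cst R n 1.
have iB := Pk_integrable x lB s0; have i1 := Pk_integrable x l1 s0.
have k0 w : 0 <= ker s (w - x) by exact: ker_ge0.
have far w : ker s (w - x) != 0 -> forall i, `|w ord0 i - x ord0 i| < s.
  move=> kn i; rewrite ltNge; apply/negP => hs; move/eqP: kn; apply.
  by apply: (@ker_out _ _ _ _ i s0); rewrite !mxE.
have P1 : Pk (fun=> 1) s x = 1 by exact: Pk_cst.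
have [xi|xi] := pselect (obox (a + const_mx s) (b - const_mx s) x).
  have xB : obox a b x.
    by move=> i; have := xi i; rewrite !mxE => /andP[? ?]; apply/andP; split; lra.
  have -> : Pk (\1_(obox a b)) s x = 1.
    rewrite -P1 /Pk; congr (_ * _); congr Rintegral; apply/funext => w.
    have [->|/far h] := eqVneq (ker s (w - x)) 0; first by rewrite !mulr0.
    rewrite indicE mem_set// => i; have := h i; have := xi i; rewrite !mxE ltr_norml => /andP[? ?] /andP[? ?].
    by apply/andP; split; lra.
  by rewrite indicE mem_set// subrr normr0 indicE.
have [xo|xo] := pselect (obox (a - const_mx s) (b + const_mx s) x); last first.
  have xB : ~ obox a b x.
    by move=> h; apply: xo => i; have := h i; rewrite !mxE => /andP[? ?]; apply/andP; split; lra.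
  have -> : Pk (\1_(obox a b)) s x = 0.
    rewrite /Pk (_ : (fun w => _) = fun=> 0) ?Rintegral_cst ?mul0r ?mulr0//.
    apply/funext => w.
    have [->|/far h] := eqVneq (ker s (w - x)) 0; first by rewrite !mulr0.
    rewrite indicE memNset ?mul0r// => wB; apply: xo => i; have := h i; have := wB i; rewrite !mxE ltr_norml => /andP[? ?] /andP[? ?].
    by apply/andP; split; lra.
  by rewrite indicE memNset// subrr normr0 indicE.
rewrite [leRHS]indicE mem_set//.
have P0 : 0 <= Pk (\1_(obox a b)) s x.
  rewrite /Pk mulr_ge0 ?invr_ge0 ?(ltW c0)//; apply: Rintegral_ge0 => // w _.
  by rewrite mulr_ge0// indicE; case: (_ \in _).
have P2 : Pk (\1_(obox a b)) s x <= 1.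
  rewrite -{}P1; apply: ler_wpM2l; first by rewrite invr_ge0 ltW.
  apply: le_Rintegral => // w _; apply: ler_wpM2r => //.
apply: (@le_trans _ _ 1) => //; rewrite indicE /=; clear -P0 P2; by rewrite ler_norml; case: (_ \in _); rewrite ?mulr1n ?mulr0n; apply/andP; split; lra.
Qed.

Lemma cvg0_small (u : nat -> \bar R) : (forall j, 0 <= u j)%E -> u j @[j --> \oo] --> 0%E ->
  forall e, 0 < e -> exists N : nat, forall j, (N <= j)%N -> (u j <= e%:E)%E.
Proof.
move=> u0 ul e e0; have oo : (0 < e%:E)%E by rewrite lte_fin.
have := ul _ (open_ereal_lt' oo).
by move=> [N _ hN]; exists N => j Nj; apply: ltW; apply: hN.
Qed.

Lemma cvg_geo2 : (2^-1 : R) ^+ j @[j --> \oo] --> (0 : R).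
Proof. by apply: cvg_expr; rewrite ger0_norm ?invr_ge0// invf_lt1// ltr1n. Qed.

Section Lp.
Variable p : R.
Hypothesis p1 : 1 < p.
Local Notation pw := (@pw _ X R muX p).
Let p0 : 0 < p. Proof. exact: lt_trans p1. Qed.
Local Notation sj j := ((2^-1 : R) ^+ j).
Let sj0 j : 0 < sj j. Proof. by rewrite exprn_gt0. Qed.

Lemma pw_indic (A : set X) : measurable A -> pw (\1_A) = muX A.
Proof.
move=> mA; have := @integral_indic _ _ _ muX setT measurableT A mA; rewrite setIT => <-; apply: eq_integral => x _; congr EFin.
by rewrite indicE; case: (_ \in _); rewrite ?normr1 ?normr0 ?powR1 ?powR0 ?gt_eqF.
Qed.

(** The smoothing differs from the indicator by at most 1, and only between an
    inner and an outer box, at distance s from the given one, whose volumes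
    have the same limit. *)
Lemma Pk_box_cvg (a b : X) e : 0 < e -> exists N : nat, forall j, (N <= j)%N ->
  (pw (fun x => Pk (\1_(obox a b)) (sj j) x - \1_(obox a b) x)%R <= e%:E)%E.
Proof.
move=> e0; pose v (s : R) := \prod_i Num.max 0 (b ord0 i - a ord0 i + s).
have vc (c : R) : v (c * sj j) @[j --> \oo] --> v 0.
  apply: (@cvg_big R _ _ _ _ (@mul_continuous R)) => i _.
  have cm (x : R) : {for x, continuous (fun x : R => Num.max 0 x)}.
    by apply: continuous_max; [exact: cvg_cst|exact: cvg_id].
  apply: (@cvg_comp _ _ _ (fun j => b ord0 i - a ord0 i + c * sj j) (fun x : R => Num.max 0 x) _ _ _ _ (cm _)).
  apply: cvgD; first exact: cvg_cst.
  by rewrite -[X in _ --> X](mulr0 c); apply: cvgM; [exact: cvg_cst|exact: cvg_geo2].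
have vc0 : (v (2 * sj j) - v (- 2 * sj j)) @[j --> \oo] --> 0.
  by rewrite -[X in _ --> X](subrr (v 0)); apply: cvgB; exact: vc.
have [N _ hN] := cvgr0_norm_le _ vc0 e e0.
exists N => j Nj; have s0 := sj0 j; set s := sj j in s0 *.
have mo := @measurable_obox R n.
set B1 := obox (a - const_mx s) (b + const_mx s); set B2 := obox (a + const_mx s) (b - const_mx s).
have B21 : B2 `<=` B1.
  by move=> x xi i; have := xi i; rewrite !mxE => /andP[? ?]; apply/andP; split; lra.
have m1 : muX B1 = (v (2 * s))%:E.
  rewrite lebesgue_obox; congr EFin; apply: eq_bigr => i _; congr Num.max; rewrite !mxE; ring.
have m2 : muX B2 = (v (- 2 * s))%:E.
  rewrite lebesgue_obox; congr EFin; apply: eq_bigr => i _; congr Num.max; rewrite !mxE; ring.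
have mI := measurable_indic (mo a b).
have -> : e%:E = ((1 `^ p)%:E * e%:E)%E by rewrite powR1 mul1e.
apply: le_trans (@le_pw _ _ _ muX p p0 _ (\1_(B1 `\` B2)) 1 ler01 _ _ _) _.
- apply: measurable_funB => //; apply: measurable_Pk => //; exact: locint_indic.
- by apply: measurable_indic; apply: measurableD; exact: mo.
- by move=> x; rewrite mul1r; apply: le_trans (Pk_indic a b s0 x) _; exact: ler_norm.
rewrite powR1 !mul1e pw_indic; last by apply: measurableD; exact: mo.
have mD : muX (B1 `\` B2) = (v (2 * s) - v (- 2 * s))%:E.
  have B1oo : (muX B1 < +oo)%E by rewrite m1 ltry.
  have := measureD (mo _ _ : measurable B1) (mo _ _ : measurable B2) B1oo.
  by move=> ->; rewrite (setIidr B21) EFinB -m1 -m2.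
rewrite mD lee_fin.
by apply: le_trans (hN j Nj); exact: ler_norm.
Qed.

Lemma pwZ (c : R) g : measT g -> (pw (fun x => c * g x)%R <= (`|c| `^ p)%:E * pw g)%E.
Proof.
move=> mg; apply: le_pw => //; first exact: measurable_funM.
by move=> x; rewrite normrM.
Qed.

Lemma pw_add3 (f g h : X -> R) : measT f -> measT g -> measT h ->
  (pw (fun x => f x + g x + h x)%R <= ((2 `^ p) ^+ 2)%:E * (pw f + pw g + pw h))%E.
Proof.
move=> mf mg mh; have mfg := measurable_funD mf mg.
have c1 : 1 <= 2 `^ p :> R by rewrite -[leLHS](powRr0 2) ler_powR ?ler1n// ltW.
apply: le_trans (pwD muX p0 mfg mh) _.
rewrite expr2 EFinM -muleA; apply: lee_wpmul2l; first by rewrite lee_fin powR_ge0.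
have -> : ((2 `^ p)%:E * (pw f + pw g + pw h) = (2 `^ p)%:E * (pw f + pw g) + (2 `^ p)%:E * pw h)%E.
  exact: (ge0_muleDr _ (adde_ge0 (pw_ge0 _ _ _) (pw_ge0 _ _ _)) (pw_ge0 _ _ _)).
apply: leeD; first exact: (pwD muX p0 mf mg).
by rewrite -[leLHS]mul1e; apply: lee_wpmul2r; rewrite ?pw_ge0// lee_fin.
Qed.

Lemma lin_lty (C : R) (a b : \bar R) : 0 <= C -> (0 <= a < +oo)%E -> (0 <= b < +oo)%E -> (C%:E * (a + b) < +oo)%E.
Proof.
move=> C0 /andP[a0 al] /andP[b0 bl]; apply: lte_mul_pinfty; rewrite ?lee_fin//.
exact: lte_add_pinfty.
Qed.

(** By uniform boundedness, the class of g for which the smoothings converge is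
    closed in L^p, and it contains the indicators of boxes. *)
Lemma Pk_cvg g : measT g -> (pw g < +oo)%E ->
  forall e, 0 < e -> exists N : nat, forall j, (N <= j)%N -> (pw (fun x => Pk g (sj j) x - g x)%R <= e%:E)%E.
Proof.
move=> mg gp; pose G f := (pw f < +oo)%E /\ forall e, 0 < e -> exists N : nat, forall j, (N <= j)%N ->
  (pw (fun x => Pk f (sj j) x - f x)%R <= e%:E)%E.
have P2 := @powR_ge0 R 2 p.
suff [] : G g by [].
apply: (@Lp_density _ _ _ p0 G _ _ _ g mg gp).
- move=> a b; split; last by move=> e; exact: Pk_box_cvg.
  by rewrite pw_indic; [rewrite lebesgue_obox ltry|exact: measurable_obox].
- move=> c f h mf mh [fp Hf] [hp Hh].
  have mcf : measT (fun x => c * f x) by exact: measurable_funM.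
  split.
    apply: le_lt_trans (pwD muX p0 mcf mh) _; apply: (lin_lty P2); apply/andP; split; [exact: pw_ge0| |exact: pw_ge0|exact: hp].
    apply: le_lt_trans (pwZ c mf) _; rewrite -[pw f]adde0; apply: (lin_lty (powR_ge0 _ _)).
      by apply/andP; split; [exact: pw_ge0|exact: fp].
    by rewrite lexx ltry.
  move=> e e0; set K := 2 `^ p * (`|c| `^ p + 1).
  have K0 : 0 < K by rewrite mulr_gt0 ?powR_gt0// ltr_wpDl ?powR_ge0.
  have eK : 0 < e / K by rewrite divr_gt0.
  have [N1 h1] := Hf _ eK; have [N2 h2] := Hh _ eK.
  exists (maxn N1 N2) => j; rewrite geq_max => /andP[/h1 {}h1 /h2 {}h2].
  have s0 := sj0 j; set s := sj j in s0 h1 h2 *.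
  have lf := locint_pw p1 mf fp; have lh := locint_pw p1 mh hp.
  have md1 : measT (fun x => Pk f s x - f x) by apply: measurable_funB => //; exact: measurable_Pk.
  have md2 : measT (fun x => Pk h s x - h x) by apply: measurable_funB => //; exact: measurable_Pk.
  have -> : (fun x => Pk (fun x => c * f x + h x) s x - (c * f x + h x)) =
      (fun x => c * (Pk f s x - f x) + (Pk h s x - h x)).
    by apply/funext => x; rewrite PkD//; ring.
  apply: le_trans (pwD muX p0 (measurable_funM (measurable_cst c) md1) md2) _.
  have -> : e = 2 `^ p * (`|c| `^ p * (e / K) + e / K).
    by rewrite -[X in _ + X]mul1r -mulrDl mulrA -/K mulrC divfK ?gt_eqF.
  rewrite EFinM; apply: lee_wpmul2l; rewrite ?lee_fin// EFinD; apply: leeD => //.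
  apply: le_trans (pwZ c md1) _; rewrite EFinM; apply: lee_wpmul2l; last exact: h1.
  by rewrite lee_fin powR_ge0.
move=> f h mf mh Gh fh; have mfh j : measT (fun x => f x - h j x) by exact: measurable_funB.
have sm := cvg0_small (fun j => pw_ge0 muX p (fun x => f x - h j x)) fh.
have fp : (pw f < +oo)%E.
  have [N hN] := sm 1 ltr01.
  have -> : f = fun x => (f x - h N x) + h N x by apply/funext => x; rewrite subrK.
  apply: le_lt_trans (pwD muX p0 (mfh N) (mh N)) _.
  apply: (lin_lty P2); apply/andP; split; [exact: pw_ge0| |exact: pw_ge0|by have [] := Gh N].
  by apply: le_lt_trans (hN N (leqnn _)) _; exact: ltry.
split; first exact: fp.
move=> e e0; set K := (2 `^ p) ^+ 2 * (kCp n p + 1 + 1).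
have k0 := kCp_ge0 n p1.
have K0 : 0 < K by rewrite mulr_gt0 ?exprn_gt0 ?powR_gt0// ltr_wpDl// addr_ge0.
have eK : 0 < e / K by rewrite divr_gt0.
have [N hN] := sm _ eK; have {hN} hN := hN N (leqnn _).
have [hp Hh] := Gh N; have [N' hN'] := Hh _ eK; exists N' => j /hN' {}hN'.
have s0 := sj0 j; set s := sj j in s0 hN' *.
have lf := locint_pw p1 mf fp; have lh := locint_pw p1 (mh N) hp.
have fhp : (pw (fun x => f x - h N x)%R < +oo)%E by apply: le_lt_trans hN _; exact: ltry.
have lfh := locint_pw p1 (mfh N) fhp.
have m1 := measurable_Pk n0 lfh s0.
have m2 : measT (fun x => Pk (h N) s x - h N x) by apply: measurable_funB => //; exact: measurable_Pk.
have m3 : measT (fun x => -1 * (f x - h N x)) by exact: measurable_funM.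
have -> : (fun x => Pk f s x - f x) =
    (fun x => Pk (fun x => f x - h N x) s x + (Pk (h N) s x - h N x) + -1 * (f x - h N x)).
  apply/funext => x.
  have E : f = (fun w => 1 * (f w - h N w) + h N w) by apply/funext => w; ring.
  by rewrite {1}E PkD//; ring.
apply: le_trans (pw_add3 m1 m2 m3) _.
have -> : e = (2 `^ p) ^+ 2 * (kCp n p * (e / K) + e / K + e / K).
  have -> : (2 `^ p) ^+ 2 * (kCp n p * (e / K) + e / K + e / K) = K * (e / K) by rewrite /K; ring.
  by rewrite mulrC divfK ?gt_eqF.
rewrite [leRHS]EFinM; apply: lee_wpmul2l; first by rewrite lee_fin exprn_ge0.
rewrite !EFinD; apply: leeD; first apply: leeD => //.
  apply: le_trans (Pk_pw n0 p1 (mfh N) fhp s0) _; rewrite [leRHS]EFinM; apply: lee_wpmul2l => //.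
apply: le_trans (pwZ _ (mfh N)) _.
by rewrite normrN1 powR1 mul1e.
Qed.
End Lp.

End approx.

(** * Gradients of continuously differentiable functions *)

Section density.
Import HBNNSimple.
Context d (T : measurableType d) (R : realType) (mu : {measure set T -> \bar R}).
Variable f : T -> R.
Hypotheses (mf : measT f) (f0 : forall x, 0 <= f x).
Let mfe : measT (EFin \o f). Proof. exact/measurable_EFinP. Qed.
Let f0e x : (0 <= (f x)%:E)%E. Proof. by rewrite lee_fin. Qed.

Let dens (A : set T) : \bar R := (\int[mu]_(x in A) (f x)%:E)%E.
Let dens0 : dens set0 = 0%E. Proof. exact: integral_set0. Qed.
Let dens_ge0 A : (0 <= dens A)%E. Proof. by apply: integral_ge0 => x _. Qed.
Let dens_sa : semi_sigma_additive dens.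
Proof.
move=> F mF tF mUF; rewrite /dens ge0_integral_bigcup//; last exact: measurable_funTS.
by apply: is_cvg_nneseries => k _ _; exact: dens_ge0.
Qed.
HB.instance Definition _ := isMeasure.Build _ _ _ dens dens0 dens_ge0 dens_sa.

Lemma density_measure : exists m : {measure set T -> \bar R}, forall A, m A = (\int[mu]_(x in A) (f x)%:E)%E.
Proof. by exists dens. Qed.

(** The change of density formula, by monotone approximation. *)
Lemma density_integral (m : {measure set T -> \bar R}) (D : set T) (g : T -> \bar R) :
  (forall A, measurable A -> m A = (\int[mu]_(x in A) (f x)%:E)%E) -> measurable D -> measurable_fun D g ->
  (forall x, D x -> (0 <= g x)%E) ->
  (\int[m]_(x in D) g x = \int[mu]_(x in D) (g x * (f x)%:E))%E.
Proof.
move=> mE mD mg g0; have mfD : measurable_fun D (EFin \o f) by exact: measurable_funTS.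
have indic E : measurable E -> (\int[m]_(x in D) (\1_E x)%:E = \int[mu]_(x in D) ((\1_E x)%:E * (f x)%:E))%E.
  move=> mE'; rewrite integral_indic// mE; last exact: measurableI.
  rewrite integral_mkcondl; apply: eq_integral => x _.
  by rewrite patchE indicE; case: (_ \in _); rewrite ?mul1e ?mul0e.
have simple (h : {nnsfun T >-> R}) :
    (\int[m]_(x in D) (h x)%:E = \int[mu]_(x in D) ((h x)%:E * (f x)%:E))%E.
  under [LHS]eq_integral do rewrite fimfunE -fsumEFin//.
  rewrite [LHS]ge0_integral_fsum//; last 2 first.
    by move=> r; exact/measurable_EFinP/measurableT_comp.
    by move=> k x _; rewrite EFinM nnfun_muleindic_ge0.
  under [RHS]eq_integral.
    move=> x xD; rewrite fimfunE -fsumEFin// ge0_mule_fsuml; last first.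
      by move=> r; rewrite EFinM nnfun_muleindic_ge0.
    over.
  rewrite [RHS]ge0_integral_fsum//; last 2 first.
    move=> r; apply: emeasurable_funM => //.
    by apply/measurable_EFinP; do 2 apply/measurableT_comp => //.
    by move=> k x _; rewrite EFinM mule_ge0// nnfun_muleindic_ge0.
  apply: eq_fsbigr => r /[!inE] -[x _ hxr].
  have r0 : 0 <= r by rewrite -hxr.
  have mr : measurable (h @^-1` [set r]) by exact: measurable_sfunP.
  transitivity (r%:E * \int[m]_(x in D) (\1_(h @^-1` [set r]) x)%:E)%E.
    rewrite -ge0_intZ//; first by apply/measurable_EFinP; exact: measurable_indic.
  rewrite indic//.
  rewrite -ge0_intZ//.
  - by apply: eq_integral => y _; rewrite EFinM muleA.
  - by apply: emeasurable_funM => //; apply/measurable_EFinP; exact: measurable_indic.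
  - by move=> y _; rewrite mule_ge0// lee_fin.
pose g_ := nnsfun_approx mD mg.
have ndg x a b : (a <= b)%N -> g_ a x <= g_ b x.
  by move=> ab; exact/lefP/nd_nnsfun_approx.
transitivity (limn (fun k => \int[m]_(x in D) (g_ k x)%:E))%E.
  rewrite -monotone_convergence//=.
  - apply: eq_integral => x /[!inE] xD; apply/esym/cvg_lim => //=.
    exact: cvg_nnsfun_approx.
  - by move=> k; apply: measurableT_comp => //; exact: measurable_funTS.
  - by move=> k x _; rewrite lee_fin.
  - by move=> x _ a b ab; rewrite lee_fin; exact: ndg.
transitivity (limn (fun k => \int[mu]_(x in D) ((g_ k x)%:E * (f x)%:E)))%E.
  by congr (limn _); apply/funext => k; exact: simple.
rewrite -monotone_convergence//=.
- apply: eq_integral => x /[!inE] xD; apply/cvg_lim => //=.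
  by apply: cvgeZr => //; exact: cvg_nnsfun_approx.
- move=> k; apply: emeasurable_funM => //; apply/measurable_EFinP; exact: measurable_funTS.
- by move=> k x _; rewrite mule_ge0// lee_fin.
- by move=> x _ a b ab; apply: lee_wpmul2r => //; rewrite lee_fin; exact: ndg.
Qed.

Lemma density_Rintegral (m : {measure set T -> \bar R}) (D : set T) (g : T -> R) :
  (forall A, measurable A -> m A = (\int[mu]_(x in A) (f x)%:E)%E) -> measurable D -> measurable_fun D g ->
  \int[m]_(x in D) g x = \int[mu]_(x in D) (g x * f x).
Proof.
move=> mE mD mg; rewrite /Rintegral integralE [in RHS]integralE; congr (fine (_ - _))%E.
  rewrite (density_integral mE)//; last by apply: measurable_funepos; exact/measurable_EFinP.
  apply: eq_integral => x _; rewrite !funeposE !EFinM -!EFin_max -EFinM; congr EFin.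
  by rewrite maxr_pMl// mul0r.
rewrite (density_integral mE)//; last by apply: measurable_funeneg; exact/measurable_EFinP.
apply: eq_integral => x _; rewrite !funenegE !EFinM -!EFinN -!EFin_max -EFinM; congr EFin.
by rewrite maxr_pMl// mul0r mulNr.
Qed.
End density.

Section c1grad.
Context {R : realType} (n : nat).
Local Notation V := ('rV[R]_(1 + n)).
Local Notation mu := (lebesgue_rV (1 + n)).
Local Notation H := (@hspace R n).
Implicit Types (u f g phi : V -> R) (z h v : V).

(** Differentiability of class C^1 depends only on the germ at each point. *)
Lemma C1_local (D : set V) f : (forall z, D z -> exists D' g, [/\ open D', D' z, C1_on D' g & forall w, D' w -> f w = g w]) ->
  C1_on D f.
Proof.
move=> hf z Dz; have [D' [g [oD' D'z Cg fg]]] := hf z Dz.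
have near1 w : D' w -> \forall w' \near w, f w' = g w'.
  by move=> D'w; have nD : nbhs w D' by [apply: open_nbhs_nbhs]; apply: filterS nD => w'; exact: fg.
have dE w v : D' w -> 'D_v f w = 'D_v g w.
  by move=> D'w; have := near1 _ D'w; exact: near_eq_derive.
have [dg cg] := Cg z D'z; split.
  have cd := diff_continuous dg.
  have E : f \o shift z = cst (f z) + ('d g z : V -> R) +o_ (0 : V) id.
    apply/eqaddoP => e e0.
    have /eqaddoP/(_ e e0) h1 := diff_locally dg.
    have h2 : \forall h \near (0 : V), f (h + z) = g (h + z).
      have := near1 _ D'z; rewrite -{1}[z]add0r.
      by move=> /(@continuous_shift _ _ z 0).
    apply: filterS2 h1 h2 => h h1 h2; move: h1; rewrite !fctE /= h2 (fg z D'z); exact.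
  have dE' : 'd f z = 'd g z :> (V -> R) by apply: diff_unique E.
  by apply/diff_locallyP; rewrite dE'.
move=> v; have := cg v; rewrite /prop_for/continuous_at (dE z v D'z) => h.
have nD : nbhs z D' by apply: open_nbhs_nbhs.
by move=> A /h hA; apply: (@filterS2 _ (nbhs z) _ _ _ _ _ hA nD) => w /= gA D'w; rewrite dE.
Qed.

Lemma measurable_continuous_hspace g : (forall z, H z -> {for z, continuous g}) -> measurable_fun H g.
Proof.
move=> cg; apply: open_continuous_measurable_rV; first exact: open_hspace.
by move=> z; rewrite inE; exact: cg.
Qed.

Lemma continuous_integrable g K : (forall z, H z -> {for z, continuous g}) -> compact K -> K `<=` H ->
  mu.-integrable K (EFin \o g).
Proof.
move=> cg cK KH; have mK := compact_measurable_rV cK.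
apply: measurable_bounded_integrable => //; first exact: lebesgue_compact_fin.
  by apply: measurable_funS (measurable_continuous_hspace cg) => //; exact: measurable_hspace.
have /compact_bounded[M [Mr MP]] : compact (g @` K).
  by apply: continuous_compact => //; apply: continuous_in_subspaceT => z; rewrite inE => /KH; exact: cg.
exists M; split => // M' MM' z Kz /=; apply: (MP _ MM'); by exists z.
Qed.

Lemma C1_cut u phi K (D : set V) : open D -> C1_on D u -> C1_on setT phi -> compact K -> K `<=` D ->
  (forall z, phi z != 0 -> K z) -> C1_on setT (fun z => u z * phi z).
Proof.
move=> oD Cu Cphi cK KD phiK; apply: C1_local => z _.
have oK : open (~` K) by apply: closed_openC; apply: compact_closed => //; exact: norm_hausdorff.
have [Kz|nKz] := pselect (K z).
  exists D, (fun z => u z * phi z); split => //; first exact: KD.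
  by apply: C1_mul => // w _; exact: Cphi.
exists (~` K), (fun=> 0); split => //; first exact: C1_cst.
by move=> w nK; apply/eqP; rewrite mulf_eq0; apply/orP; right; apply/negPn/negP => /phiK.
Qed.

(** The integral is the derivative at 0 of the integral of g(z - s h), which is
    constant in s by translation invariance; multiplying by the indicator of a
    large box provides the integrable factor. *)
Lemma integral_derive0 g K h : C1_on setT g -> compact K -> (forall z, g z != 0 -> K z) ->
  \int[mu]_z 'D_h g z = 0.
Proof.
move=> Cg cK gK; have [k Kk] := compact_sub_obox cK.
pose B : set V := obox (const_mx (- (k%:R + `|h|))) (const_mx (k%:R + `|h|)).
have mB : measurable B by exact: measurable_obox.
have iB : mu.-integrable setT (EFin \o (\1_B : V -> R)).
  apply/integrableP; split; first by apply/measurable_EFinP; exact: measurable_indic.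
  rewrite (eq_integral (fun z => (\1_B z)%:E)); last by move=> z _; rewrite /= ger0_norm.
  have Bfin : (mu B < +oo)%E by rewrite lebesgue_obox ltry.
  by rewrite integral_indic// setIT.
have KB s z : `|s| <= 1 -> K (z - s *: h) -> B z.
  move=> s1 /Kk hz i; have := hz i; rewrite !mxE.
  have : `|s * h ord0 i| <= `|h|.
    rewrite normrM -[leRHS]mul1r ler_pM//; exact: coord_le_norm.
  by rewrite ler_norml => /andP[? ?] /andP[? ?]; apply/andP; split; lra.
have mg : measT g by apply: C1_measurable => //; exact: openT.
have gB s z : `|s| <= 1 -> \1_B z * g (z - s *: h) = g (z - s *: h).
  move=> s1; have [->|/gK/(KB _ _ s1) Bz] := eqVneq (g (z - s *: h)) 0; first by rewrite mulr0.
  by rewrite indicE mem_set// mul1r.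
have dB := derive_shift_integral h 0 iB Cg cK gK.
have cst1 : \forall s \near (0 : R), \int[mu]_z (\1_B z * g (z - s *: h)) = \int[mu]_z g z.
  have n1 := @nbhs0_le R R^o 1 ltr01; near=> s.
  have s1 : `|s| <= 1 by near: s; exact: n1.
  transitivity (\int[mu]_z g (z + - (s *: h))).
    by apply: eq_Rintegral => z _; rewrite gB.
  rewrite /Rintegral; congr fine; apply: (integral_shift (- (s *: h)) (f := EFin \o g)).
  exact/measurable_EFinP.
have := near_eq_is_derive cst1 dB.
have d0 := is_derive_cst (\int[mu]_z g z) (0 : R) 1.
move=> d1; have := @derive_val _ _ _ _ _ _ _ d1; rewrite (@derive_val _ _ _ _ _ _ _ d0) => /esym/eqP.
rewrite oppr_eq0 => /eqP <-; apply: eq_Rintegral => z _.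
rewrite scale0r subr0; have [Kz|nK] := pselect (K z).
  by rewrite indicE mem_set ?mul1r//; apply: (KB 0); rewrite ?normr0// scale0r subr0.
by rewrite (support_open_derive0 _ cK gK nK) mulr0.
Unshelve. all: by end_near. Qed.

Definition pd (i : 'I_(1 + n)) u z : R := 'D_(delta_mx ord0 i) u z.

(** The components of the gradient measure have the positive and negative parts
    of the partial derivatives as densities; integration by parts holds because
    the derivative of the compactly supported function u phi has integral
    zero. *)
Lemma C1_gradient u : C1_on H u -> L1loc u /\ exists2 nu, is_gradient u nu &
  forall A, measurable A -> A `<=` H ->
    (vm_total_variation nu A <= \int[mu]_(z in A) (\sum_i `|pd i u z|)%:E)%E.
Proof.
move=> Cu; have mH := @measurable_hspace R n; have oH := @open_hspace R n.
have cu z : H z -> {for z, continuous u} by exact: C1_on_cont.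
have cD i z : H z -> {for z, continuous (pd i u)} by move=> Hz; exact: ((Cu z Hz).2 _).
split; first by split; [exact: measurable_continuous_hspace|move=> K; exact: continuous_integrable].
have mDu i : measurable_fun H (pd i u) by apply: measurable_continuous_hspace; exact: cD.
pose dp i := (fun z => Num.max (pd i u z) 0) \_ H.
pose dm i := (fun z => Num.max (- pd i u z) 0) \_ H.
have mdp i : measT (dp i).
  by apply/(measurable_restrictT _ mH); apply: measurable_maxr.
have mdm i : measT (dm i).
  by apply/(measurable_restrictT _ mH); apply: measurable_maxr => //; exact: measurableT_comp.
have dp0 i z : 0 <= dp i z by rewrite /dp patchE; case: ifP => // _; rewrite le_max lexx orbT.
have dm0 i z : 0 <= dm i z by rewrite /dm patchE; case: ifP => // _; rewrite le_max lexx orbT.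
have dpm i z : H z -> dp i z - dm i z = pd i u z.
  move=> Hz; rewrite /dp/dm !patchE mem_set//; case: (leP (pd i u z) 0) => h; case: (leP (- pd i u z) 0) => h'; lra.
have dpmD i z : H z -> dp i z + dm i z = `|pd i u z|.
  move=> Hz; rewrite /dp/dm !patchE mem_set//; have [h|h] := leP 0 (pd i u z).
    by rewrite ger0_norm// max_r ?addr0// oppr_le0.
  by rewrite ltr0_norm// max_l ?add0r// oppr_ge0 ltW.
have ple i z : H z -> dp i z <= `|pd i u z| by move=> Hz; rewrite -dpmD// lerDl.
have mle i z : H z -> dm i z <= `|pd i u z| by move=> Hz; rewrite -dpmD// lerDr.
have [nu nuE] : exists nu : vector_measure (R := R) n, forall i,
    (forall A, (nu i).1 A = (\int[mu]_(z in A) (dp i z)%:E)%E) /\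
    (forall A, (nu i).2 A = (\int[mu]_(z in A) (dm i z)%:E)%E).
  exists (fun i => (projT1 (cid (density_measure mu (mdp i) (dp0 i))), projT1 (cid (density_measure mu (mdm i) (dm0 i))))).
  by move=> i; split; [exact: (projT2 (cid (density_measure mu (mdp i) (dp0 i))))|exact: (projT2 (cid (density_measure mu (mdm i) (dm0 i))))].
have iD i K : compact K -> K `<=` H -> mu.-integrable K (EFin \o (pd i u)).
  by move=> cK KH; apply: continuous_integrable => //; exact: cD.
have fin i (f : V -> R) K : measT f -> (forall z, 0 <= f z) -> (forall z, H z -> f z <= `|pd i u z|) ->
    compact K -> K `<=` H -> (\int[mu]_(z in K) (f z)%:E < +oo)%E.
  move=> mf f0 fD cK KH; have mK := compact_measurable_rV cK.
  have /integrableP[_ ] := iD i K cK KH; apply: le_lt_trans; apply: ge0_le_integral => //.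
  - by move=> z _; rewrite lee_fin.
  - by apply/measurable_EFinP; exact: measurable_funTS.
  - apply: measurableT_comp => //; apply/measurable_EFinP; exact: measurable_funS (mDu i).
  - by move=> z Kz /=; rewrite lee_fin; apply: fD; exact: KH.
exists nu.
  split=> [i|i phi [Cphi [K [cK KH phiK]]]].
    by split=> K cK KH; rewrite ?(nuE i).1 ?(nuE i).2; apply: (fin i) => //; [exact: ple|exact: mle].
  have mK := compact_measurable_rV cK.
  have {}phiK z : phi z != 0 -> K z by move=> h; exact: phiK.
  have mphi : measT phi by apply: C1_measurable => //; exact: openT.
  have [M M0 phiM] : exists2 M, 0 <= M & forall z, `|phi z| <= M.
    apply: (compact_support_bounded _ cK) => [z|z nK]; first exact: (C1_on_cont Cphi).
    by apply/eqP/negPn/negP => /phiK.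
  have Cw := C1_cut oH Cu Cphi cK KH phiK.
  have wK z : u z * phi z != 0 -> K z by rewrite mulf_eq0 negb_or => /andP[_]; exact: phiK.
  have w0 := integral_derive0 (delta_mx ord0 i) Cw cK wK.
  have cont_int f : (forall z, H z -> {for z, continuous f}) -> (forall z, ~ K z -> f z = 0) ->
      mu.-integrable H (EFin \o f).
    move=> cf fK; have := continuous_integrable cf cK KH.
    have -> : EFin \o f = (EFin \o f) \_ K.
      by apply/funext => z; rewrite patchE; case: ifPn => //; rewrite notin_setE => nKz; rewrite /= fK.
    move=> iK; apply: (integrableS measurableT) => //; rewrite -integrable_mkcond//.
    by move: iK; apply: eq_integrable => // z zK; rewrite patchE zK.
  have cphi z : {for z, continuous phi} by exact: (C1_on_cont Cphi).
  have phi0 z : ~ K z -> phi z = 0 by move=> nK; apply/eqP/negPn/negP => /phiK.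
  have i1 : mu.-integrable H (EFin \o (fun z => phi z * pd i u z)).
    apply: cont_int => [z Hz|z nK]; last by rewrite phi0// mul0r.
    exact: cvgM (cphi z) (cD i z Hz).
  have i2 : mu.-integrable H (EFin \o (fun z => u z * pd i phi z)).
    apply: cont_int => [z Hz|z nK].
      exact: cvgM (cu z Hz) ((Cphi z I).2 _).
    by rewrite /pd (support_open_derive0 _ cK phiK nK) mulr0.
  have dom f : measT f -> (forall z, 0 <= f z) -> (forall z, H z -> f z <= `|pd i u z|) ->
      mu.-integrable H (EFin \o (fun z => phi z * f z)).
    move=> mf f0 fD; apply: le_integrable i1 => //.
      apply/measurable_EFinP; apply: measurable_funM; exact: measurable_funTS.
    move=> z Hz /=; rewrite lee_fin !normrM ler_wpM2l// (ger0_norm (f0 z)); exact: fD.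
  have mphiH : measurable_fun H phi by exact: measurable_funTS.
  rewrite /vm_integral (density_Rintegral (mdp i) (dp0 i) (fun A _ => (nuE i).1 A) mH mphiH).
  rewrite (density_Rintegral (mdm i) (dm0 i) (fun A _ => (nuE i).2 A) mH mphiH).
  rewrite -RintegralB//; [|exact: dom (ple i)|exact: dom (mle i)].
  have -> : \int[mu]_(z in H) (phi z * dp i z - phi z * dm i z) = \int[mu]_(z in H) (phi z * pd i u z).
    apply: eq_Rintegral; by move=> z /[!inE] Hz; rewrite -mulrBr dpm.
  have wH : \int[mu]_(z in H) pd i (fun z => u z * phi z) z = 0.
    rewrite -[RHS]w0 Rintegral_mkcond; apply: eq_Rintegral => z _; rewrite patchE; case: ifPn => //; rewrite notin_setE => nH.
    by rewrite (support_open_derive0 _ cK wK)// => /KH.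
  have wE z : H z -> pd i (fun z => u z * phi z) z = u z * pd i phi z + phi z * pd i u z.
    move=> Hz; rewrite /pd; apply: deriveM; apply: diff_derivable; [exact: (Cu z Hz).1|exact: (Cphi z I).1].
  move: wH; rewrite (eq_Rintegral _ (g := fun z => u z * pd i phi z + phi z * pd i u z)); last first.
    by move=> z /[!inE]; exact: wE.
  by rewrite RintegralD// => /eqP; rewrite addr_eq0 => /eqP.
move=> A mA AH; apply: tv_le => F [hF tF UF].
have mS : measurable_fun H (fun z => (\sum_i `|pd i u z|)%:E).
  by apply/measurable_EFinP; apply: measurable_sum => i; exact: measurableT_comp.
have S0 z : (0 <= (\sum_i `|pd i u z|)%:E)%E by rewrite lee_fin sumr_ge0.
rewrite -UF ge0_integral_bigcup//; first last.
- by apply: measurable_funS mS => //; rewrite UF.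
- by move=> j; exact: (hF j).1.
apply: lee_nneseries => [j _|j _]; first by rewrite lee_fin enorm_ge0.
have [mF cF] := hF j; have FH := compactly_in_hspace cF.
have lf : vm_locally_finite nu.
  move=> i; split=> K cK KH; rewrite ?(nuE i).1 ?(nuE i).2; apply: (fin i) => //; [exact: ple|exact: mle].
apply: le_trans (enorm_vm_val_le lf mF cF) _.
rewrite (eq_integral (fun z => \sum_i (dp i z + dm i z)%:E)%E); last first.
  move=> z /[!inE] Fz; rewrite -sumEFin; apply: eq_bigr => i _; rewrite dpmD//; exact: FH.
rewrite ge0_integral_sum//; first last.
- by move=> i z _; rewrite lee_fin addr_ge0.
- by move=> i; apply/measurable_EFinP; apply: measurable_funD; exact: measurable_funTS.
rewrite le_eqVlt; apply/orP; left; apply/eqP; apply: eq_bigr => i _.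
rewrite (nuE i).1 (nuE i).2 -ge0_integralD//.
- by move=> z _; rewrite lee_fin.
- by apply/measurable_EFinP; exact: measurable_funTS.
- by move=> z _; rewrite lee_fin.
- by apply/measurable_EFinP; exact: measurable_funTS.
Qed.
End c1grad.

(** * Carleson functional and non-tangential maximal function of smooth functions *)

Section series_power.
Context {R : realType}.

Lemma nneseries_le (a : nat -> \bar R) (c : \bar R) : (forall k, 0 <= a k)%E ->
  (forall N, \sum_(0 <= k < N) a k <= c)%E -> (\sum_(k <oo) a k <= c)%E.
Proof.
move=> a0 ac; apply: lime_le; first by apply: is_cvg_nneseries => k _ _.
exact: nearW.
Qed.

Lemma sum_half (N : nat) : \sum_(0 <= k < N) (2^-1 : R) ^+ k <= 2.
Proof.
have -> : \sum_(0 <= k < N) (2^-1 : R) ^+ k = 2 - 2 * 2^-1 ^+ N.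
  elim: N => [|N IH]; first by rewrite big_geq// expr0 mulr1 subrr.
  by rewrite big_nat_recr//= IH exprS; field.
by rewrite gerBl mulr_ge0// exprn_ge0.
Qed.

Lemma series_half_le (c : \bar R) : (0 <= c)%E -> (\sum_(k <oo) ((2^-1) ^+ k)%:E * c <= 2%:E * c)%E.
Proof.
move=> c0; apply: nneseries_le => [k|N]; first by rewrite mule_ge0// lee_fin exprn_ge0.
rewrite -ge0_sume_distrl; last by move=> k _; rewrite lee_fin exprn_ge0.
by rewrite sumEFin lee_wpmul2r// lee_fin sum_half.
Qed.

(** Some k has b_k at least 2^(-k-1) times the sum, or the sum is zero; hence
    no Minkowski inequality is needed for series with room to spare. *)
Lemma series_powR (b : nat -> \bar R) (p : R) : 0 < p -> (forall k, 0 <= b k)%E ->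
  ((\sum_(k <oo) b k) `^ p <= \sum_(k <oo) ((2 ^+ k.+1) `^ p)%:E * b k `^ p)%E.
Proof.
move=> p0 b0; pose M := (\sum_(k <oo) ((2 ^+ k.+1) `^ p)%:E * b k `^ p)%E; rewrite -/M.
have t0 k : (0 <= ((2 ^+ k.+1) `^ p)%:E * b k `^ p)%E by rewrite mule_ge0 ?poweR_ge0// lee_fin powR_ge0.
have M0 : (0 <= M)%E by apply: nneseries_ge0 => k _ _.
have tM k : (((2 ^+ k.+1) `^ p)%:E * b k `^ p <= M)%E.
  apply: (@le_trans _ _ (\sum_(0 <= j < k.+1) ((2 ^+ j.+1) `^ p)%:E * b j `^ p)%E); last exact: nneseries_lim_ge.
  by rewrite big_nat_recr//= leeDr// sume_ge0.
have bM k : (b k <= ((2^-1) ^+ k)%:E * (2^-1%:E * M `^ p^-1))%E.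
  have h : ((2 ^+ k.+1)%:E * b k <= M `^ p^-1)%E.
    have e : ((2 ^+ k.+1)%:E * b k = (((2 ^+ k.+1)%:E * b k) `^ p) `^ p^-1)%E.
      by rewrite -poweRrM mulfV ?gt_eqF// poweRe1// mule_ge0// lee_fin exprn_ge0.
    rewrite e; apply: gt0_ler_poweR; rewrite ?in_itv/= ?leey ?andbT ?poweR_ge0 ?invr_ge0 ?(ltW p0)//.
    by rewrite poweRM ?poweR_EFin// lee_fin exprn_ge0.
  rewrite muleA -EFinM -exprSr.
  have -> : (b k = ((2^-1) ^+ k.+1)%:E * ((2 ^+ k.+1)%:E * b k))%E.
    by rewrite muleA -EFinM -exprMn mulVf// expr1n mul1e.
  by apply: lee_wpmul2l => //; rewrite lee_fin exprn_ge0.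
have sM : (\sum_(k <oo) b k <= M `^ p^-1)%E.
  apply: (@le_trans _ _ (\sum_(k <oo) ((2^-1) ^+ k)%:E * (2^-1%:E * M `^ p^-1))%E).
    by apply: lee_nneseries => *.
  apply: le_trans (series_half_le _) _; first by rewrite mule_ge0// poweR_ge0.
  by rewrite muleA -EFinM mulfV// mul1e.
apply: (@le_trans _ _ ((M `^ p^-1) `^ p)%E).
  apply: (gt0_ler_poweR (ltW p0)); [ | |exact: sM]; rewrite in_itv/= leey andbT ?poweR_ge0//.
  exact: nneseries_ge0.
by rewrite -poweRrM mulVf ?gt_eqF// poweRe1.
Qed.
End series_power.

Section carleson_of_C1.
Context {R : realType} (n : nat).
Local Notation X := ('rV[R]_n).
Local Notation V := ('rV[R]_(1 + n)).
Local Notation mu := (lebesgue_rV (1 + n)).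
Local Notation muX := (lebesgue_rV n).
Local Notation H := (@hspace R n).

Lemma rV_consE (t : R) (y : X) : rV_cons (t, y) = rowtx t y.
Proof.
by congr row_mx; apply/rowP => i; rewrite !mxE ord1.
Qed.

Lemma measurable_tcoord : measT (@tcoord R n).
Proof. exact: measurable_rV_coord. Qed.

Lemma measurable_xcoord : measT (@xcoord R n).
Proof.
apply: measurable_fun_rV => j; rewrite (_ : _ \o _ = rV_coord (rshift 1 j)); first exact: measurable_rV_coord.
by apply/funext => z; rewrite /= /rV_coord xcoordE.
Qed.

(** By Tonelli the mass of a Carleson box is at most the integral over its base
    of the line integrals. *)
Lemma Cgrad_le_maxfun (u : V -> R) (F : V -> \bar R) (G : X -> \bar R) : C1_on H u ->
  measT F -> (forall z, 0 <= F z)%E -> (forall z, H z -> ((\sum_i `|pd i u z|)%:E <= F z)%E) ->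
  measT G -> (forall y, 0 <= G y)%E ->
  (forall y, (\int[lebesgue_measure]_t F (rowtx t y) <= G y)%E) ->
  BVloc u /\ forall x, (Cgrad u x <= maxfun G x)%E.
Proof.
move=> Cu mF F0 uF mG G0 FG; have [uL [nu gnu tvnu]] := C1_gradient Cu.
have BVu : BVloc u by split => //; exists nu.
split => // x; have mbox := @measurable_carleson_box R n.
have key a l : (vm_total_variation (grad u) (carleson_box a l) <= \int[muX]_(y in cube a l) G y)%E.
  have -> : vm_total_variation (grad u) (carleson_box a l) = vm_total_variation nu (carleson_box a l).
    by apply: eq_tv => A mA cA; exact: (gradient_unique (is_gradient_grad (ex_intro _ nu gnu)) gnu mA cA).
  apply: le_trans (tvnu _ (mbox a l) (@carleson_box_hspace _ _ a l)) _.
  apply: (@le_trans _ _ (\int[mu]_(z in carleson_box a l) F z)%E).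
    apply: ge0_le_integral => //.
    - by move=> z _; rewrite lee_fin sumr_ge0.
    - apply: (@measurable_funS _ _ _ _ H) => //; [exact: measurable_hspace|exact: carleson_box_hspace|].
      apply/measurable_EFinP; apply: measurable_sum => i; apply: measurableT_comp => //.
      apply: measurable_continuous_hspace => z Hz; exact: ((Cu z Hz).2 _).
    - exact: measurable_funTS.
    - by move=> z /carleson_box_hspace; exact: uF.
  have mcube : measurable (cube a l) by rewrite cube_obox; exact: measurable_obox.
  rewrite integral_mkcond [leRHS]integral_mkcond ge0_integral_rV_cons; last 2 first.
  - by apply/(measurable_restrictT _ (mbox a l)); exact: measurable_funTS.
  - by move=> z; rewrite patchE; case: ifP.
  apply: ge0_le_integral => //.
  - by move=> y _; apply: integral_ge0 => t _; rewrite patchE; case: ifP.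
  - have mFb : measT (F \_ (carleson_box a l)).
      by apply/(measurable_restrictT _ (mbox a l)); exact: measurable_funTS.
    have mFc := measurableT_comp mFb (@measurable_rV_cons R n).
    apply: (measurable_fun_fubini_tonelli_G _ mFc) => q /=; by rewrite patchE; case: ifP.
  - by apply/(measurable_restrictT _ mcube); exact: measurable_funTS.
  move=> y _; rewrite [leRHS]patchE; case: ifPn => ycube; last first.
    rewrite integral0_eq// => t _; rewrite rV_consE patchE memNset// => -[_]; rewrite rowtx_x => h.
    by move: ycube; rewrite notin_setE.
  apply: le_trans (FG y); apply: ge0_le_integral => //.
  - by move=> t _; rewrite patchE; case: ifP.
  - apply: (measurable_fun_pair1 (f := (F \_ (carleson_box a l)) \o @rV_cons R n)).
    apply: measurableT_comp; last exact: measurable_rV_cons.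
    by apply/(measurable_restrictT _ (mbox a l)); exact: measurable_funTS.
  - under eq_fun do rewrite -rV_consE.
    apply: (measurable_fun_pair1 (f := F \o @rV_cons R n)).
    by apply: measurableT_comp; last exact: measurable_rV_cons.
  by move=> t _; rewrite rV_consE patchE; case: ifPn.
apply: ge_ereal_sup => _ [a [l [l0 cx ->]]].
apply: le_trans (_ : (_ <= (\int[muX]_(y in cube a l) G y) / muX (cube a l))%E) _.
  by apply: lee_wpmul2r; [rewrite inve_ge0|exact: key].
by apply: ereal_sup_ubound; exists a, l.
Qed.
End carleson_of_C1.

Section ntmax.
Context {R : realType} (n : nat).
Local Notation X := ('rV[R]_n).
Local Notation V := ('rV[R]_(1 + n)).
Local Notation mu := (lebesgue_rV (1 + n)).
Local Notation muX := (lebesgue_rV n).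
Local Notation H := (@hspace R n).
Implicit Types (u : V -> R) (x : X).

Lemma open_lebesgue_gt0 m (U : set 'rV[R]_m) : open U -> U !=set0 -> (0 < lebesgue_rV m U)%E.
Proof.
move=> oU [z Uz]; have : nbhs z U by apply: open_nbhs_nbhs.
move=> /(@nbhs_ballP R ('rV[R]_m))[e /= e0 eU].
have : (lebesgue_rV m (ball z e) <= lebesgue_rV m U)%E.
  apply: le_measure; rewrite ?inE//; last exact: open_measurable_rV.
  by rewrite ball_obox//; exact: measurable_obox.
apply: lt_le_trans; rewrite ball_obox// lebesgue_obox lte_fin; apply: prodr_gt0 => i _.
by rewrite !mxE lt_max; apply/orP; right; lra.
Qed.

Lemma open_of_ball m (U : set 'rV[R]_m) : (forall z, U z -> exists2 e : R, 0 < e & forall z', `|z - z'| <= e -> U z') ->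
  open U.
Proof.
move=> h; rewrite openE => z /h[e e0 eU]; apply/(@nbhs_ballP R ('rV[R]_m)); exists e => //= z'.
by rewrite -ball_normE /= => /ltW; exact: eU.
Qed.

Lemma enorm_le_norm m (v : 'rV[R]_m) : enorm v <= m%:R * `|v|.
Proof.
apply: le_trans (enorm_le_sum v) _; apply: (@le_trans _ _ (\sum_(i < m) `|v|)).
  by apply: ler_sum => i _; exact: coord_le_norm.
by rewrite sumr_const card_ord mulr_natl.
Qed.

Lemma xcoord_norm (z : V) : `|xcoord z| <= `|z|.
Proof.
rewrite {1}/Num.norm/= mx_normrE; apply/bigmax_leP; split => //= -[i j] _ /=.
rewrite (ord1 i) xcoordE; exact: coord_le_norm.
Qed.

Lemma open_cone alpha x : 0 < alpha -> open (cone alpha x : set V).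
Proof.
move=> a0; apply: open_of_ball => z [tz ez].
pose r := alpha * tcoord z - enorm (xcoord z - x); have r0 : 0 < r by rewrite subr_gt0.
have na0 : 0 < n%:R + alpha + 1 by rewrite ltr_wpDl// addr_ge0// ltW.
exists (Num.min (tcoord z / 2) (r / (n%:R + alpha + 1))); first by rewrite lt_min !divr_gt0.
move=> z'; rewrite le_min => /andP[h1 h2].
have ht : `|tcoord z - tcoord z'| <= `|z - z'|.
  have -> : tcoord z - tcoord z' = (z - z') ord0 (t0 n) by rewrite !mxE.
  exact: coord_le_norm.
have t1 : tcoord z - tcoord z' <= `|z - z'| by apply: le_trans ht; exact: ler_norm.
split; first by lra.
have e1 : enorm (xcoord z' - x) <= enorm (xcoord z - x) + n%:R * `|z - z'|.
  have -> : xcoord z' - x = (xcoord z - x) + (xcoord z' - xcoord z) by apply/rowP => i; rewrite !mxE; ring.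
  apply: le_trans (enormD _ _) _; rewrite lerD2l; apply: le_trans (enorm_le_norm _) _.
  rewrite ler_wpM2l// distrC.
  have -> : xcoord z - xcoord z' = xcoord (z - z') by apply/rowP => i; rewrite !mxE.
  exact: xcoord_norm.
have h3 : (n%:R + alpha) * `|z - z'| < r.
  have [->|dn] := eqVneq `|z - z'| 0; first by rewrite mulr0.
  apply: (@lt_le_trans _ _ ((n%:R + alpha + 1) * `|z - z'|)); last by rewrite mulrC -ler_pdivlMr.
  by rewrite ltr_pM2r ?ltrDl// lt_neqAle eq_sym dn normr_ge0.
have h4 : alpha * (tcoord z - tcoord z') <= alpha * `|z - z'| by rewrite ler_wpM2l// ltW.
rewrite /r in h3; lra.
Qed.

Lemma open_cone_vertex alpha (z : V) : 0 < alpha -> open [set x : X | cone alpha x z].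
Proof.
move=> a0; apply: open_of_ball => x [tz ez].
pose r := alpha * tcoord z - enorm (xcoord z - x); have r0 : 0 < r by rewrite subr_gt0.
have na0 : 0 < n%:R + 1 :> R by rewrite ltr_wpDl.
exists (r / (n%:R + 1)) => [|x' h]; first by rewrite divr_gt0.
split => //; have -> : xcoord z - x' = (xcoord z - x) + (x - x') by apply/rowP => i; rewrite !mxE; ring.
apply: le_lt_trans (enormD _ _) _; rewrite -ltrBrDl -/r; apply: le_lt_trans (enorm_le_norm _) _.
have [->|dn] := eqVneq `|x - x'| 0; first by rewrite mulr0.
apply: (@lt_le_trans _ _ ((n%:R + 1) * `|x - x'|)); last by rewrite mulrC -ler_pdivlMr.
by rewrite ltr_pM2r ?ltrDl// lt_neqAle eq_sym dn normr_ge0.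
Qed.

(** For continuous u the essential supremum over the open cone is a supremum. *)
Lemma ntmax_leP u x (a : R) : 0 <= a -> (forall z, H z -> {for z, continuous u}) ->
  (ntmax u x <= a%:E)%E <-> forall z, cone 1 x z -> `|u z| <= a.
Proof.
move=> a0 cu; split=> [/ess_supP h z cz|h]; last first.
  apply/ess_supP; apply: aeW => z; rewrite patchE; case: ifPn; last by rewrite lee_fin.
  by rewrite inE lee_fin; exact: h.
rewrite leNgt; apply/negP => az.
pose U : set V := cone 1 x `&` [set w | a < `|u w|].
have oU : open U.
  rewrite openE => w [cw aw]; have Hw : H w by case: cw.
  have nc : nbhs w (cone 1 x) by apply: open_nbhs_nbhs; split => //; apply: open_cone.
  have cw' : {for w, continuous (fun w => `|u w|)} by exact: (continuous_comp (cu w Hw) (@norm_continuous _ R^o (u w))).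
  have oo : open [set r : R | a < r] by exact: open_gt.
  have nu : nbhs w [set w | a < `|u w|] by apply: cw' (open_nbhs_nbhs (conj oo aw)).
  exact: filterI nc nu.
have : (0 < mu U)%E by apply: open_lebesgue_gt0 => //; exists z.
case: h => N [mN N0 hN]; suff : (mu U <= 0)%E by rewrite leNgt => /negP.
rewrite -N0; apply: le_measure; rewrite ?inE//; first exact: open_measurable_rV.
move=> w [cw aw]; apply: hN => /=; rewrite patchE mem_set// lee_fin => h; by rewrite leNgt aw in h.
Qed.

Lemma ntmax_ge0 u x : (0 <= ntmax u x)%E.
Proof.
rewrite leNgt; apply/negP => h.
have /ess_supP[N [mN N0 hN]] : (ntmax u x <= ntmax u x)%E by [].
have : (0 < mu [set: V])%E by apply: open_lebesgue_gt0; [exact: openT|exists 0].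
suff : (mu [set: V] <= 0)%E by rewrite leNgt => /negP.
rewrite -N0; apply: le_measure; rewrite ?inE// => w _; apply: hN => /= h'.
have : (0 <= ntmax u x)%E by apply: le_trans h'; rewrite patchE; case: ifP; rewrite ?lee_fin.
by rewrite leNgt h.
Qed.

(** The set where the maximal function exceeds a is open: z lies in the
    cone at x for x in an open set. *)
Lemma measurable_ntmax u : (forall z, H z -> {for z, continuous u}) -> measT (ntmax u : X -> \bar R).
Proof.
move=> cu; apply: (measurability _ (ErealGenOInfty.measurableE R)) => /= _ [_ [a ->]] <-.
rewrite setTI preimage_itvoy; have [a0|a0] := leP 0 a; last first.
  rewrite (_ : [set _ | _] = setT); first exact: measurableT.
  by apply/seteqP; split => // x _; apply: lt_le_trans (ntmax_ge0 u x); rewrite lte_fin.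
apply: open_measurable_rV; rewrite openE => x /= ax.
have [z cz az] : exists2 z, cone 1 x z & a < `|u z|.
  apply: contrapT => h; move: ax; rewrite ltNge => /negP; apply; apply/ntmax_leP => // z cz.
  by rewrite leNgt; apply/negP => az; apply: h; exists z.
have nc : nbhs x [set x : X | cone 1 x z] by apply: open_nbhs_nbhs; split => //; exact: open_cone_vertex.
apply: (@filterS _ (nbhs x) _ _ _ _ nc) => y cy /=.
rewrite ltNge; apply/negP => /ntmax_leP => /(_ a0 cu) /(_ z cy); by rewrite leNgt az.
Qed.
End ntmax.

(** * The extension operator *)

Section choice_of_scales.
Local Opaque pw.
Context {R : realType} (n : nat).
Hypothesis n0 : (0 < n)%N.
Local Notation X := ('rV[R]_n).
Local Notation muX := (lebesgue_rV n).
Variable p : R.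
Hypothesis p1 : 1 < p.
Local Notation pw := (@pw _ X R muX p).
Let p0 : 0 < p. Proof. exact: lt_trans p1. Qed.

Lemma Pk_approx (g : X -> R) (dl b : R) : measT g -> (pw g < +oo)%E -> 0 < dl -> 0 < b ->
  exists s, 0 < s <= b /\ (pw (fun x => Pk g s x - g x)%R <= dl%:E * pw g)%E.
Proof.
move=> mg gp dl0 b0; have lg := locint_pw p1 mg gp.
have gf : pw g \is a fin_num by rewrite ge0_fin_numE// pw_ge0.
have := pw_ge0 muX p g; rewrite le_eqVlt => /orP[/eqP g0|g0].
  exists b; rewrite b0 lexx -g0 mule0; split => //.
  have mP := measurable_Pk n0 lg b0.
  have mm : measT (fun x => -1 * g x) by exact: measurable_funM.
  have -> : (fun x => Pk g b x - g x) = (fun x => Pk g b x + -1 * g x) by apply/funext => x; rewrite mulN1r.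
  apply: le_trans (pwD muX p0 mP mm) _.
  have -> : pw (Pk g b) = 0%E.
    by apply/le_anti; rewrite pw_ge0 andbT; apply: le_trans (Pk_pw n0 p1 mg gp b0) _; rewrite -g0 mule0.
  have -> : pw (fun x => -1 * g x) = 0%E.
    by apply/le_anti; rewrite pw_ge0 andbT; apply: le_trans (pwZ p1 _ mg) _; rewrite -g0 mule0.
  by rewrite adde0 mule0.
have e0 : 0 < dl * fine (pw g) by rewrite mulr_gt0// fine_gt0// g0.
have [N hN] := Pk_cvg n0 p1 mg gp e0.
have [M hM] := pow2_small b0.
pose j := maxn N M; exists ((2^-1) ^+ j); split; last first.
  by rewrite -[X in (_ <= _ * X)%E](fineK gf) -EFinM; apply: hN; exact: leq_maxl.
rewrite exprn_gt0//=; apply: le_trans hM; rewrite -exprVn.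
by apply: ler_wiXn2l; rewrite ?invr_ge0 ?leq_maxr// invf_le1// ler1n.
Qed.

(** The decay 4^(-k) leaves a factor 2^(-k) after the weights of
    [series_powR], and also gives almost everywhere convergence with a rate. *)
Lemma scales_exist (g : X -> R) : measT g -> (pw g < +oo)%E -> exists s : nat -> R,
  [/\ forall k, 0 < s k, forall k, s k <= (2^-1) ^+ k, forall k, s k.+1 <= s k &
    forall k, (pw (fun x => Pk g (s k) x - g x)%R <= (((4^-1) ^+ k.+1) `^ p)%:E * pw g)%E].
Proof.
move=> mg gp.
have dl0 k : 0 < ((4^-1 : R) ^+ k.+1) `^ p by rewrite powR_gt0// exprn_gt0.
have ex k b : exists s, 0 < b -> 0 < s <= b /\ (pw (fun x => Pk g s x - g x)%R <= (((4^-1) ^+ k.+1) `^ p)%:E * pw g)%E.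
  have [b0|b0] := ltP 0 b; last by exists 0.
  by have [s hs] := Pk_approx mg gp (dl0 k) b0; exists s.
pose pick k b := projT1 (cid (ex k b)).
have pickP k b : 0 < b -> 0 < pick k b <= b /\ (pw (fun x => Pk g (pick k b) x - g x)%R <= (((4^-1) ^+ k.+1) `^ p)%:E * pw g)%E.
  exact: (projT2 (cid (ex k b))).
(* Halving before each choice makes the scales at most 2^(-k). *)
pose fix s k := if k is j.+1 then pick k (s j / 2) else pick 0%N 1.
have s0 k : 0 < s k.
  elim: k => [|k IH] /=; first by have [/andP[]] := pickP 0%N 1 ltr01.
  by have [/andP[]] := pickP k.+1 _ (divr_gt0 IH (ltr0Sn _ 1)).
have s2 k : s k.+1 <= s k / 2 by have [/andP[]] := pickP k.+1 _ (divr_gt0 (s0 k) (ltr0Sn _ 1)).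
exists s; split => //.
- elim=> [|k IH]; first by have [/andP[]] := pickP 0%N 1 ltr01; rewrite expr0.
  by apply: le_trans (s2 k) _; rewrite exprSr ler_wpM2r.
- by move=> k; have := s2 k; have := s0 k; lra.
- move=> [|k]; first by have [] := pickP 0%N 1 ltr01.
  by have [] := pickP k.+1 _ (divr_gt0 (s0 k) (ltr0Sn _ 1)).
Qed.
End choice_of_scales.

Section cutoff.
Context {R : realType}.
Implicit Types r : R.

(** A smooth cutoff equal to 1 up to 1/2 and 0 from 1 on. *)
Definition th r : R := chi (4 * rho (1 - r)).
Definition dth r : R := 2 * Num.max (1 - 4 * rho (1 - r)) 0 * (4 * (2 * Num.max (1 - r) 0 * -1)).

Lemma th01 r : 0 <= th r <= 1.
Proof. by apply: chi01; rewrite mulr_ge0// rho_ge0. Qed.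

Lemma th_ge1 r : 1 <= r -> th r = 0.
Proof. by move=> r1; rewrite /th /rho max_r ?subr_le0// expr0n/= mulr0 chi_le0. Qed.

Lemma rho_half r : r <= 2^-1 -> 1 <= 4 * rho (1 - r).
Proof. by move=> r1; rewrite /rho max_l; nra. Qed.

Lemma th_le r : r <= 2^-1 -> th r = 1.
Proof. by move=> r1; apply: chi_ge1; exact: rho_half. Qed.

Lemma is_derive_th r : is_derive r 1 th (dth r).
Proof.
have h1 : is_derive r 1 (fun r => 1 - r : R) (-1).
  have := @is_deriveB R R R (cst (1:R)) id r 1 0 1 (is_derive_cst _ _ _) (is_derive_id _ _).
  by rewrite sub0r.
have h2 : is_derive r 1 (fun r => rho (1 - r)) (2 * Num.max (1 - r) 0 * -1).
  have := @is_derive1_comp R rho (fun r => 1 - r) r _ _ (is_derive_rho (1 - r)) h1; exact.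
have h3 : is_derive r 1 (fun r => 4 * rho (1 - r)) (4 * (2 * Num.max (1 - r) 0 * -1)).
  have := @is_deriveZ R R R _ (4 : R) r 1 _ h2; exact.
have := @is_derive1_comp R chi (fun r => 4 * rho (1 - r)) r _ _ (is_derive_chi (4 * rho (1 - r))) h3; exact.
Qed.

Lemma continuous_dth : continuous dth.
Proof.
move=> r; have c1 : {for r, continuous (fun r => 1 - r : R)} by apply: cvgB; [exact: cvg_cst|exact: cvg_id].
have cr : {for r, continuous (fun r => rho (1 - r))}.
  apply: (continuous_comp c1) => /=.
  by apply/differentiable_continuous/derivable1_diffP; apply: ex_derive; exact: is_derive_rho.
have c4 : {for r, continuous (fun r => 4 * rho (1 - r))} by apply: cvgM; [exact: cvg_cst|exact: cr].
have d1 : {for r, continuous (fun r => 2 * Num.max (1 - 4 * rho (1 - r)) 0)} := continuous_comp c4 (@continuous_dchi R _).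
have d2 : {for r, continuous (fun r => 2 * Num.max (1 - r) 0)} := @continuous_dchi R r.
apply: cvgM; first exact: d1.
by apply: cvgM; [exact: cvg_cst|apply: cvgM; [exact: d2|exact: cvg_cst]].
Qed.

Lemma dth_le r : `|dth r| <= 8 * (2^-1 <= r <= 1)%R%:R.
Proof.
have [r1|r1] := ltP r 2^-1.
  by rewrite /dth max_r ?mulr0 ?mul0r ?normr0 ?mulr_ge0// subr_le0 rho_half// ltW.
have [r2|r2] := leP r 1; last first.
  by rewrite /dth [Num.max (1 - r) 0]max_r ?mulr0 ?mul0r ?mulr0 ?normr0 ?mulr_ge0// subr_le0 ltW.
rewrite mulr1 /dth.
have m1 : 0 <= Num.max (1 - 4 * rho (1 - r)) 0 <= 1.
  by rewrite le_max lexx orbT/= ge_max ler01 andbT gerBl mulr_ge0// rho_ge0.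
have m2 : 0 <= Num.max (1 - r) 0 <= 2^-1.
  rewrite le_max lexx orbT/= ge_max; apply/andP; split; lra.
move: m1 m2; set a := Num.max _ _; set b := Num.max _ _ => /andP[a0 a1] /andP[b0 b1].
have -> : 2 * a * (4 * (2 * b * -1)) = - (16 * (a * b)) by ring.
rewrite normrN ger0_norm; last by rewrite mulr_ge0// mulr_ge0.
have : a * b <= 1 * 2^-1 by apply: ler_pM.
lra.
Qed.
End cutoff.

Lemma poweR_add_le (R : realType) (p : R) (a b : \bar R) : 0 < p -> (0 <= a)%E -> (0 <= b)%E ->
  ((a + b) `^ p <= (2 `^ p)%:E * (a `^ p + b `^ p))%E.
Proof.
move=> p0; have P2 : (0 < (2 `^ p)%:E)%E by rewrite lte_fin powR_gt0.
have py : ((+oo : \bar R) `^ p = +oo)%E by rewrite poweRyr ?gt_eqF.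
case: a => [a| |] //; case: b => [b| |] // a0 b0; rewrite ?addey ?addye// ?py.
- by rewrite -EFinD !poweR_EFin -EFinD -EFinM lee_fin powR_add_le// -lee_fin.
- by rewrite addey ?gt0_muley// poweR_EFin.
- by rewrite addye ?gt0_muley// poweR_EFin.
- by rewrite gt0_muley.
Qed.

Section extension.
Context {R : realType} (n : nat).
Hypothesis n0 : (0 < n)%N.
Local Notation X := ('rV[R]_n).
Local Notation V := ('rV[R]_(1 + n)).
Local Notation mu := (lebesgue_rV (1 + n)).
Local Notation muX := (lebesgue_rV n).
Local Notation H := (@hspace R n).
Variable s : nat -> R.
Hypotheses (s0 : forall k, 0 < s k) (s_le1 : s 0%N <= 1) (sdec : forall k, s k.+1 <= s k).
Variable g : X -> R.
Hypothesis lg : locint g.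

(** The height at which the interpolation between consecutive smoothings takes
    place, much smaller than the scale of the smoothing. *)
Definition ts k : R := (4^-1) ^+ k * s k.
(** The sequence of smoothings, started at the zero function so that u vanishes
    for large t. *)
Definition gm k : X -> R := if k is j.+1 then Pk g (s j) else fun=> 0.
Definition dgm k (i : 'I_n) : X -> R := if k is j.+1 then dPk g (s j) i else fun=> 0.
Definition hk k y : R := gm k.+1 y - gm k y.
Definition dhk k i y : R := dgm k.+1 i y - dgm k i y.
Definition uterm k (z : V) : R := th (tcoord z / ts k) * hk k (xcoord z).
Definition uN N (z : V) : R := \sum_(k < N) uterm k z.
(** The series of the [uterm k] is locally finite since the heights tend to 0: at
    height t only the first floor(1/t) terms can be nonzero. *)
Definition ext (z : V) : R := uN (Num.truncn (tcoord z)^-1) z.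

Lemma s_mono k l : (k <= l)%N -> s l <= s k.
Proof. by move=> /subnK <-; elim: (l - k)%N => [//|j IH]; apply: le_trans IH; exact: sdec. Qed.

Lemma ts_gt0 k : 0 < ts k. Proof. by rewrite mulr_gt0// exprn_gt0. Qed.

Lemma ts4 k : ts k.+1 <= ts k / 4.
Proof.
by rewrite /ts exprSr mulrAC ler_wpM2r ?invr_ge0// ler_wpM2l ?exprn_ge0.
Qed.

Lemma ts_dec k l : (k <= l)%N -> ts l <= ts k.
Proof.
move=> /subnK <-; elim: (l - k)%N => [//|j IH]; apply: le_trans IH; apply: le_trans (ts4 _) _.
by rewrite ler_pdivrMr// ler_peMr ?(ltW (ts_gt0 _))// ler1n.
Qed.

Lemma ts_small k : ts k * k.+1%:R <= 1.
Proof.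
have h : (k.+1%:R : R) <= 4 ^+ k.
  by rewrite -natrX ler_nat ltn_expl.
apply: (@le_trans _ _ ((4^-1) ^+ k * 1 * 4 ^+ k)); last by rewrite mulr1 -exprMn mulVf// expr1n.
apply: ler_pM => //; first exact: ltW (ts_gt0 k).
apply: ler_wpM2l; first by rewrite exprn_ge0.
by apply: le_trans s_le1; exact: s_mono.
Qed.

Lemma uterm0 k (z : V) : ts k <= tcoord z -> uterm k z = 0.
Proof. by move=> h; rewrite /uterm th_ge1 ?mul0r// ler_pdivlMr ?ts_gt0// mul1r. Qed.

Lemma uN_stable N M (z : V) : (N <= M)%N -> ts N <= tcoord z -> uN M z = uN N z.
Proof.
move=> NM h; rewrite /uN -!(big_mkord xpredT (fun k => uterm k z)) (big_cat_nat _ NM)//=.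
rewrite [X in _ + X]big1_seq ?addr0// => k /=; rewrite mem_index_iota => /andP[Nk _].
by apply: uterm0; apply: le_trans h; exact: ts_dec.
Qed.

Lemma ts_truncn (t : R) : 0 < t -> ts (Num.truncn t^-1) <= t.
Proof.
move=> tp; have h := truncnS_gt t^-1; set N := Num.truncn _ in h *.
have N0 : 0 < N.+1%:R :> R by rewrite ltr0n.
apply: (@le_trans _ _ (N.+1%:R^-1)); first by rewrite -[leRHS]mul1r ler_pdivlMr// ts_small.
by rewrite invf_ple ?posrE// ltW.
Qed.

Lemma ext_eq N (z : V) : H z -> ts N <= tcoord z -> ext z = uN N z.
Proof.
move=> Hz h; have h' := ts_truncn Hz; rewrite /ext; set N' := Num.truncn _ in h' *.
by rewrite -(uN_stable (leq_maxl N N') h) (uN_stable (leq_maxr N N') h').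
Qed.

Lemma gm_C1 k : C1_on H (fun z : V => gm k (xcoord z)).
Proof.
case: k => [|k]; first by apply: C1_cst; exact: open_hspace.
exact: (Pk_C1 n0 (@open_hspace R n) lg (s0 k)).
Qed.

Lemma gm_derive k (z v : V) : differentiable (fun z : V => gm k (xcoord z)) z /\
  'D_v (fun z : V => gm k (xcoord z)) z = \sum_i dgm k i (xcoord z) * xcoord v ord0 i.
Proof.
case: k => [|k]; last by have [h1 h2] := Pk_derive n0 z lg (s0 k); split => //; exact: h2.
split; first exact: differentiable_cst.
by rewrite derive_cst big1// => i _; rewrite mul0r.
Qed.

Lemma tdiv_derive k (z v : V) : differentiable (fun z : V => tcoord z / ts k) z /\
  'D_v (fun z : V => tcoord z / ts k) z = tcoord v / ts k.
Proof.
have [|df dE] := @quadratic_differentiable R n (fun z : V => tcoord z / ts k) z (rowtx (ts k)^-1 0) 0 1 ltr01 (lexx 0).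
  move=> h _; rewrite dotv_rowtx mul0r big1 ?addr0 => [|i _]; last by rewrite mxE mul0r.
  have -> : tcoord (z + h) = tcoord z + tcoord h by rewrite /tcoord mxE.
  by rewrite (_ : _ - _ = 0) ?normr0 ?mul0r//; ring.
split => //; rewrite dE dotv_rowtx big1 ?addr0 => [|i _]; last by rewrite mxE mul0r.
by rewrite mulrC.
Qed.

Lemma uterm_C1 k : C1_on H (uterm k).
Proof.
have oH := @open_hspace R n.
apply: (C1_mul oH).
  apply: (C1_comp1 oH _ is_derive_th continuous_dth).
  by apply: C1_mul => //; [exact: C1_coord|exact: C1_cst].
by apply: C1_add => //; [exact: gm_C1|apply: C1_opp => //; exact: gm_C1].
Qed.

Lemma uterm_derive k (z v : V) : differentiable (uterm k) z /\ 'D_v (uterm k) z = hk k (xcoord z) * (dth (tcoord z / ts k) * (tcoord v / ts k)) +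
    th (tcoord z / ts k) * \sum_i dhk k i (xcoord z) * xcoord v ord0 i.
Proof.
have [d1 e1] := tdiv_derive k z v.
have [d2 e2] := derive_comp1 v d1 (is_derive_th (tcoord z / ts k)).
have [d3 e3] := gm_derive k.+1 z v; have [d4 e4] := gm_derive k z v.
have d5 : differentiable (fun z : V => hk k (xcoord z)) z by exact: differentiableB d3 d4.
have e5 : 'D_v (fun z : V => hk k (xcoord z)) z = \sum_i dhk k i (xcoord z) * xcoord v ord0 i.
  have : 'D_v (fun z : V => hk k (xcoord z)) z = 'D_v (fun z : V => gm k.+1 (xcoord z)) z - 'D_v (fun z : V => gm k (xcoord z)) z.
    by apply: deriveB; exact: diff_derivable.
  by rewrite e3 e4 -sumrB => ->; apply: eq_bigr => i _; rewrite mulrBl.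
split; first exact: differentiableM d2 d5.
have -> : 'D_v (uterm k) z = th (tcoord z / ts k) * 'D_v (fun z : V => hk k (xcoord z)) z +
    hk k (xcoord z) * 'D_v (fun z : V => th (tcoord z / ts k)) z.
  by apply: deriveM; exact: diff_derivable.
by rewrite e2 e1 e5 addrC.
Qed.

Lemma uN_C1 N : C1_on H (uN N).
Proof. by apply: C1_sum => [|i]; [exact: open_hspace|exact: uterm_C1]. Qed.

Lemma uN_derive N (z v : V) : 'D_v (uN N) z = \sum_(k < N) 'D_v (uterm k) z.
Proof.
suff [] : differentiable (uN N) z /\ 'D_v (uN N) z = \sum_(k < N) 'D_v (uterm k) z by [].
rewrite /uN; elim: (index_enum _) => [|i l [d IH]].
  rewrite (_ : (fun z => _) = cst 0); last by apply/funext => w; rewrite big_nil.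
  by rewrite big_nil derive_cst; split => //; exact: differentiable_cst.
rewrite (_ : (fun z => _) = uterm i + (fun z => \sum_(k <- l) uterm k z)); last first.
  by apply/funext => w; rewrite big_cons.
have [di _] := uterm_derive i z v.
split; first exact: differentiableD.
by rewrite big_cons -IH; apply: deriveD; exact: diff_derivable.
Qed.

Lemma ext_near (z : V) : H z -> exists N D', [/\ open D', D' z & forall w, D' w -> H w /\ ext w = uN N w].
Proof.
move=> Hz; pose N := (Num.truncn (tcoord z)^-1).+1.
exists N, [set w | ts N < tcoord w]; split.
- rewrite (_ : [set _ | _] = (@tcoord R n) @^-1` `]ts N, +oo[); last by apply/seteqP; split => w /=; rewrite in_itv/= andbT.
  by apply: open_comp => // w _; exact: coord_continuous.
- apply: lt_le_trans (ts_truncn Hz); apply: le_lt_trans (ts4 _) _.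
  by rewrite ltr_pdivrMr// ltr_pMr ?ts_gt0// ltr1n.
- move=> w /= hw; have Hw : H w by apply: lt_trans hw; exact: ts_gt0.
  by split => //; apply: ext_eq => //; exact: ltW.
Qed.

Lemma ext_C1 : C1_on H ext.
Proof.
apply: C1_local => z Hz; have [N [D' [oD Dz hD]]] := ext_near Hz.
exists D', (uN N); split => //; last by move=> w /hD[].
by move=> w /hD[Hw _]; exact: uN_C1.
Qed.

Lemma pd_ext (z : V) : H z -> exists N, forall i, pd i ext z = \sum_(k < N) pd i (uterm k) z.
Proof.
move=> Hz; have [N [D' [oD Dz hD]]] := ext_near Hz; exists N => i.
have nD : nbhs z D' by apply: open_nbhs_nbhs.
rewrite /pd -uN_derive; apply: near_eq_derive.
by apply: (@filterS _ (nbhs z) _ _ _ _ nD) => w /hD[].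
Qed.

Lemma gm_le k (x y : X) : (forall i, `|y ord0 i - x ord0 i| <= s k.-1) -> ((`|gm k y|)%:E <= (kC n)%:E * Mf g x)%E.
Proof.
case: k => [|k] h; last exact: (Pk_le_Mf n0 lg (s0 k) h).
by rewrite normr0 mule_ge0 ?Mf_ge0// lee_fin kC_ge0.
Qed.

Lemma dgm_le k i y : ((`|dgm k i y|)%:E <= (4 / s k.-1)%:E * ((kC n)%:E * Mf g y))%E.
Proof.
have c0 j : 0 <= 4 / s j by rewrite divr_ge0// ltW.
case: k => [|k].
  by rewrite normr0 mule_ge0 ?lee_fin// mule_ge0 ?Mf_ge0// lee_fin kC_ge0.
apply: le_trans (_ : (_ <= (4 / s k * ((csum n (s k))^-1 * Icube g y (s k)))%:E)%E) _.
  rewrite lee_fin; apply: (dPk_le n0 i lg (s0 k)) => j; by rewrite subrr normr0 ltW.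
rewrite EFinM; apply: lee_wpmul2l; [by rewrite lee_fin|exact: Icube_le_Mf].
Qed.

Lemma dhk_le k i y : ((`|dhk k i y|)%:E <= (8 / s k)%:E * ((kC n)%:E * Mf g y))%E.
Proof.
have M0 : (0 <= (kC n)%:E * Mf g y)%E by rewrite mule_ge0 ?Mf_ge0// lee_fin kC_ge0.
apply: (@le_trans _ _ ((`|dgm k.+1 i y|)%:E + (`|dgm k i y|)%:E)%E); first by rewrite -EFinD lee_fin ler_normB.
apply: (@le_trans _ _ ((4 / s k)%:E * ((kC n)%:E * Mf g y) + (4 / s k)%:E * ((kC n)%:E * Mf g y))%E).
  apply: leeD; first exact: dgm_le.
  apply: le_trans (dgm_le _ _ _) _; apply: lee_wpmul2r => //; rewrite lee_fin ler_wpM2l// lef_pV2 ?posrE//.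
  by case: k.
rewrite -ge0_muleDl ?lee_fin ?divr_ge0 ?(ltW (s0 k))// -EFinD.
by have -> : 4 / s k + 4 / s k = 8 / s k :> R by field; rewrite gt_eqF.
Qed.

Definition K1 : R := 8 * n%:R * kC n.
(** A pointwise majorant of the gradient of the k-th term: the derivative of
    the cutoff lives on [ts k / 2, ts k], the derivatives of the smoothings on
    ]0, ts k[. *)
Definition Fk k (z : V) : \bar R :=
  ((8 / ts k * `|hk k (xcoord z)| * (ts k / 2 <= tcoord z <= ts k)%R%:R)%:E +
   ((0 < tcoord z < ts k)%R%:R)%:E * ((n%:R * (8 / s k) * kC n)%:E * Mf g (xcoord z)))%E.

Lemma Fk_ge0 k z : (0 <= Fk k z)%E.
Proof.
rewrite adde_ge0//; first by rewrite lee_fin mulr_ge0// mulr_ge0// divr_ge0// ltW// ts_gt0.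
by rewrite mule_ge0// ?lee_fin// mule_ge0 ?Mf_ge0// lee_fin !mulr_ge0 ?kC_ge0// invr_ge0 ltW.
Qed.

Lemma pd_uterm k (z : V) : H z -> ((\sum_i `|pd i (uterm k) z|)%:E <= Fk k z)%E.
Proof.
move=> Hz; have tk := ts_gt0 k; have tH : 0 < tcoord z by exact: Hz.
have th0 := @th01 R (tcoord z / ts k).
rewrite big_split_ord/= big_ord1 EFinD; apply: leeD.
  rewrite lee_fin /pd (uterm_derive k z _).2.
  have -> : \sum_i dhk k i (xcoord z) * xcoord (delta_mx ord0 (lshift n ord0) : V) ord0 i = 0.
    by apply: big1 => i _; rewrite xcoordE !mxE eqxx eq_rlshift mulr0.
  have -> : tcoord (delta_mx ord0 (lshift n ord0) : V) = 1 by rewrite /tcoord !mxE !eqxx.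
  rewrite mulr0 addr0 mul1r; have := @dth_le R (tcoord z / ts k).
  rewrite ler_pdivlMr// ler_pdivrMr// mul1r [2^-1 * _]mulrC; move: (dth _) => D h.
  rewrite !normrM [`|(ts k)^-1|]ger0_norm ?invr_ge0 ?(ltW tk)//.
  set b := (ts k / 2 <= tcoord z <= ts k)%R%:R in h *.
  have -> : 8 / ts k * `|hk k (xcoord z)| * b = `|hk k (xcoord z)| * (8 * b / ts k) by ring.
  by rewrite ler_wpM2l// ler_wpM2r// invr_ge0 ltW.
have pE i : pd (rshift 1 i) (uterm k) z = th (tcoord z / ts k) * dhk k i (xcoord z).
  rewrite /pd (uterm_derive k z _).2.
  have -> : tcoord (delta_mx ord0 (rshift 1 i) : V) = 0 by rewrite /tcoord !mxE eqxx eq_lrshift.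
  rewrite mul0r !mulr0 add0r; congr (_ * _).
  rewrite (bigD1 i)//= big1 ?addr0 => [|j ji].
    by rewrite xcoordE !mxE !eqxx mulr1.
  by rewrite xcoordE !mxE eqxx/= (inj_eq (@rshift_inj _ _)) (negbTE ji) mulr0.
have M0 : (0 <= (8 / s k)%:E * ((kC n)%:E * Mf g (xcoord z)))%E.
  by rewrite mule_ge0 ?mule_ge0 ?Mf_ge0 ?lee_fin ?kC_ge0// divr_ge0// ltW.
have [h|h] := ltP (tcoord z) (ts k); last first.
  rewrite andbF mul0e big1// => i _; rewrite pE th_ge1 ?mul0r ?normr0//.
  by rewrite ler_pdivlMr// mul1r.
rewrite tH mul1e -sumEFin.
apply: (@le_trans _ _ (\sum_(i < n) 1%:E * ((8 / s k)%:E * ((kC n)%:E * Mf g (xcoord z))))%E).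
  apply: lee_sum => i _; rewrite mul1e; apply: le_trans (dhk_le k i (xcoord z)).
  rewrite lee_fin pE normrM ger0_norm; last by case/andP: th0.
  by rewrite -[leRHS]mul1r ler_wpM2r//; case/andP: th0.
rewrite -ge0_sume_distrl; last by move=> i _; rewrite lee_fin.
rewrite sumEFin sumr_const card_ord muleA -EFinM muleA -EFinM.
by have -> : n%:R * (8 / s k) * kC n = n%:R * (8 / s k) * kC n :> R by [].
Qed.

Lemma pd_ext_le (z : V) : H z -> ((\sum_i `|pd i ext z|)%:E <= \sum_(k <oo) Fk k z)%E.
Proof.
move=> Hz; have [N hN] := pd_ext Hz.
apply: (@le_trans _ _ (\sum_(0 <= k < N) Fk k z)%E); last by apply: nneseries_lim_ge => k _ _; exact: Fk_ge0.
rewrite big_mkord.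
apply: (@le_trans _ _ (\sum_(k < N) (\sum_i `|pd i (uterm k) z|)%:E)%E).
  rewrite sumEFin lee_fin exchange_big/=; apply: ler_sum => i _; rewrite hN; exact: ler_norm_sum.
by apply: lee_sum => k _; exact: pd_uterm.
Qed.

Lemma measurable_gm k : measT (gm k).
Proof. by case: k => [|k]; [exact: measurable_cst|exact: measurable_Pk]. Qed.

Lemma measurable_hk k : measT (hk k).
Proof. by apply: measurable_funB; exact: measurable_gm. Qed.

Lemma measurable_Fk k : measT (Fk k).
Proof.
have mt := @measurable_tcoord R n; have mx := @measurable_xcoord R n.
have mi (A : set R) : measurable A -> measT (fun z : V => \1_A (tcoord z) : R).
  by move=> mA; apply: (measurableT_comp (measurable_indic mA) mt).
have e1 : (fun z : V => (ts k / 2 <= tcoord z <= ts k)%R%:R : R) = (fun z => \1_`[ts k / 2, ts k]%classic (tcoord z)).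
  by apply/funext => z; rewrite indicE mem_setE.
have e2 : (fun z : V => (0 < tcoord z < ts k)%R%:R : R) = (fun z => \1_`]0, ts k[%classic (tcoord z)).
  by apply/funext => z; rewrite indicE mem_setE.
apply: emeasurable_funD.
  apply/measurable_EFinP; apply: measurable_funM; last by rewrite e1; exact: mi.
  apply: measurable_funM => //; apply: measurableT_comp => //; apply: measurableT_comp mx; exact: measurable_hk.
apply: emeasurable_funM; first by apply/measurable_EFinP; rewrite e2; exact: mi.
by apply: emeasurable_funM => //; apply: measurableT_comp mx; exact: measurable_Mf.
Qed.

(** The integral of the majorant along a vertical line: 8 / ts k on a layer
    of thickness ts k / 2, and 8 n kC Mg / s k on thickness
    ts k = 4^(-k) s k. *)
Definition Bk k (y : X) : \bar R := ((4 * `|hk k y|)%:E + ((4^-1) ^+ k)%:E * (K1%:E * Mf g y))%E.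

Lemma Bk_ge0 k y : (0 <= Bk k y)%E.
Proof.
rewrite adde_ge0 ?lee_fin ?mulr_ge0// mule_ge0 ?lee_fin ?exprn_ge0// mule_ge0 ?Mf_ge0// lee_fin.
by rewrite mulr_ge0 ?kC_ge0// mulr_ge0.
Qed.

Lemma measurable_Bk k : measT (Bk k).
Proof.
apply: emeasurable_funD.
  by apply/measurable_EFinP; apply: measurable_funM => //; apply: measurableT_comp => //; exact: measurable_hk.
by apply: emeasurable_funM => //; apply: emeasurable_funM => //; exact: measurable_Mf.
Qed.

Lemma integral_Fk k y : (\int[lebesgue_measure]_t Fk k (rowtx t y) <= Bk k y)%E.
Proof.
have tk := ts_gt0 k.
pose c1 := 8 / ts k * `|hk k y|; pose c2 := ((n%:R * (8 / s k) * kC n)%:E * Mf g y)%E.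
have c10 : 0 <= c1 by rewrite mulr_ge0// divr_ge0// ltW.
have c20 : (0 <= c2)%E by rewrite mule_ge0 ?Mf_ge0// lee_fin !mulr_ge0 ?kC_ge0// invr_ge0 ltW.
have -> : (fun t => Fk k (rowtx t y)) =
    (fun t => c1%:E * (\1_`[ts k / 2, ts k]%classic t)%:E + (\1_`]0, ts k[%classic t)%:E * c2)%E.
  by apply/funext => t; rewrite /Fk rowtx_t rowtx_x EFinM !indicE !mem_setE.
have mI (A : set (measurableTypeR R)) : measurable A -> measT (fun t => (\1_A t : R)%:E).
  by move=> mA; apply/measurable_EFinP; exact: measurable_indic.
have iI (i : interval R) : (\int[lebesgue_measure]_t ((\1_[set` i] t : R)%:E) = lebesgue_measure ([set` i] : set (measurableTypeR R)))%E.
  have -> := @integral_indic _ (measurableTypeR R) R lebesgue_measure setT measurableT [set` i] (measurable_itv i).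
  by rewrite setIT.
rewrite ge0_integralD//; first last.
- by apply: emeasurable_funM => //; exact: mI.
- by move=> t _; rewrite mule_ge0// lee_fin.
- by apply: emeasurable_funM => //; exact: mI.
- by move=> t _; rewrite mule_ge0// lee_fin.
apply: leeD.
  rewrite (ge0_intZ lebesgue_measure measurableT (mI _ _)) ?c10//.
  rewrite iI lebesgue_measure_itv/= lte_fin ltr_pdivrMr// ltr_pMr ?ltr1n// -EFinD -EFinM lee_fin /c1.
  rewrite le_eqVlt; apply/orP; left; apply/eqP; field; by rewrite gt_eqF.
rewrite ge0_integralZr//; last exact: mI.
rewrite iI lebesgue_measure_itv/= lte_fin tk -EFinD subr0 /c2 muleA -EFinM muleA -EFinM.
have -> : ts k * (n%:R * (8 / s k) * kC n) = (4^-1) ^+ k * K1 by rewrite /ts /K1; field; rewrite gt_eqF.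
by [].
Qed.

Lemma ext_BVloc_Cgrad : BVloc ext /\ forall x, (Cgrad ext x <= maxfun (fun y => \sum_(k <oo) Bk k y) x)%E.
Proof.
apply: (@Cgrad_le_maxfun R n ext (fun z => \sum_(k <oo) Fk k z)%E).
- exact: ext_C1.
- by apply: ge0_emeasurable_sum => [k z _ _|k _]; [exact: Fk_ge0|exact: measurable_Fk].
- by move=> z; apply: nneseries_ge0 => k _ _; exact: Fk_ge0.
- exact: pd_ext_le.
- by apply: ge0_emeasurable_sum => [k z _ _|k _]; [exact: Bk_ge0|exact: measurable_Bk].
- by move=> z; apply: nneseries_ge0 => k _ _; exact: Bk_ge0.
- move=> y; rewrite integral_nneseries//.
  + by apply: lee_nneseries => [k _ _|k _]; [apply: integral_ge0 => t _; exact: Fk_ge0|exact: integral_Fk].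
  + move=> k; have -> : (fun t => Fk k (rowtx t y)) = (fun t => (Fk k \o @rV_cons R n) (t, y)).
      by apply/funext => t; rewrite /= rV_consE.
    apply: (measurable_fun_pair1 (f := Fk k \o @rV_cons R n)).
    by apply: measurableT_comp; [exact: measurable_Fk|exact: measurable_rV_cons].
  + by move=> k t _; exact: Fk_ge0.
Qed.
End extension.

(** * Estimates and boundary limits of the extension *)

Section extension_estimates.
Local Opaque pw.
Context {R : realType} (n : nat).
Hypothesis n0 : (0 < n)%N.
Local Notation X := ('rV[R]_n).
Local Notation V := ('rV[R]_(1 + n)).
Local Notation mu := (lebesgue_rV (1 + n)).
Local Notation muX := (lebesgue_rV n).
Local Notation H := (@hspace R n).
Variable p : R.
Hypothesis p1 : 1 < p.
Local Notation pw := (@pw _ X R muX p).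
Let p0 : 0 < p. Proof. exact: lt_trans p1. Qed.
Variable s : nat -> R.
Hypotheses (s0 : forall k, 0 < s k) (s_half : forall k, s k <= (2^-1) ^+ k) (sdec : forall k, s k.+1 <= s k).
Let s_le1 : s 0%N <= 1. Proof. by have := s_half 0%N; rewrite expr0. Qed.
Variable g : X -> R.
Hypotheses (mg : measT g) (gp : (pw g < +oo)%E).
Hypothesis sg : forall k, (pw (fun x => Pk g (s k) x - g x)%R <= (((4^-1) ^+ k.+1) `^ p)%:E * pw g)%E.
Let lg : locint g. Proof. exact: locint_pw gp. Qed.
Local Notation ts := (ts s).
Local Notation gm := (gm s g).
Local Notation hk := (hk s g).
Local Notation ext := (@ext R n s g).
Local Notation Bk := (Bk s g).

Definition K3 : R := kCp n p + 2 `^ p * 2.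
Definition K2 : R := 2 `^ p * (4 `^ p * K3 + (@K1 R n) `^ p * maxc n p).
Definition KE : R := maxc n p * (2 * (2 `^ p * K2)).

Lemma K3_ge0 : 0 <= K3. Proof. by rewrite addr_ge0 ?kCp_ge0// mulr_ge0// powR_ge0. Qed.

Lemma K2_ge0 : 0 <= K2.
Proof.
rewrite mulr_ge0 ?powR_ge0// addr_ge0// mulr_ge0 ?powR_ge0 ?K3_ge0//.
by apply: ltW; exact: maxc_gt0.
Qed.

Lemma KE_ge0 : 0 <= KE.
Proof. by rewrite mulr_ge0 ?(ltW (maxc_gt0 n p1))// mulr_ge0// mulr_ge0 ?powR_ge0 ?K2_ge0. Qed.

Let de k : R := ((4^-1) ^+ k) `^ p.
Let de_ge0 k : 0 <= de k. Proof. exact: powR_ge0. Qed.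
Let de_dec k : de k.+1 <= de k.
Proof.
apply: ge0_ler_powR; rewrite ?nnegrE ?exprn_ge0 ?(ltW p0)//.
by rewrite exprS ler_piMl ?exprn_ge0// invf_le1// ler1n.
Qed.

(** Consecutive smoothings are both close to g; for k = 0 the difference is the
    first smoothing itself. *)
Lemma pw_hk k : (pw (hk k) <= (K3 * de k)%:E * pw g)%E.
Proof.
have g0 := pw_ge0 muX p g.
case: k => [|k].
  have -> : hk 0%N = Pk g (s 0%N) by apply/funext => y; rewrite /hk /= subr0.
  apply: le_trans (Pk_pw n0 p1 mg gp (s0 0%N)) _; apply: lee_wpmul2r => //.
  by rewrite lee_fin /de expr0 powR1 mulr1 lerDl mulr_ge0// powR_ge0.
have mP j : measT (fun x => Pk g (s j) x - g x) by apply: measurable_funB => //; exact: measurable_Pk.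
have -> : hk k.+1 = (fun x => (Pk g (s k.+1) x - g x) + -1 * (Pk g (s k) x - g x)).
  by apply/funext => y; rewrite /hk /=; ring.
have m3 : measT (fun x => -1 * (Pk g (s k) x - g x)) by exact: measurable_funM.
apply: le_trans (pwD muX p0 (mP k.+1) m3) _.
apply: (@le_trans _ _ ((2 `^ p)%:E * ((de k.+1)%:E * pw g + (de k.+1)%:E * pw g))%E).
  apply: lee_wpmul2l; first by rewrite lee_fin powR_ge0.
  apply: leeD.
    by apply: le_trans (sg k.+1) _; apply: lee_wpmul2r => //; rewrite lee_fin; exact: de_dec.
  apply: le_trans (pwZ p1 _ (mP _)) _; rewrite normrN1 powR1 mul1e; exact: sg.
rewrite -ge0_muleDl ?lee_fin// -EFinD muleA -EFinM; apply: lee_wpmul2r => //.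
rewrite lee_fin /K3 mulrDl -[X in _ <= _ + X]mulrA.
have -> : 2 * de k.+1 = de k.+1 + de k.+1 by ring.
by rewrite lerDr mulr_ge0 ?kCp_ge0.
Qed.

Lemma Bk_pw k : (\int[muX]_y (Bk k y `^ p) <= (K2 * de k)%:E * pw g)%E.
Proof.
have mh := measurable_hk n0 s0 lg k; have mM := @measurable_Mf R n g.
have K10 : 0 <= @K1 R n by rewrite mulr_ge0 ?kC_ge0// mulr_ge0.
have m1 : measT (fun y => (`|4 * hk k y| `^ p)%:E).
  by apply: measurable_pw; exact: measurable_funM.
have m2 : measT (fun y => Mf g y `^ p)%E by apply: (measurable_poweRT p).
pose c := ((4^-1) ^+ k * @K1 R n) `^ p.
have c0 : 0 <= c by exact: powR_ge0.
have M0 y : (0 <= Mf g y `^ p)%E by exact: poweR_ge0.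
apply: (@le_trans _ _ (\int[muX]_y ((2 `^ p)%:E * ((`|4 * hk k y| `^ p)%:E + c%:E * (Mf g y `^ p))))%E).
  apply: ge0_le_integral => //.
  - by move=> y _; exact: poweR_ge0.
  - by apply: (measurable_poweRT p); exact: measurable_Bk.
  - by apply: emeasurable_funM => //; apply: emeasurable_funD => //; exact: emeasurable_funM.
  move=> y _; apply: le_trans (poweR_add_le p0 _ _) _.
  - by rewrite lee_fin mulr_ge0.
  - by rewrite mule_ge0 ?lee_fin ?exprn_ge0// mule_ge0 ?Mf_ge0// lee_fin.
  apply: lee_wpmul2l; first by rewrite lee_fin powR_ge0.
  rewrite poweR_EFin normrM (@ger0_norm _ 4)//; apply: leeD => //.
  by rewrite muleA -EFinM poweRM ?Mf_ge0 ?lee_fin ?mulr_ge0 ?exprn_ge0// poweR_EFin.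
have mcM : measT (fun y => c%:E * Mf g y `^ p)%E by exact: emeasurable_funM.
rewrite (ge0_intZ muX measurableT _) ?powR_ge0//; last 2 first.
- exact: emeasurable_funD.
- by move=> y _; rewrite adde_ge0 ?mule_ge0 ?lee_fin ?powR_ge0.
rewrite ge0_integralD//; do ?[by move=> y _; rewrite mule_ge0 ?lee_fin].
rewrite (ge0_intZ muX measurableT m2)//.
have h1 : (\int[muX]_y (`|4 * hk k y| `^ p)%:E <= (4 `^ p * (K3 * de k))%:E * pw g)%E.
  apply: le_trans (pwZ p1 4 mh) _; rewrite ger0_norm// EFinM -muleA.
  by apply: lee_wpmul2l; [rewrite lee_fin powR_ge0|exact: pw_hk].
have h2 : (c%:E * \int[muX]_y (Mf g y `^ p) <= (de k * ((@K1 R n) `^ p * maxc n p))%:E * pw g)%E.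
  rewrite /c powRM ?exprn_ge0// -/(de k) mulrA (EFinM _ (maxc n p)) -muleA; apply: lee_wpmul2l.
    by rewrite lee_fin mulr_ge0// powR_ge0.
  exact: Mf_pw.
apply: le_trans (lee_wpmul2l _ (leeD h1 h2)) _; first by rewrite lee_fin powR_ge0.
have mc0 := ltW (maxc_gt0 n p1).
have a0 : 0 <= 4 `^ p * (K3 * de k) by rewrite mulr_ge0 ?powR_ge0// mulr_ge0 ?K3_ge0.
have b0 : 0 <= de k * (@K1 R n `^ p * maxc n p) by apply: mulr_ge0 => //; apply: mulr_ge0 mc0; exact: powR_ge0.
rewrite -ge0_muleDl ?lee_fin//.
rewrite -EFinD muleA -EFinM; apply: lee_wpmul2r; first exact: pw_ge0.
by rewrite lee_fin /K2 le_eqVlt; apply/orP; left; apply/eqP; ring.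
Qed.

(** The maximal theorem applied to the sum of the line integrals, whose k-th
    term is of size 4^(-k) in norm. *)
Lemma Cgrad_ext_pw : (\int[muX]_x (Cgrad ext x `^ p) <= KE%:E * pw g)%E.
Proof.
have [BV Cle] := ext_BVloc_Cgrad n0 s0 s_le1 sdec lg.
have [m [_ CE]] := Cgrad_measure BV.
have mC : measT (Cgrad ext) by rewrite CE; exact: measurable_carleson.
have C0 x : (0 <= Cgrad ext x)%E by rewrite CE; exact: carleson_ge0.
pose G y := (\sum_(k <oo) Bk k y)%E.
have mB k := measurable_Bk n0 s0 lg k.
have B0 k y : (0 <= Bk k y)%E by exact: Bk_ge0.
have mG : measT G by apply: ge0_emeasurable_sum.
have G0 y : (0 <= G y)%E by exact: nneseries_ge0.
have maxG0 x : (0 <= maxfun G x)%E by apply: cubesup_ge0 => a l; exact: integral_ge0.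
apply: (@le_trans _ _ (\int[muX]_x (maxfun G x `^ p))%E).
  apply: ge0_le_integral => //.
  - by move=> x _; exact: poweR_ge0.
  - exact: (measurable_poweRT p).
  - by apply: (measurable_poweRT p); exact: measurable_cubesup.
  by move=> x _; apply: (gt0_ler_poweR (ltW p0)); rewrite ?in_itv/= ?leey ?C0 ?maxG0//; exact: Cle.
apply: le_trans (maximal_bound p1 mG G0) _.
rewrite /KE [in leRHS]EFinM -muleA; apply: lee_wpmul2l; first by rewrite lee_fin (ltW (maxc_gt0 n p1)).
have mBp k : measT (fun y => (((2 ^+ k.+1) `^ p)%:E * Bk k y `^ p)%E).
  by apply: emeasurable_funM => //; exact: (measurable_poweRT p).
have Bp0 k y : (0 <= ((2 ^+ k.+1) `^ p)%:E * Bk k y `^ p)%E by rewrite mule_ge0 ?poweR_ge0// lee_fin powR_ge0.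
apply: (@le_trans _ _ (\int[muX]_y (\sum_(k <oo) ((2 ^+ k.+1) `^ p)%:E * Bk k y `^ p))%E).
  apply: ge0_le_integral => //.
  - by move=> x _; exact: poweR_ge0.
  - exact: (measurable_poweRT p).
  - exact: ge0_emeasurable_sum.
  by move=> y _; apply: series_powR.
rewrite integral_nneseries//.
have cg0 : (0 <= (2 `^ p * K2)%:E * pw g)%E by rewrite mule_ge0 ?pw_ge0// lee_fin mulr_ge0 ?powR_ge0 ?K2_ge0.
apply: (@le_trans _ _ (\sum_(k <oo) ((2^-1) ^+ k)%:E * ((2 `^ p * K2)%:E * pw g))%E); last first.
  by apply: le_trans (series_half_le cg0) _; rewrite muleA -EFinM.
apply: lee_nneseries => [k _ _|k _]; first exact: integral_ge0.
rewrite (ge0_intZ muX measurableT _) ?powR_ge0//; last 2 first.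
- exact: (measurable_poweRT p).
- by move=> y _; exact: poweR_ge0.
apply: le_trans (lee_wpmul2l _ (Bk_pw k)) _; first by rewrite lee_fin powR_ge0.
rewrite !muleA -!EFinM; apply: lee_wpmul2r; first exact: pw_ge0.
rewrite lee_fin.
have -> : (2 ^+ k.+1) `^ p * (K2 * de k) = (2 ^+ k.+1 * (4^-1) ^+ k) `^ p * K2.
  by rewrite powRM ?exprn_ge0// -/(de k); ring.
have -> : 2 ^+ k.+1 * (4^-1) ^+ k = 2 * (2^-1) ^+ k :> R.
  have -> : 4^-1 = 2^-1 * 2^-1 :> R by field.
  by rewrite exprMn exprS mulrA -[2 * 2 ^+ k * _]mulrA -exprMn mulfV// expr1n mulr1.
rewrite [leRHS]mulrA; apply: ler_wpM2r; first exact: K2_ge0.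
rewrite powRM ?exprn_ge0// mulrC; apply: ler_wpM2r; first exact: powR_ge0.
have h01 : 0 <= (2^-1 : R) ^+ k <= 1 by rewrite exprn_ge0//= exprn_ile1// invf_le1// ler1n.
have [->|hn] := eqVneq ((2^-1 : R) ^+ k) 0; first by rewrite powR0// gt_eqF.
rewrite -[leRHS]powRr1; last by case/andP: h01.
apply: ger_powR; last exact: ltW.
by case/andP: h01 => h0 h1; rewrite h1 andbT lt_neqAle eq_sym hn.
Qed.

(** At each height at most one cutoff is in transition, because the heights
    decrease by a factor 4: all earlier cutoffs are 1 and the sum telescopes. *)
Lemma ext_cases (z : V) : H z -> (ts 0%N <= tcoord z /\ ext z = 0) \/ exists k (a : R),
  [/\ 0 <= a <= 1, ts k.+1 <= tcoord z < ts k & ext z = a * gm k.+1 (xcoord z) + (1 - a) * gm k (xcoord z)].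
Proof.
move=> Hz; have ex : exists N, ts N <= tcoord z by exists (Num.truncn (tcoord z)^-1); exact: ts_truncn.
case: (ex_minnP ex) => -[|k] h hmin.
  by left; split => //; rewrite (ext_eq s0 s_le1 sdec g Hz h) /uN big_ord0.
right; have tk : tcoord z < ts k by rewrite ltNge; apply/negP => /hmin; rewrite ltnn.
exists k, (th (tcoord z / ts k)); split; [exact: th01|by rewrite h|].
rewrite (ext_eq s0 s_le1 sdec g Hz h) /uN big_ord_recr/= /uterm.
have -> : \sum_(i < k) th (tcoord z / ts i) * hk i (xcoord z) = gm k (xcoord z).
  transitivity (\sum_(i < k) (gm i.+1 (xcoord z) - gm i (xcoord z))).
    apply: eq_bigr => i _; rewrite th_le ?mul1r//; rewrite ler_pdivrMr ?ts_gt0//.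
    apply: le_trans (ltW tk) _; have := ts4 sdec i; have := ts_dec s0 sdec (ltn_ord i); have := ts_gt0 s0 i; lra.
  rewrite -(big_mkord xpredT (fun i => gm i.+1 (xcoord z) - gm i (xcoord z))) telescope_sumr//.
  by rewrite [gm 0%N _]/= subr0.
have -> : hk k (xcoord z) = gm k.+1 (xcoord z) - gm k (xcoord z) by [].
rewrite /=; ring.
Qed.

Lemma cone_coord alpha x (z : V) i : cone alpha x z -> `|xcoord z ord0 i - x ord0 i| <= alpha * tcoord z.
Proof.
move=> [_ h]; apply: le_trans (ltW h).
by have := coord_le_enorm (xcoord z - x) i; rewrite !mxE.
Qed.

Lemma ts_le k : ts k <= s k.
Proof. by rewrite /ts ler_piMl ?(ltW (s0 _))// exprn_ile1// ?invr_ge0// invf_le1// ler1n. Qed.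

Lemma ext_le_Mf x (z : V) : cone 1 x z -> ((`|ext z|)%:E <= (kC n)%:E * Mf g x)%E.
Proof.
move=> cz; have Hz : H z by case: cz.
have M0 : (0 <= (kC n)%:E * Mf g x)%E by rewrite mule_ge0 ?Mf_ge0// lee_fin kC_ge0.
have [[_ ->]|[k [a [/andP[a0 a1] /andP[_ tk] ->]]]] := ext_cases Hz; first by rewrite normr0.
have near j : (j <= k)%N -> forall i, `|xcoord z ord0 i - x ord0 i| <= s j.
  move=> jk i; apply: le_trans (cone_coord i cz) _; rewrite mul1r; apply: le_trans (ltW tk) _.
  by apply: le_trans (ts_le k) _; exact: (s_mono sdec).
have h1 : ((`|gm k.+1 (xcoord z)|)%:E <= (kC n)%:E * Mf g x)%E by apply: (gm_le n0 s0 lg) => i; exact: near.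
have h2 : ((`|gm k (xcoord z)|)%:E <= (kC n)%:E * Mf g x)%E by apply: (gm_le n0 s0 lg) => i; apply: near; exact: leq_pred.
apply: (@le_trans _ _ (a%:E * (`|gm k.+1 (xcoord z)|)%:E + (1 - a)%:E * (`|gm k (xcoord z)|)%:E)%E).
  rewrite -!EFinM -EFinD lee_fin; apply: le_trans (ler_normD _ _) _.
  by rewrite !normrM (ger0_norm a0) (@ger0_norm _ (1 - a)) ?subr_ge0.
apply: (@le_trans _ _ (a%:E * ((kC n)%:E * Mf g x) + (1 - a)%:E * ((kC n)%:E * Mf g x))%E).
  by apply: leeD; apply: lee_wpmul2l; rewrite ?lee_fin ?subr_ge0.
by rewrite -ge0_muleDl ?lee_fin ?subr_ge0// -EFinD addrC subrK mul1e.
Qed.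

Lemma kC_gt0 : 0 < kC n :> R.
Proof. by rewrite mulr_gt0// exprn_gt0// mulr_gt0// ltr0n. Qed.

Lemma ext_continuous (z : V) : H z -> {for z, continuous ext}.
Proof. exact: C1_on_cont (ext_C1 n0 s0 s_le1 sdec lg). Qed.

Lemma ntmax_ext_le x : (ntmax ext x <= (kC n)%:E * Mf g x)%E.
Proof.
have := Mf_ge0 g x; case E : (Mf g x) => [M| |] // M0; last by rewrite gt0_muley ?leey// lte_fin kC_gt0.
have M1 : 0 <= kC n * M by rewrite mulr_ge0 ?kC_ge0// -lee_fin.
rewrite -EFinM; apply/(ntmax_leP x M1 ext_continuous) => z /ext_le_Mf.
by rewrite E -EFinM lee_fin.
Qed.

Lemma ntmax_ext_pw : (\int[muX]_x (ntmax ext x `^ p) <= (kCp n p)%:E * pw g)%E.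
Proof.
have mN := measurable_ntmax ext_continuous.
have mM := @measurable_Mf R n g.
apply: (@le_trans _ _ (\int[muX]_x ((kC n `^ p)%:E * (Mf g x `^ p)))%E).
  apply: ge0_le_integral => //.
  - by move=> x _; exact: poweR_ge0.
  - exact: (measurable_poweRT p).
  - by apply: emeasurable_funM => //; exact: (measurable_poweRT p).
  move=> x _; rewrite -poweR_EFin -poweRM ?lee_fin ?kC_ge0 ?Mf_ge0//.
  apply: (gt0_ler_poweR (ltW p0)); rewrite ?in_itv/= ?leey ?ntmax_ge0 ?ntmax_ext_le//.
  by rewrite mule_ge0 ?Mf_ge0// lee_fin kC_ge0.
rewrite (ge0_intZ muX measurableT _) ?powR_ge0//; last 2 first.
- exact: (measurable_poweRT p).
- by move=> y _; exact: poweR_ge0.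
by rewrite /kCp [in leRHS]EFinM -muleA; apply: lee_wpmul2l; [rewrite lee_fin powR_ge0|exact: Mf_pw].
Qed.

(** Convergence of the smoothings along the heights at which the extension uses
    them.  It implies the non-tangential limit of the extension. *)
Definition scale_limit (alpha : R) (x : X) (L : R) := forall e, 0 < e -> exists k0 : nat, forall k (y : X), (k0 <= k)%N ->
  (forall i, `|y ord0 i - x ord0 i| <= alpha * ts k) -> `|Pk g (s k) y - L| <= e.

Lemma ext_limit alpha x L : 0 < alpha -> scale_limit alpha x L ->
  forall e, 0 < e -> exists2 d, 0 < d & forall z, H z -> tcoord z < d -> cone alpha x z -> `|ext z - L| <= e.
Proof.
move=> a0 hL e e0; have [k0 hk0] := hL e e0.
exists (ts k0.+1); first exact: ts_gt0.
move=> z Hz tz cz.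
have [[t0z _]|[k [b [/andP[b0 b1] /andP[tk1 tk] ->]]]] := ext_cases Hz.
  by have := lt_le_trans tz (ts_dec s0 sdec (leq0n _)); rewrite ltNge t0z.
have k0k : (k0 < k)%N.
  rewrite ltnNge; apply/negP => kk0; have := lt_le_trans tz (ts_dec s0 sdec (kk0 : (k.+1 <= k0.+1)%N)).
  by rewrite ltNge tk1.
have near j : (j <= k)%N -> forall i, `|xcoord z ord0 i - x ord0 i| <= alpha * ts j.
  move=> jk i; apply: le_trans (cone_coord i cz) _; rewrite ler_wpM2l ?(ltW a0)//.
  by apply: le_trans (ltW tk) _; exact: (ts_dec s0 sdec).
have h1 : `|gm k.+1 (xcoord z) - L| <= e by apply: hk0; [exact: ltnW|exact: near].
have h2 : `|gm k (xcoord z) - L| <= e.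
  case: k k0k near {tk1 tk h1} => [//|k] k0k near; apply: hk0; [by []|apply: near; exact: leqnSn].
have -> : b * gm k.+1 (xcoord z) + (1 - b) * gm k (xcoord z) - L =
   b * (gm k.+1 (xcoord z) - L) + (1 - b) * (gm k (xcoord z) - L) by ring.
apply: le_trans (ler_normD _ _) _; rewrite !normrM (ger0_norm b0) (@ger0_norm _ (1 - b)) ?subr_ge0//.
have -> : e = b * e + (1 - b) * e by ring.
by apply: lerD; rewrite ler_wpM2l// subr_ge0.
Qed.

Lemma half_small (a : R) : 0 < a -> exists k1, forall k, (k1 <= k)%N -> (2^-1) ^+ k <= a.
Proof.
move=> a0; have [M hM] := pow2_small a0; exists M => k Mk; apply: le_trans hM; rewrite -exprVn.
by apply: ler_wiXn2l; rewrite ?invr_ge0// invf_le1// ler1n.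
Qed.

Lemma quarter_half k : (4^-1 : R) ^+ k <= (2^-1) ^+ k.
Proof. by rewrite lerXn2r ?nnegrE ?invr_ge0// lef_pV2 ?posrE// ler_nat. Qed.

Lemma alpha_small alpha : 0 < alpha -> exists k1, forall k, (k1 <= k)%N -> alpha * ts k <= s k.
Proof.
move=> a0; have a0' : 0 < alpha^-1 by rewrite invr_gt0.
have [k1 hk] := half_small a0'; exists k1 => k kk.
rewrite /ts mulrA ler_piMl ?(ltW (s0 _))// mulrC -ler_pdivlMr// div1r.
by apply: le_trans (quarter_half k) _; exact: hk.
Qed.

Lemma eball_obox (x : X) (r : R) : eball x r `<=` obox (x - const_mx r) (x + const_mx r).
Proof.
move=> y yr i; have := le_lt_trans (coord_le_enorm (y - x) i) yr; rewrite !mxE ltr_norml => /andP[? ?].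
by apply/andP; split; lra.
Qed.

Lemma open_eball (x : X) (r : R) : open (eball x r).
Proof.
apply: open_of_ball => y yr; pose q := r - enorm (y - x); have q0 : 0 < q by rewrite subr_gt0.
have na0 : 0 < n%:R + 1 :> R by rewrite ltr_wpDl.
exists (q / (n%:R + 1)) => [|y' h]; first by rewrite divr_gt0.
rewrite /eball /=; have -> : y' - x = (y - x) + (y' - y) by apply/rowP => i; rewrite !mxE; ring.
apply: le_lt_trans (enormD _ _) _; rewrite -ltrBrDl -/q; apply: le_lt_trans (enorm_le_norm _) _.
rewrite distrC in h.
have [->|dn] := eqVneq `|y' - y| 0; first by rewrite mulr0.
apply: (@lt_le_trans _ _ ((n%:R + 1) * `|y' - y|)); last by rewrite mulrC -ler_pdivlMr.
by rewrite ltr_pM2r ?ltrDl// lt_neqAle eq_sym dn normr_ge0.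
Qed.

(** The kernel of scale s_k around a point at distance alpha t_k <= s_k from x
    is supported in the ball of radius 4 n s_k about x and bounded by a
    multiple of its inverse volume. *)
Lemma scale_limit_lebesgue alpha x : 0 < alpha -> lebesgue_point g x -> scale_limit alpha x (g x).
Proof.
move=> a0 lx; have nR : 0 < n%:R :> R by rewrite ltr0n.
move=> e e0; pose K := 2 * (8 * n%:R ^+ 2) ^+ n : R.
have K0 : 0 < K by rewrite mulr_gt0// exprn_gt0// mulr_gt0// exprn_gt0.
have eK : (0 < (e / K)%:E)%E by rewrite lte_fin divr_gt0.
have := lx _ (open_ereal_lt' eK).
move=> /(@nbhs_ballP R R^o)[d /= d0 hd].
have [k1 hk1] := alpha_small a0.
have d4 : 0 < d / (8 * n%:R) by rewrite divr_gt0// mulr_gt0.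
have [k2 hk2] := half_small d4.
exists (maxn k1 k2) => k y; rewrite geq_max => /andP[kk1 kk2] hy.
have sk := s0 k; pose r := 4 * n%:R * s k.
have r0 : 0 < r by rewrite mulr_gt0// mulr_gt0.
have rd : r < d.
  have := le_trans (s_half k) (hk2 k kk2); rewrite ler_pdivlMr ?mulr_gt0// /r => h.
  have : s k * (8 * n%:R) = 2 * (4 * n%:R * s k) by ring.
  move=> E; rewrite E in h; have := r0; rewrite /r; lra.
have {}hd : ((\int[muX]_(y in eball x r) `|g y - g x|%:E) / muX (eball x r) < (e / K)%:E)%E.
  by apply: hd => //; rewrite -ball_normE /= sub0r normrN gtr0_norm.
have oE := @open_eball x r; have mE := open_measurable_rV oE.
have E0 : (0 < muX (eball x r))%E.
  by apply: open_lebesgue_gt0 => //; exists x; rewrite /eball /= subrr enorm0.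
have Ele : (muX (eball x r) <= ((2 * r) ^+ n)%:E)%E.
  apply: (@le_trans _ _ (muX (obox (x - const_mx r) (x + const_mx r)))).
    by apply: le_measure; rewrite ?inE//; [exact: measurable_obox|exact: eball_obox].
  rewrite lebesgue_obox lee_fin (eq_bigr (fun=> 2 * r)); first by rewrite prodr_const card_ord.
  by move=> i _; rewrite !mxE max_r; [ring|lra].
have Efin : muX (eball x r) \is a fin_num by rewrite ge0_fin_numE//; apply: le_lt_trans Ele _; exact: ltry.
pose v := fine (muX (eball x r)).
have vE : muX (eball x r) = v%:E by rewrite fineK.
have v0 : 0 < v by rewrite -lte_fin -vE.
have vle : v <= (2 * r) ^+ n by rewrite -lee_fin -vE.
move: hd; rewrite vE inver gt_eqF// lte_pdivrMr// => hd.
have lgx := locintB (g x) lg; pose g' w := g w - g x.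
rewrite PkB//.
apply: le_trans (Pk_le n0 lgx sk _) _; first by move=> i; apply: le_trans (hy i) _; exact: hk1.
have mB : measurable (bcube x (s k)) by exact: measurable_cube.
have I1 : (\int[muX]_(w in bcube x (s k)) (`|g' w|)%:E)%E = (Icube g' x (s k))%:E.
  rewrite /Icube /Rintegral fineK//; apply: integrable_fin_num => //.
  by have := integrable_abse (lgx.2 (x - const_mx (2 * s k)) (4 * s k) (mulr_gt0 (ltr0Sn _ 3) sk)).
have I2 : Icube g' x (s k) <= e / K * v.
  rewrite -lee_fin -I1 EFinM; apply: le_trans (ltW hd).
  apply: ge0_subset_integral => //.
  - by apply/measurable_EFinP; apply: measurableT_comp => //; apply: measurable_funB => //; exact: measurable_funTS.
  - move=> w /bcubeP wi; apply: le_lt_trans (enorm_le_sum _) _.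
    apply: (@le_lt_trans _ _ (\sum_(i < n) 2 * s k)).
      by apply: ler_sum => i _; rewrite !mxE ltW.
    by rewrite sumr_const card_ord -mulr_natl /r; nra.
have c0 := csum_gt0 n0 sk.
rewrite -ler_pdivlMl ?invr_gt0// invrK mulrC; apply: le_trans I2 _.
apply: (@le_trans _ _ (e / K * (2 * r) ^+ n)); first by rewrite ler_wpM2l// ltW// divr_gt0.
rewrite -mulrA ler_wpM2l ?(ltW e0)//; apply: le_trans (csum_ge n0 sk).
rewrite ler_pdivrMl// /K /r.
have aux (A B : R) : 2 * A * (2^-1 * B) = A * B by field.
rewrite aux.
rewrite -exprMn lerXn2r ?nnegrE ?mulr_ge0 ?(ltW sk) ?divr_ge0//.
rewrite le_eqVlt; apply/orP; left; apply/eqP; field; by rewrite gt_eqF.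
Qed.

Lemma Mf_ae_fin : {ae muX, forall x, (Mf g x < +oo)%E}.
Proof.
have mM : measT (fun x => Mf g x `^ p)%E by apply: (measurable_poweRT p); exact: measurable_Mf.
have iM : muX.-integrable setT (fun x => Mf g x `^ p)%E.
  apply/integrableP; split => //.
  under eq_integral do rewrite gee0_abs ?poweR_ge0//.
  by apply: le_lt_trans (Mf_pw p1 mg) _; apply: mulEFin_lty; rewrite ?pw_ge0.
have := integrable_ae measurableT iM; apply: filterS => x /(_ I).
by have := Mf_ge0 g x; case: (Mf g x) => [M _ _| |] //; rewrite ?ltry// poweRyr ?gt_eqF.
Qed.

(** The series of 2^(k p) |g_k - g|^p is integrable, so its terms are bounded
    almost everywhere. *)
Lemma Pk_ae_rate : {ae muX, forall x, exists C, forall k, `|Pk g (s k) x - g x| <= C * (2^-1) ^+ k}.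
Proof.
pose f k x := ((`|2 ^+ k * (Pk g (s k) x - g x)| `^ p)%:E)%E.
have mP k : measT (fun x => Pk g (s k) x - g x) by apply: measurable_funB => //; exact: measurable_Pk.
have mf k : measT (f k) by apply: measurable_pw; exact: measurable_funM.
have f0 k x : (0 <= f k x)%E by rewrite lee_fin powR_ge0.
pose S x := (\sum_(k <oo) f k x)%E.
have mS : measT S by exact: ge0_emeasurable_sum.
have S0 x : (0 <= S x)%E by exact: nneseries_ge0.
have g0 := pw_ge0 muX p g.
have iS : muX.-integrable setT S.
  apply/integrableP; split => //.
  under eq_integral do rewrite gee0_abs//.
  rewrite integral_nneseries//.
  apply: (@le_lt_trans _ _ (\sum_(k <oo) ((2^-1) ^+ k)%:E * pw g)%E); last first.
    by apply: le_lt_trans (series_half_le g0) _; exact: mulEFin_lty.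
  apply: lee_nneseries => [k _ _|k _]; first exact: integral_ge0.
  apply: le_trans (pwZ p1 _ (mP k)) _; rewrite ger0_norm ?exprn_ge0//.
  apply: le_trans (lee_wpmul2l _ (sg k)) _; first by rewrite lee_fin powR_ge0.
  rewrite muleA -EFinM; apply: lee_wpmul2r => //; rewrite lee_fin -powRM ?exprn_ge0//.
  have h01 : 0 <= (2^-1 : R) ^+ k <= 1 by rewrite exprn_ge0//= exprn_ile1// invf_le1// ler1n.
  have h02 : 0 < (2^-1 : R) ^+ k by rewrite exprn_gt0.
  apply: (@le_trans _ _ (((2^-1) ^+ k) `^ p)).
    apply: ge0_ler_powR; rewrite ?nnegrE ?mulr_ge0 ?exprn_ge0 ?(ltW p0)//.
    have -> : 4^-1 = 2^-1 * 2^-1 :> R by field.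
    rewrite exprS [(2^-1 * 2^-1) ^+ k]exprMn [2 ^+ k * _]mulrCA [2 ^+ k * _]mulrA -exprMn mulfV// expr1n mul1r.
    rewrite ler_piMl ?(ltW h02)//; lra.
  rewrite -[leRHS]powRr1 ?(ltW h02)//; apply: ger_powR; last exact: ltW.
  by rewrite h02; case/andP: h01.
have := integrable_ae measurableT iS; apply: filterS => x /(_ I) Sx.
exists (fine (S x) `^ p^-1) => k.
have h : (f k x <= (fine (S x))%:E)%E.
  rewrite fineK//; apply: (@le_trans _ _ (\sum_(0 <= j < k.+1) f j x)%E); last exact: nneseries_lim_ge.
  by rewrite big_nat_recr//= leeDr// sume_ge0.
rewrite /f lee_fin in h.
have : `|2 ^+ k * (Pk g (s k) x - g x)| <= fine (S x) `^ p^-1.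
  have e1 (a : R) : 0 <= a -> a = (a `^ p) `^ p^-1 by move=> a0; rewrite -powRrM mulfV ?gt_eqF// powRr1.
  rewrite [leLHS]e1//; apply: ge0_ler_powR; rewrite ?nnegrE ?powR_ge0 ?invr_ge0 ?(ltW p0)//.
  exact: fine_ge0.
rewrite normrM ger0_norm ?exprn_ge0// => h2.
by rewrite exprVn ler_pdivlMr ?exprn_gt0// mulrC.
Qed.

(** At almost every x the centres converge with a rate, and the smoothing is
    Lipschitz with constant Mg(x) / s_k near x, which is negligible over
    distances alpha 4^(-k) s_k.  This replaces Lebesgue's differentiation
    theorem. *)
Lemma ae_scale_limit alpha : 0 < alpha -> {ae muX, forall x, scale_limit alpha x (g x)}.
Proof.
move=> a0; have := Mf_ae_fin; have := Pk_ae_rate; apply: filterS2 => x [C hC] Mx e e0.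
have Mfin : Mf g x \is a fin_num by rewrite ge0_fin_numE// Mf_ge0.
pose M := fine (Mf g x); have M0 : 0 <= M by rewrite fine_ge0// Mf_ge0.
pose D := 12 * n%:R * alpha * (kC n * M) + `|C| + 1.
have D0 : 0 < D by rewrite ltr_wpDl// addr_ge0// !mulr_ge0 ?kC_ge0// ltW.
have eD : 0 < e / D by rewrite divr_gt0.
have [k1 hk1] := alpha_small a0; have [k2 hk2] := half_small eD.
exists (maxn k1 k2) => k y; rewrite geq_max => /andP[kk1 kk2] hy.
have sk := s0 k; have c0 := csum_gt0 n0 sk.
have h1 : `|Pk g (s k) y - Pk g (s k) x| <= 12 * n%:R * (alpha * ts k) / s k * ((csum n (s k))^-1 * Icube g x (s k)).
  apply: (Pk_lip n0 lg sk) => // i; last by rewrite subrr normr0 ltW.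
  by apply: le_trans (hy i) _; exact: hk1.
have h2 : (csum n (s k))^-1 * Icube g x (s k) <= kC n * M.
  by have := Icube_le_Mf n0 x lg sk; rewrite -[Mf g x]fineK// -EFinM lee_fin.
have h3 : 12 * n%:R * (alpha * ts k) / s k = 12 * n%:R * alpha * (4^-1) ^+ k.
  by rewrite /ts; field; rewrite gt_eqF.
have -> : Pk g (s k) y - g x = (Pk g (s k) y - Pk g (s k) x) + (Pk g (s k) x - g x) by ring.
apply: le_trans (ler_normD _ _) _.
have na : 0 <= 12 * n%:R * alpha by rewrite !mulr_ge0// ltW.
apply: (@le_trans _ _ (12 * n%:R * alpha * (4^-1) ^+ k * (kC n * M) + C * (2^-1) ^+ k)).
  apply: lerD => //; apply: (le_trans h1); rewrite h3 ler_wpM2l// mulr_ge0// exprn_ge0//.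
apply: (@le_trans _ _ (D * (2^-1) ^+ k)); last first.
  by rewrite mulrC -ler_pdivlMr//; exact: hk2.
have -> : D * (2^-1) ^+ k = 12 * n%:R * alpha * (kC n * M) * (2^-1) ^+ k + (`|C| * (2^-1) ^+ k + (2^-1) ^+ k) by rewrite /D; ring.
apply: lerD.
  rewrite mulrAC; apply: ler_wpM2l; last exact: quarter_half.
  by rewrite mulr_ge0// mulr_ge0// kC_ge0.
rewrite -[leLHS]addr0; apply: lerD; last by rewrite exprn_ge0.
by apply: ler_wpM2r; [rewrite exprn_ge0|exact: ler_norm].
Qed.

(** A Whitney region lies in a cone, so non-tangential limits give limits of
    Whitney averages. *)
Lemma whitney_cone (c0 c1 t : R) x (z : V) : 1 < c0 -> 0 < c1 -> 0 < t -> whitney c0 c1 t x z ->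
  [/\ H z, cone (c0 * c1) x z, c0^-1 * t < tcoord z & tcoord z < c0 * t].
Proof.
move=> hc0 hc1 t0 /(whitneyP c0 c1 x z t0)[/andP[h1 h2] h3].
have c00 : 0 < c0 by lra.
have Hz : H z by apply: lt_trans h1; rewrite mulr_gt0// invr_gt0.
split => //; split => //; apply: lt_trans h3 _.
have : t < c0 * tcoord z by rewrite -ltr_pdivrMl.
by move=> h; rewrite (_ : c0 * c1 * _ = c1 * (c0 * tcoord z)) ?ltr_pM2l//; ring.
Qed.

Lemma ext_BV : BVloc ext. Proof. by have [] := ext_BVloc_Cgrad n0 s0 s_le1 sdec lg. Qed.

Lemma ext_whitney_limit (c0 c1 : R) x L : 1 < c0 -> 0 < c1 -> scale_limit (c0 * c1) x L ->
  whitney_avg c0 c1 ext t x @[t --> 0^'+] --> L.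
Proof.
move=> hc0 hc1 hL; have c00 : 0 < c0 by lra.
apply/cvgrPdist_le => e e0.
have [d d0 hd] := ext_limit (mulr_gt0 c00 hc1) hL e0.
have dc : 0 < d / c0 by rewrite divr_gt0.
near=> t.
have t0 : 0 < t by near: t; exact: nbhs_right_gt.
have td : t < d / c0 by near: t; exact: nbhs_right_lt.
have m0 := whitney_fine_gt0 hc0 hc1 x t0.
have mW := @measurable_whitney R n c0 c1 hc1 t x t0.
have Wfin := whitney_fin hc0 hc1 x t0.
set W := whitney c0 c1 t x in m0 mW Wfin *; set m := fine _ in m0 *.
have [uL _] := ext_BV; have [K [cK KH WK]] := whitney_compact hc0 hc1 x t0.
have iu : mu.-integrable W (EFin \o ext).
  by apply: integrableS (uL.2 K cK KH) => //; exact: compact_measurable_rV.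
have ic (c : R) : mu.-integrable W (EFin \o cst c) by apply: measurable_bounded_integrable => //; exact: bounded_cst.
have iuL : mu.-integrable W (EFin \o (fun z => ext z - L)).
  by have := integrableB mW iu (ic L); congr (_.-integrable _ _); apply/funext => z.
have E : \int[mu]_(z in W) ext z - m * L = \int[mu]_(z in W) (ext z - L).
  by rewrite RintegralB//; [congr (_ - _); rewrite Rintegral_cst// mulrC|exact: ic].
rewrite /whitney_avg -/W -/m distrC.
have -> : m^-1 * \int[mu]_(z in W) ext z - L = m^-1 * (\int[mu]_(z in W) ext z - m * L).
  by field; rewrite gt_eqF.
rewrite E normrM gtr0_norm ?invr_gt0// ler_pdivrMl//.
apply: le_trans (le_normr_Rintegral mW iuL) _.
have -> : m * e = \int[mu]_(z in W) cst e z by rewrite Rintegral_cst// mulrC.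
have in1 : mu.-integrable W (EFin \o (fun z => `|ext z - L|)) by have := integrable_norm iuL; exact.
apply: (le_Rintegral mW in1 (ic e)) => z Wz; have [Hz cz _ h2] := whitney_cone hc0 hc1 t0 Wz.
apply: hd => //; apply: lt_trans h2 _; by rewrite mulrC -ltr_pdivlMr.
Unshelve. all: by end_near. Qed.

Lemma ext_whitney_infty (c0 c1 : R) x : 1 < c0 -> 0 < c1 ->
  whitney_avg c0 c1 (fun z => `|ext z|) t x @[t --> +oo] --> 0.
Proof.
move=> hc0 hc1; have c00 : 0 < c0 by lra.
apply: cvg_near_cst; near=> t.
have tt : c0 * ts 0%N <= t by near: t; apply: nbhs_pinfty_ge; exact: num_real.
have t0 : 0 < t by apply: lt_le_trans tt; rewrite mulr_gt0// ts_gt0.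
rewrite /whitney_avg (_ : \int[_]_(z in _) _ = 0) ?mulr0//.
rewrite /Rintegral integral0_eq// => z Wz.
have [Hz cz h1 _] := whitney_cone hc0 hc1 t0 Wz.
rewrite (ext_eq s0 s_le1 sdec g Hz (N := 0%N)) ?/uN ?big_ord0 ?normr0//.
apply: le_trans (ltW h1); by rewrite ler_pdivlMl.
Unshelve. all: by end_near. Qed.

Lemma ext_nontangential alpha x : 0 < alpha -> lebesgue_point g x ->
  ext z @[z --> within (cone alpha x) (nbhs (row_mx 0 x))] --> g x.
Proof.
move=> a0 lx; apply/(@cvgrPdist_le _ R^o _ (within _ (nbhs _))) => e e0.
have [d d0 hd] := ext_limit a0 (scale_limit_lebesgue a0 lx) e0.
apply/(@nbhs_ballP R V); exists d => //= z; rewrite -ball_normE /= => zd cz.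
have Hz : H z by case: cz.
rewrite distrC; apply: hd => //.
apply: le_lt_trans zd; apply: le_trans (ler_norm _) _.
have -> : tcoord z = - ((row_mx 0 x - z) ord0 (t0 n)).
  by rewrite !mxE /tcoord; case: splitP => // j _; rewrite mxE sub0r opprK.
by rewrite normrN; exact: coord_le_norm.
Qed.
End extension_estimates.

(** * The norm on the space of functions *)

Section Lnorm_facts.
Context {R : realType} (n : nat) (p : R).
Hypothesis p1 : 1 < p.
Local Notation X := ('rV[R]_n).
Local Notation muX := (lebesgue_rV n).
Local Notation pw := (@pw _ X R muX p).
Implicit Types f g h : X -> \bar R.
Let p0 : 0 < p. Proof. exact: lt_trans p1. Qed.

Lemma Lnorm_mono f g (c : R) : measT f -> measT g -> (forall x, 0 <= f x)%E -> (forall x, 0 <= g x)%E ->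
  0 <= c -> (forall x, f x <= c%:E * g x)%E -> ('N[muX]_p%:E[f] <= c%:E * 'N[muX]_p%:E[g])%E.
Proof.
move=> mf mg f0 g0 c0 fg.
have cE : c = (c `^ p) `^ p^-1 by rewrite -powRrM mulfV ?gt_eqF// powRr1.
rewrite cE; apply: Lnorm_le; rewrite ?powR_ge0//.
have mgp : measT (fun x => `|g x| `^ p)%E by apply: (measurable_poweRT p); exact: measurableT_comp.
rewrite -(ge0_intZ muX measurableT mgp) ?powR_ge0//; last by move=> x _; exact: poweR_ge0.
apply: ge0_le_integral => //.
- by move=> x _; exact: poweR_ge0.
- by apply: (measurable_poweRT p); exact: measurableT_comp.
- exact: emeasurable_funM.
move=> x _; rewrite -poweR_EFin -poweRM ?lee_fin ?abse_ge0//.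
by apply: (gt0_ler_poweR (ltW p0)); rewrite ?in_itv/= ?leey ?abse_ge0 ?andbT ?mule_ge0 ?abse_ge0 ?lee_fin// !gee0_abs.
Qed.

(** Minkowski's inequality for functions with values in the extended reals: where
    they are infinite they may be changed on a null set. *)
Lemma Lnorm_triangle f g h : measT f -> measT g -> measT h ->
  (forall x, 0 <= f x)%E -> (forall x, 0 <= g x)%E -> (forall x, 0 <= h x)%E ->
  ('N[muX]_p%:E[f] < +oo)%E -> ('N[muX]_p%:E[g] < +oo)%E -> (forall x, h x <= f x + g x)%E ->
  ('N[muX]_p%:E[h] <= 'N[muX]_p%:E[f] + 'N[muX]_p%:E[g])%E.
Proof.
move=> mf mg mh f0 g0 h0 fp gp hfg.
have mfine k : measT k -> measT (fun x : X => fine (k x)).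
  by move=> mk; apply: (measurableT_comp (fine_measurable measurableT)).
have Nfine k : measT k -> (forall x, 0 <= k x)%E -> ('N[muX]_p%:E[EFin \o (fun x : X => fine (k x))] <= 'N[muX]_p%:E[k])%E.
  move=> mk k0; rewrite -[leRHS]mul1e; apply: Lnorm_mono => //; first by apply/measurable_EFinP; exact: mfine.
    by move=> x; rewrite lee_fin fine_ge0.
  by move=> x; rewrite mul1e /=; have := k0 x; case: (k x) => //= *; rewrite leey.
have fin k : measT k -> (forall x, 0 <= k x)%E -> ('N[muX]_p%:E[k] < +oo)%E -> {ae muX, forall x : X, k x \is a fin_num}.
  move=> mk k0 kp; have mkp : measT (fun x : X => k x `^ p)%E by apply: (measurable_poweRT p).
  have ik : muX.-integrable setT (fun x => k x `^ p)%E.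
    apply/integrableP; split => //; move/(Lnorm_fin _ _ p0) : kp; apply: le_lt_trans.
    by rewrite le_eqVlt; apply/orP; left; apply/eqP; apply: eq_integral => x _; rewrite !gee0_abs// poweR_ge0.
  have := integrable_ae measurableT ik; apply: filterS => x /(_ I).
  by have := k0 x; case: (k x) => //; rewrite poweRyr ?gt_eqF.
pose s x := fine (f x) + fine (g x).
have ms : measT s by apply: measurable_funD; exact: mfine.
apply: (@le_trans _ _ ('N[muX]_p%:E[EFin \o s])%E); last first.
  apply: (@le_trans _ _ ('N[muX]_p%:E[EFin \o (fun x : X => fine (f x))] + 'N[muX]_p%:E[EFin \o (fun x : X => fine (g x))])%E).
    by apply: minkowski_EFin; [exact: mfine|exact: mfine|exact: ltW].
  by apply: leeD; exact: Nfine.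
have -> : ('N[muX]_p%:E[EFin \o s] = (1 `^ p^-1)%:E * 'N[muX]_p%:E[EFin \o s])%E by rewrite powR1 mul1e.
apply: Lnorm_le => //; rewrite mul1e.
apply: ae_ge0_le_integral => //.
- by move=> x _; exact: poweR_ge0.
- by apply: (measurable_poweRT p); exact: measurableT_comp.
- by move=> x _; exact: poweR_ge0.
- by apply: (measurable_poweRT p); apply: measurableT_comp => //; exact/measurable_EFinP.
have := fin _ mf f0 fp; have := fin _ mg g0 gp; apply: filterS2 => x gx fx _.
apply: (gt0_ler_poweR (ltW p0)); [by rewrite in_itv/= leey abse_ge0|by rewrite in_itv/= leey lee_fin normr_ge0|].
have sx : (0 <= (EFin \o s) x)%E by rewrite lee_fin addr_ge0// fine_ge0.
rewrite (gee0_abs (h0 x)) (gee0_abs sx).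
by apply: le_trans (hfg x) _; rewrite /= EFinD !fineK.
Qed.
End Lnorm_facts.

Section gradient_linear.
Context {R : realType} (n : nat).
Local Notation X := ('rV[R]_n).
Local Notation V := ('rV[R]_(1 + n)).
Local Notation mu := (lebesgue_rV (1 + n)).
Local Notation muX := (lebesgue_rV n).
Local Notation H := (@hspace R n).
Implicit Types (u v : V -> R).

Lemma measure_comb (m1 m2 m3 : {measure set V -> \bar R}) (a b : {nonneg R}) :
  exists m : {measure set V -> \bar R},
    (forall A, m A = (a%:num%:E * m1 A + b%:num%:E * m2 A + m3 A)%E) /\
    (forall f : V -> \bar R, measurable_fun H f -> (forall z, H z -> (0 <= f z)%E) ->
      (\int[m]_(z in H) f z = a%:num%:E * \int[m1]_(z in H) f z + b%:num%:E * \int[m2]_(z in H) f z + \int[m3]_(z in H) f z)%E).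
Proof.
have mH := @measurable_hspace R n.
exists (measure_add (measure_add (mscale a m1) (mscale b m2)) m3); split=> [A|f mf f0].
  by apply: (etrans (measure_addE _ _ _)); congr (_ + _)%E; exact: measure_addE.
by rewrite !ge0_integral_measure_add//= !ge0_integral_mscale.
Qed.

Lemma fine_comb (a b x1 y1 x2 y2 x3 y3 : R) :
  fine ((a%:E * x1%:E + b%:E * x2%:E + x3%:E) - (a%:E * y1%:E + b%:E * y2%:E + y3%:E))%E =
  a * (x1 - y1) + b * (x2 - y2) + (x3 - y3).
Proof. by rewrite /=; ring. Qed.

Lemma compact_support_integrable (m : {measure set V -> \bar R}) K (g : V -> R) : locally_finite m ->
  continuous g -> compact K -> K `<=` H -> (forall z, ~ K z -> g z = 0) -> m.-integrable H (EFin \o g).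
Proof.
move=> lf cg cK KH gK; have mK := compact_measurable_rV cK; have mH := @measurable_hspace R n.
have [M M0 hM] := compact_support_bounded cg cK gK.
have mg : measT g by apply: open_continuous_measurable_rV => [|z _]; [exact: openT|exact: cg].
have iK : m.-integrable K (EFin \o g).
  apply: measurable_bounded_integrable => //; [exact: lf|exact: measurable_funTS|].
  by exists M; split; [exact: num_real|move=> M' MM' z _ /=]; apply: le_trans (hM z) (ltW MM').
have E : (EFin \o g) \_ K = EFin \o g.
  by apply/funext => z; rewrite patchE; case: ifPn => //; rewrite notin_setE => nKz; rewrite /= gK.
apply: (integrableS measurableT) => //; rewrite -E -integrable_mkcond//.
Qed.

Lemma L1loc_mul_integrable u K (g : V -> R) : L1loc u -> continuous g -> compact K -> K `<=` H ->
  (forall z, ~ K z -> g z = 0) -> mu.-integrable H (EFin \o (fun z => u z * g z)).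
Proof.
move=> uL cg cK KH gK; have mK := compact_measurable_rV cK; have mH := @measurable_hspace R n.
have [M M0 hM] := compact_support_bounded cg cK gK.
have mg : measT g by apply: open_continuous_measurable_rV => [|z _]; [exact: openT|exact: cg].
have i1 := integrable_mulc measurableT M (L1loc_patch uL cK KH).
apply: (integrableS measurableT) => //.
have E : (fun z => u z * g z) = (fun z => (u \_ K) z * g z).
  by apply/funext => z; rewrite patchE; case: ifPn => //; rewrite notin_setE => nKz; rewrite gK// !mulr0.
rewrite E; apply: le_integrable i1 => //.
  apply/measurable_EFinP; apply: measurable_funM => //.
  by have /integrableP[/measurable_EFinP] := L1loc_patch uL cK KH.
by move=> z _ /=; rewrite lee_fin !normrM mulrC ler_wpM2r// (ger0_norm M0).
Qed.

Lemma comb_Rintegral (m m1 m2 m3 : {measure set V -> \bar R}) (a b : {nonneg R}) (g : V -> R) :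
  (forall f : V -> \bar R, measurable_fun H f -> (forall z, H z -> (0 <= f z)%E) ->
      (\int[m]_(z in H) f z = a%:num%:E * \int[m1]_(z in H) f z + b%:num%:E * \int[m2]_(z in H) f z + \int[m3]_(z in H) f z)%E) ->
  m1.-integrable H (EFin \o g) -> m2.-integrable H (EFin \o g) -> m3.-integrable H (EFin \o g) ->
  \int[m]_(z in H) g z = a%:num * \int[m1]_(z in H) g z + b%:num * \int[m2]_(z in H) g z + \int[m3]_(z in H) g z.
Proof.
move=> mE i1 i2 i3; have mH := @measurable_hspace R n.
have mg : measurable_fun H (EFin \o g) by exact: measurable_int i1.
have f1 := integrable_pos_fin_num mH i1; have f1' := integrable_neg_fin_num mH i1.
have f2 := integrable_pos_fin_num mH i2; have f2' := integrable_neg_fin_num mH i2.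
have f3 := integrable_pos_fin_num mH i3; have f3' := integrable_neg_fin_num mH i3.
have RE (m' : {measure set V -> \bar R}) : \int[m']_(z in H) g z =
    fine (\int[m']_(z in H) (EFin \o g)^\+ z - \int[m']_(z in H) (EFin \o g)^\- z)%E by rewrite /Rintegral integralE.
rewrite !RE.
rewrite (mE _ (measurable_funepos mg)) => [|z _]; last exact: funepos_ge0.
rewrite (mE _ (measurable_funeneg mg)) => [|z _]; last exact: funeneg_ge0.
rewrite -(fineK f1) -(fineK f1') -(fineK f2) -(fineK f2') -(fineK f3) -(fineK f3') fine_comb.
by rewrite -!EFinB.
Qed.

(** Component measures are positive, so a scalar of either sign is split into
    positive and negative parts that act on the two measures of a component
    crosswise. *)
Lemma gradient_comb u v nu1 nu2 (a : R) : L1loc u -> L1loc v -> is_gradient u nu1 -> is_gradient v nu2 ->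
  exists2 nu, is_gradient (fun z => a * u z + v z) nu &
    forall F, measurable F -> compactly_in F -> vm_val nu F = a *: vm_val nu1 F + vm_val nu2 F.
Proof.
move=> uL vL [lf1 g1] [lf2 g2].
have ap0 : 0 <= Num.max a 0 by rewrite le_max lexx orbT.
have am0 : 0 <= Num.max (- a) 0 by rewrite le_max lexx orbT.
pose ap := NngNum ap0; pose am := NngNum am0.
have apm : ap%:num - am%:num = a.
  by rewrite /=; have [h|h] := leP 0 a; [rewrite max_r ?subr0// oppr_le0|rewrite max_l ?sub0r ?opprK// oppr_ge0 ltW].
pose P i (m : {measure set V -> \bar R} * {measure set V -> \bar R}) :=
 [/\ (forall A, m.1 A = (ap%:num%:E * (nu1 i).1 A + am%:num%:E * (nu1 i).2 A + (nu2 i).1 A)%E),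
     (forall A, m.2 A = (ap%:num%:E * (nu1 i).2 A + am%:num%:E * (nu1 i).1 A + (nu2 i).2 A)%E),
    (forall f : V -> \bar R, measurable_fun H f -> (forall z, H z -> (0 <= f z)%E) ->
      (\int[m.1]_(z in H) f z = ap%:num%:E * \int[(nu1 i).1]_(z in H) f z + am%:num%:E * \int[(nu1 i).2]_(z in H) f z + \int[(nu2 i).1]_(z in H) f z)%E) &
    (forall f : V -> \bar R, measurable_fun H f -> (forall z, H z -> (0 <= f z)%E) ->
      (\int[m.2]_(z in H) f z = ap%:num%:E * \int[(nu1 i).2]_(z in H) f z + am%:num%:E * \int[(nu1 i).1]_(z in H) f z + \int[(nu2 i).2]_(z in H) f z)%E)].
have exP i : exists m, P i m.
  have [m [h1 h2]] := measure_comb (nu1 i).1 (nu1 i).2 (nu2 i).1 ap am.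
  have [m' [h1' h2']] := measure_comb (nu1 i).2 (nu1 i).1 (nu2 i).2 ap am.
  by exists (m, m').
pose nu : vector_measure n := fun i => projT1 (cid (exP i)).
have nuP i : P i (nu i) by exact: (projT2 (cid (exP i))).
exists nu.
  split=> [i|i phi tphi].
    have [h1 h2 _ _] := nuP i; split=> K cK KH; rewrite ?h1 ?h2.
      rewrite !lte_add_pinfty//; [exact: mulEFin_lty ((lf1 i).1 K cK KH)|exact: mulEFin_lty ((lf1 i).2 K cK KH)|exact: (lf2 i).1].
    rewrite !lte_add_pinfty//; [exact: mulEFin_lty ((lf1 i).2 K cK KH)|exact: mulEFin_lty ((lf1 i).1 K cK KH)|exact: (lf2 i).2].
  have [_ _ h1 h2] := nuP i; have [Cphi [K [cK KH phiK]]] := tphi.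
  have {}phiK z : phi z != 0 -> K z by move=> h; exact: phiK.
  have phi0 z : ~ K z -> phi z = 0 by move=> nK; apply/eqP/negPn/negP => /phiK.
  have cphi : continuous phi by move=> z; exact: (C1_on_cont Cphi).
  have ii (m : {measure set V -> \bar R}) : locally_finite m -> m.-integrable H (EFin \o phi).
    by move=> lf; exact: compact_support_integrable lf cphi cK KH phi0.
  pose D z : R := 'D_(delta_mx ord0 i) phi z.
  have cD : continuous D by move=> z; exact: ((Cphi z I).2 _).
  have D0 z : ~ K z -> D z = 0 by move=> nK; rewrite /D (support_open_derive0 _ cK phiK nK).
  have iu := L1loc_mul_integrable uL cD cK KH D0; have iv := L1loc_mul_integrable vL cD cK KH D0.
  have mH := @measurable_hspace R n.
  have -> : \int[mu]_(z in H) ((a * u z + v z) * 'D_(delta_mx ord0 i) phi z) =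
      a * \int[mu]_(z in H) (u z * D z) + \int[mu]_(z in H) (v z * D z).
    rewrite -RintegralZl// -RintegralD//; last exact: integrable_mulc.
    by apply: eq_Rintegral => z _; rewrite -/(D z); ring.
  rewrite (g1 i phi tphi) (g2 i phi tphi) /vm_integral.
  rewrite (comb_Rintegral h1) ?(comb_Rintegral h2); try (apply: ii; by [exact: (lf1 i).1|exact: (lf1 i).2|exact: (lf2 i).1|exact: (lf2 i).2]).
  by rewrite -[in LHS]apm; ring.
move=> F mF [K [cK KH FK]]; apply/rowP => i; rewrite !mxE.
have [h1 h2 _ _] := nuP i.
have ff (m : {measure set V -> \bar R}) : locally_finite m -> m F \is a fin_num.
  move=> lf; rewrite ge0_fin_numE//; apply: le_lt_trans (lf K cK KH).
  by apply: le_measure; rewrite ?inE//; exact: compact_measurable_rV.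
have e1 := fineK (ff _ (lf1 i).1); have e2 := fineK (ff _ (lf1 i).2).
have e3 := fineK (ff _ (lf2 i).1); have e4 := fineK (ff _ (lf2 i).2).
rewrite h1 h2 -e1 -e2 -e3 -e4 /=; move: apm => /= apm.
have -> : Num.max (- a) 0 = Num.max a 0 - a by rewrite -{3}apm; ring.
ring.
Qed.

Lemma L1loc_comb u v (a : R) : L1loc u -> L1loc v -> L1loc (fun z => a * u z + v z).
Proof.
move=> [mu1 iu] [mv iv]; split; first by apply: measurable_funD => //; exact: measurable_funM.
move=> K cK KH; have mK := compact_measurable_rV cK.
have := integrableD mK (integrable_mulc mK a (iu K cK KH)) (iv K cK KH).
by congr (_.-integrable _ _); apply/funext => z.
Qed.

Lemma BVloc_comb u v (a : R) : BVloc u -> BVloc v -> BVloc (fun z => a * u z + v z).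
Proof.
move=> [uL [nu1 g1]] [vL [nu2 g2]]; split; first exact: L1loc_comb.
by have [nu gnu _] := gradient_comb a uL vL g1 g2; exists nu.
Qed.

Lemma Cgrad_ge0 u x : BVloc u -> (0 <= Cgrad u x)%E.
Proof. by move=> /Cgrad_measure[m [_ ->]]; exact: carleson_ge0. Qed.

Lemma measurable_Cgrad u : measT (Cgrad u : X -> \bar R).
Proof. exact: measurable_carleson. Qed.

Lemma lin_mule (k : R) (x y c : \bar R) : 0 <= k -> (0 <= x)%E -> (0 <= y)%E ->
  ((k%:E * x + y) * c = k%:E * (x * c) + y * c)%E.
Proof. by move=> k0 x0 y0; rewrite ge0_muleDl ?mule_ge0 ?lee_fin// muleA. Qed.

Lemma Cgrad_comb u v (a : R) x : BVloc u -> BVloc v ->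
  (Cgrad (fun z => a * u z + v z)%R x <= `|a|%:E * Cgrad u x + Cgrad v x)%E.
Proof.
move=> BVu BVv; have BVw := BVloc_comb a BVu BVv.
have [uL gu] := BVu; have [vL gv] := BVv; have [_ gw] := BVw.
have hu := is_gradient_grad gu; have hv := is_gradient_grad gv; have hw := is_gradient_grad gw.
have [nu gnu nuE] := gradient_comb a uL vL hu hv.
apply: ge_ereal_sup => _ [b [l [l0 cx ->]]].
have mbox := @measurable_carleson_box R n b l; have boxH := @carleson_box_hspace R n b l.
have tvle : (vm_total_variation (grad (fun z => a * u z + v z)%R) (carleson_box b l) <=
    `|a|%:E * vm_total_variation (grad u) (carleson_box b l) + vm_total_variation (grad v) (carleson_box b l))%E.
  apply: tv_le_comb; [exact: hu.1|exact: hv.1|move=> F mF cF].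
  by rewrite -nuE//; exact: (gradient_unique hw gnu).
have u0 : (0 <= vm_total_variation (grad u) (carleson_box b l))%E by exact: (tv_ge0 _ mbox boxH).
have v0 : (0 <= vm_total_variation (grad v) (carleson_box b l))%E by exact: (tv_ge0 _ mbox boxH).
have i0 : (0 <= (muX (cube b l))^-1)%E by rewrite inve_ge0.
apply: (@le_trans _ _ ((`|a|%:E * vm_total_variation (grad u) (carleson_box b l) + vm_total_variation (grad v) (carleson_box b l)) / muX (cube b l))%E).
  exact: lee_wpmul2r.
rewrite (lin_mule _ (normr_ge0 a) u0 v0); apply: leeD.
  by apply: lee_wpmul2l; rewrite ?lee_fin//; apply: ereal_sup_ubound; exists b, l.
by apply: ereal_sup_ubound; exists b, l.
Qed.

Lemma null_Cgrad u : L1loc u -> {ae mu, forall z, H z -> u z = 0} ->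
  BVloc u /\ forall x, Cgrad u x = 0%E.
Proof.
move=> uL u0; have mH := @measurable_hspace R n.
pose nu : vector_measure n := fun=> ([the {measure set V -> \bar R} of mzero], [the {measure set V -> \bar R} of mzero]).
have gnu : is_gradient u nu.
  split=> [i|i phi [Cphi [K [cK KH phiK]]]].
    by split=> K cK KH; rewrite /nu /= /mzero ltry.
  rewrite /vm_integral /nu /= /Rintegral !integral_measure_zero subrr oppr0.
  rewrite (ae_eq_integral (cst 0%E))//.
  - by rewrite integral_cst// mul0e.
  - apply/measurable_EFinP; apply: measurable_funM; first exact: uL.1.
    by apply: measurable_continuous_hspace => z Hz; exact: ((Cphi z I).2 _).
  - by apply: filterS u0 => z hz Hz; rewrite /= hz// mul0r.
have BVu : BVloc u by split => //; exists nu.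
split => // x; apply/le_anti; rewrite Cgrad_ge0// andbT.
apply: ge_ereal_sup => _ [b [l [l0 cx ->]]].
have -> : vm_total_variation (grad u) (carleson_box b l) = 0%E; last by rewrite mul0e.
have -> : vm_total_variation (grad u) (carleson_box b l) = vm_total_variation nu (carleson_box b l).
  by apply: eq_tv => A mA cA; exact: (gradient_unique (is_gradient_grad (ex_intro _ nu gnu)) gnu mA cA).
apply/le_anti; rewrite (tv_ge0 nu (@measurable_carleson_box R n b l) (@carleson_box_hspace R n b l)) andbT.
apply: tv_le => F [_ _ _]; rewrite eseries0// => j _ _.
rewrite (_ : vm_val nu (F j) = 0) ?enorm0//; apply/rowP => i; rewrite !mxE /nu /=.
by rewrite subrr.
Qed.

(** One value C(grad u)(x) = 0 forces every Carleson box over a cube containing x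
    to have zero variation, and each cube contains such an x. *)
Lemma tv_zero_of_Cgrad u : BVloc u -> {ae muX, forall x, Cgrad u x = 0%E} ->
  forall K, compact K -> K `<=` H -> vm_total_variation (grad u) K = 0%E.
Proof.
move=> BVu C0 K cK KH; have [_ gu] := BVu; have hu := is_gradient_grad gu.
have [k Kk] := compact_sub_obox cK.
pose a : X := const_mx (- k.+1%:R); pose l : R := 2 * k.+1%:R.
have l0 : 0 < l by rewrite mulr_gt0// ltr0n.
have KB : K `<=` carleson_box a l.
  move=> z Kz; have kk : k%:R < k.+1%:R :> R by rewrite ltr_nat.
  have k0 : 0 <= k%:R :> R by [].
  split; first (apply/andP; split; [exact: KH|]).
    have := Kk z Kz (t0 n); rewrite !mxE /tcoord /l => /andP[_ h]; move: h; rewrite /t0; lra.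
  by move=> i; rewrite xcoordE !mxE; have := Kk z Kz (rshift 1 i); rewrite !mxE /l => /andP[? ?]; apply/andP; split; lra.
have mK := compact_measurable_rV cK; have mB := @measurable_carleson_box R n a l.
have BH := @carleson_box_hspace R n a l.
apply/le_anti; rewrite (tv_ge0 _ mK KH) andbT.
apply: le_trans (le_tv _ mK mB KB BH) _.
rewrite leNgt; apply/negP => tv0.
have mc : measurable (cube a l) by rewrite cube_obox; exact: measurable_obox.
have cpos : (0 < muX (cube a l))%E by rewrite lebesgue_cube ?(ltW l0)// lte_fin exprn_gt0.
have : (muX (cube a l) <= 0)%E; last by rewrite leNgt cpos.
have [N [mN N0 hN]] := C0; rewrite -N0; apply: le_measure; rewrite ?inE// => x cx; apply: hN => /= Cx.
have : (vm_total_variation (grad u) (carleson_box a l) / muX (cube a l) <= 0)%E.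
  by rewrite -Cx; apply: ereal_sup_ubound; exists a, l.
rewrite leNgt => /negP; apply; apply: mule_gt0 => //.
by rewrite lebesgue_cube ?(ltW l0)// inver gt_eqF ?exprn_gt0// lte_fin invr_gt0 exprn_gt0.
Qed.

(** With vanishing variation, Poincare says that averages over all open sets
    with compact closure agree; comparing with Whitney regions far away they
    vanish, so the positive and negative parts of u have the same mass on boxes,
    hence everywhere. *)
Lemma zero_of_tv_zero (c0 c1 : R) u : 1 < c0 -> 0 < c1 -> BVloc u ->
  (forall K, compact K -> K `<=` H -> vm_total_variation (grad u) K = 0%E) ->
  (forall x, whitney_avg c0 c1 (fun z => `|u z|) t x @[t --> +oo] --> 0) ->
  {ae mu, forall z, H z -> u z = 0}.
Proof.
move=> hc0 hc1 [uL gu] tv0 av0; have hu := is_gradient_grad gu.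
have open0 (B : set V) k : open B -> B `<=` exhaust k -> \int[mu]_(z in B) u z = 0.
  move=> oB Bk; pose b := fine (mu B).
  have b0 : 0 <= b by exact: fine_ge0.
  apply/eqP; rewrite -normr_le0; apply/ler_addgt0Pr => e e0; rewrite add0r.
  have e1 : 0 < e / (b + 1) by rewrite divr_gt0// ltr_wpDl.
  have /cvgr0_norm_le/(_ _ e1) := av0 0 => -[M [Mr hM]].
  pose t := Num.max M 0 + 1.
  have t0 : 0 < t by rewrite ltr_wpDl// le_max lexx orbT.
  have {}hM : `|whitney_avg c0 c1 (fun z => `|u z|) t 0| <= e / (b + 1).
    by apply: hM; rewrite ltr_pwDr// le_max lexx.
  have m0 := whitney_fine_gt0 hc0 hc1 (0 : X) t0.
  have [K [cK KH WK]] := whitney_compact hc0 hc1 (0 : X) t0.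
  have cU : compact (K `|` exhaust k) by apply: compactU => //; exact: compact_exhaust.
  have UH : K `|` exhaust k `<=` H by move=> z [/KH|/(@exhaust_hspace R n)].
  have [j Uj] := compact_sub_oexh cU UH.
  have jj : exhaust (R := R) (n := n) j `<=` exhaust j.+1 by apply/subsetPset; apply: exhaust_nd.
  have sub z : (K `|` exhaust k) z -> exhaust j.+1 z by move=> /Uj/(@oexh_exhaust R n)/jj.
  have oW := @open_whitney R n c0 c1 hc1 t 0 t0.
  have := @poincare_box R n u (grad u) (\row_i (if i == lshift n ord0 then j.+2%:R^-1 else - j.+2%:R)) (const_mx j.+2%:R)
    B (whitney c0 c1 t 0) uL hu _ _ oB oW.
  rewrite -/(exhaust j.+1) tv0//=; [|exact: compact_exhaust|exact: exhaust_hspace].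
  rewrite !mulr0 => /(_ _ (@exhaust_hspace R n j.+1) _ _).
  set m := fine (mu (whitney c0 c1 t 0)) in m0 *.
  move=> h; have {h} : `|m * \int[mu]_(z in B) u z - b * \int[mu]_(z in whitney c0 c1 t 0) u z| <= 0.
    apply: h.
    - move=> i; rewrite !mxE; have j0 : 0 < j.+2%:R :> R by rewrite ltr0n.
      have j1 : 1 < j.+2%:R :> R by rewrite ltr1n.
      case: ifP => _; last by lra.
      by apply: lt_trans j1; rewrite invf_lt1// ltr1n.
    - by move=> z /Bk zk; apply: sub; right.
    - by move=> z /WK zK; apply: sub; left.
  rewrite normr_le0 subr_eq0 => /eqP E.
  have -> : \int[mu]_(z in B) u z = b * whitney_avg c0 c1 u t 0.
    by rewrite /whitney_avg -/m mulrCA -E mulKf// gt_eqF.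
  rewrite normrM (ger0_norm b0).
  apply: (@le_trans _ _ (b * (e / (b + 1)))).
    apply: ler_wpM2l => //; apply: le_trans (whitney_avg_le hc0 hc1 (0 : X) uL t0) _.
    by apply: le_trans hM; exact: ler_norm.
  by rewrite mulrA ler_pdivrMr ?ltr_wpDl// mulrC ler_wpM2l ?(ltW e0)// lerDl.
have w0 k : {ae mu, forall z, (u \_ (oexh k)) z = 0}.
  have oO : open (oexh (R := R) (n := n) k) by exact: open_obox.
  have mO := open_measurable_rV oO.
  have iO : mu.-integrable (oexh k) (EFin \o u).
    apply: (integrableS (measurable_exhaust k) mO (@oexh_exhaust R n k)).
    exact: uL.2 (@compact_exhaust R n k) (@exhaust_hspace R n k).
  pose w := u \_ (oexh k).
  have wE : EFin \o w = (EFin \o u) \_ (oexh k) by apply/funext => z; rewrite /w /= !patchE; case: ifP.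
  have iw : mu.-integrable setT (EFin \o w) by rewrite wE -integrable_mkcond.
  have mw : measT w by have /integrableP[/measurable_EFinP] := iw.
  have mp : measT (fun z => Num.max (w z) 0) by exact: measurable_maxr.
  have mn : measT (fun z => Num.max (- w z) 0) by apply: measurable_maxr => //; exact: measurableT_comp.
  have p0 z : 0 <= Num.max (w z) 0 by rewrite le_max lexx orbT.
  have q0 z : 0 <= Num.max (- w z) 0 by rewrite le_max lexx orbT.
  have [m1 m1E] := density_measure mu mp p0; have [m2 m2E] := density_measure mu mn q0.
  have pE : (fun z => (Num.max (w z) 0)%:E) = ((EFin \o w)^\+)%E by apply/funext => z; rewrite funeposE /= -EFin_max.
  have nE : (fun z => (Num.max (- w z) 0)%:E) = ((EFin \o w)^\-)%E by apply/funext => z; rewrite funenegE /= -EFin_max.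
  have iE (E : set V) : measurable E -> mu.-integrable E (EFin \o w) by move=> mE; exact: integrableS iw.
  have fin1 E : measurable E -> m1 E \is a fin_num by move=> mE; rewrite m1E pE; exact: integrable_pos_fin_num (iE E mE).
  have fin2 E : measurable E -> m2 E \is a fin_num by move=> mE; rewrite m2E nE; exact: integrable_neg_fin_num (iE E mE).
  have intE E : measurable E -> (\int[mu]_(z in E) (w z)%:E = m1 E - m2 E)%E.
    by move=> mE; rewrite m1E m2E pE nE -integralE.
  have eqm E : measurable E -> m1 E = m2 E.
    move=> mE; apply: measure_eq_oboxes => // [a b|j]; last first.
      by rewrite ltey_eq fin1//; exact: measurable_obox.
    have mQ := @measurable_obox R (1 + n) a b.
    have := open0 (obox a b `&` oexh k) k (openI (@open_obox R _ a b) oO) (fun z h => @oexh_exhaust R n k z h.2).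
    rewrite /Rintegral.
    have -> : (\int[mu]_(z in obox a b `&` oexh k) (u z)%:E = \int[mu]_(z in obox a b) (w z)%:E)%E.
      by rewrite integral_mkcondr; apply: eq_integral => z _; rewrite /w !patchE; case: ifP.
    rewrite intE// -(fineK (fin1 _ mQ)) -(fineK (fin2 _ mQ)) -EFinB /= => /eqP; rewrite subr_eq0 => /eqP ->.
    by [].
  have := integral_ae_eq measurableT iw (measurable_cst 0%E).
  have h (E : set V) : E `<=` setT -> measurable E -> (\int[mu]_(z in E) (EFin \o w) z = \int[mu]_(z in E) cst 0 z)%E.
    by move=> _ mE; rewrite integral_cst// mul0e /= intE// eqm// subee// fin2.
  by move=> /(_ h); apply: filterS => z /(_ I) /= [].
have := ae_foralln w0; apply: filterS => z hz Hz.
have [k Ok] := compact_sub_oexh (@compact_set1 _ z) (fun w (e : w = z) => eq_ind_r H Hz e).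
have := hz k; rewrite patchE mem_set//; exact: Ok.
Qed.
End gradient_linear.

Lemma measurable_mulc d (T : measurableType d) (R : realType) (k : R) (f : T -> \bar R) :
  measT f -> measT (fun x => k%:E * f x)%E.
Proof. by move=> mf; exact: emeasurable_funM. Qed.

(** * The trace theorem *)

Section main.
Context {R : realType} (n : nat) (p c0 c1 : R).
Hypotheses (n0 : (0 < n)%N) (p1 : 1 < p) (hc0 : 1 < c0) (hc1 : 0 < c1).
Local Notation X := ('rV[R]_n).
Local Notation V := ('rV[R]_(1 + n)).
Local Notation mu := (lebesgue_rV (1 + n)).
Local Notation muX := (lebesgue_rV n).
Local Notation H := (@hspace R n).
Let p0 : 0 < p. Proof. exact: lt_trans p1. Qed.

Lemma whitney_avg_comb (u v : V -> R) (a t : R) (x : X) : L1loc u -> L1loc v -> 0 < t ->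
  whitney_avg c0 c1 (fun z => `|a * u z + v z|) t x <=
    `|a| * whitney_avg c0 c1 (fun z => `|u z|) t x + whitney_avg c0 c1 (fun z => `|v z|) t x.
Proof.
move=> uL vL t0; have m0 := whitney_fine_gt0 hc0 hc1 x t0.
have mW := @measurable_whitney R n c0 c1 hc1 t x t0.
have [K [cK KH WK]] := whitney_compact hc0 hc1 x t0.
have ii (w : V -> R) : L1loc w -> mu.-integrable (whitney c0 c1 t x) (EFin \o (fun z => `|w z|)).
  move=> wL; apply: (integrable_norm (f := w)).
  by apply: integrableS (wL.2 K cK KH) => //; exact: compact_measurable_rV.
have iu := ii u uL; have iv := ii v vL; have iw := ii _ (L1loc_comb a uL vL).
rewrite /whitney_avg mulrCA -mulrDr; apply: ler_wpM2l; first by rewrite invr_ge0 ltW.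
rewrite -RintegralZl// -RintegralD//; last exact: integrable_mulc.
apply: le_Rintegral => //.
  have := integrableD mW (integrable_mulc mW `|a| iu) iv; by congr (_.-integrable _ _); apply/funext => z.
by move=> z _; apply: le_trans (ler_normD _ _) _; rewrite normrM.
Qed.

Lemma whitney_avg_ge0 (u : V -> R) (t : R) (x : X) : 0 < t -> 0 <= whitney_avg c0 c1 (fun z => `|u z|) t x.
Proof.
by move=> t0; rewrite mulr_ge0 ?invr_ge0 ?(ltW (whitney_fine_gt0 hc0 hc1 x t0))//; apply: Rintegral_ge0 => z _.
Qed.

Lemma V0_comb (a : R) (u v : V -> R) : V0 c0 c1 p u -> V0 c0 c1 p v -> V0 c0 c1 p (fun z => a * u z + v z).
Proof.
move=> [BVu [mCu Nu] au] [BVv [mCv Nv] av]; have BVw := BVloc_comb a BVu BVv.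
split; first exact: BVw.
  split; first exact: measurable_Cgrad.
  have aC0 x : (0 <= `|a|%:E * Cgrad u x)%E by rewrite mule_ge0 ?Cgrad_ge0// lee_fin.
  have maC := measurable_mulc `|a| mCu.
  have Na : ('N[muX]_p%:E[(fun x => `|a|%:E * Cgrad u x)%E] < +oo)%E.
    apply: le_lt_trans (_ : (_ <= `|a|%:E * 'N[muX]_p%:E[Cgrad u])%E) _.
      by apply: Lnorm_mono => // x; exact: Cgrad_ge0.
    by apply: mulEFin_lty => //; exact: Lnorm_ge0.
  apply: le_lt_trans (lte_add_pinfty Na Nv).
  apply: (Lnorm_triangle p1 maC mCv (measurable_Cgrad _)) => // x; [exact: Cgrad_ge0|exact: Cgrad_ge0|exact: Cgrad_comb].
move=> x; have h : `|a| * whitney_avg c0 c1 (fun z => `|u z|) t x + whitney_avg c0 c1 (fun z => `|v z|) t x @[t --> +oo] --> (0 : R).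
  rewrite -[X in _ --> X](addr0 0) -{1}(mulr0 `|a|); apply: cvgD; last exact: av.
  by apply: cvgM; [exact: cvg_cst|exact: au].
apply: (squeeze_cvgr _ (cvg_cst 0) h); near=> t.
have t0 : 0 < t by near: t; apply: nbhs_pinfty_gt; exact: num_real.
by rewrite whitney_avg_ge0//= whitney_avg_comb//; [exact: BVu.1|exact: BVv.1].
Unshelve. all: by end_near. Qed.

Lemma V0_null (u : V -> R) : L1loc u -> {ae mu, forall z, H z -> u z = 0} ->
  'N[muX]_p%:E[Cgrad u]%E = 0%E.
Proof.
move=> uL u0; have [_ C0] := null_Cgrad uL u0.
rewrite unlock /=; have -> : (fun x : X => `|Cgrad u x| `^ p)%E = cst 0%E.
  by apply/funext => x; rewrite C0 abse0 poweR0r// gt_eqF.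
by rewrite integral_cst// mul0e poweR0r// invr_eq0 gt_eqF.
Qed.

Lemma V0_zero : V0 c0 c1 p (fun _ : V => 0 : R).
Proof.
have uL : L1loc (fun _ : V => 0 : R).
  by have [] := C1_gradient (@C1_cst R n H 0 (@open_hspace R n)).
have u0 : {ae mu, forall z : V, H z -> (fun=> 0 : R) z = 0} by apply: aeW.
have [BV _] := null_Cgrad uL u0.
split => //; first by split; [exact: measurable_Cgrad|rewrite V0_null].
move=> x; apply: cvg_near_cst; apply: nearW => t.
rewrite /whitney_avg (_ : \int[_]_(z in _) _ = 0) ?mulr0//.
by rewrite /Rintegral integral0_eq// => z _; rewrite normr0.
Qed.

Lemma Lnorm_Cgrad_scale (a : R) (u : V -> R) : V0 c0 c1 p u ->
  ('N[muX]_p%:E[Cgrad (fun z => a * u z)%R] <= `|a|%:E * 'N[muX]_p%:E[Cgrad u])%E.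
Proof.
move=> Vu; have V00 := V0_zero; have [BVu _ _] := Vu; have [BV0' _ _] := V00.
have Vau := V0_comb a Vu V00.
have E : (fun z => a * u z + 0) = (fun z => a * u z) by apply/funext => z; rewrite addr0.
rewrite E in Vau; have [BVau _ _] := Vau.
have [_ C00] := null_Cgrad BV0'.1 (aeW mu (fun z (_ : H z) => erefl (0 : R))).
apply: (Lnorm_mono p1) => //; [exact: measurable_Cgrad|exact: measurable_Cgrad|by move=> x; exact: Cgrad_ge0|by move=> x; exact: Cgrad_ge0|].
by move=> x; have := Cgrad_comb a x BVu BV0'; rewrite C00 adde0 E.
Qed.

Lemma V0_normed : normed_linear_space (@V0 R n c0 c1 p) (fun u => 'N[muX]_p%:E[Cgrad u]%E).
Proof.
split.
- by split; [exact: V0_zero|exact: V0_comb].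
- by move=> u [_ [_ Nu] _]; rewrite Lnorm_ge0.
- move=> a u Vu; apply/le_anti; rewrite Lnorm_Cgrad_scale//=.
  have [->|an0] := eqVneq a 0; first by rewrite normr0 mul0e Lnorm_ge0.
  have Vau := V0_comb a Vu V0_zero.
  have E : (fun z => a * u z + 0) = (fun z => a * u z) by apply/funext => z; rewrite addr0.
  rewrite E in Vau; have := Lnorm_Cgrad_scale a^-1 Vau.
  have -> : (fun z => a^-1 * (a * u z)) = u by apply/funext => z; rewrite mulKf.
  move=> h; apply: (@le_trans _ _ (`|a|%:E * (`|a^-1|%:E * 'N[muX]_p%:E[Cgrad (fun z => a * u z)%R]))%E).
    by apply: lee_wpmul2l; rewrite ?lee_fin.
  by rewrite muleA -EFinM -normrM mulfV// normr1 mul1e.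
- move=> u v [BVu [mu1 Nu] _] [BVv [mv1 Nv] _].
  have E : (fun z => 1 * u z + v z) = (fun z => u z + v z) by apply/funext => z; rewrite mul1r.
  have BVw := BVloc_comb 1 BVu BVv; rewrite E in BVw.
  apply: (Lnorm_triangle p1 mu1 mv1 (measurable_Cgrad _)) => // x; [exact: Cgrad_ge0|exact: Cgrad_ge0|exact: Cgrad_ge0|].
  by have := Cgrad_comb 1 x BVu BVv; rewrite normr1 mul1e E.
- move=> u [BVu [mCu Nu] au]; split=> [N0|u0]; last by apply: V0_null => //; exact: BVu.1.
  apply: (zero_of_tv_zero hc0 hc1 BVu _ au); apply: tv_zero_of_Cgrad => //.
  have := Lnorm_eq0_eq0 mCu _ N0; rewrite lte_fin => /(_ p0).
  by apply: filterS => x; apply.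
Qed.

Lemma extension_exists : exists2 C : R, 0 <= C & forall g : X -> R, Lp p (EFin \o g) ->
  exists u : V -> R,
        [/\ V0 c0 c1 p u /\ VN p u,
            {ae muX, forall x, whitney_trace c0 c1 u x = g x},
            ('N[muX]_p%:E[Cgrad u] <= C%:E * 'N[muX]_p%:E[EFin \o g])%E,
            ('N[muX]_p%:E[ntmax u] <= C%:E * 'N[muX]_p%:E[EFin \o g])%E &
            forall x, lebesgue_point g x -> forall alpha : R, 0 < alpha ->
              u z @[z --> within (cone alpha x) (nbhs (row_mx 0 x))] --> g x].
Proof.
pose C1 := (KE n p) `^ p^-1; pose C2 := (kCp n p) `^ p^-1.
have C10 : 0 <= C1 by exact: powR_ge0. have C20 : 0 <= C2 by exact: powR_ge0.
exists (C1 + C2); first exact: addr_ge0.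
move=> g [/measurable_EFinP mg gN].
have absE (x : X) : (`|(EFin \o g) x| `^ p = (`|g x| `^ p)%:E)%E by [].
have gp : (@pw _ X R muX p g < +oo)%E by move/(Lnorm_fin _ _ p0) : gN.
have [s [s0 s_half sdec sg]] := scales_exist n0 p1 mg gp.
have lg := locint_pw p1 mg gp.
have s_le1 : s 0%N <= 1 by have := s_half 0%N; rewrite expr0.
pose u := @ext R n s g.
have BVu : BVloc u by exact: (ext_BV n0 p1 s0 s_half sdec mg gp).
have Cu : C1_on H u by exact: (ext_C1 n0 s0 s_le1 sdec lg).
have mN : measT (ntmax u : X -> \bar R) by apply: measurable_ntmax => z; exact: C1_on_cont.
have eC : (\int[muX]_x (`|Cgrad u x| `^ p) <= (KE n p)%:E * \int[muX]_x (`|(EFin \o g) x| `^ p))%E.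
  apply: le_trans (Cgrad_ext_pw n0 p1 s0 s_half sdec mg gp sg).
  by rewrite le_eqVlt; apply/orP; left; apply/eqP; apply: eq_integral => x _; rewrite gee0_abs// Cgrad_ge0.
have eN : (\int[muX]_x (`|ntmax u x| `^ p) <= (kCp n p)%:E * \int[muX]_x (`|(EFin \o g) x| `^ p))%E.
  apply: le_trans (ntmax_ext_pw n0 p1 s0 s_half sdec mg gp).
  by rewrite le_eqVlt; apply/orP; left; apply/eqP; apply: eq_integral => x _; rewrite gee0_abs// ntmax_ge0.
have NC := Lnorm_le p0 (KE_ge0 n p1) eC; have NN := Lnorm_le p0 (kCp_ge0 n p1) eN.
have g0 : (0 <= 'N[muX]_p%:E[EFin \o g])%E by exact: Lnorm_ge0.
have LC : Lp p (Cgrad u : X -> \bar R).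
  by split; [exact: measurable_Cgrad|apply: le_lt_trans NC _; exact: mulEFin_lty].
exists u; split.
- split; first by split => // x; exact: (ext_whitney_infty s0 s_half sdec g x hc0 hc1).
  by split => //; split => //; apply: le_lt_trans NN _; exact: mulEFin_lty.
- have c00 : 0 < c0 := lt_trans ltr01 hc0.
  have := ae_scale_limit n0 p1 s0 mg gp sg (mulr_gt0 c00 hc1).
  apply: filterS => x hx.
  apply: cvg_lim => //; exact: (ext_whitney_limit n0 p1 s0 s_half sdec mg gp hc0 hc1 hx).
- apply: le_trans NC _; apply: lee_wpmul2r => //; by rewrite lee_fin lerDl.
- apply: le_trans NN _; apply: lee_wpmul2r => //; by rewrite lee_fin lerDr.
- move=> x lx alpha a0; exact: (ext_nontangential n0 p1 s0 s_half sdec mg gp a0 lx).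
Qed.
End main.

Unset Implicit Arguments.
Theorem theorem1p1 (R : realType) (n : nat) (p c0 c1 : R) :
  (0 < n)%N -> 1 < p -> 1 < c0 -> 0 < c1 ->
  normed_linear_space (@V0 R n c0 c1 p)
    (fun u => 'N[lebesgue_rV n]_p%:E[Cgrad u]%E) /\
  exists c : R,
    (forall u : 'rV[R]_(1 + n) -> R, V0 c0 c1 p u ->
      [/\ {ae lebesgue_rV n, forall x, cvg (whitney_avg c0 c1 u t x @[t --> 0^'+])},
          Lp p (EFin \o whitney_trace c0 c1 u) &
          ('N[lebesgue_rV n]_p%:E[EFin \o whitney_trace c0 c1 u]
             <= c%:E * 'N[lebesgue_rV n]_p%:E[Cgrad u])%E]) /\
    (forall g : 'rV[R]_n -> R, Lp p (EFin \o g) ->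
      exists u : 'rV[R]_(1 + n) -> R,
        [/\ V0 c0 c1 p u /\ VN p u,
            {ae lebesgue_rV n, forall x, whitney_trace c0 c1 u x = g x},
            ('N[lebesgue_rV n]_p%:E[Cgrad u]
               <= c%:E * 'N[lebesgue_rV n]_p%:E[EFin \o g])%E,
            ('N[lebesgue_rV n]_p%:E[ntmax u]
               <= c%:E * 'N[lebesgue_rV n]_p%:E[EFin \o g])%E &
            forall x, lebesgue_point g x -> forall alpha : R, 0 < alpha ->
              u z @[z --> within (cone alpha x) (nbhs (row_mx 0 x))] --> g x]).
Proof.
move=> n0 p1 hc0 hc1; split; first exact: V0_normed.
have [A A0 hA] := @trace_bound R n c0 c1 p hc0 hc1 p1.
have [B B0 hB] := @extension_exists R n p c0 c1 n0 p1 hc0 hc1.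
exists (A + B); split=> [u /hA[h1 h2 h3]|g /hB[u [h1 h2 h3 h4 h5]]].
  split => //; apply: le_trans h3 _; apply: lee_wpmul2r; [exact: Lnorm_ge0|by rewrite lee_fin lerDl].
have AB : B <= A + B by rewrite lerDr.
exists u; split => //.
  by apply: le_trans h3 _; apply: lee_wpmul2r; [exact: Lnorm_ge0|rewrite lee_fin].
by apply: le_trans h4 _; apply: lee_wpmul2r; [exact: Lnorm_ge0|rewrite lee_fin].
Qed.
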